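(* Let $G$ be a semisimple Lie group with finite centre, $K$ a maximal compact subgroup of $G$, $P\subset G$ a parabolic subgroup, and let $V\to G/P$ and $W\to G/K$ be tractor bundles. Then a Poisson transform $\Phi\colon\Omega^k(G/P,V)\to\Omega^\ell(G/K,W)$ factors to the BGG-complex on $G/P$ if and only if its underlying kernel $\phi$ satisfies $\partial_P^*\phi=0$ and $\partial_P^*d_P\phi=0$.
   Context: **Tractor bundles.** $V=G\times_P\mathbb V$, $W=G\times_K\mathbb W$ with $\mathbb V,\mathbb W$ finite dimensional $G$-representations. A tractor bundle $G\times_H\mathbb V$ carries the flat tractor connection coming from the trivialization $[g,v]\mapsto(gH,g\cdot v)$; $d^V$ is the induced covariant exterior derivative on $\Omega^*(G/P,V)$. **Kostant codifferential.** $\mathfrak g,\mathfrak p$ are the Lie algebras of $G,P$; $\mathfrak p_+$ is the nilradical of $\mathfrak p$; $(\mathfrak g/\mathfrak p)^*\cong\mathfrak p_+$ via the Killing form. For a $P$-representation $\mathbb V$, $$\partial^*(Z_1\wedge\dots\wedge Z_k\otimes v)=\sum_i(-1)^iZ_1\wedge\dots\widehat{Z_i}\dots\wedge Z_k\otimes Z_i\cdot v+\sum_{i<j}(-1)^{i+j}[Z_i,Z_j]\wedge Z_1\wedge\dots\widehat{Z_i}\dots\widehat{Z_j}\dots\wedge Z_k\otimes v$$ on $\Lambda^k\mathfrak p_+\otimes\mathbb V$. It induces tensorial operators $\partial^*\colon\Omega^k(G/P,V)\to\Omega^{k-1}(G/P,V)$, and $\mathcal H_k(G/P,V)=\ker\partial^*/\mathrm{im}\,\partial^*$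 are the homology bundles. **Factoring to the BGG-complex.** An operator $\Phi\colon\Omega^k(G/P,V)\to\Omega^\ell(G/K,W)$ is said to factor to the BGG-complex if $\Phi\circ\partial^*=0$ and $\Phi\circ d^V\circ\partial^*=0$. (The first condition gives an induced operator $\underline\Phi\colon\Gamma(\mathcal H_k(G/P,V))\to\Omega^\ell(G/K,W)$.) **Poisson transforms.** Let $n=\dim(G/P)$ and $M=K\cap P$; $G/K\times G/P\cong G/M$ with projections $\pi_K,\pi_P$. $(p,q)$-forms on $G/M$ are sections of $\Lambda^pT^*(G/K)\otimes\Lambda^qT^*(G/P)$ pulled back. Put $W_M=\pi_K^*W$, $V_M=\pi_P^*V$, $E=W_M\otimes V_M^*$. A Poisson transform with Poisson kernel $\phi\in\Omega^{\ell,n-k}(G/M,E)$ is a $G$-equivariant operator of the form $\Phi(\alpha)=\int_{G/P}\phi\wedge\pi_P^*\alpha$, where the wedge uses the contraction $V^*\otimes V\to\mathbb R$ and the integral is fibre integration along $\pi_K$ with fibre $G/P$ ($G/P$ oriented, orientation preserved by $G$). **Operators on $G/M$.** $d_P$ is the component of bidegree $(0,1)$ of the covariant exterior derivative $d^E$ of the connection on $E$ obtained as tensor product of the pullbacks of the tractor connections of $W$ and $V^*$. For $\alpha\in\Omega^{p,0}(G/M,W_M)$ and $\beta\in\Omega^{0,q}(G/M,V_M^* )$ put $\partial_P^*(\alpha\wedge\beta)=(-1)^p\alpha\wedge\partial^*\beta$ (with $\partial^*$ the lift to $G/M$ of the Kostant codifferential on $V^*$-valued forms), extended linearly (over functions).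 *)

(* Defs.v *)
(* MathComp-Analysis world.

   The library has no manifolds, so Lie groups are set up from charts, and
   forms on homogeneous spaces are written in the standard way as equivariant
   functions on the group: a k-form on G/H with values in G x_H V is a function
   f : G -> Alt^k(g/h; V) with f (y h) = h^-1 . f (y) o Ad h, the form being
   T_{yH}(G/H) = g/h, via the class of X at d/dt y exp(tX) H. *)
From HB Require Import structures.
From mathcomp Require Import all_boot all_order all_algebra perm.
From mathcomp Require Import all_classical all_reals all_analysis.

Set Implicit Arguments.
Unset Strict Implicit.
Unset Printing Implicit Defensive.

Import Order.TTheory GRing.Theory Num.Theory.
Import numFieldNormedType.Exports.

Local Open Scope classical_set_scope.
Local Open Scope ring_scope.

(** * Smooth functions and Lie groups *)

Definition pderiv (R : realType) (n : nat) (i : 'I_n)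
    (f : 'rV[R]_n -> R) (u : 'rV[R]_n) : R :=
  derive1 (fun t : R => f (u + t *: delta_mx 0 i)) 0.

Fixpoint Ck_on (R : realType) (n m : nat) (U : set 'rV[R]_n)
    (f : 'rV[R]_n -> R) : Prop :=
  (forall u, U u -> {for u, continuous f}) /\
  match m with
  | 0%N => True
  | m'.+1 => forall i : 'I_n,
      (forall u, U u -> derivable (fun t : R => f (u + t *: delta_mx 0 i)) 0 1)
      /\ Ck_on m' U (pderiv i f)
  end.

Definition smooth_on (R : realType) (n : nat) (U : set 'rV[R]_n)
    (f : 'rV[R]_n -> R) : Prop := forall m, Ck_on m U f.

Record chart (R : realType) (n : nat) (M : topologicalType) := Chart {
  chart_dom : set M;
  chart_map : M -> 'rV[R]_n;
  chart_inv : 'rV[R]_n -> M }.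

Definition chart_img (R : realType) (n : nat) (M : topologicalType)
    (c : chart R n M) : set 'rV[R]_n := chart_map c @` chart_dom c.

Definition is_chart (R : realType) (n : nat) (M : topologicalType)
    (c : chart R n M) : Prop :=
  [/\ open (chart_dom c), open (chart_img c),
      forall x, chart_dom c x -> chart_inv c (chart_map c x) = x,
      forall x, chart_dom c x -> {for x, continuous (chart_map c)}
    & forall u, chart_img c u -> {for u, continuous (chart_inv c)}].

Definition smooth_atlas (R : realType) (n : nat) (M : topologicalType)
    (A : set (chart R n M)) : Prop :=
  [/\ forall c, A c -> is_chart c,
      forall x, exists2 c, A c & chart_dom c x
    & forall c c', A c -> A c' -> forall i : 'I_n,
        smooth_on (chart_img c `&` chart_inv c @^-1` chart_dom c')
          (fun u => chart_map c' (chart_inv c u) 0 i)].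

Definition smooth_fun (R : realType) (n : nat) (M : topologicalType)
    (A : set (chart R n M)) (h : M -> R) : Prop :=
  forall c, A c -> smooth_on (chart_img c) (h \o chart_inv c).

(* smoothness on the product manifold M x M *)
Definition smooth_fun2 (R : realType) (n : nat) (M : topologicalType)
    (A : set (chart R n M)) (h : M -> M -> R) : Prop :=
  forall c c', A c -> A c' ->
    smooth_on [set z : 'rV[R]_(n + n) |
                chart_img c (lsubmx z) /\ chart_img c' (rsubmx z)]
      (fun z => h (chart_inv c (lsubmx z)) (chart_inv c' (rsubmx z))).

#[short(type="topGroupType")]
HB.structure Definition TopGroup := {T of Topological T & Group T}.

Definition left_invariant_field (R : realType) (n : nat) (G : topGroupType)
    (A : set (chart R n G)) (D : (G -> R) -> G -> R) : Prop :=
  [/\ forall h, smooth_fun A h -> smooth_fun A (D h),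
      forall (a : R) h h', smooth_fun A h -> smooth_fun A h' ->
        forall x, D (fun y => a * h y + h' y) x = a * D h x + D h' x,
      forall h h', smooth_fun A h -> smooth_fun A h' ->
        forall x, D (fun y => h y * h' y) x = D h x * h' x + h x * D h' x
    & forall h, smooth_fun A h ->
        forall a x, D (fun y => h (a * y)%g) x = D h (a * x)%g].

(* Maps are smooth when they pull smooth functions back to smooth functions.
   [lie] is the Lie algebra: [lvf] identifies it with the space of all
   left-invariant vector fields, viewed as derivations of the algebra of smooth
   functions. *)
Record lieGroup (R : realType) := LieGroup {
  lg_sort :> topGroupType;
  lg_dim : nat;
  lg_atlas : set (chart R lg_dim lg_sort);
  lg_hausdorff : hausdorff_space lg_sort;
  lg_second_countable : @second_countable lg_sort;
  lg_smooth_atlas : smooth_atlas lg_atlas;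
  lg_smooth_mul : forall h, smooth_fun lg_atlas h ->
    smooth_fun2 lg_atlas (fun x y => h (x * y)%g);
  lg_smooth_inv : forall h, smooth_fun lg_atlas h ->
    smooth_fun lg_atlas (fun x => h (x^-1)%g);
  lie : vectType R;
  lvf : lie -> (lg_sort -> R) -> lg_sort -> R;
  lvf_field : forall X, left_invariant_field lg_atlas (lvf X);
  lvf_linear : forall (a : R) X Y h, smooth_fun lg_atlas h ->
    forall x, lvf (a *: X + Y) h x = a * lvf X h x + lvf Y h x;
  lvf_inj : forall X,
    (forall h, smooth_fun lg_atlas h -> forall x, lvf X h x = 0) -> X = 0;
  lvf_surj : forall D, left_invariant_field lg_atlas D ->
    exists X, forall h, smooth_fun lg_atlas h -> forall x, lvf X h x = D h x }.

Definition smooth (R : realType) (G : lieGroup R) : (G -> R) -> Prop :=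
  smooth_fun (@lg_atlas R G).

Definition smooth2 (R : realType) (G : lieGroup R) : (G -> G -> R) -> Prop :=
  smooth_fun2 (@lg_atlas R G).

Definition vcoord (R : realType) (V : vectType R) (b : 'I_(\dim {:V})) (v : V)
  : R := coord (vbasis {:V}) b v.

Definition vbase (R : realType) (V : vectType R) (b : 'I_(\dim {:V})) : V :=
  tnth (vbasis {:V}) b.

Definition br (R : realType) (G : lieGroup R) (X Y : lie G) : lie G :=
  xget 0 [set Z | forall h, smooth h -> forall x : G,
    lvf Z h x = lvf X (lvf Y h) x - lvf Y (lvf X h) x].

(* Ad(a) X is the velocity of t |-> a exp(tX) a^-1. *)
Definition Ad (R : realType) (G : lieGroup R) (a : G) (X : lie G) : lie G :=
  xget 0 [set Y | forall h, smooth h -> forall x : G,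
    lvf Y h x = lvf X (fun y => h (y * a^-1)%g) (x * a)%g].

Definition brv (R : realType) (G : lieGroup R) (A B : {vspace lie G})
  : {vspace lie G} := <<[seq br X Y | X <- vbasis A, Y <- vbasis B]>>%VS.

Definition killing (R : realType) (G : lieGroup R) (X Y : lie G) : R :=
  \sum_b vcoord b (br X (br Y (vbase b))).

Definition semisimple (R : realType) (G : lieGroup R) : Prop :=
  forall X : lie G, (forall Y, killing X Y = 0) -> X = 0.

Definition finite_centre (R : realType) (G : lieGroup R) : Prop :=
  finite_set [set z : G | forall x : G, (z * x = x * z)%g].

(** * Subgroups *)

Definition is_subgroup (G : topGroupType) (H : set G) : Prop :=
  [/\ H 1%g, forall x y, H x -> H y -> H (x * y)%g
    & forall x, H x -> H (x^-1)%g].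

Definition maximal_compact_subgroup (G : topGroupType) (K : set G) : Prop :=
  [/\ is_subgroup K, compact K
    & forall K', is_subgroup K' -> compact K' -> K `<=` K' -> K' = K].

Definition one_parameter_subgroup (R : realType) (G : lieGroup R)
    (c : R -> G) (X : lie G) : Prop :=
  (forall s t, c (s + t) = (c s * c t)%g) /\
  (forall h, smooth h -> forall t : R, is_derive t 1 (h \o c) (lvf X h (c t))).

Definition lie_algebra_of (R : realType) (G : lieGroup R)
    (H : set G) (hh : {vspace lie G}) : Prop :=
  forall X, X \in hh <->
    exists2 c : R -> G, one_parameter_subgroup c X & forall t, H (c t).

(* |m|-gradings g = g_{-m} + ... + g_m. As m = 0, and simple ideals contained
   in g_0, are allowed, the subalgebras g_0 + ... + g_m are all the parabolic
   subalgebras, g itself included. *)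
Definition grading (R : realType) (G : lieGroup R) (m : nat)
    (gr : int -> {vspace lie G}) : Prop :=
  [/\ forall i : int, m%:Z < `|i| -> gr i = 0%VS,
      (\sum_(i < m.*2.+1) gr (i%:Z - m%:Z))%VS = {:lie G}%VS,
      directv (\sum_(i < m.*2.+1) gr (i%:Z - m%:Z))%VS,
      forall i j X Y, X \in gr i -> Y \in gr j -> br X Y \in gr (i + j)
    & forall i : int, i < 0 -> gr (i - 1) = brv (gr i) (gr (- 1))].

Definition parabolic_subalgebra (R : realType) (G : lieGroup R)
    (p : {vspace lie G}) : Prop :=
  exists m gr, grading m gr /\ p = (\sum_(i < m.+1) gr i%:Z)%VS.

Definition normalizer (R : realType) (G : lieGroup R) (p : {vspace lie G})
  : set G := [set x | forall X, (Ad x X \in p) = (X \in p)].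

Definition parabolic_subgroup (R : realType) (G : lieGroup R)
    (P : set G) (p : {vspace lie G}) : Prop :=
  [/\ is_subgroup P, parabolic_subalgebra p,
      connected_component (normalizer p) 1%g `<=` P
    & P `<=` normalizer p].

Definition nilpotent_ideal (R : realType) (G : lieGroup R)
    (p n : {vspace lie G}) : Prop :=
  [/\ (n <= p)%VS, (brv p n <= n)%VS & exists N, iter N (brv n) n = 0%VS].

Definition nilradical (R : realType) (G : lieGroup R)
    (p pp : {vspace lie G}) : Prop :=
  nilpotent_ideal p pp /\ forall n, nilpotent_ideal p n -> (n <= pp)%VS.

(* G/M -> G/K x G/P, gM |-> (gK, gP), is onto, where M is the intersection of
   K and P (injectivity is automatic). *)
Definition quotient_splits (G : topGroupType) (K P : set G) : Prop :=
  forall x y : G, exists g : G, K (g^-1 * x)%g /\ P (g^-1 * y)%g.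

(** * Representations *)

Definition representation (R : realType) (G : lieGroup R) (V : vectType R)
    (r : G -> 'End(V)) : Prop :=
  [/\ r 1%g = \1%VF, forall x y, r (x * y)%g = (r x \o r y)%VF
    & forall v b, smooth (fun x => vcoord b (r x v))].

Definition dual_rep (R : realType) (G : lieGroup R) (V : vectType R)
    (r : G -> 'End(V)) (x : G) (lam : 'Hom(V, R^o)) : 'Hom(V, R^o) :=
  (lam \o r (x^-1)%g)%VF.

Definition vderiv (R : realType) (T : Type) (a V : vectType R)
    (lv : a -> (T -> R) -> T -> R) (X : a) (f : T -> V) (t : T) : V :=
  \sum_b lv X (fun u => vcoord b (f u)) t *: vbase b.

Definition drep (R : realType) (G : lieGroup R) (V : vectType R)
    (r : G -> V -> V) (X : lie G) (v : V) : V :=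
  vderiv (@lvf R G) X (fun x => r x v) 1%g.

(** * Forms *)

Definition alternating_map (R : realType) (a : vectType R) (V : lmodType R)
    (k : nat) (f : ('I_k -> a) -> V) : Prop :=
  (forall (X : 'I_k -> a) i (c : R) y z,
     f [eta X with i |-> c *: y + z] =
     c *: f [eta X with i |-> y] + f [eta X with i |-> z]) /\
  (forall (X : 'I_k -> a) i j, i != j -> X i = X j -> f X = 0).

(* maps on a/h *)
Definition alternating_mod (R : realType) (a : vectType R) (V : lmodType R)
    (k : nat) (h : {vspace a}) (f : ('I_k -> a) -> V) : Prop :=
  alternating_map f /\ (forall (X : 'I_k -> a) i, X i \in h -> f X = 0).

(* k-forms on G/H with values in G x_H V *)
Definition bundle_form (R : realType) (G : lieGroup R) (V : vectType R) (k : nat)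
    (H : set G) (hh : {vspace lie G}) (r : G -> V -> V)
    (f : G -> ('I_k -> lie G) -> V) : Prop :=
  [/\ forall x, alternating_mod hh (f x),
      forall X b, smooth (fun x => vcoord b (f x X))
    & forall x h X, H h -> f (x * h)%g X = r (h^-1)%g (f x (Ad h \o X))].

Definition translate (R : realType) (G : lieGroup R) (T : Type)
    (a : G) (f : G -> T) (x : G) : T := f (a^-1 * x)%g.

(* (p,q)-forms on G/M = G/K x G/P with values in W_M (x) V_M^*, whose fibre
   W (x) V^* is taken to be Hom(V, W). The first p arguments are tangent to
   G/K, the last q to G/P. *)
Definition biform (R : realType) (G : lieGroup R) (V W : vectType R)
    (p q : nat) (K P : set G) (hK hP : {vspace lie G})
    (rV : G -> 'End(V)) (rW : G -> 'End(W))
    (phi : G -> G -> ('I_p -> lie G) -> ('I_q -> lie G) -> 'Hom(V, W)) : Prop :=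
  [/\ forall x y Y, alternating_mod hK (fun X => phi x y X Y),
      forall x y X, alternating_mod hP (phi x y X),
      forall X Y b, smooth2 (fun x y => vcoord b (phi x y X Y))
    & forall x y k h X Y, K k -> P h ->
        phi (x * k)%g (y * h)%g X Y =
        (rW (k^-1)%g
         \o phi x y (fun i => Ad k (X i)) (fun i => Ad h (Y i)) \o rV h)%VF].

(** * Exterior derivatives *)

Definition omit2 (T : Type) (k : nat) (X : 'I_k -> T) (i j : 'I_k) : seq T :=
  [seq X l | l <- enum 'I_k & (l != i) && (l != j)].

(* exterior derivative of a V-valued form evaluated on a frame of left-invariant
   vector fields, indexed by the Lie algebra (a, brk) *)
Definition ext_d (R : realType) (T : Type) (a V : vectType R)
    (brk : a -> a -> a) (lv : a -> (T -> R) -> T -> R) (k : nat)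
    (f : T -> ('I_k -> a) -> V) (t : T) (X : 'I_k.+1 -> a) : V :=
  \sum_(i < k.+1) (- 1) ^+ i *:
     vderiv lv (X i) (fun u => f u (X \o lift i)) t
  + \sum_(i < k.+1) \sum_(j < k.+1 | (i < j)%N) (- 1) ^+ (i + j) *:
     f t (fun l : 'I_k => nth 0 (brk (X i) (X j) :: omit2 X i j) l).

(* d^V: the trivialization [x, v] |-> (xP, x . v) turns f into the V-valued form
   x . f(x), on which d^V is the exterior derivative. *)
Definition dV (R : realType) (G : lieGroup R) (V : vectType R)
    (r : G -> 'End(V)) (k : nat) (f : G -> ('I_k -> lie G) -> V)
    (x : G) (X : 'I_k.+1 -> lie G) : V :=
  r (x^-1)%g (ext_d (@br R G) (@lvf R G) (fun y Y => r y (f y Y)) x X).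

Definition br2 (R : realType) (G : lieGroup R) (Z Z' : lie G * lie G)
  : lie G * lie G := (br Z.1 Z'.1, br Z.2 Z'.2).

Definition lvf2 (R : realType) (G : lieGroup R) (Z : lie G * lie G)
    (h : G * G -> R) (u : G * G) : R :=
  lvf Z.1 (fun x => h (x, u.2)) u.1 + lvf Z.2 (fun y => h (u.1, y)) u.2.

(* a (p,q)-form as a (p+q)-form on the product *)
Definition total_form (R : realType) (G : lieGroup R) (E : vectType R)
    (p q : nat) (phi : G -> G -> ('I_p -> lie G) -> ('I_q -> lie G) -> E)
    (u : G * G) (Z : 'I_(p + q) -> lie G * lie G) : E :=
  (p`! * q`!)%:R^-1 *: \sum_(s : 'S_(p + q)) (- 1) ^+ s *:
    phi u.1 u.2 (fun i => (Z (s (lshift q i))).1)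
                (fun j => (Z (s (rshift p j))).2).

(* d^E for the tensor product of the pulled back flat connections; it is the
   exterior derivative in the trivialization (x, y, T) |-> x T y^-1 of E. *)
Definition dE (R : realType) (G : lieGroup R) (V W : vectType R)
    (rV : G -> 'End(V)) (rW : G -> 'End(W)) (k : nat)
    (f : G * G -> ('I_k -> lie G * lie G) -> 'Hom(V, W))
    (u : G * G) (Z : 'I_k.+1 -> lie G * lie G) : 'Hom(V, W) :=
  (rW (u.1^-1)%g \o
   ext_d (@br2 R G) (@lvf2 R G)
     (fun w Z' => (rW w.1 \o f w Z' \o rV (w.2^-1)%g)%VF) u Z
   \o rV u.2)%VF.

(* the component of bidegree (p,q+1) of d^E phi *)
Definition dP (R : realType) (G : lieGroup R) (V W : vectType R)
    (rV : G -> 'End(V)) (rW : G -> 'End(W)) (p q : nat)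
    (phi : G -> G -> ('I_p -> lie G) -> ('I_q -> lie G) -> 'Hom(V, W))
    (x y : G) (X : 'I_p -> lie G) (Y : 'I_q.+1 -> lie G) : 'Hom(V, W) :=
  dE rV rW (total_form phi) (x, y)
    (fun i => nth 0 ([seq (X a, 0) | a <- enum 'I_p] ++
                     [seq (0, Y b) | b <- enum 'I_q.+1]) i).

(** * Kostant codifferential *)

(* Z_1 /\ ... /\ Z_k (x) v as an alternating map on g/p, via the Killing form *)
Definition decomposable (R : realType) (G : lieGroup R) (V : lmodType R)
    (k : nat) (Z : 'I_k -> lie G) (v : V) (X : 'I_k -> lie G) : V :=
  \det (\matrix_(i < k, j < k) killing (Z i) (X j)) *: v.

(* The codifferential of Z_1 /\ ... /\ Z_{k+1} (x) v; indices start at 0 here,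
   whence the shifted exponents. *)
Definition codiff_decomposable (R : realType) (G : lieGroup R) (V : lmodType R)
    (act : lie G -> V -> V) (k : nat) (Z : 'I_k.+1 -> lie G) (v : V)
    (X : 'I_k -> lie G) : V :=
  \sum_(i < k.+1) (- 1) ^+ i.+1 *: decomposable (Z \o lift i) (act (Z i) v) X
  + \sum_(i < k.+1) \sum_(j < k.+1 | (i < j)%N) (- 1) ^+ (i.+1 + j.+1) *:
      decomposable
        (fun l : 'I_k => nth 0 (br (Z i) (Z j) :: omit2 Z i j) l) v X.

(* elements of g dual, for the Killing form, to the basis of p_+; they are
   unique modulo p and form a basis of g/p *)
Definition dual_basis (R : realType) (G : lieGroup R) (pp : {vspace lie G})
  : {ffun 'I_(\dim pp) -> lie G} :=
  xget [ffun=> 0] [set xi : {ffun 'I_(\dim pp) -> lie G} |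
    forall a b, killing (tnth (vbasis pp) a) (xi b) = (a == b)%:R].

(* Linear extension of [codiff_decomposable] to Alt^{k+1}(g/p; V), using
   f = 1/(k+1)! sum_s Z_{s 0} /\ ... /\ Z_{s k} (x) f (xi_{s 0}, ..., xi_{s k})
   for dual bases Z, xi. *)
Definition codiff (R : realType) (G : lieGroup R) (V : lmodType R)
    (pp : {vspace lie G}) (act : lie G -> V -> V) (k : nat)
    (f : ('I_k.+1 -> lie G) -> V) (X : 'I_k -> lie G) : V :=
  (k.+1)`!%:R^-1 *: \sum_(s : {ffun 'I_k.+1 -> 'I_(\dim pp)})
    codiff_decomposable act (fun i => tnth (vbasis pp) (s i))
      (f (fun i => dual_basis pp (s i))) X.

(* on Omega^{k+1}(G/P, V) *)
Definition dstar (R : realType) (G : lieGroup R) (V : vectType R)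
    (pp : {vspace lie G}) (r : G -> 'End(V)) (k : nat)
    (f : G -> ('I_k.+1 -> lie G) -> V) (x : G) : ('I_k -> lie G) -> V :=
  codiff pp (drep (fun g => r g)) (f x).

(* On W (x) V^* the codifferential acts on the V^*-valued part only: phi is
   expanded as sum_b w_b (x) phi_b for a basis w_b of W. *)
Definition dPstar (R : realType) (G : lieGroup R) (V W : vectType R)
    (pp : {vspace lie G}) (rV : G -> 'End(V)) (p q : nat)
    (phi : G -> G -> ('I_p -> lie G) -> ('I_q.+1 -> lie G) -> 'Hom(V, W))
    (x y : G) (X : 'I_p -> lie G) (Y : 'I_q -> lie G) : 'Hom(V, W) :=
  (- 1) ^+ p *: \sum_(b < \dim {:W})
    linfun (fun v : V =>
      codiff pp (drep (dual_rep rV))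
        (fun Y' => linfun (fun v' : V => vcoord b (phi x y X Y' v') : R^o)) Y v
      *: vbase b).

(** * Integration over G/P and Poisson transforms *)

(* A G-invariant orientation of G/P: an orientation of g/p preserved by P. *)
Definition invariant_orientation (R : realType) (G : lieGroup R) (n : nat)
    (P : set G) (p : {vspace lie G}) (o : ('I_n -> lie G) -> R^o) : Prop :=
  [/\ alternating_mod p o, exists Y, o Y != 0
    & forall h, P h -> exists2 c : R, 0 < c & forall Y, o (Ad h \o Y) = c * o Y].

(* iterated Lebesgue integral over R^n *)
Fixpoint iter_int (R : realType) (n : nat) : ('rV[R]_n -> R) -> R :=
  match n with
  | 0%N => fun f => f 0
  | n'.+1 => fun f => Rintegral lebesgue_measure setT
      (fun t : R => iter_int (fun v : 'rV[R]_n' =>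
         f (row_mx (t%:M : 'rV[R]_1) v : 'rV[R]_(1 + n'))))
  end.

(* left logarithmic derivative of sigma in the i-th coordinate direction *)
Definition log_deriv (R : realType) (G : lieGroup R) (n : nat)
    (sigma : 'rV[R]_n -> G) (u : 'rV[R]_n) (i : 'I_n) : lie G :=
  xget 0 [set X | forall h, smooth h ->
    pderiv i (h \o sigma) u = lvf X h (sigma u)].

(* sigma : U -> G lifts the inverse of a positively oriented chart of G/P *)
Definition oriented_chart (R : realType) (G : lieGroup R) (n : nat)
    (P : set G) (o : ('I_n -> lie G) -> R^o)
    (U : set 'rV[R]_n) (sigma : 'rV[R]_n -> G) : Prop :=
  [/\ open U, forall h, smooth h -> smooth_on U (h \o sigma),
      forall u v, U u -> U v -> P ((sigma u)^-1 * sigma v)%g -> u = v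
    & forall u, U u -> 0 < o (log_deriv sigma u)].

(* I is integration of n-forms over the compact oriented n-manifold G/P: it is
   linear, and is given by the Lebesgue integral for forms supported in a chart.
   By partitions of unity, these conditions determine I on n-forms. *)
Definition form_integral (R : realType) (G : lieGroup R) (n : nat)
    (P : set G) (p : {vspace lie G}) (o : ('I_n -> lie G) -> R^o)
    (I : (G -> ('I_n -> lie G) -> R^o) -> R) : Prop :=
  let top_form := bundle_form P p (fun _ => @id R^o) in
  (forall (c : R) f f', top_form f -> top_form f' ->
     I (fun x X => c * f x X + f' x X) = c * I f + I f') /\
  (forall U sigma C f, oriented_chart P o U sigma ->
     compact C -> C `<=` U -> top_form f ->
     (forall x, (forall u, C u -> ~ P ((sigma u)^-1 * x)%g) ->
        forall X, f x X = 0) ->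
     I f = iter_int
       (fun u => if u \in U then f (sigma u) (log_deriv sigma u) else 0)).

(* wedge product of W (x) V^*-valued with V-valued forms, by contraction *)
Definition contract_wedge (R : realType) (a V W : vectType R) (j k : nat)
    (f : ('I_j -> a) -> 'Hom(V, W)) (g : ('I_k -> a) -> V)
    (Y : 'I_(j + k) -> a) : W :=
  (j`! * k`!)%:R^-1 *: \sum_(s : 'S_(j + k)) (- 1) ^+ s *:
    f (fun i => Y (s (lshift k i))) (g (fun i => Y (s (rshift j i)))).

(* The fibre of pi_K over xK is G/P; phi /\ pi_P^* alpha is integrated over it
   as a top form with values in the fixed vector space
   Lambda^l T^*_{xK}(G/K) (x) W_{xK}. *)
Definition poisson_integral (R : realType) (G : lieGroup R) (V W : vectType R)
    (l j k : nat) (I : (G -> ('I_(j + k) -> lie G) -> R^o) -> R)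
    (phi : G -> G -> ('I_l -> lie G) -> ('I_j -> lie G) -> 'Hom(V, W))
    (alpha : G -> ('I_k -> lie G) -> V)
    (x : G) (X : 'I_l -> lie G) : W :=
  \sum_(b < \dim {:W})
    I (fun y Y => vcoord b (contract_wedge (phi x y X) (alpha y) Y)) *: vbase b.

Definition poisson_transform (R : realType) (G : lieGroup R)
    (V W : vectType R) (l j k : nat) (K P : set G) (kk p : {vspace lie G})
    (rV : G -> 'End(V)) (rW : G -> 'End(W))
    (I : (G -> ('I_(j + k) -> lie G) -> R^o) -> R)
    (phi : G -> G -> ('I_l -> lie G) -> ('I_j -> lie G) -> 'Hom(V, W))
    (Phi : (G -> ('I_k -> lie G) -> V) -> G -> ('I_l -> lie G) -> W) : Prop :=
  [/\ biform K P kk p rV rW phi,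
      forall alpha, bundle_form P p (fun x => rV x) alpha ->
        Phi alpha = poisson_integral I phi alpha
    & forall a alpha, bundle_form P p (fun x => rV x) alpha ->
        Phi (translate a alpha) = translate a (Phi alpha)].

(* In degree 0 the codifferential vanishes, and the second condition is void. *)
Definition factors_to_BGG (R : realType) (G : lieGroup R) (V W : vectType R)
    (l k : nat) (P : set G) (p pp : {vspace lie G}) (rV : G -> 'End(V))
    (Phi : (G -> ('I_k -> lie G) -> V) -> G -> ('I_l -> lie G) -> W) : Prop :=
  (forall alpha : G -> ('I_k.+1 -> lie G) -> V,
     bundle_form P p (fun x => rV x) alpha ->
     forall x X, Phi (dstar pp rV alpha) x X = 0) /\
  (match k return
     ((G -> ('I_k -> lie G) -> V) -> G -> ('I_l -> lie G) -> W) -> Prop with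
   | 0%N => fun _ => True
   | k'.+1 => fun Phi' =>
       forall alpha : G -> ('I_k'.+1 -> lie G) -> V,
       bundle_form P p (fun x => rV x) alpha ->
       forall x X, Phi' (dV rV (dstar pp rV alpha)) x X = 0
   end) Phi.

(* On (l,0)-forms the operator is zero. *)
Definition in_ker_dPstar (R : realType) (G : lieGroup R) (V W : vectType R)
    (l q : nat) (pp : {vspace lie G}) (rV : G -> 'End(V)) :
    (G -> G -> ('I_l -> lie G) -> ('I_q -> lie G) -> 'Hom(V, W)) -> Prop :=
  match q with
  | 0%N => fun _ => True
  | q'.+1 => fun phi => forall x y X Y, dPstar pp rV phi x y X Y = 0
  end.

(* Main.v *)
(* Write a form on G/P as an equivariant function on G. The kernel phi, at a fixed
   point (x, X) of the G/K-direction, is a Hom(V, W)-valued form on G/P, and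
   Phi(alpha) is the integral over G/P of the top form phi /\ alpha. Three facts
   turn the conditions on Phi into conditions on phi.
   - Algebra: phi /\ d^* alpha = +- d^* phi /\ alpha pointwise. In terms of
     dual bases Z_a of p_+ and xi_a of g/p, d^* is the sum over a of
     -Z_a iota(xi_a), plus half of a derivation by ad Z_a. The interior product
     is an antiderivation of the vanishing form phi /\ alpha of degree
     dim G/P + 1, and the derivations act on top forms by a trace which is zero.
   - Stokes: the integral of d(phi /\ d^* alpha) vanishes, which moves d^V from
     alpha to phi; and d_P is d in the second variable up to sign.
   - Nondegeneracy: a form which pairs to zero with all forms is zero.
   Stokes and nondegeneracy need charts of G/P and P-invariant bump functions on
   G. Let E be the grading element of a grading defining p. As [E, -] is
   invertible on g_-, the projection to g_- of E along Ad(y) p, as a function of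
   yP, is a local diffeomorphism at the base point; it identifies nearby points
   only if they agree modulo the normalizer of p. Composing it with a flat
   function gives the bumps, and as G = KP with K compact, finitely many
   translates give a partition of unity. *)
Require Import Defs.
From HB Require Import structures.
From mathcomp Require Import all_boot all_order all_algebra perm.
From mathcomp Require Import all_classical all_reals all_analysis.
From mathcomp Require Import ring lra zify.

Set Implicit Arguments.
Unset Strict Implicit.
Unset Printing Implicit Defensive.

Import Order.TTheory GRing.Theory Num.Theory.
Import numFieldNormedType.Exports.

Local Open Scope classical_set_scope.
Local Open Scope ring_scope.

#[local] Opaque pderiv.

(** * Calculus on open sets of row vectors *)

(** The Lie algebra is given only as a space of left-invariant derivations, without an exponential
    map. Hadamard's lemma in a chart at the identity turns its elements into tangent vectors there,
    and curves replace one-parameter subgroups.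

    The delicate point is that p is tangent to P: only then is d of an equivariant form again
    horizontal, that is, a form on G/P. P is merely known to lie between the normalizer of p and its
    identity component. A straight segment in the chart is pushed into the zero set of the cell
    functions by the implicit function theorem with parameters; these zeros normalize p, and a path
    of them from 1 stays in the component. It follows that P is open in the normalizer, closed in G
    and tangent to p.

    The codifferential and the exterior derivative both contain brackets of pairs of arguments. Each
    bracket is shared evenly between its two arguments, so that every summand acts as a derivation
    on wedge products; this is the origin of the factor 1/2 in [codiff_term] and [ext_term].

    In the extreme degrees one condition is void, and its counterpart concerns forms of degree above
    dim G/P, which vanish. *)

Section Calculus.
Variable R : realType.

Lemma mean_value_bound (g dg : R -> R) (s e : R) :
  (forall t : R, `|t| <= `|s| -> is_derive t 1 g (dg t)) ->
  (forall t : R, `|t| <= `|s| -> `|dg t| <= e) ->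
  `|g s - g 0| <= e * `|s|.
Proof.
move=> dgP dge.
have cg a b : `|a| <= `|s| -> `|b| <= `|s| -> a <= b ->
    {within `[a, b], continuous g}.
  move=> ha hb ab; apply: derivable_within_continuous => x.
  rewrite in_itv/= => /andP[ax xb].
  have /dgP[] // : `|x| <= `|s|.
  move: ha hb; rewrite !ler_norml => /andP[h1 h2] /andP[h3 h4].
  by rewrite (le_trans h1 ax) (le_trans xb h4).
have inb a b x : `|a| <= `|s| -> `|b| <= `|s| -> a <= x -> x <= b ->
    `|x| <= `|s|.
  move=> ha hb ax xb; move: ha hb; rewrite !ler_norml.
  by move=> /andP[h1 h2] /andP[h3 h4]; rewrite (le_trans h1 ax) (le_trans xb h4).
have n0 : `|(0 : R)| <= `|s| by rewrite normr0 normr_ge0.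
have [s0|s0] := leP 0 s.
  have [x|c] := MVT_segment s0 (df := dg) (f := g) _ (cg _ _ n0 (lexx _) s0).
    by rewrite in_itv/= => /andP[h1 h2]; apply/dgP/(inb 0 s) => //; exact: ltW.
  rewrite in_itv/= => /andP[h1 h2] ->; rewrite subr0 normrM.
  by rewrite ler_wpM2r// dge// (inb 0 s).
have [x|c] := MVT_segment (ltW s0) (df := dg) (f := g) _
    (cg _ _ (lexx _) n0 (ltW s0)).
  by rewrite in_itv/= => /andP[h1 h2]; apply/dgP/(inb s 0) => //; exact: ltW.
rewrite in_itv/= => /andP[h1 h2] e1; rewrite distrC e1 sub0r normrM normrN.
by rewrite ler_wpM2r// dge// (inb s 0).
Qed.

Lemma is_derive_affine (a b t0 : R) :
  is_derive t0 1 (fun t : R => a + t * b) b.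
Proof.
have h1 : is_derive t0 1 (id : R -> R) 1 := is_derive_id t0 1.
have h2 : is_derive t0 1 (cst b : R -> R) 0 := is_derive_cst b t0 1.
have h3 : is_derive t0 1 (cst a : R -> R) 0 := is_derive_cst a t0 1.
have h := is_deriveD h3 (is_deriveM h1 h2); apply: is_derive_eq h _.
by rewrite scaler0 !add0r [_ *: 1]mulr1.
Qed.

Variable n : nat.
Implicit Types (f g : 'rV[R]_n -> R) (U : set 'rV[R]_n) (u v w : 'rV[R]_n).

Lemma derivable_line f u v :
  derivable (fun t : R => f (u + t *: v)) 0 1 <-> derivable f u v.
Proof.
have -> : (fun t : R => f (u + t *: v)) = (fun h : R => f (h *: v + u)).
  by apply/funext => t; rewrite addrC.
exact: iff_sym (@derivable1P R _ _ f u v).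
Qed.

Lemma derive1_line f u v :
  derive1 (fun t : R => f (u + t *: v)) 0 = 'D_v f u.
Proof.
rewrite /derive1 /derive.
have -> // : (fun h : R => h^-1 *: (f (u + (h + 0) *: v) - f (u + 0 *: v))) =
  (fun h : R => h^-1 *: ((f \o shift u) (h *: v) - f u)).
by apply/funext => h /=; rewrite addr0 scale0r addr0 [u + _]addrC.
Qed.

Lemma pderivE (i : 'I_n) f u : pderiv i f u = 'D_(delta_mx 0 i) f u.
Proof. exact: derive1_line. Qed.

Lemma is_derive_line f u v (t0 : R) (d : R) :
  is_derive (u + t0 *: v) v f d ->
  is_derive t0 1 (fun t : R => f (u + t *: v)) d.
Proof.
move=> [df <-]; set g := fun t : R => _.
have gE : (fun h : R => h^-1 *: (((g \o shift t0) (h *: (1:R))) - g t0)) =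
  (fun h : R => h^-1 *: ((f \o shift (u + t0 *: v)) (h *: v) - f (u + t0 *: v))).
  apply/funext => h; rewrite /g /= scalerDl [h *: 1]mulr1.
  by rewrite [u + (_ + _)]addrCA.
by apply: DeriveDef; rewrite /derivable /derive gE.
Qed.

(** The corners of a staircase from 0 to v: two successive ones differ by a step along a single
    axis. *)
Definition truncate (k : nat) v : 'rV[R]_n :=
  \row_i (if (i < k)%N then v 0 i else 0).

Lemma coord_norm v i : `|v 0 i| <= `|v|.
Proof.
rewrite [leRHS]/Num.Def.normr/= mx_normrE.
exact: (le_bigmax _ (fun i => `|v i.1 i.2|) (0, i)).
Qed.

Lemma row_norm_le v (e : R) : 0 <= e -> (forall i, `|v 0 i| <= e) -> `|v| <= e.
Proof.
move=> e0 h; rewrite [leLHS]/Num.Def.normr/= mx_normrE.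
by apply: bigmax_le => // -[i j] _ /=; rewrite ord1.
Qed.

(** Each step of the staircase is estimated by the mean value bound along its axis, applied to f
    minus the linear term. The sup norm keeps all points of the staircase within distance |v| of
    u. *)
Lemma linear_approx f u (L : 'I_n -> R) (r e : R) :
  (forall w i, `|w - u| < r -> derivable f w (delta_mx 0 i)) ->
  (forall w i, `|w - u| < r -> `|pderiv i f w - L i| <= e) ->
  forall v, `|v| < r -> `|f (u + v) - f u - \sum_i v 0 i * L i| <= n%:R * e * `|v|.
Proof.
move=> dfP pdP v vr.
have [n0|n0] := posnP n.
  have -> : v = 0 by subst n; apply/rowP => -[].
  rewrite addr0 subrr sub0r normrN big1 ?normr0 ?mulr0//.
  by move=> i _; rewrite mxE mul0r.
have e0 : 0 <= e.
  apply: le_trans (pdP u (Ordinal n0) _); first exact: normr_ge0.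
  by rewrite subrr normr0 (le_lt_trans _ vr).
suff H k : (k <= n)%N -> `|f (u + truncate k v) - f u -
    \sum_(i < n | (i < k)%N) v 0 i * L i| <= k%:R * e * `|v|.
  move: (H n (leqnn n)).
  have -> : truncate n v = v by apply/rowP => i; rewrite mxE ltn_ord.
  by under eq_bigl do rewrite ltn_ord.
elim: k => [_|k IH kn].
  rewrite (_ : truncate 0 v = 0); last by apply/rowP => i; rewrite !mxE.
  by rewrite addr0 subrr big_pred0 ?subr0 ?normr0 ?mul0r.
set i := Ordinal kn; set w := truncate k v.
have wE : truncate k.+1 v = w + v 0 i *: delta_mx 0 i.
  apply/rowP => j; rewrite !mxE eqxx/= -val_eqE/= ltnS leq_eqVlt.
  case: (ltngtP j k) => [jk|jk|jk]; rewrite ?mulr0 ?addr0 ?mulr1 ?add0r//.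
  by congr (v 0 _); exact: val_inj.
rewrite (bigD1 i)/= ?ltnS// (eq_bigl (fun j : 'I_n => (j < k)%N)); last first.
  by move=> j; rewrite ltnS ltn_neqAle andbC -val_eqE.
pose g (t : R) := f (u + w + t *: delta_mx 0 i) - t * L i.
have ok (t : R) : `|t| <= `|v 0 i| -> `|u + w + t *: delta_mx 0 i - u| < r.
  move=> tv; rewrite addrAC [u + w]addrC addrK; apply: le_lt_trans vr.
  apply: row_norm_le => // j; rewrite !mxE eqxx/=.
  case: (j =P i) => [->|_]; last first.
    by rewrite mulr0 addr0; case: ifP => _; rewrite ?normr0 ?coord_norm.
  rewrite ltnn add0r mulr1; exact: le_trans tv (coord_norm _ _).
have dg (t : R) : `|t| <= `|v 0 i| ->
    is_derive t 1 g (pderiv i f (u + w + t *: delta_mx 0 i) - L i).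
  move=> tv; apply: is_deriveB.
    by apply: is_derive_line; rewrite pderivE; apply/derivableP/dfP/ok.
  rewrite -[X in is_derive _ _ _ X]mulr1.
  have := @is_deriveM R _ id (cst (L i)) t 1 1 0 _ _.
  rewrite scaler0 add0r => h.
  by rewrite /GRing.scale/= in h; exact: h.
have := mean_value_bound dg (fun t tv => pdP _ i (ok t tv)).
have uE : u + truncate k.+1 v = u + w + v 0 i *: delta_mx 0 i.
  by rewrite wE addrA.
rewrite /g scale0r mul0r addr0 subr0 -uE => h.
have -> : f (u + truncate k.+1 v) - f u -
   (v 0 i * L i + \sum_(j < n | (j < k)%N) v 0 j * L j) =
   (f (u + truncate k.+1 v) - v 0 i * L i - f (u + w)) +
   (f (u + w) - f u - \sum_(j < n | (j < k)%N) v 0 j * L j) by ring.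
apply: le_trans (ler_normD _ _) _.
rewrite -natr1 mulrDl mul1r mulrDl addrC lerD ?IH ?(ltnW kn)//.
by apply: le_trans h _; rewrite ler_wpM2l// coord_norm.
Qed.

Lemma is_derive_lineP f u v (d : R) :
  is_derive u v f d <-> is_derive (0 : R) 1 (fun t : R => f (u + t *: v)) d.
Proof.
split=> [h|[h1 h2]]; first by apply: is_derive_line; rewrite scale0r addr0.
apply: DeriveDef; first exact/derivable_line.
by rewrite -h2 -derive1_line derive1E.
Qed.

Lemma is_derive_comp1 (b : R -> R) f u v (db df : R) :
  is_derive (f u) 1 b db -> is_derive u v f df ->
  is_derive u v (fun w => b (f w)) (db * df).
Proof.
move=> hb /is_derive_lineP hf; apply/is_derive_lineP.
have := @is_derive1_comp R b (fun t : R => f (u + t *: v)) 0 db df.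
by rewrite scale0r addr0; apply.
Qed.

Lemma is_derive_mul f g u v (df dg : R) :
  is_derive u v f df -> is_derive u v g dg ->
  is_derive u v (fun w => f w * g w) (df * g u + f u * dg).
Proof.
move=> hf hg; have := is_deriveM hf hg.
by move=> h; apply: is_derive_eq h _; rewrite /GRing.scale/= addrC mulrC.
Qed.

Lemma is_derive_add f g u v (df dg : R) :
  is_derive u v f df -> is_derive u v g dg ->
  is_derive u v (fun w => f w + g w) (df + dg).
Proof. by move=> hf hg; have := is_deriveD hf hg. Qed.

Lemma is_derive_bigsum (I : Type) (r : seq I) (P : pred I)
    (h : I -> 'rV[R]_n -> R) u v (dh : I -> R) :
  (forall i, is_derive u v (h i) (dh i)) ->
  is_derive u v (fun w => \sum_(i <- r | P i) h i w)
    (\sum_(i <- r | P i) dh i).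
Proof.
move=> hP; elim: r => [|i r IH].
  rewrite big_nil (_ : (fun _ => _) = cst 0); first exact: is_derive_cst.
  by apply/funext => w; rewrite big_nil.
rewrite big_cons; under [fun _ => _]funext do rewrite big_cons.
by case: (P i) => //; exact: is_derive_add.
Qed.

Definition dotp (L : 'I_n -> R) v : R := \sum_i v 0 i * L i.

Lemma dotp_linear L : linear (dotp L).
Proof.
move=> a v w; rewrite /dotp scaler_sumr -big_split/=; apply: eq_bigr => i _.
by rewrite !mxE mulrDl /GRing.scale/= mulrA.
Qed.

Lemma sum_continuous (T : topologicalType) (I : Type) (r : seq I) (P : pred I)
    (h : I -> T -> R) (x : T) :
  (forall i, {for x, continuous (h i)}) ->
  {for x, continuous (fun w : T => \sum_(i <- r | P i) h i w)}.
Proof.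
move=> hP; elim: r => [|i r IH].
  rewrite (_ : (fun _ => _) = cst 0); first exact: cst_continuous.
  by apply/funext => w; rewrite big_nil.
rewrite (_ : (fun _ => _) =
  (fun w : T => (if P i then h i w else 0) + \sum_(i <- r | P i) h i w)); last first.
  by apply/funext => w; rewrite big_cons; case: (P i); rewrite ?add0r.
apply: continuousD => //; case: (P i); by [exact: hP|exact: cst_continuous].
Qed.

Lemma dotp_continuous L : continuous (dotp L).
Proof.
move=> v; apply: sum_continuous => i.
by apply: continuousM; [exact: coord_continuous|exact: cst_continuous].
Qed.

Lemma C1_differentiable f u :
  (\forall w \near u, forall i, derivable f w (delta_mx 0 i)) ->
  (forall i, {for u, continuous (pderiv i f)}) ->
  differentiable f u /\ forall v, 'd f u v = dotp (fun i => pderiv i f u) v.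
Proof.
move=> /nbhs_ballP[r0 /= r0p hr0] cf.
pose L i := pderiv i f u.
have [lf lfE] : exists lf : {linear 'rV[R]_n -> R}, lf = dotp L :> (_ -> _).
  pose lfM := GRing.isLinear.Build R 'rV[R]_n R _ (dotp L) (dotp_linear L).
  by exists (HB.pack_for {linear 'rV[R]_n -> R} (dotp L) lfM).
have clf : continuous lf by rewrite lfE; exact: dotp_continuous.
have dxf : f \o shift u = cst (f u) + lf +o_ (0 : 'rV[R]_n) id.
  apply/eqaddoP => e e0.
  (* [linear_approx] multiplies the error by n; dividing by n + 1 also covers n = 0. *)
  have e'0 : 0 < e / n.+1%:R by rewrite divr_gt0.
  have H i : \forall w \near u, `|L i - pderiv i f w| <= e / n.+1%:R.
    by have /cvgrPdist_le/(_ _ e'0) := cf i.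
  have : \forall w \near u, forall i, `|L i - pderiv i f w| <= e / n.+1%:R.
    exact: (@filter_forall _ _ (fun i w => `|L i - pderiv i f w| <= e / n.+1%:R)
      (nbhs u) _ H).
  move=> /nbhs_ballP[r1 /= r1p hr1].
  have rp : 0 < Num.min r0 r1 by rewrite lt_min r0p.
  apply/nbhs_ballP; exists (Num.min r0 r1) => //= v.
  rewrite -ball_normE/= sub0r normrN => vr.
  have := @linear_approx f u L (Num.min r0 r1) (e / n.+1%:R) _ _ v vr.
  rewrite lfE -[X in _ -> `|X| <= _]/(f (v + u) - (f u + dotp L v)).
  rewrite opprD addrA [v + u]addrC => h.
  apply: le_trans (h _ _) _ => //.
  - move=> w i wu; apply: hr0; rewrite -ball_normE/= distrC.
    by apply: lt_le_trans wu _; rewrite ge_min lexx.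
  - move=> w i wu; rewrite distrC; apply: hr1; rewrite -ball_normE/= distrC.
    by apply: lt_le_trans wu _; rewrite ge_min lexx orbT.
  rewrite ler_wpM2r// mulrCA ger_pMr// ler_pdivrMr// mul1r ler_nat.
  exact: leqnSn.
have dE := diff_unique clf dxf.
split; first by apply/diff_locallyP; rewrite dE.
by move=> v; rewrite dE lfE.
Qed.

Lemma Ck_on_cont m U f :
  Ck_on m U f -> forall u, U u -> {for u, continuous f}.
Proof. by case: m => [|m] []. Qed.

Lemma Ck_onS m U f : Ck_on m.+1 U f -> Ck_on m U f.
Proof.
elim: m f => [|m IH] f [cf h]; split=> // i; have [h1 h2] := h i.
by split=> //; exact: IH.
Qed.

Lemma Ck_on_le m m' U f : (m <= m')%N -> Ck_on m' U f -> Ck_on m U f.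
Proof.
move=> mm; rewrite -(subnK mm); elim: (_ - _)%N => // k IH h.
by apply: IH; apply: Ck_onS.
Qed.

Lemma Ck_on_is_derive m U f : Ck_on m.+1 U f -> forall u i, U u ->
  is_derive u (delta_mx 0 i) f (pderiv i f u).
Proof.
move=> [_ h] u i Uu; have [h1 _] := h i; rewrite pderivE.
by apply/derivableP/derivable_line/h1.
Qed.

Lemma Ck_on_pderiv m U f i : Ck_on m.+1 U f -> Ck_on m U (pderiv i f).
Proof. by move=> [_ h]; have [] := h i. Qed.

Lemma Ck_on_sub m U U' f : U' `<=` U -> Ck_on m U f -> Ck_on m U' f.
Proof.
move=> UU; elim: m f => [|m IH] f [cf h]; split => //.
- by move=> u /UU/cf.
- by move=> u /UU/cf.
move=> i; have [h1 h2] := h i; split; last exact: IH.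
by move=> u /UU/h1.
Qed.

Lemma near_continuous (T T' : topologicalType) (f g : T -> T') (x : T) :
  (\near x, f x = g x) -> {for x, continuous f} -> {for x, continuous g}.
Proof.
move=> fg cf; rewrite /prop_for /continuous_at -(nbhs_singleton fg).
by apply: cvg_trans cf; apply: near_eq_cvg.
Qed.

Lemma Ck_on_eq m U f g : open U -> (forall u, U u -> f u = g u) ->
  Ck_on m U f -> Ck_on m U g.
Proof.
move=> oU; elim: m f g => [|m IH] f g fg [cf h].
  split => // u Uu; apply: near_continuous (cf _ Uu).
  by have := open_nbhs_nbhs (conj oU Uu); apply: filterS.
have nfg u : U u -> \near u, f u = g u.
  by move=> Uu; have := open_nbhs_nbhs (conj oU Uu); apply: filterS.
split => [u Uu|i]; first by apply: near_continuous (cf _ Uu); exact: nfg.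
have [h1 h2] := h i; split=> [u Uu|].
  apply/derivable_line; apply: near_eq_derivable (nfg _ Uu) _.
  exact/derivable_line/h1.
apply: IH h2 => u Uu; rewrite !pderivE; exact/near_eq_derive/nfg.
Qed.

Lemma Ck_on_local m U f :
  (forall u, U u -> exists2 U', open_nbhs u U' & Ck_on m U' f) -> Ck_on m U f.
Proof.
elim: m f => [|m IH] f h.
  by split=> // u /h[U' [_ U'u] /Ck_on_cont]; exact.
split=> [u /h[U' [_ U'u] /Ck_on_cont]|i]; first exact.
split=> [u /h[U' [_ U'u] [_ /(_ i)[h1 _]]]|]; first exact: h1.
by apply: IH => u /h[U' U'u /(Ck_on_pderiv i)]; exists U'.
Qed.

(** The closure properties are proved by induction on m through this step: any explicit formula for
    the partial derivatives on U may stand for [pderiv]. *)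
Lemma Ck_on_step m U f (df : 'I_n -> 'rV[R]_n -> R) : open U ->
  (forall u, U u -> {for u, continuous f}) ->
  (forall i u, U u -> is_derive u (delta_mx 0 i) f (df i u)) ->
  (forall i, Ck_on m U (df i)) -> Ck_on m.+1 U f.
Proof.
move=> oU cf dfP h; split=> // i; split=> [u Uu|].
  by apply/derivable_line; have [] := dfP i u Uu.
apply: Ck_on_eq (h i) => // u Uu; rewrite pderivE.
by have [_ ->] := dfP i u Uu.
Qed.

Lemma Ck_on_cst m U (c : R) : open U -> Ck_on m U (cst c).
Proof.
move=> oU; elim: m c => [|m IH] c; first by split=> // u _; exact: cst_continuous.
apply: (@Ck_on_step _ _ _ (fun _ => cst 0)) => //.
  by move=> u _; exact: cst_continuous.
Qed.

Lemma Ck_on_add m U f g : open U ->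
  Ck_on m U f -> Ck_on m U g -> Ck_on m U (fun u => f u + g u).
Proof.
move=> oU; elim: m f g => [|m IH] f g hf hg.
  split=> // u Uu; exact: continuousD (Ck_on_cont hf Uu) (Ck_on_cont hg Uu).
apply: (@Ck_on_step _ _ _ (fun i u => pderiv i f u + pderiv i g u)) => //.
- by move=> u Uu; exact: continuousD (Ck_on_cont hf Uu) (Ck_on_cont hg Uu).
- by move=> i u Uu; exact: is_derive_add (Ck_on_is_derive hf _ Uu) (Ck_on_is_derive hg _ Uu).
- by move=> i; apply: IH; exact: Ck_on_pderiv.
Qed.

Lemma Ck_on_mul m U f g : open U ->
  Ck_on m U f -> Ck_on m U g -> Ck_on m U (fun u => f u * g u).
Proof.
move=> oU; elim: m f g => [|m IH] f g hf hg.
  split=> // u Uu; exact: continuousM (Ck_on_cont hf Uu) (Ck_on_cont hg Uu).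
apply: (@Ck_on_step _ _ _
  (fun i u => pderiv i f u * g u + f u * pderiv i g u)) => //.
- by move=> u Uu; exact: continuousM (Ck_on_cont hf Uu) (Ck_on_cont hg Uu).
- by move=> i u Uu; exact: is_derive_mul (Ck_on_is_derive hf _ Uu) (Ck_on_is_derive hg _ Uu).
- move=> i; apply: Ck_on_add => //; apply: IH;
    by [exact: Ck_on_pderiv|exact: Ck_onS].
Qed.

Lemma Ck_on_sum (I : Type) (r : seq I) (P : pred I) (h : I -> 'rV[R]_n -> R)
    m U : open U -> (forall i, Ck_on m U (h i)) ->
  Ck_on m U (fun u => \sum_(i <- r | P i) h i u).
Proof.
move=> oU hP; elim: r => [|i r IH].
  apply: Ck_on_eq (Ck_on_cst _ 0 oU) => // u _; by rewrite big_nil.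
apply: (@Ck_on_eq _ _ (fun u => (if P i then h i u else 0) +
   \sum_(i <- r | P i) h i u)) => //.
  by move=> u _; rewrite big_cons; case: (P i); rewrite ?add0r.
apply: Ck_on_add => //; case: (P i) => //; exact: (Ck_on_cst m 0).
Qed.

Lemma Ck_on_coord m U i : open U -> Ck_on m U (fun u => u 0 i).
Proof.
move=> oU; case: m => [|m].
  by split=> // u _; exact: coord_continuous.
apply: (@Ck_on_step _ _ _ (fun j => cst (i == j)%:R)) => //.
- by move=> u _; exact: coord_continuous.
- move=> j u _; apply/is_derive_lineP.
  have -> : (fun t : R => (u + t *: delta_mx 0 j) 0 i) =
    (fun t : R => u 0 i + t * (i == j)%:R).
    by apply/funext => t; rewrite !mxE eqxx.
  exact: is_derive_affine.
by move=> j; exact: Ck_on_cst.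
Qed.

Lemma Ck_on_inv m U f : open U -> (forall u, U u -> f u != 0) ->
  Ck_on m U f -> Ck_on m U (fun u => (f u)^-1).
Proof.
move=> oU f0; elim: m => [|m IH] hf.
  by split=> // u Uu; exact: continuousV (f0 _ Uu) (Ck_on_cont hf Uu).
apply: (@Ck_on_step _ _ _
  (fun i u => (-1) * ((f u)^-1 * (f u)^-1 * pderiv i f u))) => //.
- by move=> u Uu; exact: continuousV (f0 _ Uu) (Ck_on_cont hf Uu).
- move=> i u Uu; have h := Ck_on_is_derive hf i Uu.
  have hb : is_derive (f u) 1 (fun x : R => x^-1) (- (f u) ^- 2).
    have := @is_deriveV R id (f u) 1 1 (f0 _ Uu) (is_derive_id _ _).
    by rewrite [_ *: 1]mulr1.
  apply: is_derive_eq (is_derive_comp1 hb h) _.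
  by rewrite -invfM -expr2; ring.
move=> i; apply: Ck_on_mul => //; first exact: (Ck_on_cst m (-1)).
apply: Ck_on_mul => //; last exact: Ck_on_pderiv.
have := IH (Ck_onS hf) => h; exact: Ck_on_mul.
Qed.

End Calculus.

(** * Chain rule, symmetry of second derivatives, flat functions *)

Section Calculus2.
Variable R : realType.

Lemma row_continuous (T : topologicalType) n (g : T -> 'rV[R]_n) (x : T) :
  (forall j, {for x, continuous (fun y : T => g y 0 j)}) ->
  {for x, continuous g}.
Proof.
move=> h; apply/cvgrPdist_le => e e0.
have H j : \forall y \near x, `|g x 0 j - g y 0 j| <= e.
  by have /cvgrPdist_le/(_ _ e0) := h j.
apply: filterS (@filter_forall _ _ (fun j y => `|g x 0 j - g y 0 j| <= e)
  (nbhs x) _ H) => y hy; apply: row_norm_le => [|j]; first exact: ltW.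
by rewrite !mxE; exact: hy.
Qed.

Lemma C1_differentiable_on n V (f : 'rV[R]_n -> R) u :
  open V -> Ck_on 1 V f -> V u ->
  differentiable f u /\ forall v, 'd f u v = dotp (fun i => pderiv i f u) v.
Proof.
move=> oV hf Vu; apply: C1_differentiable.
  have := open_nbhs_nbhs (conj oV Vu); apply: filterS => w Vw i.
  by have [] := Ck_on_is_derive hf i Vw.
by move=> i; exact: (Ck_on_cont (Ck_on_pderiv i hf) Vu).
Qed.

Lemma is_derive_comp_row n V (f : 'rV[R]_n -> R) (g : R -> 'rV[R]_n) (t0 : R)
    (dg : 'I_n -> R) :
  open V -> Ck_on 1 V f -> V (g t0) ->
  (forall j, is_derive t0 1 (fun t : R => g t 0 j) (dg j)) ->
  is_derive t0 1 (fun t : R => f (g t)) (\sum_j dg j * pderiv j f (g t0)).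
Proof.
move=> oV hf Vg hg.
have [df dfE] := C1_differentiable_on oV hf Vg.
have gd : derivable g t0 1.
  by apply/derivable_mxP => i j; rewrite ord1; have [] := hg j.
have gdiff : differentiable g t0 by apply/derivable1_diffP.
have cdiff := differentiable_comp gdiff df.
have cd : derivable (f \o g) t0 1 by apply/derivable1_diffP.
apply: DeriveDef; first exact: cd.
have gE : 'd g t0 1 = 'D_1 g t0 by rewrite deriveE.
rewrite -[LHS]/('D_1 (f \o g) t0) deriveE// diff_comp//= gE dfE.
apply: eq_bigr => j _; rewrite derive_mx// mxE.
by have [_ ->] := hg j.
Qed.

Lemma is_derive_dir n V (f : 'rV[R]_n -> R) u v :
  open V -> Ck_on 1 V f -> V u ->
  is_derive u v f (\sum_j v 0 j * pderiv j f u).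
Proof.
move=> oV hf Vu; apply/is_derive_lineP.
have := @is_derive_comp_row n V f (fun t => u + t *: v) 0 (fun j => v 0 j) oV hf.
rewrite scale0r addr0; apply=> // j.
have -> : (fun t : R => (u + t *: v) 0 j) = (fun t : R => u 0 j + t * v 0 j).
  by apply/funext => t; rewrite !mxE.
exact: is_derive_affine.
Qed.

Lemma Ck_on_comp n n' m U V (f : 'rV[R]_n' -> R) (g : 'rV[R]_n -> 'rV[R]_n') :
  open U -> open V -> Ck_on m V f -> (forall j, Ck_on m U (fun u => g u 0 j)) ->
  (forall u, U u -> V (g u)) -> Ck_on m U (fun u => f (g u)).
Proof.
move=> oU oV; elim: m f => [|m IH] f hf hg UV.
  split=> // u Uu; apply: continuous_comp.
    by apply: row_continuous => j; exact: (Ck_on_cont (hg j) Uu).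
  exact: (Ck_on_cont hf (UV _ Uu)).
have hg' j := Ck_onS (hg j).
apply: (@Ck_on_step _ _ _ _ _
  (fun i u => \sum_j pderiv i (fun w => g w 0 j) u * pderiv j f (g u))) => //.
- move=> u Uu; apply: continuous_comp.
    by apply: row_continuous => j; exact: (Ck_on_cont (hg j) Uu).
  exact: (Ck_on_cont hf (UV _ Uu)).
- move=> i u Uu; apply/is_derive_lineP.
  have := @is_derive_comp_row n' V f (fun t => g (u + t *: delta_mx 0 i)) 0
    (fun j => pderiv i (fun w => g w 0 j) u) oV.
  rewrite scale0r addr0; apply.
  + by apply: Ck_on_le hf.
  + exact: UV.
  + move=> j; apply/(is_derive_lineP (fun w => g w 0 j)).
    exact: (Ck_on_is_derive (hg j) i Uu).
- move=> i; apply: Ck_on_sum => // j; apply: Ck_on_mul => //.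
    exact: (Ck_on_pderiv i (hg j)).
  exact: IH (Ck_on_pderiv j hf) hg' UV.
Qed.

Lemma mvt0 (g dg : R -> R) (h : R) : 0 < h ->
  (forall t, 0 <= t <= h -> is_derive t 1 g (dg t)) ->
  exists2 c, 0 <= c <= h & g h - g 0 = dg c * h.
Proof.
move=> h0 hg; have [|||c] := @MVT_segment R g dg 0 h; rewrite ?ltW//.
- by move=> x; rewrite in_itv/= => /andP[x0 xh]; apply: hg; rewrite !ltW.
- apply: derivable_within_continuous => x; rewrite in_itv/= => xh.
  by have [] := hg x xh.
- by rewrite in_itv/= subr0 => ch ->; exists c.
Qed.

(** The mean value theorem in direction i, applied to the difference of two translates of f that are
    h apart in direction j, and then in direction j. The left side is symmetric in i and j, which is
    what [pderivC] exploits. *)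
Lemma second_difference n V (f : 'rV[R]_n -> R) (u : 'rV[R]_n) (i j : 'I_n) (r h : R) :
  open V -> Ck_on 2 V f -> ball u r `<=` V -> 0 < h -> h + h < r ->
  exists2 w : 'rV[R]_n, `|w - u| <= h + h &
  f (u + h *: delta_mx 0 i + h *: delta_mx 0 j) - f (u + h *: delta_mx 0 i) -
  f (u + h *: delta_mx 0 j) + f u = pderiv j (pderiv i f) w * h * h.
Proof.
move=> oV hf uV h0 hr; set ei := delta_mx 0 i; set ej := delta_mx 0 j.
have en (k : 'I_n) (s : R) : `|s *: (delta_mx 0 k : 'rV[R]_n)| <= `|s|.
  apply: row_norm_le => // l; rewrite !mxE eqxx/=.
  by case: (l == k); rewrite ?mulr1 ?mulr0 ?normr0.
have close (s t : R) : 0 <= s <= h -> 0 <= t <= h ->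
    `|u + s *: ei + t *: ej - u| <= h + h.
  move=> /andP[s0 sh] /andP[t0 th].
  rewrite -(addrA u) [X in `|X|]addrC addKr; apply: le_trans (ler_normD _ _) _.
  by apply: lerD; apply: le_trans (en _ _) _; rewrite ger0_norm.
have inV (s t : R) : 0 <= s <= h -> 0 <= t <= h -> V (u + s *: ei + t *: ej).
  move=> sh th; apply: uV; rewrite -ball_normE/= distrC.
  exact: le_lt_trans (close _ _ sh th) hr.
have hh : 0 <= h <= h by rewrite ltW//=.
have h00 : 0 <= (0 : R) <= h by rewrite lexx ltW.
pose g (s : R) := f (u + h *: ej + s *: ei) - f (u + s *: ei).
have [c ch cE] : exists2 c, 0 <= c <= h & g h - g 0 =
    (pderiv i f (u + h *: ej + c *: ei) - pderiv i f (u + c *: ei)) * h.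
  apply: (mvt0 (dg := fun c => pderiv i f (u + h *: ej + c *: ei) -
    pderiv i f (u + c *: ei)) h0) => t th.
  apply: is_deriveB; apply: is_derive_line; apply: (Ck_on_is_derive hf).
    by rewrite addrAC; exact: inV.
  by have := inV t 0 th h00; rewrite scale0r addr0.
have [d dh dE] : exists2 d, 0 <= d <= h &
    pderiv i f (u + c *: ei + h *: ej) - pderiv i f (u + c *: ei + 0 *: ej) =
    pderiv j (pderiv i f) (u + c *: ei + d *: ej) * h.
  apply: (mvt0 (g := fun d => pderiv i f (u + c *: ei + d *: ej))
    (dg := fun d => pderiv j (pderiv i f) (u + c *: ei + d *: ej)) h0) => t th.
  apply: is_derive_line.
  exact: (Ck_on_is_derive (Ck_on_pderiv i hf) _ (inV _ _ ch th)).
exists (u + c *: ei + d *: ej); first exact: close.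
rewrite -dE scale0r addr0 [u + c *: ei + h *: ej]addrAC -cE /g scale0r !addr0.
by rewrite [u + h *: ej + h *: ei]addrAC; ring.
Qed.

Lemma pderivC n V (f : 'rV[R]_n -> R) (u : 'rV[R]_n) (i j : 'I_n) :
  open V -> Ck_on 2 V f -> V u ->
  pderiv j (pderiv i f) u = pderiv i (pderiv j f) u.
Proof.
move=> oV hf Vu; apply/eqP; rewrite -subr_eq0 -normr_le0; apply/ler_addgt0Pr => e e0.
rewrite add0r.
have c1 : {for u, continuous (pderiv j (pderiv i f))}.
  exact: (Ck_on_cont (Ck_on_pderiv j (Ck_on_pderiv i hf)) Vu).
have c2 : {for u, continuous (pderiv i (pderiv j f))}.
  exact: (Ck_on_cont (Ck_on_pderiv i (Ck_on_pderiv j hf)) Vu).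
have e2 : 0 < e / 2 by rewrite divr_gt0.
have /cvgrPdist_le/(_ _ e2)/nbhs_ballP[r1 /= r10 h1] := c1.
have /cvgrPdist_le/(_ _ e2)/nbhs_ballP[r2 /= r20 h2] := c2.
have /nbhs_ballP[r0 /= r00 h0] := open_nbhs_nbhs (conj oV Vu).
pose r := Num.min r0 (Num.min r1 r2).
have rp : 0 < r by rewrite !lt_min r00 r10.
have [h hp hr] : exists2 h, 0 < h & h + h < r.
  by exists (r / 4); [rewrite divr_gt0|lra].
have hr0 : h + h < r0 by apply: lt_le_trans hr _; rewrite ge_min lexx.
have [w w1 wE] := second_difference i j oV hf h0 hp hr0.
have [z z1 zE] := second_difference j i oV hf h0 hp hr0.
have wz : pderiv j (pderiv i f) w = pderiv i (pderiv j f) z.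
  have hn : h * h != 0 by rewrite mulf_neq0 ?gt_eqF.
  move: wE zE.
  generalize (pderiv j (pderiv i f) w) (pderiv i (pderiv j f) z) => a b wE zE.
  apply: (mulIf hn); rewrite !mulrA -wE -zE [u + h *: delta_mx 0 j + _]addrAC.
  by rewrite -!addrA; congr (_ + _); rewrite addrCA.
rewrite -[X in `|X|](subrKA (pderiv j (pderiv i f) w)) {2}wz.
apply: le_trans (ler_normD _ _) _; rewrite (splitr e); apply: lerD.
  apply: h1; rewrite -ball_normE/= distrC; apply: le_lt_trans w1 _.
  by apply: lt_le_trans hr _; rewrite !ge_min lexx !orbT.
rewrite distrC; apply: h2; rewrite -ball_normE/= distrC; apply: le_lt_trans z1 _.
by apply: lt_le_trans hr _; rewrite !ge_min lexx !orbT.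
Qed.

(** The powers of t make the family closed under differentiation, see [is_derive_flat]; smoothness
    then follows by an induction in which k varies. *)
Definition flat (k : nat) (t : R) : R := if 0 < t then t ^- k * expR (- t^-1) else 0.

Lemma flat_le0 k t : t <= 0 -> flat k t = 0.
Proof. by rewrite /flat ltNge => ->. Qed.

Lemma flat_gt0 k t : 0 < t -> 0 < flat k t.
Proof. by move=> t0; rewrite /flat t0 mulr_gt0 ?expR_gt0// invr_gt0 exprn_gt0. Qed.

Lemma flat_ge0 k t : 0 <= flat k t.
Proof. by have [t0|/(flat_le0 k)->//] := ltP 0 t; exact/ltW/flat_gt0. Qed.

(** From exp x >= x^(k+2) / (k+2)! at x = 1/t. The square of t on the right is what forces the
    derivative at 0 to vanish. *)
Lemma flat_bound k t : `|flat k t| <= (k.+2)`!%:R * t ^+ 2.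
Proof.
have [t0|/(flat_le0 k)->] := ltP 0 t; last first.
  by rewrite normr0 mulr_ge0// sqr_ge0.
rewrite ger0_norm ?flat_ge0// /flat t0.
have tV : 0 < t^-1 by rewrite invr_gt0.
have := expR_ge1Dxn k.+1 (ltW tV); set E := expR _ => h.
have h' : (t^-1) ^+ k.+2 / (k.+2)`!%:R <= E by apply: le_trans h; rewrite lerDr.
rewrite expRN -/E; have E0 : 0 < E by exact: expR_gt0.
rewrite ler_pdivrMr//.
have f0 : 0 < (k.+2)`!%:R :> R by rewrite ltr0n fact_gt0.
have := ler_wpM2l (ltW (mulr_gt0 f0 (exprn_gt0 2 t0))) h'.
apply: le_trans; rewrite [leRHS](_ : _ = t ^+ 2 * t ^- k.+2); last first.
  rewrite exprVn; move: f0; set F := _`!%:R => f0; set X := _^-1.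
  by field; rewrite gt_eqF.
rewrite -(addn2 k) exprD invfM mulrC -mulrA mulVf ?mulr1//.
by rewrite expf_neq0// gt_eqF.
Qed.

Lemma is_derive_square_bound (g : R -> R) (C : R) : 0 <= C -> g 0 = 0 ->
  (forall t, `|g t| <= C * t ^+ 2) -> is_derive (0 : R) 1 g 0.
Proof.
move=> C0 g0 gC.
have h : (fun h : R => h^-1 *: ((g \o shift 0) (h *: (1 : R)) - g 0)) @ 0^' --> (0 : R).
  apply/cvgrPdist_le => e e0.
  have C1 : 0 < C + 1 by rewrite ltr_wpDl.
  near=> t; rewrite sub0r normrN g0 subr0/= addr0 [t *: 1]mulr1.
  have tn : t != 0 by near: t; exact: nbhs_dnbhs_neq.
  have te : `|t| <= e / (C + 1).
    by near: t; apply: dnbhs0_le; rewrite divr_gt0.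
  rewrite normrM normfV mulrC ler_pdivrMr ?normr_gt0//.
  apply: le_trans (gC t) _; rewrite -real_normK ?num_real// expr2 mulrA.
  rewrite ler_wpM2r//; apply: (@le_trans _ _ ((C + 1) * `|t|)).
    by rewrite ler_wpM2r// lerDl.
  by rewrite mulrC -ler_pdivlMr.
apply: DeriveDef; last exact: cvg_lim h.
by apply/cvg_ex; exists 0.
Unshelve. all: by end_near. Qed.

Lemma is_derive_flat k (t : R) :
  is_derive t 1 (flat k) (flat k.+2 t - k%:R * flat k.+1 t).
Proof.
have [t0|t0|->] := ltgtP t 0.
- rewrite !flat_le0 ?ltW// mulr0 subr0.
  apply: (@near_eq_is_derive _ _ _ (cst (0 : R))).
  near=> s; rewrite flat_le0//; apply: ltW.
  by near: s; exact: lt_nbhsl.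
- have tn : t != 0 by rewrite gt_eqF.
  apply: (@near_eq_is_derive _ _ _ (fun s : R => (s ^+ k)^-1 * expR (- s^-1))).
    near=> s; rewrite /flat; have -> // : 0 < s.
    by near: s; exact: lt_nbhsr.
  have hid : is_derive t (1:R) (id : R -> R) 1 := is_derive_id t 1.
  have h1 := @is_deriveX _ _ id k t 1 1 hid.
  have idX : (id ^+ k : R -> R) = (fun s => s ^+ k).
    by apply/funext => s; rewrite fctE.
  rewrite idX in h1.
  have h2 := @is_deriveV R (fun s => s ^+ k) t _ 1 (expf_neq0 k tn) h1.
  have h3 := @is_deriveN _ _ _ _ _ _ _ (@is_deriveV R id t 1 1 tn hid).
  have h3' : is_derive t 1 (fun s : R => - s^-1) (- (- t ^- 2 *: 1)) := h3.
  have h4 := @is_derive1_comp R expR (fun s => - s^-1) t _ _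
    (is_derive_expR (- t^-1)) h3'.
  have := is_deriveM h2 h4.
  set F1 := (X in is_derive _ _ X _ -> _).
  have -> : F1 = (fun s : R => (s ^+ k)^-1 * expR (- s^-1)) by [].
  move=> h; apply: is_derive_eq h _.
  rewrite /flat t0 /GRing.scale/= !exprS.
  clear -tn; case: k => [|k]/=; first by field; rewrite ?tn.
  by rewrite !exprS; field; rewrite ?tn ?expf_neq0.
- rewrite !flat_le0// mulr0 subr0.
  apply: (@is_derive_square_bound _ (k.+2)`!%:R) => //.
    exact: flat_le0.
  exact: flat_bound.
Unshelve. all: by end_near. Qed.

Lemma Ck_on_flat n m k U (f : 'rV[R]_n -> R) : open U ->
  Ck_on m U f -> Ck_on m U (fun u => flat k (f u)).
Proof.
move=> oU; elim: m k => [|m IH] k hf.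
  split=> // u Uu; apply: continuous_comp; first exact: (Ck_on_cont hf Uu).
  apply: differentiable_continuous; apply/derivable1_diffP.
  by have [] := is_derive_flat k (f u).
apply: (@Ck_on_step _ _ _ _ _ (fun i u =>
  (flat k.+2 (f u) + (- k%:R) * flat k.+1 (f u)) * pderiv i f u)) => //.
- move=> u Uu; apply: continuous_comp; first exact: (Ck_on_cont hf Uu).
  apply: differentiable_continuous; apply/derivable1_diffP.
  by have [] := is_derive_flat k (f u).
- move=> i u Uu; rewrite mulNr.
  exact: (is_derive_comp1 (is_derive_flat _ _) (Ck_on_is_derive hf _ Uu)).
- move=> i; have hf' := Ck_onS hf.
  apply: Ck_on_mul => //; last exact: Ck_on_pderiv.
  apply: Ck_on_add => //; first exact: IH.
  by apply: Ck_on_mul => //; [exact: (Ck_on_cst m)|exact: IH].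
Qed.

End Calculus2.

(** * Integrals with parameters *)

Section ParamIntegral.
Variable R : realType.
Implicit Types (a b e : R) (f g : R -> R).

Definition seg_int a b f : R := \int[lebesgue_measure]_(t in `[a, b]) f t.

Definition cont_seg a b f := forall t : R, a <= t <= b -> {for t, continuous f}.

Lemma cont_seg_within a b f : cont_seg a b f -> {within `[a, b], continuous f}.
Proof.
move=> cf; apply: continuous_in_subspaceT => t.
by rewrite inE/= in_itv/= => /cf.
Qed.

Lemma cont_seg_integrable a b f : cont_seg a b f ->
  lebesgue_measure.-integrable `[a, b] (EFin \o f).
Proof.
move=> cf; apply: continuous_compact_integrable; first exact: segment_compact.
exact: cont_seg_within.
Qed.

Lemma cont_seg_add a b f g : cont_seg a b f -> cont_seg a b g ->
  cont_seg a b (fun t => f t + g t).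
Proof. by move=> hf hg t tab; exact: continuousD (hf t tab) (hg t tab). Qed.

Lemma cont_seg_cst a b (c : R) : cont_seg a b (fun=> c).
Proof. by move=> t _; exact: cst_continuous. Qed.

Lemma cont_seg_mul a b f g : cont_seg a b f -> cont_seg a b g ->
  cont_seg a b (fun t => f t * g t).
Proof. by move=> hf hg t tab; exact: continuousM (hf t tab) (hg t tab). Qed.

Lemma seg_int_add a b f g : cont_seg a b f -> cont_seg a b g ->
  seg_int a b (fun t => f t + g t) = seg_int a b f + seg_int a b g.
Proof.
by move=> hf hg; rewrite /seg_int RintegralD//; exact: cont_seg_integrable.
Qed.

Lemma seg_int_scale a b (c : R) f : cont_seg a b f ->
  seg_int a b (fun t => c * f t) = c * seg_int a b f.
Proof.
by move=> hf; rewrite /seg_int RintegralZl//; exact: cont_seg_integrable.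
Qed.

Lemma eq_seg_int a b f g : (forall t, a <= t <= b -> f t = g t) ->
  seg_int a b f = seg_int a b g.
Proof. by move=> fg; apply: eq_Rintegral => t; rewrite inE/= in_itv/= => /fg. Qed.

Lemma seg_int_cst a b (c : R) : a <= b -> seg_int a b (fun=> c) = c * (b - a).
Proof.
move=> ab; rewrite /seg_int Rintegral_cst//= lebesgue_measure_itv/= lte_fin.
case: ltgtP ab => [lab _|//|-> _]; last by rewrite subrr.
by rewrite -EFinB.
Qed.

Lemma seg_int_le a b f g : cont_seg a b f -> cont_seg a b g ->
  (forall t, a <= t <= b -> f t <= g t) -> seg_int a b f <= seg_int a b g.
Proof.
move=> hf hg h; apply: le_Rintegral => //; try exact: cont_seg_integrable.
Qed.

Lemma seg_int_norm a b f e : a <= b -> cont_seg a b f ->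
  (forall t, a <= t <= b -> `|f t| <= e) -> `|seg_int a b f| <= e * (b - a).
Proof.
move=> ab hf h; rewrite ler_norml -mulNr -!seg_int_cst//.
apply/andP; split; apply: seg_int_le => //; try exact: cont_seg_cst.
  by move=> t /h; rewrite ler_norml => /andP[].
by move=> t /h; rewrite ler_norml => /andP[].
Qed.

Lemma seg_int_FTC a b (F f : R -> R) : a <= b -> cont_seg a b f ->
  (forall t, a <= t <= b -> is_derive t 1 F (f t)) ->
  seg_int a b f = F b - F a.
Proof.
rewrite le_eqVlt => /orP[/eqP->|ab] cf dF.
  by rewrite /seg_int set_itv1 Rintegral_set1 subrr.
have cF t : a <= t <= b -> {for t, continuous F}.
  move=> tab; apply: differentiable_continuous; apply/derivable1_diffP.
  by have [] := dF t tab.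
rewrite /seg_int /Rintegral (@continuous_FTC2 R f F a b ab)//.
- exact: cont_seg_within.
- split.
  + by move=> t; rewrite in_itv/= => /andP[ta tb]; have [|] := dF t; rewrite ?ltW.
  + by apply: cvg_at_right_filter; apply: cF; rewrite lexx ltW.
  + by apply: cvg_at_left_filter; apply: cF; rewrite lexx ltW.
- move=> t; rewrite in_itv/= => /andP[ta tb]; rewrite derive1E.
  by have [|_ ->] := dF t; rewrite ?ltW.
Qed.

(** A tube argument: compactness of the segment turns continuity at each point (x, t) into an
    estimate uniform in t. *)
Lemma uniform_near (T : topologicalType) a b (F : T -> R -> R) (x : T) e :
  0 < e ->
  (forall t : R, a <= t <= b ->
     {for (x, t), continuous (fun z : T * R => F z.1 z.2)}) ->
  \forall y \near x, forall t, a <= t <= b -> `|F x t - F y t| <= e.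
Proof.
move=> e0 cF.
have /compact_near_coveringP/(_ T (nbhs x) (fun y t => `|F x t - F y t| <= e) _)
  := @segment_compact R a b.
have e2 : 0 < e / 2 by rewrite divr_gt0.
have H t : `[a, b]%classic t -> \forall t' \near t & y \near x, `|F x t' - F y t'| <= e.
  rewrite /= in_itv/= => tab.
  have /cvgrPdist_le/(_ _ e2) := cF t tab.
  move=> [[A B] /= [xA tB] AB].
  exists (B, A) => //= -[t' y] /= [Bt' Ay].
  have h1 := AB (x, t') (conj (nbhs_singleton xA) Bt').
  have h2 := AB (y, t') (conj Ay Bt').
  rewrite /= in h1 h2; rewrite (splitr e).
  apply: le_trans (lerD h1 h2).
  rewrite distrC -[X in `|X|](subrKA (F x t)).
  by rewrite addrC [in leRHS]distrC; apply: le_trans (ler_normD _ _) _; rewrite lerD// distrC.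
move=> /(_ H); apply: filterS => y h t tab.
by apply: h; rewrite /= in_itv.
Qed.

Lemma seg_int_continuous (T : topologicalType) a b (F : T -> R -> R) (x : T) :
  a <= b ->
  (\forall y \near x, cont_seg a b (F y)) ->
  (forall t : R, a <= t <= b ->
     {for (x, t), continuous (fun z : T * R => F z.1 z.2)}) ->
  {for x, continuous (fun y : T => seg_int a b (F y))}.
Proof.
move=> ab cF1 cF; apply/cvgrPdist_le => e e0.
have c0 : 0 < b - a + 1 by rewrite ltr_wpDl// subr_ge0.
have e1 : 0 < e / (b - a + 1) by rewrite divr_gt0.
near=> y.
have cx : cont_seg a b (F x) by exact: nbhs_singleton cF1.
have cy : cont_seg a b (F y) by near: y.
have h : forall t, a <= t <= b -> `|F x t - F y t| <= e / (b - a + 1).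
  by near: y; exact: uniform_near.
have -> : seg_int a b (F x) - seg_int a b (F y) =
    seg_int a b (fun t => F x t + (-1) * F y t).
  rewrite seg_int_add//; last by apply: cont_seg_mul => //; exact: cont_seg_cst.
  by rewrite seg_int_scale// mulN1r.
apply: le_trans (@seg_int_norm _ _ _ (e / (b - a + 1)) ab _ _) _.
- by apply: cont_seg_add => //; apply: cont_seg_mul => //; exact: cont_seg_cst.
- by move=> t tab; rewrite mulN1r; exact: h.
- by rewrite mulrAC ler_pdivrMr// ler_wpM2l ?ltW// ltrDl.
Unshelve. all: by end_near. Qed.

Lemma is_derive_of_bound (G : R -> R) (L : R) :
  (forall e, 0 < e -> \forall s \near (0 : R), `|G s - G 0 - s * L| <= e * `|s|) ->
  is_derive (0 : R) 1 G L.
Proof.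
move=> H.
have h : (fun h : R => h^-1 *: ((G \o shift 0) (h *: (1 : R)) - G 0)) @ 0^' --> L.
  apply/cvgrPdist_le => e e0; have /nbhs_ballP[d /= d0 hd] := H e e0.
  near=> s.
  have sn : s != 0 by near: s; exact: nbhs_dnbhs_neq.
  have hs : `|G s - G 0 - s * L| <= e * `|s|.
    apply: hd; rewrite -ball_normE/= sub0r normrN.
    by near: s; exact: dnbhs0_lt.
  rewrite /= addr0 [s *: 1]mulr1 distrC.
  have -> : s^-1 *: (G s - G 0) - L = s^-1 * (G s - G 0 - s * L).
    by rewrite /GRing.scale/= [RHS]mulrBr mulKf.
  by rewrite normrM normfV mulrC ler_pdivrMr ?normr_gt0.
apply: DeriveDef; last exact: cvg_lim h.
by apply/cvg_ex; exists L.
Unshelve. all: by end_near. Qed.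

(** The remainder F s t - F 0 t - s dF 0 t is bounded by the mean value theorem in s, uniformly in t
    by [uniform_near], and then integrated. *)
Lemma is_derive_seg_int a b (F dF : R -> R -> R) (r : R) :
  a <= b -> 0 < r ->
  (forall s, `|s| < r -> cont_seg a b (F s)) ->
  (forall s t : R, `|s| < r -> a <= t <= b ->
     is_derive s 1 (fun s : R => F s t) (dF s t)) ->
  cont_seg a b (dF 0) ->
  (forall t : R, a <= t <= b ->
     {for (0 : R, t), continuous (fun z : R * R => dF z.1 z.2)}) ->
  is_derive (0 : R) 1 (fun s => seg_int a b (F s)) (seg_int a b (dF 0)).
Proof.
move=> ab r0 cF dFP c0 cdF; apply: is_derive_of_bound => e e0.
have p0 : 0 < b - a + 1 by rewrite ltr_wpDl// subr_ge0.
have e1 : 0 < e / (b - a + 1) by rewrite divr_gt0.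
have /nbhs_ballP[d /= d0 hd] := uniform_near e1 cdF.
apply/nbhs_ballP; exists (Num.min r d); rewrite /= ?lt_min ?r0// => s.
rewrite -ball_normE/= sub0r normrN lt_min => /andP[sr sd].
have key t : a <= t <= b -> `|F s t - F 0 t - s * dF 0 t| <= e / (b - a + 1) * `|s|.
  move=> tab.
  have := @mean_value_bound R (fun s => F s t - s * dF 0 t)
    (fun s => dF s t - dF 0 t) s (e / (b - a + 1)).
  have -> : F s t - s * dF 0 t - (F 0 t - 0 * dF 0 t) =
    F s t - F 0 t - s * dF 0 t by ring.
  apply=> s' ss'.
    apply: is_deriveB; first by apply: dFP => //; exact: le_lt_trans sr.
    have := is_derive_affine 0 (dF 0 t) s'.
    by under [fun _ => 0 + _]funext do rewrite add0r.
  rewrite distrC; apply: hd => //; rewrite -ball_normE/= sub0r normrN.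
  exact: le_lt_trans sd.
have n0 : `|(0 : R)| < r by rewrite normr0.
have cs := cF s sr; have c00 := cF 0 n0.
have cc (c : R) g : cont_seg a b g -> cont_seg a b (fun t => c * g t).
  by move=> cg; apply: cont_seg_mul => //; exact: cont_seg_cst.
have -> : seg_int a b (F s) - seg_int a b (F 0) - s * seg_int a b (dF 0) =
    seg_int a b (fun t => (F s t + (-1) * F 0 t) + (- s) * dF 0 t).
  rewrite !(seg_int_add, seg_int_scale) ?mulN1r ?mulNr//; try exact: cc.
  by apply: cont_seg_add => //; exact: cc.
apply: le_trans (@seg_int_norm _ _ _ (e / (b - a + 1) * `|s|) ab _ _) _.
- by do 2?[apply: cont_seg_add => //]; exact: cc.
- by move=> t tab; rewrite mulN1r mulNr; exact: key.
- rewrite mulrAC ler_wpM2r// mulrAC ler_pdivrMr// ler_wpM2l ?ltW//.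
  by rewrite ltrDl.
Qed.

Lemma cont_seg_sum a b (I : Type) (s : seq I) (h : I -> R -> R) :
  (forall i, cont_seg a b (h i)) -> cont_seg a b (fun t => \sum_(i <- s) h i t).
Proof. by move=> hh t tab; apply: sum_continuous => i; exact: hh. Qed.

Lemma seg_int_sum a b (I : Type) (s : seq I) (h : I -> R -> R) :
  a <= b -> (forall i, cont_seg a b (h i)) ->
  seg_int a b (fun t => \sum_(i <- s) h i t) = \sum_(i <- s) seg_int a b (h i).
Proof.
move=> ab hh; elim: s => [|i s IH].
  rewrite big_nil (@eq_seg_int _ _ _ (fun=> 0)); last by move=> t _; rewrite big_nil.
  by rewrite seg_int_cst// mul0r.
rewrite big_cons -IH -seg_int_add//; last exact: cont_seg_sum.
by apply: eq_seg_int => t _; rewrite big_cons.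
Qed.

Lemma pair_continuous (T T1 T2 : topologicalType) (f : T -> T1) (g : T -> T2)
    (x : T) : {for x, continuous f} -> {for x, continuous g} ->
  {for x, continuous (fun y => (f y, g y))}.
Proof. by move=> hf hg; exact: (cvg_pair hf hg). Qed.

(** * Hadamard's lemma *)

Section Hadamard.
Variables (n : nat) (w : 'rV[R]_n) (r : R).
Let B : set 'rV[R]_n := ball w r.

(** For k = 0 and h a partial derivative, these are the coefficients in Hadamard's lemma. The power
    of t records the factor that each differentiation under the integral produces. *)
Definition radial (k : nat) (h : 'rV[R]_n -> R) (u : 'rV[R]_n) : R :=
  seg_int 0 1 (fun t => t ^+ k * h (w + t *: (u - w))).

Let oB : open B. Proof. exact: ball_open. Qed.

Let inB (u : 'rV[R]_n) (t : R) : B u -> 0 <= t <= 1 -> B (w + t *: (u - w)).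
Proof.
rewrite /B -ball_normE/= => ur /andP[t0 t1].
rewrite opprD addNKr normrN normrZ ger0_norm// -[`|u - w|]distrC.
by apply: le_lt_trans ur; rewrite ler_piMl.
Qed.

Let segment_cont (u : 'rV[R]_n) (t : R) :
  {for (u, t), continuous (fun z : 'rV[R]_n * R => w + z.2 *: (z.1 - w))}.
Proof.
apply: row_continuous => j.
have -> : (fun z : 'rV[R]_n * R => (w + z.2 *: (z.1 - w)) 0 j) =
   (fun z : 'rV[R]_n * R => w 0 j + z.2 * (z.1 0 j - w 0 j)).
  by apply/funext => z; rewrite !mxE.
apply: continuousD; first exact: cst_continuous.
apply: continuousM; first exact: cvg_snd.
apply: continuousB; last exact: cst_continuous.
apply: (@continuous_comp _ _ _ fst (fun v : 'rV[R]_n => v 0 j)).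
  exact: cvg_fst.
exact: coord_continuous.
Qed.

Let joint_cont k h (u : 'rV[R]_n) (t : R) : Ck_on 0 B h -> B u -> 0 <= t <= 1 ->
  {for (u, t), continuous (fun z : 'rV[R]_n * R => z.2 ^+ k * h (w + z.2 *: (z.1 - w)))}.
Proof.
move=> hh Bu t01; apply: continuousM.
  apply: (@continuous_comp _ _ _ snd (fun t : R => t ^+ k)); first exact: cvg_snd.
  exact: exprn_continuous.
apply: (@continuous_comp _ _ _ (fun z : 'rV[R]_n * R => w + z.2 *: (z.1 - w)) h).
  exact: segment_cont.
exact: (Ck_on_cont hh (inB Bu t01)).
Qed.

Let slice_cont k h (u : 'rV[R]_n) : Ck_on 0 B h -> B u ->
  cont_seg 0 1 (fun t => t ^+ k * h (w + t *: (u - w))).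
Proof.
move=> hh Bu t t01.
apply: (@continuous_comp _ _ _ (fun t : R => (u, t))
  (fun z : 'rV[R]_n * R => z.2 ^+ k * h (w + z.2 *: (z.1 - w)))).
  by apply: pair_continuous; [exact: cst_continuous|exact: cvg_id].
exact: joint_cont.
Qed.

(** Differentiation under the integral sign raises k by one and differentiates h, so the induction
    on m lets both vary. *)
Lemma Ck_radial m k h : Ck_on m B h -> Ck_on m B (radial k h).
Proof.
have cont k' h' u : Ck_on 0 B h' -> B u -> {for u, continuous (radial k' h')}.
  move=> hh Bu; apply: seg_int_continuous => //.
    by have := open_nbhs_nbhs (conj oB Bu); apply: filterS => y By; exact: slice_cont.
  by move=> t t01; exact: joint_cont.
elim: m k h => [|m IH] k h hh; first by split=> // u Bu; exact: cont.
have h0 : Ck_on 0 B h by exact: Ck_on_le hh.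
apply: (@Ck_on_step _ _ _ _ _ (fun j => radial k.+1 (pderiv j h))) => //.
- by move=> u Bu; exact: cont.
- move=> j u Bu; apply/is_derive_lineP.
  have /nbhs_ballP[r' /= r'0 hr'] := open_nbhs_nbhs (conj oB Bu).
  have inB' (s : R) : `|s| < r' -> B (u + s *: delta_mx 0 j).
    move=> sr; apply: hr'; rewrite -ball_normE/= opprD addNKr normrN.
    apply: le_lt_trans sr; apply: row_norm_le => // l; rewrite !mxE eqxx/=.
    by case: (l == j); rewrite ?mulr1 ?mulr0 ?normr0.
  have uE : u + 0 *: delta_mx 0 j = u by rewrite scale0r addr0.
  have hp : Ck_on 0 B (pderiv j h) by exact: Ck_on_le (Ck_on_pderiv j hh).
  rewrite -{2}uE.
  apply: (@is_derive_seg_int 0 1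
    (fun s t => t ^+ k * h (w + t *: (u + s *: delta_mx 0 j - w)))
    (fun s t => t ^+ k.+1 * pderiv j h (w + t *: (u + s *: delta_mx 0 j - w)))
    r') => //.
  + by move=> s sr; apply: slice_cont => //; exact: inB'.
  + move=> s t sr t01.
    have Bs := inB (inB' _ sr) t01.
    have := @is_derive_comp_row R n B h
      (fun s => w + t *: (u + s *: delta_mx 0 j - w)) s
      (fun i => t * (i == j)%:R) oB (Ck_on_le _ hh) Bs.
    have -> : \sum_(i < n) t * (i == j)%:R *
       pderiv i h (w + t *: (u + s *: delta_mx 0 j - w)) =
       t * pderiv j h (w + t *: (u + s *: delta_mx 0 j - w)).
      rewrite (bigD1 j)//= eqxx mulr1 big1 ?addr0// => i /negbTE ->.
      by rewrite mulr0 mul0r.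
    move=> H; have {}H := H isT _.
    have H1 : is_derive s 1
      (fun s : R => h (w + t *: (u + s *: delta_mx 0 j - w)))
      (t * pderiv j h (w + t *: (u + s *: delta_mx 0 j - w))).
      apply: H => i.
      have -> : (fun s : R => (w + t *: (u + s *: delta_mx 0 j - w)) 0 i) =
        (fun s : R => (w 0 i + t * (u 0 i - w 0 i)) + s * (t * (i == j)%:R)).
        by apply/funext => s'; rewrite !mxE eqxx/=; ring.
      exact: is_derive_affine.
    have H2 := is_deriveM (is_derive_cst (t ^+ k : R) s (1 : R)) H1.
    by apply: is_derive_eq H2 _; rewrite scaler0 addr0 /GRing.scale/= exprSr mulrA.
  + by rewrite uE; exact: slice_cont.
  + move=> t t01.
    apply: (@continuous_comp _ _ _ (fun z : R * R => (u + z.1 *: delta_mx 0 j, z.2))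
      (fun z : 'rV[R]_n * R => z.2 ^+ k.+1 * pderiv j h (w + z.2 *: (z.1 - w)))).
      apply: pair_continuous; last exact: cvg_snd.
      apply: row_continuous => l.
      have -> : (fun z : R * R => (u + z.1 *: delta_mx 0 j) 0 l) =
        (fun z : R * R => u 0 l + z.1 * (l == j)%:R).
        by apply/funext => z; rewrite !mxE eqxx.
      apply: continuousD; first exact: cst_continuous.
      apply: continuousM; first exact: cvg_fst.
      exact: cst_continuous.
    by rewrite /= uE; exact: joint_cont.
- by move=> j; apply: IH; exact: Ck_on_pderiv.
Qed.

(** The fundamental theorem of calculus on the segment from w to u. *)
Lemma hadamard h u : Ck_on 1 B h -> B u ->
  h u = h w + \sum_i (u 0 i - w 0 i) * radial 0 (pderiv i h) u.
Proof.
move=> hh Bu.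
have hp i : Ck_on 0 B (pderiv i h) by exact: Ck_on_pderiv.
have c0 i : cont_seg 0 1 (fun t => t ^+ 0 * pderiv i h (w + t *: (u - w))).
  exact: slice_cont.
have c1 i : cont_seg 0 1
    (fun t => (u 0 i - w 0 i) * (t ^+ 0 * pderiv i h (w + t *: (u - w)))).
  by apply: cont_seg_mul => //; exact: cont_seg_cst.
have -> : \sum_i (u 0 i - w 0 i) * radial 0 (pderiv i h) u =
  seg_int 0 1 (fun t => \sum_i (u 0 i - w 0 i) * (t ^+ 0 * pderiv i h (w + t *: (u - w)))).
  by rewrite seg_int_sum//; apply: eq_bigr => i _; rewrite seg_int_scale.
have cc := @cont_seg_sum 0 1 _ (index_enum _) _ c1.
have dd (t : R) : 0 <= t <= 1 -> is_derive t 1 (fun t => h (w + t *: (u - w)))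
   (\sum_i (u 0 i - w 0 i) * (t ^+ 0 * pderiv i h (w + t *: (u - w)))).
  move=> t01; under eq_bigr do rewrite expr0 mul1r.
  apply: (@is_derive_comp_row R n B h (fun t => w + t *: (u - w))) => //.
    exact: inB.
  move=> j.
  have -> : (fun t : R => (w + t *: (u - w)) 0 j) =
    (fun t : R => w 0 j + t * (u 0 j - w 0 j)).
    by apply/funext => s; rewrite !mxE.
  exact: is_derive_affine.
rewrite (@seg_int_FTC 0 1 _ _ ler01 cc dd) scale1r scale0r addr0.
by rewrite addrC subrK addrC subrK.
Qed.

End Hadamard.

End ParamIntegral.

(** * Smooth functions on a Lie group *)

Section Charts.
Variables (R : realType) (G : lieGroup R).
Local Notation N := (lg_dim G).
Local Notation atlas := (@lg_atlas R G).
Implicit Types (c : chart R N G) (h : G -> R) (O : set G).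

Lemma atlas_chart c : atlas c -> is_chart c.
Proof. by have [h _ _] := lg_smooth_atlas G; exact: h. Qed.

Lemma exists_chart (x : G) : exists2 c, atlas c & chart_dom c x.
Proof. by have [_ h _] := lg_smooth_atlas G; exact: h. Qed.

Lemma open_chart_dom c : atlas c -> open (chart_dom c).
Proof. by move=> /atlas_chart[]. Qed.

Lemma open_chart_img c : atlas c -> open (chart_img c).
Proof. by move=> /atlas_chart[]. Qed.

Lemma chart_invK c x : atlas c -> chart_dom c x ->
  chart_inv c (chart_map c x) = x.
Proof. by move=> /atlas_chart[_ _ h _ _]; exact: h. Qed.

Lemma chart_img_map c x : chart_dom c x -> chart_img c (chart_map c x).
Proof. by move=> cx; exists x. Qed.

Lemma chart_dom_inv c u : atlas c -> chart_img c u -> chart_dom c (chart_inv c u).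
Proof. by move=> ac [x cx <-]; rewrite chart_invK. Qed.

Lemma chart_map_cont c x : atlas c -> chart_dom c x ->
  {for x, continuous (chart_map c)}.
Proof. by move=> /atlas_chart[_ _ _ h _]; exact: h. Qed.

Lemma chart_inv_cont c u : atlas c -> chart_img c u ->
  {for u, continuous (chart_inv c)}.
Proof. by move=> /atlas_chart[_ _ _ _ h]; exact: h. Qed.

Definition chart_part c O : set 'rV[R]_N := chart_img c `&` chart_inv c @^-1` O.

Lemma open_chart_part c O : atlas c -> open O -> open (chart_part c O).
Proof.
move=> ac oO; rewrite openE => u [iu Ou].
apply: filterI; first exact: open_nbhs_nbhs (conj (open_chart_img ac) iu).
by apply: (chart_inv_cont ac iu); exact: open_nbhs_nbhs.
Qed.

Definition smooth_in O h := forall c, atlas c ->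
  smooth_on (chart_part c O) (h \o chart_inv c).

Lemma smooth_inT h : smooth_in setT h <-> smooth h.
Proof.
have E c : chart_part c setT = chart_img c.
  by rewrite /chart_part preimage_setT setIT.
by split=> H c ac; have := H c ac; rewrite E.
Qed.

Lemma smooth_in_sub O O' h : O' `<=` O -> smooth_in O h -> smooth_in O' h.
Proof.
move=> OO H c ac m; apply: Ck_on_sub (H c ac m) => u [iu Ou].
by split=> //; exact: OO.
Qed.

Lemma smooth_smooth_in O h : smooth h -> smooth_in O h.
Proof. by move=> /smooth_inT; apply: smooth_in_sub. Qed.

Lemma smooth_in_eq O h h' : open O -> (forall x, O x -> h x = h' x) ->
  smooth_in O h -> smooth_in O h'.
Proof.
move=> oO hh H c ac m; apply: Ck_on_eq (H c ac m); first exact: open_chart_part.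
by move=> u [_ Ou] /=; exact: hh.
Qed.

Lemma smooth_local h :
  (forall x, exists2 O, open_nbhs x O & smooth_in O h) -> smooth h.
Proof.
move=> H c ac m; apply: Ck_on_local => u iu.
have [Q [Qo Qx] hQ] := H (chart_inv c u).
exists (chart_part c Q); last exact: hQ.
by split; [exact: open_chart_part|split].
Qed.

Lemma smooth_in_cst O (a : R) : open O -> smooth_in O (cst a).
Proof. by move=> oO c ac m; apply: Ck_on_cst; exact: open_chart_part. Qed.

Lemma smooth_in_add O h h' : open O -> smooth_in O h -> smooth_in O h' ->
  smooth_in O (fun x => h x + h' x).
Proof.
move=> oO H H' c ac m.
exact: (Ck_on_add (open_chart_part ac oO) (H c ac m) (H' c ac m)).
Qed.

Lemma smooth_in_mul O h h' : open O -> smooth_in O h -> smooth_in O h' ->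
  smooth_in O (fun x => h x * h' x).
Proof.
move=> oO H H' c ac m.
exact: (Ck_on_mul (open_chart_part ac oO) (H c ac m) (H' c ac m)).
Qed.

Lemma smooth_in_sum (I : Type) (r : seq I) (P : pred I) (h : I -> G -> R) O :
  open O -> (forall i, smooth_in O (h i)) ->
  smooth_in O (fun x => \sum_(i <- r | P i) h i x).
Proof.
move=> oO H c ac m.
exact: (Ck_on_sum r P (open_chart_part ac oO) (fun i => H i c ac m)).
Qed.

Lemma smooth_in_prod (I : Type) (r : seq I) (P : pred I) (h : I -> G -> R) O :
  open O -> (forall i, smooth_in O (h i)) ->
  smooth_in O (fun x => \prod_(i <- r | P i) h i x).
Proof.
move=> oO H; elim: r => [|i r IH].
  apply: smooth_in_eq (smooth_in_cst 1 oO) => // x _; by rewrite big_nil.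
apply: (@smooth_in_eq _ (fun x => (if P i then h i x else 1) *
   \prod_(i <- r | P i) h i x)) => //.
  by move=> x _; rewrite big_cons; case: (P i); rewrite ?mul1r.
apply: smooth_in_mul => //; case: (P i) => //; exact: smooth_in_cst.
Qed.

Lemma smooth_in_inv O h : open O -> (forall x, O x -> h x != 0) ->
  smooth_in O h -> smooth_in O (fun x => (h x)^-1).
Proof.
move=> oO h0 H c ac m.
apply: (Ck_on_inv (open_chart_part ac oO) _ (H c ac m)).
by move=> u [_ Ou]; exact: h0.
Qed.

Lemma smooth_in_flat O k h : open O -> smooth_in O h ->
  smooth_in O (fun x => flat k (h x)).
Proof.
by move=> oO H c ac m; exact: (Ck_on_flat k (open_chart_part ac oO) (H c ac m)).
Qed.

Lemma smooth_in_det O k (M : G -> 'M[R]_k) : open O ->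
  (forall i j, smooth_in O (fun x => M x i j)) ->
  smooth_in O (fun x => \det (M x)).
Proof.
move=> oO H; apply: smooth_in_sum => // s; apply: smooth_in_mul => //.
  exact: smooth_in_cst.
exact: smooth_in_prod.
Qed.

Lemma smooth_in_invmx O k (M : G -> 'M[R]_k) : open O ->
  (forall x, O x -> M x \in unitmx) ->
  (forall i j, smooth_in O (fun x => M x i j)) ->
  forall i j, smooth_in O (fun x => invmx (M x) i j).
Proof.
move=> oO Mu H i j.
apply: (@smooth_in_eq _ (fun x => (\det (M x))^-1 * cofactor (M x) j i)) => //.
  by move=> x Ox; rewrite /invmx Mu// !mxE.
apply: smooth_in_mul => //.
  apply: smooth_in_inv => //; last exact: smooth_in_det.
  by move=> x /Mu; rewrite unitmxE unitfE.
apply: smooth_in_mul => //; first exact: smooth_in_cst.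
by apply: smooth_in_det => // a b; apply: smooth_in_eq (H (lift j a) (lift i b)) => // x _; rewrite !mxE.
Qed.

Lemma smooth_cst (a : R) : smooth (cst a : G -> R).
Proof. by apply/smooth_inT; apply: smooth_in_cst; exact: openT. Qed.

Lemma smooth_add h h' : smooth h -> smooth h' -> smooth (fun x => h x + h' x).
Proof.
by move=> H H'; apply/smooth_inT; apply: smooth_in_add; [exact: openT| |]; apply/smooth_inT.
Qed.

Lemma smooth_mul h h' : smooth h -> smooth h' -> smooth (fun x => h x * h' x).
Proof.
by move=> H H'; apply/smooth_inT; apply: smooth_in_mul; [exact: openT| |]; apply/smooth_inT.
Qed.

Lemma smooth_sum (I : Type) (r : seq I) (P : pred I) (h : I -> G -> R) :
  (forall i, smooth (h i)) -> smooth (fun x => \sum_(i <- r | P i) h i x).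
Proof.
move=> H; apply/smooth_inT; apply: smooth_in_sum; first exact: openT.
by move=> i; apply/smooth_inT.
Qed.

Lemma smooth_continuous h : smooth h -> continuous h.
Proof.
move=> H x; have [c ac cx] := exists_chart x.
have cont : {for x, continuous ((h \o chart_inv c) \o chart_map c)}.
  apply: continuous_comp; first exact: chart_map_cont.
  exact: Ck_on_cont (H c ac 0%N) _ (chart_img_map cx).
apply: near_continuous cont.
have := open_nbhs_nbhs (conj (open_chart_dom ac) cx).
by apply: filterS => y cy /=; rewrite chart_invK.
Qed.

(* The support of [F] is carried by a compact subset of the chart, closed in G
   because G is Hausdorff. *)
Lemma smooth_extend c (F : 'rV[R]_N -> R) (C : set 'rV[R]_N) :
  atlas c -> (forall m, Ck_on m setT F) -> compact C -> C `<=` chart_img c ->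
  (forall u, ~ C u -> F u = 0) ->
  smooth (fun x => if x \in chart_dom c then F (chart_map c x) else 0).
Proof.
move=> ac hF cC Cc F0; apply: smooth_local => x.
have [cx|ncx] := pselect (chart_dom c x).
  exists (chart_dom c); first by split => //; exact: open_chart_dom.
  move=> c' ac' m.
  have oD := open_chart_part ac' (open_chart_dom ac).
  apply: (@Ck_on_eq _ _ _ _ (fun u => F (chart_map c (chart_inv c' u)))) => //.
    by move=> u [_ /= cu]; rewrite mem_set.
  apply: (@Ck_on_comp _ _ _ _ _ setT F (fun u => chart_map c (chart_inv c' u))) => //.
    exact: openT.
  move=> j; have [_ _ ht] := lg_smooth_atlas G.
  exact: (ht c' c ac' ac j m).
have cI : closed (chart_inv c @` C).
  apply: compact_closed; first exact: lg_hausdorff.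
  apply: continuous_compact => //.
  by apply: continuous_in_subspaceT => u; rewrite inE => /Cc; exact: chart_inv_cont.
exists (~` (chart_inv c @` C)).
  split; first exact: closed_openC.
  by move=> [u /Cc cu ux]; apply: ncx; rewrite -ux; exact: chart_dom_inv.
apply: smooth_in_eq (smooth_in_cst 0 (closed_openC cI)); first exact: closed_openC.
move=> y ny; case: ifPn => //; rewrite inE => cy; rewrite F0// => Cy.
by apply: ny; exists (chart_map c y) => //; rewrite chart_invK.
Qed.

Definition sqdist (u v : 'rV[R]_N) : R := \sum_i (u 0 i - v 0 i) ^+ 2.

Lemma Ck_sqdist m v (U : set 'rV[R]_N) : open U -> Ck_on m U (sqdist^~ v).
Proof.
move=> oU; apply: Ck_on_sum => // i.
have h : Ck_on m U (fun u => u 0 i - v 0 i).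
  by apply: Ck_on_add => //; [exact: Ck_on_coord|exact: (Ck_on_cst m)].
by apply: Ck_on_eq (Ck_on_mul oU h h) => // u _; rewrite expr2.
Qed.

(** Equal to 1 where the squared distance to v is at most e^2/2, and to 0 from e^2 on; the two terms
    of the denominator never vanish together. *)
Definition plateau (v : 'rV[R]_N) (e : R) (u : 'rV[R]_N) : R :=
  flat 0 (e ^+ 2 - sqdist u v) /
  (flat 0 (e ^+ 2 - sqdist u v) + flat 0 (sqdist u v - e ^+ 2 / 2)).

Lemma plateau_den v e u : 0 < e ->
  0 < flat 0 (e ^+ 2 - sqdist u v) + flat 0 (sqdist u v - e ^+ 2 / 2).
Proof.
move=> e0; have [h|h] := ltP (sqdist u v) (e ^+ 2).
  by apply: ltr_wpDr; [exact: flat_ge0|apply: flat_gt0; rewrite subr_gt0].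
apply: ltr_wpDl; [exact: flat_ge0|apply: flat_gt0]; rewrite subr_gt0.
by apply: lt_le_trans h; rewrite ltr_pdivrMr// ltr_pMr ?exprn_gt0// ltr1n.
Qed.

Lemma plateau_ge0 v e u : 0 < e -> 0 <= plateau v e u.
Proof.
by move=> e0; rewrite /plateau divr_ge0 ?flat_ge0// ltW// plateau_den.
Qed.

Lemma Ck_plateau m v e (U : set 'rV[R]_N) : open U -> 0 < e ->
  Ck_on m U (plateau v e).
Proof.
move=> oU e0; have h1 : Ck_on m U (fun u => flat 0 (e ^+ 2 - sqdist u v)).
  apply: Ck_on_flat => //; apply: Ck_on_add => //; first exact: (Ck_on_cst m).
  apply: Ck_on_eq (Ck_on_mul oU (Ck_on_cst m (-1) oU) (Ck_sqdist m v oU)) => //.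
  by move=> u _; rewrite mulN1r.
apply: Ck_on_mul => //; apply: Ck_on_inv => //.
  by move=> u _; rewrite gt_eqF// plateau_den.
apply: Ck_on_add => //; apply: Ck_on_flat => //; apply: Ck_on_add => //.
  exact: Ck_sqdist.
exact: (Ck_on_cst m).
Qed.

(** The plateau vanishes off a Euclidean ball, and the sup norm ball of the same radius contains
    that ball. *)
Lemma plateau_out v e u : 0 < e -> ~ closed_ball_ Num.Def.normr v e u -> plateau v e u = 0.
Proof.
move=> e0 h; rewrite /plateau flat_le0 ?mul0r// subr_le0.
rewrite leNgt; apply/negP => hs; apply: h; rewrite /closed_ball_/= distrC.
apply: row_norm_le => [|i]; first exact: ltW.
rewrite !mxE -(@ler_pXn2r _ 2)// ?nnegrE ?(ltW e0)//.
rewrite real_normK ?num_real//; apply: le_trans (ltW hs).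
rewrite /sqdist (bigD1 i)//= lerDl sumr_ge0// => j _; exact: sqr_ge0.
Qed.

Lemma plateau1 v e : 0 < e -> \forall u \near v, plateau v e u = 1.
Proof.
move=> e0; have c : {for v, continuous (sqdist^~ v)}.
  exact: Ck_on_cont (Ck_sqdist 0 v openT) _ _.
have e2 : 0 < e ^+ 2 / 2 by rewrite divr_gt0// exprn_gt0.
have /cvgrPdist_lt/(_ _ e2) := c; apply: filterS => u.
rewrite {1}/sqdist big1 ?sub0r ?normrN => [hs|i _]; last by rewrite subrr expr0n.
have hs' : sqdist u v < e ^+ 2 / 2 by apply: le_lt_trans hs; exact: ler_norm.
have z : flat 0 (sqdist u v - e ^+ 2 / 2) = 0 by rewrite flat_le0// subr_le0 ltW.
rewrite /plateau z addr0 mulfV// gt_eqF// flat_gt0// subr_gt0; apply: lt_trans hs' _.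
by rewrite ltr_pdivrMr// ltr_pMr ?exprn_gt0// ltr1n.
Qed.

Lemma compact_closed_ball (n : nat) (v : 'rV[R]_n) (e : R) : 0 < e ->
  compact (closed_ball_ Num.Def.normr v e : set 'rV[R]_n).
Proof.
move=> e0; rewrite -closed_ballE//; apply: bounded_closed_compact; last exact: closed_ball_closed.
exists (`|v| + e); split; first exact: num_real.
move=> M ltM u; rewrite closed_ballE// /closed_ball_/= => h.
apply: le_trans (ltW ltM); rewrite -[u](subrKC v).
by rewrite (le_trans (ler_normD _ _))// lerD2l distrC.
Qed.

Lemma open_closed_ball (n : nat) (W : set 'rV[R]_n) v : open W -> W v ->
  exists2 e, 0 < e & closed_ball_ Num.Def.normr v e `<=` W.
Proof.
move=> oW Wv; have /nbhs_ballP[r /= r0 hr] := open_nbhs_nbhs (conj oW Wv).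
exists (r / 2); first by rewrite divr_gt0.
move=> u; rewrite /closed_ball_/= => h; apply: hr; rewrite -ball_normE/=.
by apply: le_lt_trans h _; rewrite ltr_pdivrMr// ltr_pMr// ltr1n.
Qed.

(** Left-invariant fields act on globally smooth functions, so a function given in a chart is first
    cut off by a plateau. *)
Lemma smooth_local_extension c (x : G) (W : set 'rV[R]_N) (f : 'rV[R]_N -> R) :
  atlas c -> chart_dom c x -> open W -> W (chart_map c x) -> smooth_on W f ->
  exists2 h, smooth h & \forall y \near x, chart_dom c y /\ h y = f (chart_map c y).
Proof.
move=> ac cx oW Wx hf.
have oI := openI oW (open_chart_img ac).
have [e e0 he] := open_closed_ball oI (conj Wx (chart_img_map cx)).
set v := chart_map c x; pose F u := plateau v e u * f u.
exists (fun y => if y \in chart_dom c then F (chart_map c y) else 0).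
  apply: (@smooth_extend c F (closed_ball_ Num.Def.normr v e)) => //.
  - move=> m; apply: Ck_on_local => u _.
    have [Wu|nWu] := pselect (W u).
      exists W; first by split.
      apply: Ck_on_mul => //; exact: Ck_plateau.
    have oC : open (~` closed_ball_ Num.Def.normr v e).
      apply: closed_openC; rewrite -closed_ballE//; exact: closed_ball_closed.
    exists (~` closed_ball_ Num.Def.normr v e).
      by split=> // /he[].
    apply: Ck_on_eq (Ck_on_cst m 0 oC) => // w hw.
    by rewrite /F plateau_out// mul0r.
  - exact: compact_closed_ball.
  - by move=> u /he[].
  - by move=> u hu; rewrite /F plateau_out// mul0r.
have n1 := open_nbhs_nbhs (conj (open_chart_dom ac) cx).
have n2 : \forall y \near x, plateau v e (chart_map c y) = 1.
  exact: chart_map_cont ac cx _ (plateau1 v e0).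
near=> y; have cy : chart_dom c y by near: y.
split=> //; rewrite mem_set// /F.
by have -> : plateau v e (chart_map c y) = 1 by [near: y]; rewrite mul1r.
Unshelve. all: by end_near. Qed.

Lemma bump_function (x : G) O : open O -> O x -> exists h,
  [/\ smooth h, forall y, 0 <= h y, \forall y \near x, h y = 1
    & forall y, ~ O y -> h y = 0].
Proof.
move=> oO Ox; have [c ac cx] := exists_chart x.
have Px : chart_part c O (chart_map c x).
  by split; [exact: chart_img_map|rewrite /= chart_invK].
have [e e0 he] := open_closed_ball (open_chart_part ac oO) Px.
set v := chart_map c x.
exists (fun y => if y \in chart_dom c then plateau v e (chart_map c y) else 0).
split.
- apply: (@smooth_extend c _ (closed_ball_ Num.Def.normr v e)) => //.
  + by move=> m; apply: Ck_plateau => //; exact: openT.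
  + exact: compact_closed_ball.
  + by move=> u /he[].
  + by move=> u hu; exact: plateau_out.
- by move=> y; case: ifP => // _; exact: plateau_ge0.
- have n1 := open_nbhs_nbhs (conj (open_chart_dom ac) cx).
  have n2 : \forall y \near x, plateau v e (chart_map c y) = 1.
    exact: chart_map_cont ac cx _ (plateau1 v e0).
  by near=> y; rewrite mem_set; [near: y|near: y].
- move=> y nOy; case: ifPn => //; rewrite inE => cy.
  apply: plateau_out => // /he[_ /=]; by rewrite chart_invK.
Unshelve. all: by end_near. Qed.

(** Bump functions separate a point from the complement of any of its neighbourhoods, so smooth
    functions detect convergence. *)
Lemma continuous_of_smooth (T : topologicalType) (g : T -> G) (t : T) :
  (forall h, smooth h -> {for t, continuous (h \o g)}) ->
  {for t, continuous g}.
Proof.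
move=> H A; rewrite nbhsE => -[Q [Qo Qg] QA].
have [h [hs h0 h1 hQ]] := bump_function Qo Qg.
have /cvgrPdist_lt/(_ _ ltr01) := H h hs.
rewrite /= (nbhs_singleton h1); apply: filterS => s hs1.
apply: QA; apply: contrapT => nQ; move: hs1.
by rewrite /= hQ// subr0 normr1 ltxx.
Qed.

End Charts.

(** * Left-invariant fields in a chart at the identity *)

Section LieGroup.
Variables (R : realType) (G : lieGroup R).
Local Notation N := (lg_dim G).
Local Notation atlas := (@lg_atlas R G).
Implicit Types (c : chart R N G) (h : G -> R) (H : G -> G -> R) (X Y : lie G).

Lemma Ck_row_mx (m n n1 n2 : nat) (U : set 'rV[R]_n)
    (f : 'rV[R]_n -> 'rV[R]_n1) (g : 'rV[R]_n -> 'rV[R]_n2) :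
  (forall j, Ck_on m U (fun u => f u 0 j)) ->
  (forall j, Ck_on m U (fun u => g u 0 j)) ->
  forall j, Ck_on m U (fun u => row_mx (f u) (g u) 0 j).
Proof.
move=> hf hg j; case: (split_ordP j) => k ->.
  rewrite (_ : (fun u => _) = (fun u => f u 0 k))//.
  by apply/funext => u; rewrite row_mxEl.
rewrite (_ : (fun u => _) = (fun u => g u 0 k))//.
by apply/funext => u; rewrite row_mxEr.
Qed.

Lemma row_mx_continuous (T : topologicalType) (n1 n2 : nat)
    (f : T -> 'rV[R]_n1) (g : T -> 'rV[R]_n2) (t : T) :
  {for t, continuous f} -> {for t, continuous g} ->
  {for t, continuous (fun s => row_mx (f s) (g s))}.
Proof.
move=> hf hg; apply: row_continuous => j; case: (split_ordP j) => k ->.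
  rewrite (_ : (fun s => _) = (fun s => f s 0 k)); last first.
    by apply/funext => u; rewrite row_mxEl.
  by apply: (@continuous_comp _ _ _ f (fun v : 'rV[R]_n1 => v 0 k)) => //; exact: coord_continuous.
rewrite (_ : (fun s => _) = (fun s => g s 0 k)); last first.
  by apply/funext => u; rewrite row_mxEr.
by apply: (@continuous_comp _ _ _ g (fun v : 'rV[R]_n2 => v 0 k)) => //; exact: coord_continuous.
Qed.

Lemma eq_derive_fun n (f g : 'rV[R]_n -> R) z b :
  f =1 g -> 'D_b f z = 'D_b g z.
Proof. by move=> /funext ->. Qed.

Definition prod_img c c' : set 'rV[R]_(N + N) :=
  [set z | chart_img c (lsubmx z) /\ chart_img c' (rsubmx z)].

Lemma open_prod_img c c' : atlas c -> atlas c' -> open (prod_img c c').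
Proof.
move=> ac ac'; apply: openI.
  by apply: open_comp (open_chart_img ac) => z _; exact: continuous_lsubmx.
by apply: open_comp (open_chart_img ac') => z _; exact: continuous_rsubmx.
Qed.

Definition in_charts c c' H (z : 'rV[R]_(N + N)) : R :=
  H (chart_inv c (lsubmx z)) (chart_inv c' (rsubmx z)).

Lemma smooth2_in_charts c c' H m : atlas c -> atlas c' -> smooth2 H ->
  Ck_on m (prod_img c c') (in_charts c c' H).
Proof. by move=> ac ac' hH; exact: (hH c c' ac ac' m). Qed.

Lemma smooth2_l H y : smooth2 H -> smooth (H^~ y).
Proof.
move=> hH c ac m; have [c' ac' cy] := exists_chart y.
apply: (@Ck_on_eq _ _ _ _ (fun u => in_charts c c' H (row_mx u (chart_map c' y)))).
- exact: open_chart_img.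
- by move=> u iu; rewrite /in_charts row_mxKl row_mxKr chart_invK.
apply: (@Ck_on_comp _ _ _ _ _ (prod_img c c')); [exact: open_chart_img|exact: open_prod_img| | |].
- exact: smooth2_in_charts.
- apply: Ck_row_mx => j; first by apply: Ck_on_coord; exact: open_chart_img.
  by apply: (Ck_on_cst m); exact: open_chart_img.
- move=> u iu; rewrite /prod_img/= row_mxKl row_mxKr; split=> //; exact: chart_img_map.
Qed.

Lemma smooth2_r H x : smooth2 H -> smooth (H x).
Proof.
move=> hH c ac m; have [c' ac' cx] := exists_chart x.
apply: (@Ck_on_eq _ _ _ _ (fun u => in_charts c' c H (row_mx (chart_map c' x) u))).
- exact: open_chart_img.
- by move=> u iu; rewrite /in_charts row_mxKl row_mxKr chart_invK.
apply: (@Ck_on_comp _ _ _ _ _ (prod_img c' c)); [exact: open_chart_img|exact: open_prod_img| | |].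
- exact: smooth2_in_charts.
- apply: Ck_row_mx => j; last by apply: Ck_on_coord; exact: open_chart_img.
  by apply: (Ck_on_cst m); exact: open_chart_img.
- move=> u iu; rewrite /prod_img/= row_mxKl row_mxKr; split=> //; exact: chart_img_map.
Qed.

Lemma pderiv_row_mx_r n1 n2 (f : 'rV[R]_(n1 + n2) -> R) u z i :
  pderiv i (fun w => f (row_mx u w)) z = pderiv (rshift n1 i) f (row_mx u z).
Proof.
rewrite !pderivE -!derive1_line.
suff -> : (fun t : R => f (row_mx u (z + t *: delta_mx 0 i))) =
  (fun t : R => f (row_mx u z + t *: delta_mx 0 (rshift n1 i))) by [].
apply/funext => t; congr f; apply/rowP => j; case: (split_ordP j) => k ->.
  by rewrite row_mxEl [RHS]mxE row_mxEl !mxE eqxx eq_lrshift mulr0 addr0.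
by rewrite row_mxEr [RHS]mxE row_mxEr !mxE eqxx (inj_eq (@rshift_inj _ _)).
Qed.

Lemma pderiv_row_mx_l n1 n2 (f : 'rV[R]_(n1 + n2) -> R) u z i :
  pderiv i (fun w => f (row_mx w z)) u = pderiv (lshift n2 i) f (row_mx u z).
Proof.
rewrite !pderivE -!derive1_line.
suff -> : (fun t : R => f (row_mx (u + t *: delta_mx 0 i) z)) =
  (fun t : R => f (row_mx u z + t *: delta_mx 0 (lshift n2 i))) by [].
apply/funext => t; congr f; apply/rowP => j; case: (split_ordP j) => k ->.
  by rewrite row_mxEl [RHS]mxE row_mxEl !mxE eqxx (inj_eq (@lshift_inj _ _)).
by rewrite row_mxEr [RHS]mxE row_mxEr !mxE eqxx eq_rlshift mulr0 addr0.
Qed.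

Lemma smooth2_pderiv_r H c z i : smooth2 H -> atlas c -> chart_img c z ->
  smooth (fun x => pderiv i (fun u => H x (chart_inv c u)) z).
Proof.
move=> hH ac iz c' ac' m.
apply: (@Ck_on_eq _ _ _ _
  (fun u => pderiv (rshift N i) (in_charts c' c H) (row_mx u z))).
- exact: open_chart_img.
- move=> u iu /=; rewrite -pderiv_row_mx_r.
  congr (pderiv i _ z); apply/funext => w.
  by rewrite /in_charts row_mxKl row_mxKr.
apply: (@Ck_on_comp _ _ _ _ _ (prod_img c' c)); [exact: open_chart_img|exact: open_prod_img| | |].
- by apply: Ck_on_pderiv; exact: smooth2_in_charts.
- apply: Ck_row_mx => j; first by apply: Ck_on_coord; exact: open_chart_img.
  by apply: (Ck_on_cst m); exact: open_chart_img.
- by move=> u iu; rewrite /prod_img/= row_mxKl row_mxKr.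
Qed.

Lemma smooth2_pderiv_l H c z i : smooth2 H -> atlas c -> chart_img c z ->
  smooth (fun y => pderiv i (fun u => H (chart_inv c u) y) z).
Proof.
move=> hH ac iz c' ac' m.
apply: (@Ck_on_eq _ _ _ _
  (fun u => pderiv (lshift N i) (in_charts c c' H) (row_mx z u))).
- exact: open_chart_img.
- move=> u iu /=; rewrite -pderiv_row_mx_l.
  congr (pderiv i _ z); apply/funext => w.
  by rewrite /in_charts row_mxKl row_mxKr.
apply: (@Ck_on_comp _ _ _ _ _ (prod_img c c')); [exact: open_chart_img|exact: open_prod_img| | |].
- by apply: Ck_on_pderiv; exact: smooth2_in_charts.
- apply: Ck_row_mx => j; last by apply: Ck_on_coord; exact: open_chart_img.
  by apply: (Ck_on_cst m); exact: open_chart_img.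
- by move=> u iu; rewrite /prod_img/= row_mxKl row_mxKr.
Qed.

Lemma smooth2_continuous H : smooth2 H -> continuous (fun z : G * G => H z.1 z.2).
Proof.
move=> hH -[x y]; have [c ac cx] := exists_chart x; have [c' ac' cy] := exists_chart y.
pose rho := fun z : G * G => row_mx (chart_map c z.1) (chart_map c' z.2).
have crho : {for (x, y), continuous rho}.
  apply: row_mx_continuous.
    apply: (@continuous_comp _ _ _ fst (chart_map c)); first exact: cvg_fst.
    exact: chart_map_cont.
  apply: (@continuous_comp _ _ _ snd (chart_map c')); first exact: cvg_snd.
  exact: chart_map_cont.
have : {for (x, y), continuous (in_charts c c' H \o rho)}.
  apply: (continuous_comp crho).
  apply: (Ck_on_cont (smooth2_in_charts 0 ac ac' hH)).
  by rewrite /prod_img/rho/= row_mxKl row_mxKr; split; exact: chart_img_map.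
apply: near_continuous.
exists (chart_dom c, chart_dom c') => /=.
  by split; apply: open_nbhs_nbhs; split=> //; exact: open_chart_dom.
move=> [a b] /= [ca cb]; rewrite /in_charts/rho/= row_mxKl row_mxKr.
by rewrite !chart_invK.
Qed.

Lemma smooth2_mul h : smooth h -> smooth2 (fun x y : G => h (x * y)%g).
Proof. exact: lg_smooth_mul. Qed.

Lemma smooth_lmul (a : G) h : smooth h -> smooth (fun y : G => h (a * y)%g).
Proof. by move=> /smooth2_mul/(smooth2_r a). Qed.

Lemma smooth_rmul (a : G) h : smooth h -> smooth (fun y : G => h (y * a)%g).
Proof. by move=> /smooth2_mul/(smooth2_l a). Qed.

Lemma smooth_inv h : smooth h -> smooth (fun y : G => h (y^-1)%g).
Proof. exact: lg_smooth_inv. Qed.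

Lemma mulg_continuous : continuous (fun z : G * G => (z.1 * z.2)%g).
Proof.
move=> z; apply: continuous_of_smooth => h hs.
exact: (smooth2_continuous (smooth2_mul hs)).
Qed.

Lemma invg_continuous : continuous (fun x : G => (x^-1)%g).
Proof.
move=> z; apply: continuous_of_smooth => h hs.
exact: (smooth_continuous (smooth_inv hs)).
Qed.

Lemma lmul_continuous (a : G) : continuous (fun x : G => (a * x)%g).
Proof.
move=> z; apply: continuous_of_smooth => h hs.
exact: (smooth_continuous (smooth_lmul a hs)).
Qed.

Lemma rmul_continuous (a : G) : continuous (fun x : G => (x * a)%g).
Proof.
move=> z; apply: continuous_of_smooth => h hs.
exact: (smooth_continuous (smooth_rmul a hs)).
Qed.

Lemma lvf_smooth X h : smooth h -> smooth (lvf X h).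
Proof. by have [f _ _ _] := lvf_field X; exact: f. Qed.

Lemma lvf_mul X h h' x : smooth h -> smooth h' ->
  lvf X (fun y => h y * h' y) x = lvf X h x * h' x + h x * lvf X h' x.
Proof. by move=> hs hs'; have [_ _ f _] := lvf_field X; exact: f. Qed.

Lemma lvf_left X h a x : smooth h ->
  lvf X (fun y => h (a * y)%g) x = lvf X h (a * x)%g.
Proof. by move=> hs; have [_ _ _ f] := lvf_field X; exact: f. Qed.

Lemma lvf_cst X (a : R) x : lvf X (cst a) x = 0.
Proof.
have s0 : smooth (cst 0 : G -> R) := smooth_cst 0.
have s1 : smooth (cst 1 : G -> R) := smooth_cst 1.
have l1 : lvf X (cst 1) x = 0.
  have := lvf_mul X x s1 s1.
  rewrite (_ : (fun y : G => cst 1 y * cst 1 y) = cst (1 : R)); last first.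
    by apply/funext => y; rewrite /= mulr1.
  by rewrite /= mulr1 mul1r => /eqP; rewrite -subr_eq subrr => /eqP ->.
have l0 : lvf X (cst 0) x = 0.
  have := lvf_mul X x s0 s0.
  rewrite (_ : (fun y : G => cst 0 y * cst 0 y) = cst (0 : R)); last first.
    by apply/funext => y; rewrite /= mulr0.
  by rewrite /= mulr0 mul0r addr0.
have [_ f _ _] := lvf_field X; have := f a _ _ s1 s0 x.
rewrite (_ : (fun y : G => a * cst 1 y + cst 0 y) = cst a); last first.
  by apply/funext => y; rewrite /= mulr1 addr0.
by move=> ->; rewrite l1 l0 mulr0 addr0.
Qed.

Lemma lvf_add X h h' x : smooth h -> smooth h' ->
  lvf X (fun y => h y + h' y) x = lvf X h x + lvf X h' x.
Proof.
move=> hs hs'; have [_ f _ _] := lvf_field X; have := f 1 _ _ hs hs' x.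
rewrite mul1r; under [fun y => 1 * _ + _]funext do rewrite mul1r.
by [].
Qed.

Lemma lvf_scale X (a : R) h x : smooth h ->
  lvf X (fun y => a * h y) x = a * lvf X h x.
Proof.
move=> hs; rewrite (lvf_mul X x (@smooth_cst R G a) hs) lvf_cst mul0r add0r.
by [].
Qed.

Lemma smooth_scale (a : R) h : smooth h -> smooth (fun y : G => a * h y).
Proof. exact: (smooth_mul (@smooth_cst R G a)). Qed.

Lemma lvf_sum X (I : Type) (r : seq I) (P : pred I) (h : I -> G -> R) x :
  (forall i, smooth (h i)) ->
  lvf X (fun y => \sum_(i <- r | P i) h i y) x = \sum_(i <- r | P i) lvf X (h i) x.
Proof.
move=> hs; elim: r => [|i r IH].
  rewrite big_nil (_ : (fun y => _) = cst 0) ?lvf_cst//.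
  by apply/funext => y; rewrite big_nil.
rewrite big_cons -IH; case: ifP => Pi.
  rewrite -lvf_add//; last exact: smooth_sum.
  by congr (lvf X _ x); apply/funext => y; rewrite big_cons Pi.
by congr (lvf X _ x); apply/funext => y; rewrite big_cons Pi.
Qed.

Lemma lvf_addX X Y h x : smooth h -> lvf (X + Y) h x = lvf X h x + lvf Y h x.
Proof. by move=> hs; rewrite -{1}[X]scale1r lvf_linear// mul1r. Qed.

Lemma lvf0X h x : smooth h -> lvf (0 : lie G) h x = 0.
Proof.
move=> hs; have := lvf_addX 0 0 x hs.
by rewrite addr0 => /eqP; rewrite -subr_eq subrr => /eqP ->.
Qed.

Lemma lvf_scaleX a X h x : smooth h -> lvf (a *: X) h x = a * lvf X h x.
Proof. by move=> hs; rewrite -[a *: X]addr0 lvf_linear// lvf0X// addr0. Qed.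

Lemma lvf_sumX (I : Type) (r : seq I) (P : pred I) (X : I -> lie G) h x :
  smooth h ->
  lvf (\sum_(i <- r | P i) X i) h x = \sum_(i <- r | P i) lvf (X i) h x.
Proof.
by move=> hs; elim/big_rec2: _ => [|i a b _ <-]; rewrite ?lvf0X ?lvf_addX.
Qed.

(** Derivations are local: if b is a bump at x supported where the difference d vanishes, then b * d
    = 0, and the Leibniz rule at x leaves only the derivative of d. *)
Lemma lvf_near X h h' x : smooth h -> smooth h' -> (\near x, h x = h' x) ->
  lvf X h x = lvf X h' x.
Proof.
move=> hs hs' hh; pose d y := h y + (-1) * h' y.
have ds : smooth d by apply: smooth_add => //; exact: smooth_scale.
suff : lvf X d x = 0.
  rewrite lvf_add//; last exact: smooth_scale.
  by rewrite lvf_scale// mulN1r => /eqP; rewrite subr_eq0 => /eqP.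
move: hh; rewrite /prop_near1 nbhsE => -[Q [oQ Qx] hQ].
have [b [bs _ b1 bQ]] := bump_function oQ Qx.
have := lvf_mul X x bs ds.
rewrite (_ : (fun y => b y * d y) = cst 0); last first.
  apply/funext => y; have [Qy|/bQ ->] := pselect (Q y); last by rewrite mul0r.
  by rewrite /d hQ// mulN1r subrr mulr0.
rewrite lvf_cst (nbhs_singleton b1) mul1r /d hQ// mulN1r subrr mulr0 add0r.
by move=> <-.
Qed.

Lemma lvf_inj1 X : (forall h, smooth h -> lvf X h 1%g = 0) -> X = 0.
Proof.
move=> H; apply: lvf_inj => h hs x.
by rewrite -[x]mulg1 -lvf_left// H//; exact: smooth_lmul.
Qed.

Lemma lvf_eq1 X Y : (forall h, smooth h -> lvf X h 1%g = lvf Y h 1%g) -> X = Y.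
Proof.
move=> H; apply/eqP; rewrite -subr_eq0; apply/eqP/lvf_inj1 => h hs.
by rewrite -scaleN1r lvf_addX// lvf_scaleX// mulN1r H// subrr.
Qed.

(** One chart around the identity is fixed for good; [ucoord] is the coordinate vector of 1 and
    [upt] the inverse of the chart. *)
Definition uchart : chart R N G := sval (cid2 (exists_chart (1%g : G))).
Definition ucoord : 'rV[R]_N := chart_map uchart 1%g.
Definition upt (u : 'rV[R]_N) : G := chart_inv uchart u.

Lemma uchart_atlas : atlas uchart.
Proof. by rewrite /uchart; case: cid2. Qed.

Lemma uchart_dom : chart_dom uchart 1%g.
Proof. by rewrite /uchart; case: cid2. Qed.

Lemma ucoord_img : chart_img uchart ucoord.
Proof. exact: chart_img_map uchart_dom. Qed.

Lemma upt_ucoord : upt ucoord = 1%g.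
Proof. exact: chart_invK uchart_atlas uchart_dom. Qed.

Lemma smooth_upt (a : G) h : smooth h ->
  smooth_on (chart_img uchart) (fun u => h (a * upt u)%g).
Proof. move=> hs; exact: (smooth_lmul a hs uchart_atlas). Qed.

Lemma is_derive_upt (a : G) h z b : smooth h -> chart_img uchart z ->
  is_derive z b (fun u => h (a * upt u)%g)
    (\sum_j b 0 j * pderiv j (fun u => h (a * upt u)%g) z).
Proof.
move=> hs iz; apply: is_derive_dir iz; first exact: open_chart_img uchart_atlas.
exact: smooth_upt.
Qed.

(** Left translation by x (upt z)^-1 moves the chart point to x, so the derivative in direction b
    defines a left-invariant derivation, and [lvf_surj] provides X. *)
Lemma frame_field z b : chart_img uchart z -> exists X, forall h, smooth h ->
  forall x : G, lvf X h x = 'D_b (fun u => h (x * (upt z)^-1 * upt u)%g) z.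
Proof.
move=> iz; pose D (h : G -> R) (x : G) : R := 'D_b (fun u => h (x * (upt z)^-1 * upt u)%g) z.
have dP h a : smooth h -> is_derive z b (fun u => h (a * upt u)%g)
    ('D_b (fun u => h (a * upt u)%g) z).
  by move=> hs; have [d _] := is_derive_upt a b hs iz; exact: derivableP.
have DS h : smooth h -> smooth (fun x : G => 'D_b (fun u => h (x * upt u)%g) z).
  move=> hs.
  have -> : (fun x : G => 'D_b (fun u => h (x * upt u)%g) z) =
    (fun x => \sum_j b 0 j * pderiv j (fun u => h (x * upt u)%g) z).
    by apply/funext => x; have [_ ->] := is_derive_upt x b hs iz.
  apply: smooth_sum => j; apply: smooth_scale.
  exact: (smooth2_pderiv_r j (smooth2_mul hs) uchart_atlas iz).
have [|X hX] := @lvf_surj R G D; last by exists X.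
split.
- move=> h hs; exact: (smooth_rmul ((upt z)^-1)%g (DS h hs)).
- move=> a h h' hs hs' x; rewrite /D.
  have h1 := dP h (x * (upt z)^-1)%g hs; have h2 := dP h' (x * (upt z)^-1)%g hs'.
  have h3 := is_derive_mul (is_derive_cst a z b) h1.
  have [_ ->] := is_derive_add h3 h2.
  by rewrite mul0r add0r.
- move=> h h' hs hs' x; rewrite /D.
  have h1 := dP h (x * (upt z)^-1)%g hs; have h2 := dP h' (x * (upt z)^-1)%g hs'.
  have [_ ->] := is_derive_mul h1 h2.
  by rewrite mulgVK.
- move=> h hs a x; rewrite /D; apply: eq_derive_fun => u.
  by rewrite !mulgA.
Qed.

Definition velocity X (b : 'rV[R]_N) := forall h, smooth h -> forall x : G,
  lvf X h x = 'D_b (fun u => h (x * upt u)%g) ucoord.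

(** By Hadamard's lemma, h = h(1) + the sum of hc_i g_i near 1, with hc_i(1) = 0. So a derivation at
    1 is determined by its values on the hc_i, and an abstract left-invariant derivation becomes a
    tangent vector. *)
Lemma coordinate_functions : exists hc : 'I_N -> G -> R,
  (forall i, smooth (hc i)) /\ forall X, velocity X (\row_i lvf X (hc i) 1%g).
Proof.
pose coordf i (u : 'rV[R]_N) : R := u 0 i - ucoord 0 i.
have ac := uchart_atlas; have c1 := uchart_dom; have i1 := ucoord_img.
have oI := open_chart_img ac.
have [e e0 he] : exists2 e : R, 0 < e & ball ucoord e `<=` chart_img uchart.
  by have /nbhs_ballP[e] := open_nbhs_nbhs (conj oI i1); exists e.
have oB : open (ball ucoord e) by exact: ball_open.
have Bu : ball ucoord e ucoord by exact: ballxx.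
have cfs i : exists h, smooth h /\ \forall y \near (1%g : G),
    chart_dom uchart y /\ h y = coordf i (chart_map uchart y).
  have [||h hs hE] := @smooth_local_extension R G uchart 1%g setT (coordf i) ac c1 openT.
  - by [].
  - by move=> m; apply: Ck_on_add; [exact: openT|exact: (Ck_on_coord m i openT)|exact: (Ck_on_cst m _ openT)].
  - by exists h.
have {cfs} [hc hcP] := choice cfs.
exists hc; split=> [i|X h hs x]; first by have [] := hcP i.
(* Left invariance moves the point to the identity. *)
wlog -> : h hs x / x = 1%g.
  move=> W; rewrite -[x]mulg1 -lvf_left// (W _ (smooth_lmul x hs) 1%g erefl).
  by apply: eq_derive_fun => u; rewrite mul1g mulg1.
have hsu : smooth_on (chart_img uchart) (h \o upt) by exact: (hs uchart ac).
have gs i : exists g, smooth g /\ \forall y \near (1%g : G),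
    chart_dom uchart y /\
    g y = radial ucoord 0 (pderiv i (h \o upt)) (chart_map uchart y).
  have [||g gs gE] := @smooth_local_extension R G uchart 1%g (ball ucoord e)
     (radial ucoord 0 (pderiv i (h \o upt))) ac c1 oB.
  - by [].
  - move=> m; apply: Ck_radial; apply: Ck_on_sub he _.
    exact: Ck_on_pderiv (hsu m.+1).
  - by exists g.
have {gs} [g gP] := choice gs.
have n1 : \forall y \near (1%g : G), forall i, hc i y = coordf i (chart_map uchart y).
  apply: (@filter_forall _ _ (fun i y => hc i y = coordf i (chart_map uchart y))) => i.
  by have [_] := hcP i; apply: filterS => y [].
have n2 : \forall y \near (1%g : G), forall i,
    g i y = radial ucoord 0 (pderiv i (h \o upt)) (chart_map uchart y).
  apply: (@filter_forall _ _ (fun i y => g i y = radial ucoord 0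
    (pderiv i (h \o upt)) (chart_map uchart y))) => i.
  by have [_] := gP i; apply: filterS => y [].
have n3 : \forall y \near (1%g : G), chart_dom uchart y.
  exact: open_nbhs_nbhs (conj (open_chart_dom ac) c1).
have n4 : \forall y \near (1%g : G), ball ucoord e (chart_map uchart y).
  exact: (chart_map_cont ac c1 (open_nbhs_nbhs (conj oB Bu))).
have near_h : \forall y \near (1%g : G), h y = h 1%g + \sum_i hc i y * g i y.
  near=> y.
  have cy : chart_dom uchart y by near: y.
  have E1 : forall i, hc i y = coordf i (chart_map uchart y) by near: y.
  have E2 : forall i, g i y = radial ucoord 0 (pderiv i (h \o upt)) (chart_map uchart y) by near: y.
  have By : ball ucoord e (chart_map uchart y) by near: y.
  have := hadamard (Ck_on_sub he (hsu 1%N)) By.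
  rewrite /= /upt chart_invK// -/(upt ucoord) upt_ucoord => ->; congr (_ + _).
  by apply: eq_bigr => i _; rewrite E1 E2.
have hcs i : smooth (hc i) by have [] := hcP i.
have gs i : smooth (g i) by have [] := gP i.
have hgs i : smooth (fun y => hc i y * g i y) by exact: smooth_mul.
rewrite (lvf_near X hs (smooth_add (@smooth_cst R G (h 1%g)) (smooth_sum _ _ hgs)) near_h).
rewrite lvf_add; [|exact: smooth_cst|exact: smooth_sum].
rewrite lvf_cst add0r lvf_sum//.
have [_ ->] := is_derive_upt 1%g (\row_i lvf X (hc i) 1%g) hs i1.
apply: eq_bigr => i _; rewrite lvf_mul// mxE.
have -> : hc i 1%g = 0.
  by rewrite (nbhs_singleton n1 i) /coordf /ucoord subrr.
rewrite mul0r addr0; congr (_ * _).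
(* At the centre of the ball the integrand of [radial] is constant, so the coefficient is the
   partial derivative itself. *)
rewrite (nbhs_singleton n2 i) -/ucoord /radial.
under [fun t => _ * _]funext do rewrite subrr scaler0 addr0 expr0 mul1r.
rewrite seg_int_cst// subr0 mulr1; congr (pderiv i _ _).
by apply/funext => u /=; rewrite mul1g.
Unshelve. all: by end_near. Qed.

End LieGroup.

(** * The Lie algebra *)

Section Adjoint.
Variables (R : realType) (G : lieGroup R).
Local Notation N := (lg_dim G).
Local Notation d := (\dim {:lie G}).
Implicit Types (h : G -> R) (X Y Z : lie G) (x y : G).

Lemma eq_pderiv n (i : 'I_n) (f g : 'rV[R]_n -> R) z :
  f =1 g -> pderiv i f z = pderiv i g z.
Proof. by move=> /funext ->. Qed.

Lemma ex_velocity X : exists b, velocity X b.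
Proof. by have [hc [_ h]] := coordinate_functions G; exists (\row_i lvf X (hc i) 1%g). Qed.

Lemma velocityE X b h x : velocity X b -> smooth h ->
  lvf X h x = \sum_j b 0 j * pderiv j (fun u => h (x * upt u)%g) (ucoord G).
Proof.
by move=> Xb hs; rewrite Xb//; have [_ ->] := is_derive_upt x b hs (ucoord_img G).
Qed.

Lemma is_derive_curve X b (g : R -> 'rV[R]_N) h x :
  velocity X b -> g 0 = ucoord G ->
  (forall j, is_derive (0 : R) 1 (fun t : R => g t 0 j) (b 0 j)) -> smooth h ->
  is_derive (0 : R) 1 (fun t : R => h (x * upt (g t))%g) (lvf X h x).
Proof.
move=> Xb g0 dg hs; rewrite (velocityE x Xb hs) -g0.
apply: (@is_derive_comp_row R N _ (fun u => h (x * upt u)%g)) => //.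
- exact: open_chart_img (uchart_atlas G).
- exact: smooth_upt.
- by rewrite g0; exact: ucoord_img.
Qed.

(** [Ad] is defined by choice, which is meaningful only once a solution exists; [br_exists] does the
    same for [br]. *)
Lemma Ad_exists a X : exists Y, forall h, smooth h -> forall x,
  lvf Y h x = lvf X (fun y => h (y * a^-1)%g) (x * a)%g.
Proof.
have [|Y hY] := @lvf_surj R G (fun h x => lvf X (fun y => h (y * a^-1)%g) (x * a)%g).
  split.
  - move=> h hs; apply: (smooth_rmul a); apply: lvf_smooth; exact: smooth_rmul.
  - move=> c h h' hs hs' x; rewrite lvf_add; last exact: smooth_rmul.
      by rewrite lvf_scale//; exact: smooth_rmul.
    by apply: smooth_scale; exact: smooth_rmul.
  - move=> h h' hs hs' x; rewrite lvf_mul; [|exact: smooth_rmul|exact: smooth_rmul].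
    by rewrite mulgK.
  - move=> h hs b x; rewrite -mulgA -(lvf_left X b (x * a)%g (smooth_rmul (a^-1)%g hs)).
    by congr (lvf X _ _); apply/funext => y; rewrite mulgA.
by exists Y.
Qed.

Lemma AdE a X h x : smooth h ->
  lvf (Ad a X) h x = lvf X (fun y => h (y * a^-1)%g) (x * a)%g.
Proof.
move=> hs; have [Y hY] := Ad_exists a X.
pose P := [set Y : lie G | forall h, smooth h -> forall x : G,
    lvf Y h x = lvf X (fun y => h (y * a^-1)%g) (x * a)%g].
exact: (@xgetPex _ 0 P (ex_intro _ Y hY) h hs x).
Qed.

Lemma br_exists X Y : exists Z, forall h, smooth h -> forall x : G,
  lvf Z h x = lvf X (lvf Y h) x - lvf Y (lvf X h) x.
Proof.
have [|Z hZ] := @lvf_surj R G (fun h x => lvf X (lvf Y h) x - lvf Y (lvf X h) x).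
  have sub (f g : G -> R) : smooth f -> smooth g -> smooth (fun x => f x - g x).
    move=> hf hg; have -> : (fun x => f x - g x) = (fun x => f x + (-1) * g x).
      by apply/funext => x; rewrite mulN1r.
    by apply: smooth_add => //; exact: smooth_scale.
  split.
  - move=> h hs; apply: sub; do 2!apply: lvf_smooth => //.
  - move=> c h h' hs hs' x.
    have E W : lvf W (fun y : G => c * h y + h' y) =
       (fun y => c * lvf W h y + lvf W h' y).
      by apply/funext => y; rewrite lvf_add ?lvf_scale//; exact: smooth_scale.
    rewrite !E !lvf_add ?lvf_scale; try exact: lvf_smooth;
      try (apply: smooth_scale; exact: lvf_smooth).
    by rewrite mulrBr; ring.
  - move=> h h' hs hs' x.
    have E W : lvf W (fun y : G => h y * h' y) =
       (fun y => lvf W h y * h' y + h y * lvf W h' y).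
      by apply/funext => y; rewrite lvf_mul.
    have s1 W : smooth (lvf W h) by exact: lvf_smooth.
    have s2 W : smooth (lvf W h') by exact: lvf_smooth.
    rewrite !E !lvf_add; try exact: smooth_mul.
    by rewrite !lvf_mul//; ring.
  - move=> h hs b x.
    have E W : lvf W (fun y : G => h (b * y)%g) = (fun y => lvf W h (b * y)%g).
      by apply/funext => y; rewrite lvf_left.
    by rewrite !E !lvf_left//; exact: lvf_smooth.
by exists Z.
Qed.

Lemma brE X Y h x : smooth h ->
  lvf (br X Y) h x = lvf X (lvf Y h) x - lvf Y (lvf X h) x.
Proof.
move=> hs; have [Z hZ] := br_exists X Y.
pose P := [set Z : lie G | forall h, smooth h -> forall x : G,
    lvf Z h x = lvf X (lvf Y h) x - lvf Y (lvf X h) x].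
exact: (@xgetPex _ 0 P (ex_intro _ Z hZ) h hs x).
Qed.

Lemma lvf_linX (c : R) X Y h x : smooth h ->
  lvf (c *: X + Y) h x = c * lvf X h x + lvf Y h x.
Proof. by move=> hs; exact: lvf_linear. Qed.

Lemma br_linear_l Y : linear (fun X : lie G => br X Y).
Proof.
move=> c X X'; apply: lvf_eq1 => h hs; rewrite lvf_linX// !brE//.
rewrite (_ : lvf (c *: X + X') h = (fun y => c * lvf X h y + lvf X' h y)); last first.
  by apply/funext => y; rewrite lvf_linX.
rewrite lvf_add; [|by apply: smooth_scale; exact: lvf_smooth|exact: lvf_smooth].
rewrite lvf_scale; last exact: lvf_smooth.
by rewrite lvf_linX; [ring|exact: lvf_smooth].
Qed.

Lemma brC X Y : br X Y = - br Y X.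
Proof.
apply: lvf_eq1 => h hs; rewrite -scaleN1r lvf_scaleX// !brE// mulN1r opprB.
by [].
Qed.

Lemma br_linear_r X : linear (br X).
Proof.
move=> c Y Z; rewrite brC br_linear_l [br Y X]brC [br Z X]brC.
by rewrite scalerN -opprD opprK.
Qed.

HB.instance Definition _ X := GRing.isLinear.Build R (lie G) (lie G) _ (br X)
  (br_linear_r X).

Lemma br0l X : br 0 X = 0.
Proof. by have /= := br_linear_l X (-1) 0 0; rewrite scaler0 addr0 scaleN1r addNr. Qed.

Lemma brDl X Y Z : br (X + Y) Z = br X Z + br Y Z.
Proof. by have := br_linear_l Z 1 X Y; rewrite !scale1r. Qed.

Lemma brZl c X Z : br (c *: X) Z = c *: br X Z.
Proof. by have := br_linear_l Z c X 0; rewrite !addr0 br0l addr0. Qed.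

Lemma br_suml (I : Type) (r : seq I) (P : pred I) (F : I -> lie G) Z :
  br (\sum_(i <- r | P i) F i) Z = \sum_(i <- r | P i) br (F i) Z.
Proof. by elim/big_rec2: _ => [|i a b _ <-]; rewrite ?br0l ?brDl. Qed.

Lemma jacobi X Y Z : br X (br Y Z) = br (br X Y) Z + br Y (br X Z).
Proof.
have sub (f g : G -> R) : smooth f -> smooth g -> forall W x,
    lvf W (fun x => f x - g x) x = lvf W f x - lvf W g x.
  move=> hf hg W x; have -> : (fun x => f x - g x) = (fun x => f x + (-1) * g x).
    by apply/funext => y; rewrite mulN1r.
  by rewrite lvf_add ?lvf_scale ?mulN1r//; exact: smooth_scale.
have E U W h : smooth h -> lvf (br U W) h = (fun x => lvf U (lvf W h) x - lvf W (lvf U h) x).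
  by move=> hs; apply/funext => x; rewrite brE.
apply: lvf_eq1 => h hs; rewrite lvf_addX//.
have s1 U : smooth (lvf U h) by exact: lvf_smooth.
have s2 U W : smooth (lvf U (lvf W h)) by exact: lvf_smooth.
by rewrite !brE// !E// !sub//; ring.
Qed.

Lemma Ad_linear a : linear (Ad a : lie G -> lie G).
Proof.
move=> c X Y; apply: lvf_eq1 => h hs; rewrite lvf_linX// !AdE// lvf_linX//.
exact: smooth_rmul.
Qed.

HB.instance Definition _ a := GRing.isLinear.Build R (lie G) (lie G) _ (@Ad R G a)
  (Ad_linear a).

Lemma Ad1 X : Ad (1%g : G) X = X.
Proof.
apply: lvf_eq1 => h hs; rewrite AdE// mulg1; congr (lvf X _ _).
by apply/funext => y; rewrite invg1 mulg1.
Qed.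

Lemma AdM a b X : Ad (a * b)%g X = Ad a (Ad b X).
Proof.
apply: lvf_eq1 => h hs; rewrite !AdE//; last exact: smooth_rmul.
rewrite mulgA; congr (lvf X _ _).
by apply/funext => y; rewrite invgM mulgA.
Qed.

Lemma AdK a X : Ad (a^-1)%g (Ad a X) = X.
Proof. by rewrite -AdM mulVg Ad1. Qed.

Lemma AdVK a X : Ad a (Ad (a^-1)%g X) = X.
Proof. by rewrite -AdM mulgV Ad1. Qed.

Lemma Ad_br a X Y : Ad a (br X Y) = br (Ad a X) (Ad a Y).
Proof.
have E W h : smooth h -> lvf (Ad a W) h =
    (fun x => lvf W (fun y => h (y * a^-1)%g) (x * a)%g).
  by move=> hs; apply/funext => x; rewrite AdE.
have sr h : smooth h -> smooth (fun y : G => h (y * a^-1)%g) by exact: smooth_rmul.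
apply: lvf_eq1 => h hs; rewrite AdE// !brE//; last exact: sr.
rewrite !E//; try exact: lvf_smooth; try (apply: (smooth_rmul a); apply: lvf_smooth; exact: sr).
by under [fun y => lvf Y _ _]funext do rewrite mulgVK;
  under [fun y => lvf X _ _]funext do rewrite mulgVK.
Qed.

Lemma vcoord_is_linear (V : vectType R) (b : 'I_(\dim {:V})) : linear (vcoord b : V -> R^o).
Proof. by move=> c u v; rewrite /vcoord linearP. Qed.

HB.instance Definition _ (V : vectType R) (b : 'I_(\dim {:V})) :=
  GRing.isLinear.Build R V R^o _ (@vcoord R V b) (vcoord_is_linear b).

Lemma vcoord_sum (V : vectType R) (v : V) :
  v = \sum_b vcoord b v *: vbase b.
Proof.
rewrite {1}(coord_vbasis (memvf v)); apply: eq_bigr => b _.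
by rewrite /vbase (tnth_nth 0).
Qed.

Lemma vcoord_vbase (V : vectType R) (a b : 'I_(\dim {:V})) :
  vcoord a (vbase b : V) = (a == b)%:R.
Proof.
rewrite /vcoord /vbase (tnth_nth 0) coord_free 1?eq_sym//.
exact: basis_free (vbasisP _).
Qed.

Lemma vcoord_inj (V : vectType R) (u v : V) :
  (forall b, vcoord b u = vcoord b v) -> u = v.
Proof. by move=> h; rewrite (vcoord_sum u) (vcoord_sum v); apply: eq_bigr => b _; rewrite h. Qed.

(** The matrix C of derivatives of the coordinate functions has independent rows, since a field with
    zero velocity at 1 vanishes; a right inverse of C recombines the coordinate functions. *)
Lemma dual_functions : exists hd : 'I_d -> G -> R,
  (forall b, smooth (hd b)) /\ forall X b, lvf X (hd b) 1%g = vcoord b X.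
Proof.
have [hc [hcs hcP]] := coordinate_functions G.
pose C : 'M[R]_(d, N) := \matrix_(b, i) lvf (vbase b : lie G) (hc i) 1%g.
have lvfC X i : lvf X (hc i) 1%g = \sum_b vcoord b X * C b i.
  rewrite {1}(vcoord_sum X) lvf_sumX//; apply: eq_bigr => b _.
  by rewrite lvf_scaleX// mxE.
have fC : row_free C.
  rewrite -kermx_eq0; apply/rowV0P => v /sub_kermxP vC.
  pose X : lie G := \sum_b v 0 b *: vbase b.
  have vX b : vcoord b X = v 0 b.
    rewrite /X linear_sum (bigD1 b)//= linearZ/= vcoord_vbase eqxx big1.
      by rewrite addr0 /GRing.scale/= mulr1.
    by move=> a ab; rewrite linearZ/= vcoord_vbase eq_sym (negbTE ab) scaler0.
  have X0 : X = 0.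
    apply: lvf_inj1 => h hs; rewrite (hcP X)//.
    have -> : \row_i lvf X (hc i) 1%g = 0.
      apply/rowP => i; rewrite !mxE lvfC.
      have := congr1 (fun w : 'rV_N => w 0 i) vC; rewrite !mxE => {2}<-.
      by apply: eq_bigr => b _; rewrite vX.
    by rewrite derive0.
  by apply/rowP => b; rewrite -vX X0 linear0 mxE.
exists (fun b x => \sum_i pinvmx C i b * hc i x); split=> [b|X b].
  by apply: smooth_sum => i; exact: smooth_scale.
rewrite lvf_sum; last by move=> i; exact: smooth_scale.
under eq_bigr => i _ do rewrite lvf_scale// lvfC mulr_sumr.
rewrite exchange_big/= (bigD1 b)//= [X in _ + X]big1 ?addr0 => [|a ab].
  under eq_bigr do rewrite mulrCA.
  rewrite -mulr_sumr -[RHS]mulr1; congr (_ * _).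
  have E : (C *m pinvmx C) b b = 1 by rewrite (mulmxVp fC) mxE eqxx.
  by under eq_bigr do rewrite mulrC; move: E; rewrite mxE.
under eq_bigr do rewrite mulrCA.
rewrite -mulr_sumr; have := congr1 (fun M : 'M[R]_(d) => M a b) (mulmxVp fC).
rewrite !mxE (negbTE ab) => E.
by under eq_bigr do rewrite mulrC; rewrite E mulr0.
Qed.

(** The field y |-> Ad(y^-1) X is right invariant: applied to h at y it is the derivative of u |->
    h(u y) at u = 1, which is smooth in y because multiplication is smooth in both variables. *)
Lemma smooth_AdV_lvf X h : smooth h ->
  smooth (fun y : G => lvf (Ad (y^-1)%g X) h y).
Proof.
move=> hs; have [c Xc] := ex_velocity X.
have -> : (fun y : G => lvf (Ad (y^-1)%g X) h y) =
  (fun y => \sum_j c 0 j * pderiv j (fun u => h (upt u * y)%g) (ucoord G)).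
  apply/funext => y; rewrite AdE// mulgV.
  rewrite (velocityE _ Xc); last exact: smooth_rmul.
  apply: eq_bigr => j _; congr (_ * _); apply: eq_pderiv => u.
  by rewrite mul1g invgK.
apply: smooth_sum => j; apply: smooth_scale.
exact: (smooth2_pderiv_l j (smooth2_mul hs) (uchart_atlas G) (ucoord_img G)).
Qed.

(** Near y0, translates of the dual functions have an invertible matrix M of derivatives along the
    left-invariant frame, so the coordinates of Ad(y^-1) X solve a linear system with smooth
    data. *)
Lemma smooth_AdV X b : smooth (fun y : G => vcoord b (Ad (y^-1)%g X)).
Proof.
have [hd [hds hdP]] := dual_functions.
apply: smooth_local => y0.
pose hb (a : 'I_d) (y : G) := hd a (y0^-1 * y)%g.
have hbs a : smooth (hb a) by exact: smooth_lmul.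
pose M (y : G) : 'M[R]_d := \matrix_(c, a) lvf (vbase c : lie G) (hb a) y.
have Ms c a : smooth (fun y => M y c a).
  have -> : (fun y => M y c a) = lvf (vbase c : lie G) (hb a).
    by apply/funext => y; rewrite mxE.
  exact: lvf_smooth.
have ds : smooth (fun y => \det (M y)).
  by apply/smooth_inT/smooth_in_det; [exact: openT|move=> c a; apply/smooth_inT].
pose Q := [set y : G | \det (M y) != 0].
have oQ : open Q.
  apply: (@open_comp _ _ (fun y => \det (M y)) [set r : R | r != 0]).
    by move=> y _; exact: smooth_continuous.
  exact: open_neq.
have M1 : M y0 = 1%:M.
  apply/matrixP => c a; rewrite !mxE lvf_left// mulVg hdP vcoord_vbase.
  by rewrite eq_sym.
exists Q; first by split=> //; rewrite /Q/= M1 det1 oner_neq0.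
apply: (@smooth_in_eq _ _ _ (fun y => \sum_a lvf (Ad (y^-1)%g X) (hb a) y * invmx (M y) a b)) => //.
  move=> y Qy; have Mu : M y \in unitmx by rewrite unitmxE unitfE.
  pose v : 'rV[R]_d := \row_c vcoord c (Ad (y^-1)%g X).
  have E a : lvf (Ad (y^-1)%g X) (hb a) y = (v *m M y) 0 a.
    rewrite mxE {1}(vcoord_sum (Ad (y^-1)%g X)) lvf_sumX//.
    by apply: eq_bigr => c _; rewrite lvf_scaleX// !mxE.
  under eq_bigr do rewrite E.
  have := congr1 (fun w : 'rV_d => w 0 b) (mulmxK Mu v).
  by rewrite !mxE.
apply: smooth_in_sum => // a; apply: smooth_in_mul => //.
  by apply: smooth_smooth_in; exact: smooth_AdV_lvf.
apply: smooth_in_invmx => //.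
  by move=> y Qy; rewrite unitmxE unitfE.
by move=> c e; exact: smooth_smooth_in.
Qed.

Lemma smooth_Ad X b : smooth (fun y : G => vcoord b (Ad y X)).
Proof.
have := smooth_inv (smooth_AdV X b).
by under [fun y => vcoord _ _]funext do rewrite invgK.
Qed.

(** Both sides are mixed second derivatives of h(x y) at (1, 1), in the two possible orders: the
    left-invariant X differentiates the right factor, the right-invariant field y |-> Ad(y^-1) Y the
    left factor. *)
Lemma lvf_mixed X Y h : smooth h ->
  lvf X (fun y : G => lvf (Ad (y^-1)%g Y) h y) 1%g = lvf Y (lvf X h) 1%g.
Proof.
move=> hs; have [a Xa] := ex_velocity X; have [c Yc] := ex_velocity Y.
set uc := ucoord G; have ac := uchart_atlas G; have iu := ucoord_img G.
pose f := in_charts (uchart G) (uchart G) (fun x y => h (x * y)%g).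
pose W := prod_img (uchart G) (uchart G).
have oW : open W by exact: open_prod_img.
have Wu : W (row_mx uc uc) by rewrite /W/prod_img/= row_mxKl row_mxKr.
have hf m : Ck_on m W f by apply: smooth2_in_charts => //; exact: smooth2_mul.
have fE u v : f (row_mx u v) = h (upt u * upt v)%g by rewrite /f/in_charts row_mxKl row_mxKr.
have dr (j : 'I_(N + N)) i : is_derive uc (delta_mx 0 i) (fun v => pderiv j f (row_mx uc v))
    (pderiv (rshift N i) (pderiv j f) (row_mx uc uc)).
  rewrite -pderiv_row_mx_r.
  apply: (@Ck_on_is_derive _ _ 0 (chart_img (uchart G))) => //.
  apply: (@Ck_on_comp _ _ _ _ _ W); [exact: open_chart_img|by []| | |].
  - exact: Ck_on_pderiv.
  - apply: Ck_row_mx => k; last by apply: Ck_on_coord; exact: open_chart_img.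
    by apply: (Ck_on_cst 1); exact: open_chart_img.
  - by move=> u iu'; rewrite /W/prod_img/= row_mxKl row_mxKr.
have dl (j : 'I_(N + N)) i : is_derive uc (delta_mx 0 i) (fun u => pderiv j f (row_mx u uc))
    (pderiv (lshift N i) (pderiv j f) (row_mx uc uc)).
  rewrite -pderiv_row_mx_l.
  apply: (@Ck_on_is_derive _ _ 0 (chart_img (uchart G))) => //.
  apply: (@Ck_on_comp _ _ _ _ _ W); [exact: open_chart_img|by []| | |].
  - exact: Ck_on_pderiv.
  - apply: Ck_row_mx => k; first by apply: Ck_on_coord; exact: open_chart_img.
    by apply: (Ck_on_cst 1); exact: open_chart_img.
  - by move=> u iu'; rewrite /W/prod_img/= row_mxKl row_mxKr.
have dscale (k : R) i (g : 'rV[R]_N -> R) (dg : R) :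
    is_derive uc (delta_mx 0 i) g dg -> is_derive uc (delta_mx 0 i) (fun v => k * g v) (k * dg).
  move=> hg; have := is_derive_mul (is_derive_cst k uc (delta_mx 0 i)) hg.
  by rewrite mul0r add0r.
pose D i j := pderiv (rshift N i) (pderiv (lshift N j) f) (row_mx uc uc).
pose D' i j := pderiv (lshift N j) (pderiv (rshift N i) f) (row_mx uc uc).
have L : lvf X (fun y : G => lvf (Ad (y^-1)%g Y) h y) 1%g =
    \sum_i a 0 i * \sum_j c 0 j * D i j.
  rewrite (velocityE _ Xa); last exact: smooth_AdV_lvf.
  apply: eq_bigr => i _; congr (_ * _); rewrite pderivE.
  have := @is_derive_bigsum R N _ (index_enum 'I_N) xpredT _ uc (delta_mx 0 i) _
    (fun j => dscale (c 0 j) i _ _ (dr (lshift N j) i)).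
  move=> [_ <-]; apply: eq_derive_fun => v.
  rewrite mul1g AdE// mulgV (velocityE _ Yc); last exact: smooth_rmul.
  apply: eq_bigr => j _; congr (_ * _); rewrite -pderiv_row_mx_l.
  by apply: eq_pderiv => u; rewrite fE mul1g invgK.
have L' : lvf Y (lvf X h) 1%g =
    \sum_j c 0 j * \sum_i a 0 i * D' i j.
  rewrite (velocityE _ Yc); last exact: lvf_smooth.
  apply: eq_bigr => j _; congr (_ * _); rewrite pderivE.
  have := @is_derive_bigsum R N _ (index_enum 'I_N) xpredT _ uc (delta_mx 0 j) _
    (fun i => dscale (a 0 i) j _ _ (dl (rshift N i) j)).
  move=> [_ <-]; apply: eq_derive_fun => u.
  rewrite mul1g (velocityE _ Xa)//.
  apply: eq_bigr => i _; congr (_ * _); rewrite -pderiv_row_mx_r.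
  by apply: eq_pderiv => v; rewrite fE.
have DE i j : D' i j = D i j by rewrite /D' /D (pderivC _ _ oW (hf 2%N) Wu).
clearbody D D'; rewrite L L'.
under eq_bigr do rewrite mulr_sumr; rewrite exchange_big/=.
apply: eq_bigr => j _; rewrite mulr_sumr; apply: eq_bigr => i _.
by rewrite DE mulrCA.
Qed.

(** With Ad(y^-1) Y expanded in the basis, the left side of [lvf_mixed] is the derivative of the
    coefficients, applied to h, plus X Y h. So the former is Y X h - X Y h. *)
Lemma lvf_AdV X Y b :
  lvf X (fun y : G => vcoord b (Ad (y^-1)%g Y)) 1%g = vcoord b (br Y X).
Proof.
pose Z : lie G := \sum_b lvf X (fun y : G => vcoord b (Ad (y^-1)%g Y)) 1%g *: vbase b.
have vZ : vcoord b Z = lvf X (fun y : G => vcoord b (Ad (y^-1)%g Y)) 1%g.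
  rewrite /Z linear_sum (bigD1 b)//= linearZ/= vcoord_vbase eqxx big1.
    by rewrite addr0 /GRing.scale/= mulr1.
  by move=> a ab; rewrite linearZ/= vcoord_vbase eq_sym (negbTE ab) scaler0.
rewrite -vZ; congr vcoord; apply: lvf_eq1 => h hs; rewrite brE// -lvf_mixed//.
have -> : (fun y : G => lvf (Ad (y^-1)%g Y) h y) =
  (fun y => \sum_b vcoord b (Ad (y^-1)%g Y) * lvf (vbase b : lie G) h y).
  apply/funext => y; rewrite {1}(vcoord_sum (Ad _ Y)) lvf_sumX//.
  by apply: eq_bigr => a _; rewrite lvf_scaleX.
have s1 a : smooth (fun y : G => vcoord a (Ad (y^-1)%g Y)) by exact: smooth_AdV.
have s2 a : smooth (lvf (vbase a : lie G) h) by exact: lvf_smooth.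
rewrite lvf_sum; last by move=> a; exact: smooth_mul.
under eq_bigr do rewrite lvf_mul// invg1 Ad1.
have -> : lvf Z h 1%g = \sum_a lvf X (fun y : G => vcoord a (Ad (y^-1)%g Y)) 1%g *
    lvf (vbase a : lie G) h 1%g.
  by rewrite lvf_sumX//; apply: eq_bigr => a _; rewrite lvf_scaleX.
rewrite big_split/=.
suff -> : \sum_a vcoord a Y * lvf X (lvf (vbase a : lie G) h) 1%g = lvf X (lvf Y h) 1%g.
  by rewrite addrK.
have -> : lvf Y h = (fun y => \sum_a vcoord a Y * lvf (vbase a : lie G) h y).
  apply/funext => y; rewrite {1}(vcoord_sum Y) lvf_sumX//.
  by apply: eq_bigr => a _; rewrite lvf_scaleX.
rewrite lvf_sum; last by move=> a; exact: smooth_scale.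
by apply: eq_bigr => a _; rewrite lvf_scale.
Qed.

(** Differentiate the constant Ad(y) Ad(y^-1) Y at y = 1. *)
Lemma lvf_Ad X Y b :
  lvf X (fun y : G => vcoord b (Ad y Y)) 1%g = vcoord b (br X Y).
Proof.
have s1 c Z : smooth (fun y : G => vcoord c (Ad (y^-1)%g Z)) by exact: smooth_AdV.
have s2 c Z : smooth (fun y : G => vcoord c (Ad y Z)) by exact: smooth_Ad.
have E : lvf X (fun y : G => \sum_c vcoord c (Ad (y^-1)%g Y) * vcoord b (Ad y (vbase c))) 1%g = 0.
  rewrite (_ : (fun y : G => _) = cst (vcoord b Y)) ?lvf_cst//.
  apply/funext => y; rewrite -[Y in RHS](AdVK y) {2}(vcoord_sum (Ad _ Y)) !linear_sum/=.
  by apply: eq_bigr => c _; rewrite !linearZ.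
move: E; rewrite lvf_sum; last by move=> c; exact: smooth_mul.
under eq_bigr do rewrite lvf_mul// invg1 !Ad1 lvf_AdV vcoord_vbase.
rewrite big_split/= (bigD1 b)//= eqxx mulr1 big1 ?addr0; last first.
  by move=> c cb; rewrite eq_sym (negbTE cb) mulr0.
have -> : \sum_c vcoord c Y * lvf X (fun y : G => vcoord b (Ad y (vbase c))) 1%g =
   lvf X (fun y : G => vcoord b (Ad y Y)) 1%g.
  have -> : (fun y : G => vcoord b (Ad y Y)) =
    (fun y => \sum_c vcoord c Y * vcoord b (Ad y (vbase c))).
    apply/funext => y; rewrite {1}(vcoord_sum Y) !linear_sum/=.
    by apply: eq_bigr => c _; rewrite !linearZ.
  rewrite lvf_sum; last by move=> c; exact: smooth_scale.
  by apply: eq_bigr => c _; rewrite lvf_scale.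
by move=> /eqP; rewrite addrC addr_eq0 => /eqP ->; rewrite [br Y X]brC linearN opprK.
Qed.

End Adjoint.

(** * Traces and nilpotent maps *)

Section Trace.
Variables (R : realType) (V : vectType R).
Local Notation d := (\dim {:V}).

(** Since M^k = 0, the matrix X - M divides X^k, so the characteristic polynomial divides a power of
    X and equals X^n; its coefficient of degree n - 1 is minus the trace. *)
Lemma nilpotent_mxtrace n (M : 'M[R]_n) k :
  (forall v : 'rV[R]_n, iter k (mulmxr M) v = 0) -> \tr M = 0.
Proof.
case: n M => [|n] M nilM; first by rewrite /mxtrace big_ord0.
have Mk : M ^+ k = 0.
  apply/row_matrixP => i; rewrite row0 rowE.
  suff -> : forall v : 'rV[R]_n.+1, v *m M ^+ k = iter k (mulmxr M) v by [].
  elim: k {nilM} => [|k IH] v; first by rewrite expr0 mulmx1.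
  by rewrite exprSr mulmxA IH.
set p := char_poly M.
pose S := \sum_(i < k) ('X%:M : 'M[{poly R}]_n.+1) ^+ (k.-1 - i) *
   (map_mx (@polyC R) M) ^+ i.
have XM : ('X%:M : 'M[{poly R}]_n.+1) ^+ k = char_poly_mx M * S.
  rewrite -subrXX_comm; last exact: esym (scalar_mxC _ _).
  have -> : (map_mx (@polyC R) M) ^+ k = 0.
    by rewrite -(rmorphXn (map_mx (@polyC R))) /= Mk map_mx0.
  by rewrite subr0.
have dv : p %| ('X - 0%:P) ^+ (k * n.+1).
  rewrite subr0 /p /char_poly.
  have := congr1 determinant XM.
  rewrite -(rmorphXn (@scalar_mx {poly R} n.+1)) det_scalar -exprM => ->.
  by rewrite -[char_poly_mx M * S]/(char_poly_mx M *m S) det_mulmx dvdp_mulr.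
have [j _] := dvdp_exp_XsubCP dv; rewrite subr0 => pX.
have pE : p = 'X^j.
  by apply/eqP; rewrite -eqp_monic ?char_poly_monic ?monicXn.
have jn : j = n.+1.
  by have := size_char_poly M; rewrite -/p pE size_polyXn => -[].
have := char_poly_trace M (ltn0Sn n); rewrite -/p pE jn coefXn/=.
by rewrite ltn_eqF// => /eqP; rewrite eq_sym oppr_eq0 => /eqP.
Qed.

(** A trace in coordinates, taken of plain functions so that composites and differences need no
    bundled linear structure. *)
Definition ltr (f : V -> V) : R := \sum_b vcoord b (f (vbase b)).

Lemma eq_ltr f g : f =1 g -> ltr f = ltr g.
Proof. by move=> fg; apply: eq_bigr => b _; rewrite fg. Qed.

Lemma ltrC (f g : {linear V -> V}) : ltr (f \o g) = ltr (g \o f).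
Proof.
have E (f' g' : {linear V -> V}) : ltr (f' \o g') =
    \sum_b \sum_c vcoord c (g' (vbase b)) * vcoord b (f' (vbase c)).
  apply: eq_bigr => b _ /=; rewrite {1}(vcoord_sum (g' _)) !linear_sum/=.
  by apply: eq_bigr => c _; rewrite !linearZ.
rewrite !E exchange_big/=; apply: eq_bigr => b _; apply: eq_bigr => c _.
by rewrite mulrC.
Qed.

Lemma ltrB f g : ltr (fun v => f v - g v) = ltr f - ltr g.
Proof. by rewrite /ltr -sumrB; apply: eq_bigr => b _; rewrite linearB. Qed.

Lemma ltr_rank1 (l : {linear V -> R^o}) u : ltr (fun v => l v *: u) = l u.
Proof.
rewrite /ltr; under eq_bigr do rewrite linearZ.
rewrite {2}(vcoord_sum u) linear_sum; apply: eq_bigr => b _.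
by rewrite linearZ/= /GRing.scale/= mulrC.
Qed.

Lemma ltr_sum (I : Type) (r : seq I) (F : I -> V -> V) :
  ltr (fun v => \sum_(i <- r) F i v) = \sum_(i <- r) ltr (F i).
Proof.
rewrite /ltr exchange_big/=; apply: eq_bigr => b _; by rewrite linear_sum.
Qed.

Lemma ltr_nilpotent (f : {linear V -> V}) k :
  (forall v, iter k f v = 0) -> ltr f = 0.
Proof.
move=> nf; pose M : 'M[R]_d := \matrix_(i, j) vcoord j (f (vbase i)).
have -> : ltr f = \tr M by rewrite /mxtrace; apply: eq_bigr => b _; rewrite mxE.
apply: (@nilpotent_mxtrace _ _ k) => v.
pose w (v : 'rV[R]_d) : V := \sum_b v 0 b *: vbase b.
have vw (v' : 'rV[R]_d) b : vcoord b (w v') = v' 0 b.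
  rewrite /w linear_sum (bigD1 b)//= linearZ/= vcoord_vbase eqxx big1.
    by rewrite addr0 /GRing.scale/= mulr1.
  by move=> a ab; rewrite linearZ/= vcoord_vbase eq_sym (negbTE ab) scaler0.
have wM v' : w (v' *m M) = f (w v').
  apply: vcoord_inj => b; rewrite vw mxE /w linear_sum linear_sum.
  by apply: eq_bigr => c _; rewrite !linearZ/= !mxE.
have : w (iter k (mulmxr M) v) = 0.
  rewrite -(nf (w v)); elim: k {nf} => //= k IH.
  by rewrite /mulmxr wM IH.
by move=> w0; apply/rowP => b; rewrite -vw w0 linear0 mxE.
Qed.

End Trace.

(** * The Killing form; derivations are inner *)

Section Killing.
Variables (R : realType) (G : lieGroup R).
Implicit Types X Y Z W : lie G.
Local Notation d := (\dim {:lie G}).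

Lemma brNl X Y : br (- X) Y = - br X Y.
Proof. by rewrite -scaleN1r brZl scaleN1r. Qed.

Lemma brBl X Y Z : br (X - Y) Z = br X Z - br Y Z.
Proof. by rewrite brDl brNl. Qed.

Lemma killingE X Y : killing X Y = ltr (br X \o br Y).
Proof. by []. Qed.

Lemma killingC X Y : killing X Y = killing Y X.
Proof. exact: ltrC. Qed.

Lemma killing_linear X : linear (killing X : lie G -> R^o).
Proof.
move=> c Y Z; rewrite /killing scaler_sumr -big_split; apply: eq_bigr => b _ /=.
by rewrite brDl brZl !linearD !linearZ.
Qed.

HB.instance Definition _ X := GRing.isLinear.Build R (lie G) R^o _
  (@killing R G X) (killing_linear X).

Lemma killingDl X Y Z : killing (X + Y) Z = killing X Z + killing Y Z.
Proof. by rewrite killingC linearD/= [killing Z X]killingC [killing Z Y]killingC. Qed.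

Lemma killingZl c X Y : killing (c *: X) Y = c * killing X Y.
Proof. by rewrite killingC linearZ/= [killing Y X]killingC. Qed.

Lemma killing_suml (I : Type) (r : seq I) (P : pred I) (F : I -> lie G) Z :
  killing (\sum_(i <- r | P i) F i) Z = \sum_(i <- r | P i) killing (F i) Z.
Proof. by rewrite killingC linear_sum; apply: eq_bigr => i _; rewrite killingC. Qed.

Lemma killing_inv X Y Z : killing (br Z X) Y = - killing X (br Z Y).
Proof.
rewrite !killingE.
have E1 : ltr (br (br Z X) \o br Y) = ltr (br Z \o (br X \o br Y)) - ltr (br X \o (br Z \o br Y)).
  by rewrite -ltrB; apply: eq_ltr => W /=; rewrite (jacobi Z X (br Y W)) addrK.
have E2 : ltr (br X \o br (br Z Y)) = ltr (br X \o (br Z \o br Y)) - ltr (br X \o (br Y \o br Z)).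
  rewrite -ltrB; apply: eq_ltr => W /=.
  by rewrite -linearB (jacobi Z Y W) addrK.
rewrite E1 E2 ltrC opprB; congr (_ - _).
Qed.

Lemma killing_Ad a X Y : killing (Ad a X) (Ad a Y) = killing X Y.
Proof.
rewrite !killingE.
rewrite (@eq_ltr _ _ _ (Ad a \o ((br X \o br Y) \o Ad (a^-1)%g))); last first.
  by move=> W /=; rewrite !Ad_br AdVK.
by rewrite ltrC; apply: eq_ltr => W /=; rewrite AdK.
Qed.

Hypothesis ss : semisimple G.

(** Semisimplicity makes the Gram matrix of the Killing form invertible. *)
Lemma killing_repr (l : {linear lie G -> R^o}) : exists E, forall X, killing E X = l X.
Proof.
pose M : 'M[R]_d := \matrix_(i, j) killing (vbase i : lie G) (vbase j).
have kM : row_free M.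
  rewrite -kermx_eq0; apply/rowV0P => v /sub_kermxP vM.
  pose X : lie G := \sum_b v 0 b *: vbase b.
  have X0 : X = 0.
    apply: ss => Y; rewrite (vcoord_sum Y) linear_sum big1// => c _.
    rewrite linearZ/= /X killing_suml.
    have := congr1 (fun w : 'rV_(d) => w 0 c) vM; rewrite !mxE => E.
    under eq_bigr do rewrite killingZl.
    have -> : \sum_i v 0 i * killing (vbase i : lie G) (vbase c) = 0.
      by rewrite -[RHS]E; apply: eq_bigr => b _; rewrite mxE.
    by rewrite scaler0.
  apply/rowP => b; rewrite mxE.
  have : vcoord b X = v 0 b.
    rewrite /X linear_sum (bigD1 b)//= linearZ/= vcoord_vbase eqxx big1.
      by rewrite addr0 /GRing.scale/= mulr1.
    by move=> a ab; rewrite linearZ/= vcoord_vbase eq_sym (negbTE ab) scaler0.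
  by rewrite X0 linear0 => <-.
have uM : M \in unitmx by rewrite -row_free_unit.
pose r : 'rV[R]_d := (\row_b l (vbase b)) *m invmx M.
exists (\sum_b r 0 b *: vbase b) => X.
have rM c : \sum_b r 0 b * killing (vbase b : lie G) (vbase c) = l (vbase c).
  have := congr1 (fun w : 'rV_(d) => w 0 c) (mulmxKV uM (\row_b l (vbase b))).
  rewrite -/r mxE [in X in _ = X]mxE => <-; apply: eq_bigr => b _.
  by rewrite [M b c]mxE.
rewrite [in RHS](vcoord_sum X) [in LHS](vcoord_sum X) !linear_sum; apply: eq_bigr => c _.
rewrite !linearZ/= killing_suml -rM; congr (_ *: _).
by apply: eq_bigr => b _; rewrite killingZl.
Qed.

(** E represents X |-> tr(D ad X). Then delta = D - ad E is a derivation with tr(delta ad Z) = 0 for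
    all Z, and killing (delta X) Y = tr([delta, ad X] ad Y) = tr(delta ad [X, Y]) = 0. *)
Lemma derivation_inner (D : {linear lie G -> lie G}) :
  (forall X Y, D (br X Y) = br (D X) Y + br X (D Y)) ->
  exists E, forall X, D X = br E X.
Proof.
move=> dD.
pose lf X : R^o := ltr (D \o br X).
have ll : linear lf.
  move=> c X Y; rewrite /lf /ltr scaler_sumr -big_split; apply: eq_bigr => b _ /=.
  by rewrite brDl brZl !linearD !linearZ.
pose lM := GRing.isLinear.Build R (lie G) R^o _ lf ll.
have [E hE] := killing_repr (HB.pack_for {linear lie G -> R^o} lf lM).
exists E => X; apply/eqP; rewrite -subr_eq0; apply/eqP/ss => Y.
pose dl := fun W => D W - br E W.
have dlr Z : ltr (dl \o br Z) = 0.
  have := hE Z; rewrite killingE/= /lf => e.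
  by rewrite /dl (eq_ltr (g := fun W => (D \o br Z) W - (br E \o br Z) W))// ltrB e subrr.
have dll : linear dl by move=> c U W; rewrite /dl (linearP D) (linearP (br E)) scalerBr opprD addrACA.
pose dL := HB.pack_for {linear lie G -> lie G} dl (GRing.isLinear.Build R (lie G) (lie G) _ dl dll).
have ddl U W : dl (br U W) = br (dl U) W + br U (dl W).
  by rewrite /dl dD (jacobi E) brBl linearB/= opprD addrACA.
rewrite -/(dl X) killingE.
have -> : ltr (br (dl X) \o br Y) = ltr (dL \o (br X \o br Y)) - ltr (br X \o (dL \o br Y)).
  by rewrite -ltrB; apply: eq_ltr => W /=; rewrite ddl addrK.
have -> : ltr (br X \o (dL \o br Y)) = ltr (dL \o (br Y \o br X)).
  rewrite ltrC; apply: eq_ltr => W //.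
rewrite -ltrB -[RHS](dlr (br X Y)); apply: eq_ltr => W /=.
rewrite -[dl (br X (br Y W)) - _](linearB dL)/=; congr dl.
by rewrite (jacobi X Y W) addrK.
Qed.

End Killing.

(** * Gradings, parabolic subalgebras and the Killing form *)

Section Grading.
Variables (R : realType) (G : lieGroup R) (m : nat) (gr : int -> {vspace lie G}).
Hypothesis grG : grading m gr.
Implicit Types (X Y Z v w : lie G) (i j k : int).

Let wt (s : 'I_m.*2.+1) : int := s%:Z - m%:Z.

(** The sum has at most one term. Writing it as a sum makes the component available for every
    integer i, with value 0 outside [-m, m]. *)
Definition gcomp i v : lie G :=
  \sum_(s < m.*2.+1 | wt s == i)
    sumv_pi_for (erefl (\sum_(s < m.*2.+1) gr (wt s))%VS) s v.

Lemma gcomp_linear i : linear (gcomp i).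
Proof.
move=> c v w; rewrite /gcomp scaler_sumr -big_split; apply: eq_bigr => s _.
by rewrite linearP.
Qed.

HB.instance Definition _ i := GRing.isLinear.Build R (lie G) (lie G) _ (gcomp i)
  (gcomp_linear i).

Lemma gcomp_mem i v : gcomp i v \in gr i.
Proof. by apply: rpred_sum => s /eqP <-; exact: memv_sum_pi. Qed.

Lemma gr_out i : m%:Z < `|i| -> gr i = 0%VS.
Proof. by have [h _ _ _ _] := grG; exact: h. Qed.

Lemma gcomp_out i v : m%:Z < `|i| -> gcomp i v = 0.
Proof. by move=> /gr_out h; have := gcomp_mem i v; rewrite h memv0 => /eqP. Qed.

Lemma gcomp_sum v : v = \sum_(s < m.*2.+1) gcomp (wt s) v.
Proof.
have [_ full _ _ _] := grG.
rewrite -[LHS](sumv_pi_sum (erefl (\sum_(s < m.*2.+1) gr (wt s))%VS)); last first.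
  by rewrite full memvf.
apply: eq_bigr => s _; rewrite /gcomp [RHS](big_pred1 s)// => t.
by rewrite /wt (inj_eq (addIr _)) eqz_nat.
Qed.

Lemma wt_ex i : `|i| <= m%:Z -> exists s, wt s = i.
Proof.
move=> im; have lt : (absz (i + m%:Z)%R < m.*2.+1)%N.
    by rewrite ltnS -addnn; lia.
by exists (Ordinal lt); rewrite /wt/=; lia.
Qed.

Lemma gcomp_id i v : v \in gr i -> gcomp i v = v /\ forall j, j != i -> gcomp j v = 0.
Proof.
move=> vi; have [im|im] := leP `|i| m%:Z; last first.
  have -> : v = 0 by move: vi; rewrite gr_out// memv0 => /eqP.
  by split=> [|j _]; rewrite linear0.
have [s si] := wt_ex im; have [_ _ dir _ _] := grG.
have /directv_sum_unique U := dir.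
pose us t := gcomp (wt t) v; pose vs t := if t == s then v else 0.
have usm t : true -> us t \in gr (wt t) by move=> _; exact: gcomp_mem.
have vsm t : true -> vs t \in gr (wt t).
  by move=> _; rewrite /vs; case: eqP => [->|_]; rewrite ?si// mem0v.
have := U us vs usm vsm; rewrite -gcomp_sum /vs -big_mkcond big_pred1_eq eqxx.
move=> /esym/forall_inP E; split.
  by have /eqP := E s isT; rewrite /us /vs eqxx si.
move=> j ji; have [jm|] := leP `|j| m%:Z; last exact: gcomp_out.
have [t tj] := wt_ex jm; have /eqP := E t isT; rewrite /us /vs tj => ->.
case: eqP => // ts; move: ji; by rewrite -tj -si ts eqxx.
Qed.

Lemma gcomp_gr i j v : v \in gr i -> gcomp j v = if j == i then v else 0.
Proof. by move=> /gcomp_id[h1 h2]; case: eqP => [->//|/eqP]; exact: h2. Qed.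

Lemma gcomp_eq0 v : (forall i, gcomp i v = 0) -> v = 0.
Proof. by move=> h; rewrite (gcomp_sum v) big1. Qed.

Lemma gr_br i j v w : v \in gr i -> w \in gr j -> br v w \in gr (i + j).
Proof. by have [_ _ _ h _] := grG; exact: h. Qed.

Lemma gr_ind (P : lie G -> Prop) : P 0 -> (forall v w, P v -> P w -> P (v + w)) ->
  (forall i v, v \in gr i -> P v) -> forall v, P v.
Proof.
move=> P0 PD Pg v; rewrite (gcomp_sum v); elim/big_ind: _ => // s _.
exact: Pg (gcomp_mem _ _).
Qed.

(** This is the grading derivation; being inner when G is semisimple, it provides the grading
    element. *)
Definition weight_op v : lie G := \sum_(s < m.*2.+1) (wt s)%:~R *: gcomp (wt s) v.

Lemma weight_op_linear : linear weight_op.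
Proof.
move=> c v w; rewrite /weight_op scaler_sumr -big_split; apply: eq_bigr => s _.
by rewrite linearP scalerDr !scalerA mulrC.
Qed.

HB.instance Definition _ := GRing.isLinear.Build R (lie G) (lie G) _ weight_op
  weight_op_linear.

Lemma weight_op_gr i v : v \in gr i -> weight_op v = i%:~R *: v.
Proof.
move=> vi; rewrite /weight_op; have [im|im] := leP `|i| m%:Z; last first.
  have -> : v = 0 by move: vi; rewrite gr_out// memv0 => /eqP.
  by rewrite scaler0 big1// => s _; rewrite linear0 scaler0.
have [s si] := wt_ex im; rewrite (bigD1 s)//= big1 => [|t ts].
  by rewrite (gcomp_gr _ vi) si eqxx addr0.
rewrite (gcomp_gr _ vi) -si /wt (inj_eq (addIr _)) eqz_nat.
by rewrite (inj_eq val_inj) (negbTE ts) scaler0.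
Qed.

Lemma weight_op_der v w : weight_op (br v w) = br (weight_op v) w + br v (weight_op w).
Proof.
elim/gr_ind: v => [|v v' IH IH'|i v vi].
- by rewrite !linear0 !br0l linear0 addr0.
- by rewrite brDl !linearD/= !brDl IH IH' addrACA.
elim/gr_ind: w => [|w w' IH IH'|j w wj].
- by rewrite !linear0 addr0.
- by rewrite !linearD/= IH IH' addrACA.
rewrite (weight_op_gr (gr_br vi wj)) (weight_op_gr vi) (weight_op_gr wj).
by rewrite brZl linearZ/= -scalerDl -intrD.
Qed.

Lemma gcomp_weight i v : gcomp i (weight_op v) = i%:~R *: gcomp i v.
Proof.
elim/gr_ind: v => [|v w IH IH'|j v vj]; first by rewrite !linear0 ?scaler0.
  by rewrite (linearD weight_op) !(linearD (gcomp i))/= IH IH' scalerDr.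
rewrite (weight_op_gr vj) linearZ/= (gcomp_gr _ vj).
by case: eqP => [->|]; rewrite ?scaler0.
Qed.

(** Together with [deg_ge], the filtrations of the grading: [deg_le (-1)] is g_-, [deg_ge 0] is p,
    and [deg_ge 1] turns out to be the nilradical of p. *)
Definition deg_le k v := forall i, k < i -> gcomp i v = 0.

Lemma deg_le_gr i k v : v \in gr i -> i <= k -> deg_le k v.
Proof.
move=> vi ik j kj; rewrite (gcomp_gr _ vi); case: eqP => // ji.
by move: kj; rewrite ji ltNge ik.
Qed.

Lemma deg_leD k v w : deg_le k v -> deg_le k w -> deg_le k (v + w).
Proof. by move=> hv hw i ki; rewrite linearD/= hv// hw// addr0. Qed.

Lemma deg_leZ k c v : deg_le k v -> deg_le k (c *: v).
Proof. by move=> hv i ki; rewrite linearZ/= hv// scaler0. Qed.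

Lemma deg_leB k v w : deg_le k v -> deg_le k w -> deg_le k (v - w).
Proof. by move=> hv hw; rewrite -scaleN1r; apply: deg_leD => //; exact: deg_leZ. Qed.

Lemma deg_le0 k : deg_le k 0.
Proof. by move=> i _; rewrite linear0. Qed.

Lemma deg_leW k l v : k <= l -> deg_le k v -> deg_le l v.
Proof. by move=> kl h i li; apply: h; exact: le_lt_trans kl li. Qed.

Lemma deg_le_top v : deg_le m%:Z v.
Proof. by move=> i mi; apply: gcomp_out; rewrite gtr0_norm// (le_lt_trans _ mi). Qed.

Lemma deg_le_bot v k : k < - m%:Z -> deg_le k v -> v = 0.
Proof.
move=> km h; apply: gcomp_eq0 => i; have [ki|ik] := ltP k i; first exact: h.
by apply: gcomp_out; lia.
Qed.

Lemma deg_le_ind k (P : lie G -> Prop) : P 0 -> (forall v w, P v -> P w -> P (v + w)) ->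
  (forall i v, i <= k -> v \in gr i -> P v) -> forall v, deg_le k v -> P v.
Proof.
move=> P0 PD Pg v hv; rewrite (gcomp_sum v); elim/big_ind: _ => // s _.
have [ki|ik] := ltP k (wt s); first by rewrite hv.
exact: Pg ik (gcomp_mem _ _).
Qed.

Lemma deg_le_br k l v w : deg_le k v -> deg_le l w -> deg_le (k + l) (br v w).
Proof.
move=> hv; elim/deg_le_ind: v / hv => [|v v' IH IH'|i v ik vi] hw.
- by rewrite br0l; exact: deg_le0.
- by rewrite brDl; apply: deg_leD; [exact: IH|exact: IH'].
elim/deg_le_ind: w / hw => [|w w' IH IH'|j w jl wj].
- by rewrite linear0; exact: deg_le0.
- by rewrite linearD; exact: deg_leD.
- by apply: deg_le_gr (gr_br vi wj) _; exact: lerD.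
Qed.

Definition deg_ge k v := forall i, i < k -> gcomp i v = 0.

Lemma deg_geD k v w : deg_ge k v -> deg_ge k w -> deg_ge k (v + w).
Proof. by move=> hv hw i ki; rewrite linearD/= hv// hw// addr0. Qed.

Lemma deg_ge0 k : deg_ge k 0.
Proof. by move=> i _; rewrite linear0. Qed.

Lemma deg_ge_gr i k v : v \in gr i -> k <= i -> deg_ge k v.
Proof.
move=> vi ik j kj; rewrite (gcomp_gr _ vi); case: eqP => // ji.
by move: kj; rewrite ji ltNge ik.
Qed.

Lemma deg_ge_ind k (P : lie G -> Prop) : P 0 -> (forall v w, P v -> P w -> P (v + w)) ->
  (forall i v, k <= i -> v \in gr i -> P v) -> forall v, deg_ge k v -> P v.
Proof.
move=> P0 PD Pg v hv; rewrite (gcomp_sum v); elim/big_ind: _ => // s _.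
have [ki|ik] := ltP (wt s) k; first by rewrite hv.
exact: Pg ik (gcomp_mem _ _).
Qed.

Lemma deg_ge_br k l v w : deg_ge k v -> deg_ge l w -> deg_ge (k + l) (br v w).
Proof.
move=> hv; elim/deg_ge_ind: v / hv => [|v v' IH IH'|i v ik vi] hw.
- by rewrite br0l; exact: deg_ge0.
- by rewrite brDl; apply: deg_geD; [exact: IH|exact: IH'].
elim/deg_ge_ind: w / hw => [|w w' IH IH'|j w jl wj].
- by rewrite linear0; exact: deg_ge0.
- by rewrite linearD; exact: deg_geD.
- by apply: deg_ge_gr (gr_br vi wj) _; exact: lerD.
Qed.

Lemma deg_ge_top v k : m%:Z < k -> deg_ge k v -> v = 0.
Proof.
move=> km h; apply: gcomp_eq0 => i; have [ki|ik] := ltP i k; first exact: h.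
by apply: gcomp_out; lia.
Qed.

(** The map ad v ad w shifts degrees by i + j, which is not zero, so it is nilpotent: 2m + 1 shifts
    leave the range [-m, m] from any starting degree. *)
Lemma killing_gr i j v w : i + j != 0 -> v \in gr i -> w \in gr j -> killing v w = 0.
Proof.
move=> ij vi wj; rewrite killingE.
have nil u : iter m.*2.+1 (br v \o br w) u = 0.
  elim/gr_ind: u => [|u u' IH IH'|k u uk].
  - by elim: m.*2.+1 => //= q ->; rewrite !linear0.
  - have D q : iter q (br v \o br w) (u + u') =
       iter q (br v \o br w) u + iter q (br v \o br w) u'.
      by elim: q => //= q ->; rewrite !linearD.
    by rewrite D IH IH' addr0.
  have [km|km] := leP `|k| m%:Z; last first.
    have -> : u = 0 by move: uk; rewrite gr_out// memv0 => /eqP.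
    by elim: m.*2.+1 => //= q ->; rewrite !linear0.
  have H q : iter q (br v \o br w) u \in gr (k + (i + j) * q%:Z).
    elim: q => [|q IH] /=; first by rewrite mulr0 addr0.
    have -> : k + (i + j) * q.+1%:Z = i + (j + (k + (i + j) * q%:Z)).
      by rewrite -addn1 PoszD; ring.
    exact: gr_br vi (gr_br wj IH).
  have := H m.*2.+1; rewrite gr_out ?memv0 => [/eqP//|].
  have h1 : (1 <= `|i + j|) by rewrite -gtz0_ge1 normr_gt0.
  have h2 : m.*2.+1%:Z <= `|(i + j) * m.*2.+1%:Z|.
    by rewrite normrM ler_peMl.
  have h3 : `|(i + j) * m.*2.+1%:Z| <= `|k + (i + j) * m.*2.+1%:Z| + `|k|.
    by move: ((i + j) * _) => a; lia.
  move: h2 h3 km; rewrite -addnn; lia.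
exact: (@ltr_nilpotent R (lie G) (br v \o br w) m.*2.+1 nil).
Qed.

Hypothesis ss : semisimple G.

Lemma grading_element : exists E, forall v, br E v = weight_op v.
Proof.
have [E hE] := @derivation_inner R G ss weight_op weight_op_der.
by exists E.
Qed.

(** [weight_op] maps E to [E, E] = 0, and it is injective on components of nonzero degree. *)
Lemma grading_element_gr0 E : (forall v, br E v = weight_op v) -> E \in gr 0.
Proof.
move=> hE; have E0 : weight_op E = 0.
  by apply/eqP; rewrite -hE -[_ == 0](inj_eq (@scalerI _ _ (2:R) _))// scaler0
    scaler_nat mulr2n {1}brC addNr.
rewrite (gcomp_sum E); apply: rpred_sum => s _.
have [->|s0] := eqVneq (wt s) 0; first exact: gcomp_mem.
have := gcomp_weight (wt s) E; rewrite E0 linear0 => /esym/eqP.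
by rewrite scaler_eq0 intr_eq0 (negbTE s0)/= => /eqP ->; exact: mem0v.
Qed.

Variable p : {vspace lie G}.
Hypothesis pE : p = (\sum_(i < m.+1) gr i%:Z)%VS.

Lemma parabolicP v : v \in p <-> deg_ge 0 v.
Proof.
rewrite pE; split=> [/memv_sumP[vs hvs ->] i i0|].
  by rewrite linear_sum big1// => s _; apply: (deg_ge_gr (hvs s isT) _ i0).
move=> hv; elim/deg_ge_ind: v / hv => [|v w|i v i0 vi]; first exact: mem0v.
  exact: memvD.
have [im|im] := leP i m%:Z; last first.
  by move: vi; rewrite gr_out ?ger0_norm// memv0 => /eqP ->; exact: mem0v.
have lt : (absz i < m.+1)%N by lia.
have iE : i = (Ordinal lt : nat)%:Z by rewrite /=; lia.
by apply: (subvP (sumv_sup (Ordinal lt) isT (subvv _))); rewrite -iE.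
Qed.

Lemma killing_comp i v w : killing (gcomp i v) w = killing v (gcomp (- i) w).
Proof.
have [im|im] := leP `|i| m%:Z; last first.
  by rewrite !gcomp_out ?normrN// linear0 killingC linear0.
have [s si] := wt_ex im.
have im' : `|- i| <= m%:Z by rewrite normrN.
have [t ti] := wt_ex im'.
rewrite {1}(gcomp_sum w) linear_sum (bigD1 t)//= big1 ?addr0 => [|r rt]; last first.
  apply: killing_gr (gcomp_mem _ _) (gcomp_mem _ _).
  rewrite -[i]opprK -ti addrC subr_eq0 /wt (inj_eq (addIr _)) eqz_nat.
  by rewrite (inj_eq val_inj).
rewrite ti [in RHS](gcomp_sum v) [RHS]killing_suml [RHS](bigD1 s)//= [X in _ = _ + X]big1 ?addr0 => [|r rs].
  by rewrite si.
apply: killing_gr (gcomp_mem _ _) (gcomp_mem _ _).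
rewrite -si subr_eq0 /wt (inj_eq (addIr _)) eqz_nat.
by rewrite (inj_eq val_inj).
Qed.

(** The Killing form is nondegenerate and pairs degree i with degree -i only, so orthogonality to
    all degrees >= 0 kills the components of degree <= 0. *)
Lemma perp_parabolicP v : (forall w, w \in p -> killing v w = 0) <-> deg_ge 1 v.
Proof.
split=> [h i i1|h w /parabolicP hw].
  apply: ss => w; rewrite killing_comp h//; apply/parabolicP.
  by apply: deg_ge_gr (gcomp_mem _ _) _; lia.
rewrite (gcomp_sum w) linear_sum big1// => s _ /=.
have [s0|s0] := ltP (wt s) 0; first by rewrite hw// linear0.
have := killing_comp (- wt s) v w; rewrite opprK => <-; rewrite h; last by lia.
by rewrite killingC linear0.
Qed.

Lemma perp_positiveP v : (forall w, deg_ge 1 w -> killing w v = 0) <-> v \in p.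
Proof.
split=> [h|vp w /perp_parabolicP]; last exact.
apply/parabolicP => i i0; apply: ss => w; rewrite killing_comp killingC h//.
by apply: deg_ge_gr (gcomp_mem _ _) _; lia.
Qed.

Lemma brvP (A B C : {vspace lie G}) :
  (forall X Y, X \in A -> Y \in B -> br X Y \in C) <-> (brv A B <= C)%VS.
Proof.
split=> [h|/subvP h X Y XA YB].
  apply/span_subvP => Z /allpairsP[[X Y] /= [XA YB ->]]; apply: h.
    exact: vbasis_mem.
  exact: vbasis_mem.
apply: h; rewrite (coord_vbasis XA) (coord_vbasis YB) br_suml.
apply: rpred_sum => a _; rewrite linear_sum; apply: rpred_sum => b _ /=.
rewrite brZl linearZ/=; do 2!apply: rpredZ.
by apply: memv_span; apply/allpairsP; exists ((vbasis A)`_a, (vbasis B)`_b); split=> //=;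
  apply: mem_nth; rewrite size_tuple.
Qed.

Lemma brv_mem (A B : {vspace lie G}) X Y : X \in A -> Y \in B -> br X Y \in brv A B.
Proof. by move: X Y; apply/brvP; exact: subvv. Qed.

Lemma brv_ind (A B : {vspace lie G}) (P : lie G -> Prop) : P 0 ->
  (forall v w, P v -> P w -> P (v + w)) -> (forall c v, P v -> P (c *: v)) ->
  (forall X Y, X \in A -> Y \in B -> P (br X Y)) ->
  forall v, v \in brv A B -> P v.
Proof.
move=> P0 PD PZ Pb v; rewrite /brv; set s := [seq _ | _ <- _, _ <- _].
move=> /(@coord_span _ _ _ (in_tuple s)) ->; elim/big_ind: _ => // i _; apply: PZ.
have /allpairsP[[X Y] /= [XA YB ->]] : (in_tuple s)`_i \in s.
  by rewrite mem_nth ?size_tuple//; have := ltn_ord i; rewrite size_tuple.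
by apply: Pb; exact: vbasis_mem.
Qed.

Variable pp : {vspace lie G}.
Hypothesis ppN : nilradical p pp.

Let p_br X Y : X \in p -> Y \in p -> br X Y \in p.
Proof.
by move=> /parabolicP hX /parabolicP hY; apply/parabolicP; have := deg_ge_br hX hY; rewrite addr0.
Qed.

Lemma nilradical_sub X : X \in pp -> X \in p.
Proof. by have [[/subvP h _ _] _] := ppN; exact: h. Qed.

Lemma nilradical_ideal X Y : X \in p -> Y \in pp -> br X Y \in pp.
Proof. by have [[_ /brvP h _] _] := ppN; exact: h. Qed.

(** The lower central series of the nilradical; its terms are ideals of p. *)
Let C (k : nat) := iter k (brv pp) pp.

Let C_ideal (k : nat) X Y : X \in p -> Y \in C k -> br X Y \in C k.
Proof.
elim: k X Y => [|k IH] X Y Xp; first exact: nilradical_ideal.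
move: Y; apply: brv_ind => [|v w|c v|Z W Zpp WC].
- by rewrite linear0 mem0v.
- by rewrite linearD; exact: memvD.
- by rewrite linearZ; exact: memvZ.
rewrite jacobi; apply: rpredD.
  by apply: brv_mem => //; exact: nilradical_ideal.
by apply: brv_mem => //; exact: IH.
Qed.

Let C_sub (k : nat) : (C k <= pp)%VS.
Proof.
elim: k => [|q hq]; first exact: subvv.
apply/brvP => A B Ap BC; apply: nilradical_ideal (nilradical_sub Ap) _.
exact: (subvP hq).
Qed.

(** l projects onto the nilradical, where ad Z descends the lower central series; so ad Z composed
    with l is nilpotent. *)
Lemma nilradical_trace Z (l : {linear lie G -> lie G}) : Z \in pp ->
  (forall v, l v \in pp) -> (forall v, v \in pp -> l v = v) ->
  ltr (br Z \o l) = 0.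
Proof.
move=> Zpp lpp lid; have [[_ _ [N hN]] _] := ppN.
apply: (@ltr_nilpotent R (lie G) (br Z \o l) N.+1) => v.
have H (k : nat) : iter k.+1 (br Z \o l) v \in C k.
  elim: k => [|k IH] /=; first by apply: nilradical_ideal (nilradical_sub Zpp) _; exact: lpp.
  rewrite lid; first exact: brv_mem.
  exact: (subvP (C_sub k)).
by have := H N; rewrite /C hN memv0 => /eqP.
Qed.

Let pos : {vspace lie G} := (\sum_(i < m) gr i.+1%:Z)%VS.

Let posP v : v \in pos <-> deg_ge 1 v.
Proof.
split=> [/memv_sumP[vs hvs ->] i i0|].
  rewrite linear_sum big1// => s _; apply: (deg_ge_gr (hvs s isT) _ i0); lia.
move=> hv; elim/deg_ge_ind: v / hv => [|v w|i v i0 vi]; first exact: mem0v.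
  exact: memvD.
have [im|im] := leP i m%:Z; last first.
  by move: vi; rewrite gr_out ?memv0 => [/eqP ->|]; [exact: mem0v|lia].
have lt : ((absz i).-1 < m)%N by lia.
have iE : i = (Ordinal lt : nat).+1%:Z by rewrite /=; lia.
by apply: (subvP (sumv_sup (Ordinal lt) isT (subvv _))); rewrite -iE.
Qed.

(** Brackets within the positive part raise the degree, so it is a nilpotent ideal of p, and pp
    contains all of these. *)
Let pos_sub_pp : (pos <= pp)%VS.
Proof.
have [_ max] := ppN; apply: max; split.
- apply/subvP => v /posP hv; apply/parabolicP => i i0; apply: hv; lia.
- apply/brvP => X Y /parabolicP hX /posP hY; apply/posP.
  by have := deg_ge_br hX hY; rewrite add0r.
- exists m; apply/eqP; rewrite -subv0; apply/subvP => v hv.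
  rewrite memv0; apply/eqP; apply: (@deg_ge_top _ (m%:Z + 1)); first lia.
  have H (q : nat) w : w \in iter q (brv pos) pos -> deg_ge (q%:Z + 1) w.
    elim: q w => [|q IH] w; first by rewrite add0r => /posP.
    move: w; apply: brv_ind => [|u w|c u|X Y /posP hX /IH hY].
    - exact: deg_ge0.
    - exact: deg_geD.
    - by move=> hu i hi; rewrite linearZ/= hu// scaler0.
    - have := deg_ge_br hX hY; congr deg_ge; lia.
  exact: H.
Qed.

(** The lower central series shows that ad Z ad X is nilpotent on p, but the trace is over all of g.
    By invariance of the Killing form, ad X ad Z is the adjoint of ad Z ad X. As N + 1 iterates of
    the former vanish on p, those of the latter map g into the orthogonal space of p, which has
    degrees >= 1 and so lies in p. Another N + 1 iterates give 0. *)
Lemma nilradical_perp Z X : Z \in pp -> X \in p -> killing Z X = 0.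
Proof.
move=> Zpp Xp; have [[_ _ [N hN]] _] := ppN.
have T1 (f g : {linear lie G -> lie G}) :
    (forall v, v \in p -> f (g v) \in pp) ->
    (forall (k : nat) v, v \in C k -> f (g v) \in C k.+1) ->
    forall v, v \in p -> iter N.+1 (f \o g) v = 0.
  move=> h1 h2 v vp; have H (k : nat) : iter k.+1 (f \o g) v \in C k.
    by elim: k => [|k IH]; [exact: h1|exact: h2].
  by have := H N; rewrite /C hN memv0 => /eqP.
have A : forall v, v \in p -> iter N.+1 (br X \o br Z) v = 0.
  apply: T1 => [v vp|k v vC].
    change (br X (br Z v) \in pp).
    by apply: nilradical_ideal => //; rewrite brC memvN nilradical_ideal.
  change (br X (br Z v) \in C k.+1).
  by apply: C_ideal => //; exact: brv_mem.
have B : forall v, v \in p -> iter N.+1 (br Z \o br X) v = 0.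
  apply: T1 => [v vp|k v vC].
    change (br Z (br X v) \in pp).
    by rewrite brC memvN nilradical_ideal//; exact: p_br.
  change (br Z (br X v) \in C k.+1).
  by apply: brv_mem => //; exact: C_ideal.
have adj (k : nat) v w : killing (iter k (br Z \o br X) v) w =
    killing v (iter k (br X \o br Z) w).
  elim: k v w => // k IH v w; rewrite iterS iterSr/= killing_inv killing_inv opprK.
  by rewrite IH.
rewrite killingE; apply: (@ltr_nilpotent R (lie G) (br Z \o br X) (N.+1 + N.+1)) => v.
rewrite iterD; apply: B; apply/parabolicP.
have : deg_ge 1 (iter N.+1 (br Z \o br X) v).
  by apply/perp_parabolicP => w wp; rewrite adj A// linear0.
by move=> h i i0; apply: h; lia.
Qed.

Lemma nilradicalP Z : Z \in pp <-> deg_ge 1 Z.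
Proof.
split=> [Zpp|/posP]; last exact: (subvP pos_sub_pp).
by apply/perp_parabolicP => X; exact: nilradical_perp.
Qed.

End Grading.

(** * Projection to g_-, and bases dual under the Killing form *)

Section Parabolic.
Variables (R : realType) (G : lieGroup R) (m : nat) (gr : int -> {vspace lie G}).
Hypothesis grG : grading m gr.
Hypothesis ss : semisimple G.
Variable p : {vspace lie G}.
Hypothesis pE : p = (\sum_(i < m.+1) gr i%:Z)%VS.
Implicit Types (X Y Z v w : lie G) (i j k : int).

Let wt (s : 'I_m.*2.+1) : int := s%:Z - m%:Z.

(** The projection to g_- along p. *)
Definition negproj v : lie G := \sum_(s < m.*2.+1 | wt s < 0) gcomp m gr (wt s) v.

Lemma negproj_linear : linear negproj.
Proof.
move=> c v w; rewrite /negproj scaler_sumr -big_split; apply: eq_bigr => s _.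
by rewrite linearP.
Qed.

HB.instance Definition _ := GRing.isLinear.Build R (lie G) (lie G) _ negproj
  negproj_linear.

Lemma negproj_deg v : deg_le m gr (- 1) (negproj v).
Proof.
rewrite /negproj; elim/big_ind: _ => [|u w|s s0]; first exact: deg_le0.
  exact: deg_leD.
by apply: (deg_le_gr grG (gcomp_mem _ _ _ _)); lia.
Qed.

Lemma negproj_sub v : v - negproj v \in p.
Proof.
apply/(parabolicP grG pE) => i i0.
rewrite [X in X - _](gcomp_sum grG v) [X in X - _](bigID (fun s => wt s < 0))/= addrAC subrr add0r.
rewrite linear_sum big1// => s /negP s0.
by rewrite /= (gcomp_gr grG _ (gcomp_mem _ _ _ _)); case: eqP => // ii; move: s0; rewrite /wt; lia.
Qed.

Lemma deg_le_p v : deg_le m gr (- 1) v -> v \in p -> v = 0.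
Proof.
move=> h /(parabolicP grG pE) h'; apply: (gcomp_eq0 grG) => i.
have [i0|i0] := ltP i 0; [exact: h'|apply: h; lia].
Qed.

Lemma negproj_p v : negproj v = 0 <-> v \in p.
Proof.
split=> [h|vp]; first by have := negproj_sub v; rewrite h subr0.
apply: deg_le_p; first exact: negproj_deg.
by have := memvB vp (negproj_sub v); rewrite opprB addrC subrK.
Qed.

Lemma negproj_id v : deg_le m gr (- 1) v -> negproj v = v.
Proof.
move=> h; apply/esym/eqP; rewrite -subr_eq0; apply/eqP.
apply: deg_le_p; last exact: negproj_sub.
by apply: deg_leB => //; exact: negproj_deg.
Qed.

Let neg : {vspace lie G} := (\sum_(i < m) gr (- i.+1%:Z))%VS.

Let negP v : v \in neg <-> deg_le m gr (- 1) v.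
Proof.
split=> [/memv_sumP[vs hvs ->] i i0|].
  rewrite linear_sum big1// => s _; apply: (deg_le_gr grG (hvs s isT) _ i0); lia.
move=> hv; elim/(deg_le_ind grG): v / hv => [|v w|i v i0 vi]; first exact: mem0v.
  exact: memvD.
have [im|im] := leP (- i) m%:Z; last first.
  by move: vi; rewrite (gr_out grG) ?memv0 => [/eqP ->|]; [exact: mem0v|lia].
have lt : ((absz i).-1 < m)%N by lia.
have iE : i = - (Ordinal lt : nat).+1%:Z by rewrite /=; lia.
by apply: (subvP (sumv_sup (Ordinal lt) isT (subvv _))); rewrite -iE.
Qed.

Lemma complement_frame n : (n = \dim {:lie G} - \dim p)%N ->
  exists (e : 'I_n -> lie G) (c : 'I_n -> {linear lie G -> R^o}),
  [/\ forall a b, c a (e b) = (a == b)%:R,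
      forall v, v \in p <-> forall a, c a v = 0,
      forall v, v - \sum_a c a v *: e a \in p,
      forall v, negproj v = \sum_a c a v *: e a
    & forall a, deg_le m gr (- 1) (e a)].
Proof.
have capE : (neg :&: p = 0)%VS.
  apply/eqP; rewrite -subv0; apply/subvP => v; rewrite memv_cap => /andP[/negP vn vp].
  by rewrite memv0; apply/eqP; exact: deg_le_p.
have addE : (neg + p = {:lie G})%VS.
  apply/eqP; rewrite eqEsubv subvf/=; apply/subvP => v _.
  rewrite -[v](subrK (negproj v)) addrC; apply: memv_add; last exact: negproj_sub.
  by apply/negP; exact: negproj_deg.
have dimE : (\dim neg + \dim p)%N = \dim {:lie G} by rewrite -dimv_disjoint_sum ?addE.
rewrite -dimE addnK => ->.
pose e (a : 'I_(\dim neg)) := (vbasis neg)`_a.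
pose c (a : 'I_(\dim neg)) (v : lie G) : R^o := coord (vbasis neg) a (negproj v).
have cl a : linear (c a) by move=> t u v; rewrite /c !linearP.
pose C a : {linear lie G -> R^o} := HB.pack_for {linear lie G -> R^o} (c a)
  (GRing.isLinear.Build R (lie G) R^o _ (c a) (cl a)).
have CE v : negproj v = \sum_a c a v *: e a.
  by apply: coord_vbasis; apply/negP; exact: negproj_deg.
have en a : deg_le m gr (- 1) (e a).
  by apply/negP; apply: vbasis_mem; rewrite mem_nth// size_tuple.
exists e, C; split=> //.
- move=> a b; rewrite /C/= /c (negproj_id (en b)) /e coord_free// ?(basis_free (vbasisP _))//.
  by rewrite eq_sym.
- move=> v; split=> [/negproj_p h a|h]; first by rewrite /C/= /c h linear0.
  by apply/negproj_p; rewrite CE big1// => a _; rewrite [c a v]h scale0r.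
- by move=> v; rewrite -(CE v); exact: negproj_sub.
Qed.

Section Recover.
Variable E : lie G.
Hypothesis EE : forall v, br E v = weight_op m gr v.

(** The product of the operators ad (E - Z) - l over l = m, ..., 0 is [shifts]. For Z in g_-, the
    factor l kills the part of degree l and so lowers a top degree l by one: the product maps all of
    g into g_-. *)
Let shift Z (l : nat) v := br (E - Z) v - l%:R *: v.
Let shifts Z v := foldr (fun l => shift Z l) v (iota 0 m.+1).

Let shift_deg Z (l : nat) v : deg_le m gr (- 1) Z -> deg_le m gr l%:Z v ->
  deg_le m gr (l%:Z - 1) (shift Z l v).
Proof.
move=> hZ hv i il; rewrite /shift brBl EE !linearB/= linearZ/= (gcomp_weight grG).
have [li|il'] := ltP l%:Z i.
  rewrite hv// !scaler0 sub0r subr0 (deg_le_br grG hZ hv) ?oppr0//; lia.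
have -> : i = l%:Z by lia.
rewrite (deg_le_br grG hZ hv) ?subr0; last by lia.
by rewrite -pmulrn subrr.
Qed.

(** In the top degree i of v, the equation reads (i - l) v_i = 0 because Z lowers degrees; as i < 0
    <= l, the top component vanishes, and one descends. *)
Let shift_inj Z (l : nat) v : deg_le m gr (- 1) Z -> deg_le m gr (- 1) v ->
  shift Z l v = 0 -> v = 0.
Proof.
move=> hZ hv h.
have H (q : nat) : deg_le m gr (- 1 - q%:Z) v.
  elim: q => [|q IH]; first by rewrite subr0.
  move=> i hi; have [|qi] := ltP (- 1 - q%:Z) i; first exact: IH.
  have := congr1 (gcomp m gr i) h; rewrite /shift brBl EE !linearB/= linear0 linearZ/=.
  rewrite (gcomp_weight grG) (deg_le_br grG hZ IH); last by lia.
  rewrite subr0 -[l%:R]/((l%:Z)%:~R).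
  rewrite -scalerBl -intrB => /eqP; rewrite scaler_eq0 intr_eq0 => /orP[|/eqP//].
  lia.
apply: (deg_le_bot grG _ (H m.+1)); lia.
Qed.

Let shifts_neg Z v : deg_le m gr (- 1) Z -> deg_le m gr (- 1) (shifts Z v).
Proof.
move=> hZ; rewrite /shifts.
have H (q r : nat) : (q + r = m.+1)%N ->
    deg_le m gr (q%:Z - 1) (foldr (fun l => shift Z l) v (iota q r)).
  elim: r q => [|r IH] q qr /=.
    by apply: deg_leW (deg_le_top grG v); lia.
  apply: shift_deg => //; have := IH q.+1; rewrite addSnnS => /(_ qr).
  by congr deg_le; lia.
exact: (H 0%N m.+1).
Qed.

Let shift_sub Z (l : nat) v : deg_le m gr (- 1) Z -> deg_le m gr (- 1) v ->
  deg_le m gr (- 1) (shift Z l v).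
Proof.
move=> hZ hv; rewrite /shift; apply: deg_leB; last exact: deg_leZ.
rewrite brBl EE; apply: deg_leB => [i hi|].
  by rewrite (gcomp_weight grG) hv// scaler0.
by apply: deg_leW (deg_le_br grG hZ hv); lia.
Qed.

Let shifts_inj Z v : deg_le m gr (- 1) Z -> deg_le m gr (- 1) v ->
  shifts Z v = 0 -> v = 0.
Proof.
move=> hZ hv; rewrite /shifts.
have sub s : deg_le m gr (- 1) (foldr (fun l => shift Z l) v s).
  by elim: s => //= l s IH; exact: shift_sub.
by elim: (iota _ _) => //= l s IH h; apply: IH; exact: shift_inj h.
Qed.

Let shifts_linear Z : linear (shifts Z).
Proof.
move=> c u v; rewrite /shifts; elim: (iota _ _) => //= l s ->.
by rewrite /shift linearP/= scalerDr !scalerBr !scalerA [l%:R * c]mulrC opprD addrACA.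
Qed.

Let shifts_mem Z v (q : {vspace lie G}) : (forall X Y, X \in q -> Y \in q -> br X Y \in q) ->
  E - Z \in q -> v \in q -> shifts Z v \in q.
Proof.
move=> hq hE hv; rewrite /shifts; elim: (iota _ _) => //= l s IH.
by rewrite /shift; apply: memvB; [exact: hq|exact: memvZ].
Qed.

(* A complement of g_- which is a subalgebra containing E - Z is determined by
   Z: it is the sum of the eigenspaces of ad (E - Z) for eigenvalues >= 0. *)
Lemma complement_unique Z (q1 q2 : {vspace lie G}) : deg_le m gr (- 1) Z ->
  (forall X Y, X \in q1 -> Y \in q1 -> br X Y \in q1) ->
  (forall X Y, X \in q2 -> Y \in q2 -> br X Y \in q2) ->
  E - Z \in q1 -> E - Z \in q2 ->
  (forall v, v \in q1 -> deg_le m gr (- 1) v -> v = 0) ->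
  (forall v, v \in q2 -> deg_le m gr (- 1) v -> v = 0) ->
  (forall v, exists2 a, a \in q2 & deg_le m gr (- 1) (v - a)) ->
  (q1 <= q2)%VS.
Proof.
move=> hZ h1 h2 E1 E2 d1 d2 s2; apply/subvP => v v1.
have [a a2 hb] := s2 v.
(* Both complements are stable under [shifts], whose image lies in g_-. Meeting g_- only in 0, they
   are killed by it. *)
have Sv : shifts Z v = 0 by apply: d1; [exact: shifts_mem|exact: shifts_neg].
have Sa : shifts Z a = 0 by apply: d2; [exact: shifts_mem|exact: shifts_neg].
have : shifts Z (v - a) = 0.
  by rewrite addrC -scaleN1r (shifts_linear Z) Sa Sv scaler0 addr0.
by move=> /(shifts_inj hZ hb)/eqP; rewrite subr_eq0 => /eqP ->.
Qed.

End Recover.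

Variable pp : {vspace lie G}.
Hypothesis ppN : nilradical p pp.

Notation ppb a := (tnth (vbasis pp) a).

(** The choice in [dual_basis] succeeds: the coordinate functionals of pp, extended to the Lie
    algebra by a projection, are represented by the Killing form. *)
Lemma dual_basisP a b : killing (ppb a) (dual_basis pp b) = (a == b)%:R.
Proof.
pose l (b : 'I_(\dim pp)) (v : lie G) : R^o := coord (vbasis pp) b (projv pp v).
have ll c : linear (l c) by move=> t u v; rewrite /l !linearP.
pose L c : {linear lie G -> R^o} := HB.pack_for {linear lie G -> R^o} (l c)
  (GRing.isLinear.Build R (lie G) R^o _ (l c) (ll c)).
have [xi hxi] := choice (fun c => killing_repr ss (L c)).
have hex : exists xi : {ffun 'I_(\dim pp) -> lie G},
    forall a b, killing (ppb a) (xi b) = (a == b)%:R.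
  exists [ffun c => xi c] => a' b'; rewrite ffunE killingC hxi /= /l projv_id; last first.
    by apply: vbasis_mem; exact: mem_tnth.
  by rewrite (tnth_nth 0) coord_free ?(basis_free (vbasisP _))// eq_sym.
pose Q := [set xi : {ffun 'I_(\dim pp) -> lie G} |
    forall a b, killing (ppb a) (xi b) = (a == b)%:R].
have [xi0 h0] := hex.
exact: (@xgetPex _ [ffun=> 0] Q (ex_intro _ xi0 h0) a b).
Qed.

Lemma nilradical_expand Z : Z \in pp ->
  Z = \sum_a killing Z (dual_basis pp a) *: ppb a.
Proof.
move=> Zpp; rewrite {1}(coord_vbasis Zpp); apply: eq_bigr => a _.
rewrite {2}(coord_vbasis Zpp) killing_suml (bigD1 a)//= big1 ?addr0 => [|b ba].
  by rewrite killingZl -tnth_nth dual_basisP eqxx mulr1 (tnth_nth 0).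
by rewrite killingZl -tnth_nth dual_basisP (negbTE ba) mulr0.
Qed.

(** p is the annihilator of pp, so it suffices to pair with elements of pp. *)
Lemma dual_expand X : X - \sum_a killing (ppb a) X *: dual_basis pp a \in p.
Proof.
apply/(perp_positiveP grG ss pE) => w /(nilradicalP grG ss pE ppN) wpp.
rewrite (linearB (killing w))/= (linear_sum (killing w))/= {1}(nilradical_expand wpp) killing_suml.
apply/eqP; rewrite subr_eq0; apply/eqP/eq_bigr => a _.
by rewrite linearZ/= killingZl mulrC.
Qed.

(** Paired with Z in pp, the sum gives the trace of ad Z on pp, which is zero because ad Z is
    nilpotent there. *)
Lemma dual_trace : \sum_a br (ppb a) (dual_basis pp a) \in p.
Proof.
apply/(perp_positiveP grG ss pE) => Z /(nilradicalP grG ss pE ppN) Zpp.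
pose l (v : lie G) : lie G := \sum_a killing v (dual_basis pp a) *: ppb a.
have ll : linear l.
  move=> c u v; rewrite /l scaler_sumr -big_split; apply: eq_bigr => a _.
  by rewrite killingDl killingZl scalerDl scalerA.
pose L : {linear lie G -> lie G} := HB.pack_for {linear lie G -> lie G} l
  (GRing.isLinear.Build R (lie G) (lie G) _ l ll).
have lpp v : L v \in pp.
  by apply: rpred_sum => a _; apply: rpredZ; apply: vbasis_mem; exact: mem_tnth.
have lid v : v \in pp -> L v = v by move=> h; rewrite [RHS]nilradical_expand.
have := nilradical_trace ppN Zpp lpp lid.
rewrite (@eq_ltr _ _ _ (fun v => \sum_a killing (dual_basis pp a) v *: br Z (ppb a))); last first.
  move=> v /=; rewrite /L/= /l linear_sum; apply: eq_bigr => a _.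
  by rewrite linearZ/= killingC.
rewrite ltr_sum => H; rewrite -[RHS]H (linear_sum (killing Z))/=; apply: eq_bigr => a _.
rewrite (ltr_rank1 (killing (dual_basis pp a))).
rewrite (brC Z) (linearN (killing (dual_basis pp a)))/= [killing (dual_basis pp a) _]killingC.
by rewrite killing_inv opprK.
Qed.

Lemma positive_Ad x Z : normalizer p x -> Z \in pp -> Ad x Z \in pp.
Proof.
move=> xp /(nilradicalP grG ss pE ppN)/(perp_parabolicP grG ss pE) h.
apply/(nilradicalP grG ss pE ppN)/(perp_parabolicP grG ss pE) => w wp.
by rewrite -[w](AdVK x) killing_Ad; apply: h; rewrite -xp AdVK.
Qed.

(** The sum of Z_a tensor xi_a is the canonical element of p_+ tensor g/p, independent of the choice
    of dual bases, and Ad x maps one pair of dual bases to another. This is the source of the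
    P-equivariance of the codifferential. *)
Lemma dual_basis_change (V : lmodType R) (B : lie G -> lie G -> V) x :
  (forall X, linear (B^~ X)) -> (forall Z, linear (B Z)) ->
  (forall Z X, X \in p -> B Z X = 0) -> normalizer p x ->
  \sum_a B (Ad x (ppb a)) (Ad x (dual_basis pp a)) =
  \sum_a B (ppb a) (dual_basis pp a).
Proof.
move=> Bl Br Bp xp.
have Blsum X (F : 'I_(\dim pp) -> R) (H : 'I_(\dim pp) -> lie G) :
    B (\sum_a F a *: H a) X = \sum_a F a *: B (H a) X.
  pose BX := B^~ X; pose L := HB.pack_for {linear lie G -> V} BX
    (GRing.isLinear.Build R (lie G) V _ BX (Bl X)).
  change (L (\sum_a F a *: H a) = \sum_a F a *: L (H a)).
  by rewrite linear_sum; apply: eq_bigr => a _; rewrite linearZ.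
have Brsum Z (F : 'I_(\dim pp) -> R) (H : 'I_(\dim pp) -> lie G) :
    B Z (\sum_a F a *: H a) = \sum_a F a *: B Z (H a).
  pose BX := B Z; pose L := HB.pack_for {linear lie G -> V} BX
    (GRing.isLinear.Build R (lie G) V _ BX (Br Z)).
  change (L (\sum_a F a *: H a) = \sum_a F a *: L (H a)).
  by rewrite linear_sum; apply: eq_bigr => a _; rewrite linearZ.
have Bmod Z X Y : X - Y \in p -> B Z X = B Z Y.
  move=> h; have := Br Z 1 (X - Y) Y; rewrite scale1r subrK => ->.
  by rewrite Bp// scaler0 add0r.
transitivity (\sum_a \sum_b killing (Ad x (ppb a)) (dual_basis pp b) *:
    B (ppb b) (Ad x (dual_basis pp a))).
  apply: eq_bigr => a _; rewrite -Blsum -nilradical_expand//.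
  by apply: positive_Ad => //; apply: vbasis_mem; exact: mem_tnth.
rewrite exchange_big; apply: eq_bigr => b _ /=; rewrite -Brsum; apply: Bmod.
rewrite -memvN opprB.
have := dual_expand (Ad (x^-1)%g (dual_basis pp b)); rewrite -xp linearB/= AdVK linear_sum.
congr (_ - _ \in p); apply: eq_bigr => a _; rewrite linearZ/=; congr (_ *: _).
by rewrite -[RHS](killing_Ad (x^-1)%g) AdK.
Qed.

End Parabolic.

(** * Alternating maps *)

Section Insertion.
Variable T : Type.

Definition ins n (i : 'I_n.+1) (x : T) (X : 'I_n -> T) (l : 'I_n.+1) : T :=
  if unlift i l is Some m then X m else x.

Definition upd n (X : 'I_n -> T) (i : 'I_n) (y : T) (l : 'I_n) : T :=
  if l == i then y else X l.

Lemma ins_id n (i : 'I_n.+1) x X : ins i x X i = x.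
Proof. by rewrite /ins unlift_none. Qed.

Lemma ins_lift n (i : 'I_n.+1) x X l : ins i x X (lift i l) = X l.
Proof. by rewrite /ins liftK. Qed.

Lemma ins_liftE n (i : 'I_n.+1) x X : ins i x X \o lift i = X.
Proof. by apply/funext => l; rewrite /= ins_lift. Qed.

Lemma insK n (i : 'I_n.+1) X : ins i (X i) (X \o lift i) = X.
Proof. by apply/funext => l; case: (unliftP i l) => [m|] ->; rewrite ?ins_lift ?ins_id. Qed.

Lemma ins_perm n (i : 'I_n.+1) x X : ins i x X = ins ord0 x X \o lift_perm i ord0 1%g.
Proof.
apply/funext => l /=; case: (unliftP i l) => [m|] ->.
  by rewrite lift_perm_lift !ins_lift perm1.
by rewrite lift_perm_id !ins_id.
Qed.

Lemma upd_ins n (i : 'I_n.+1) x X y : upd (ins i x X) i y = ins i y X.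
Proof.
apply/funext => l; rewrite /upd; case: (unliftP i l) => [m|] ->.
  by rewrite eq_sym (negbTE (neq_lift _ _)) !ins_lift.
by rewrite eqxx ins_id.
Qed.

Lemma upd_ins_lift n (i : 'I_n.+1) x X y l : upd (ins i x X) (lift i l) y = ins i x (upd X l y).
Proof.
apply/funext => q; rewrite /upd; case: (unliftP i q) => [m|] ->.
  by rewrite (inj_eq (@lift_inj _ i)) !ins_lift.
by rewrite (negbTE (neq_lift _ _)) !ins_id.
Qed.

Lemma updE n (i : 'I_n.+1) X y : upd X i y = ins i y (X \o lift i).
Proof. by rewrite -[in LHS](insK i X) upd_ins. Qed.

Lemma upd_id n (X : 'I_n -> T) i : upd X i (X i) = X.
Proof. by apply/funext => l; rewrite /upd; case: eqP => [->|]. Qed.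

Lemma upd_perm n (X : 'I_n -> T) (s : 'S_n) i y : upd X (s i) y \o s = upd (X \o s) i y.
Proof. by apply/funext => l; rewrite /upd /= (inj_eq perm_inj). Qed.

End Insertion.

Lemma fwithE (T : Type) n (X : 'I_n -> T) i y : ([eta X with i |-> y] : 'I_n -> T) = upd X i y.
Proof. by []. Qed.

Lemma sign_lift_perm n (i j : 'I_n.+1) (s : 'S_n) (R : pzRingType) :
  (-1) ^+ lift_perm i j s = (-1) ^+ i * (-1) ^+ j * (-1) ^+ s :> R.
Proof.
by rewrite odd_lift_perm; move: (odd_perm s) => b; rewrite !signr_addb !signr_odd.
Qed.

Section Reindexing.
Variables (V : zmodType).

Lemma sum_lift_perm_r n (i : 'I_n.+1) (F : 'S_n.+1 -> V) :
  \sum_s F s = \sum_j \sum_t F (lift_perm i j t).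
Proof.
rewrite pair_big (reindex (fun q : 'I_n.+1 * 'S_n => lift_perm i q.1 q.2)) //.
apply: onW_bij; apply: inj_card_bij; last first.
  by rewrite card_prod card_ord !card_Sn factS.
move=> [j t] [j' t'] /= /permP h; have jj : j = j'.
  by have := h i; rewrite !lift_perm_id.
rewrite -jj in h *; congr (_, _); apply/permP => l; apply: (@lift_inj _ j).
by have := h (lift i l); rewrite !lift_perm_lift.
Qed.

Lemma sum_lift_perm_l n (j : 'I_n.+1) (F : 'S_n.+1 -> V) :
  \sum_s F s = \sum_i \sum_t F (lift_perm i j t).
Proof.
rewrite pair_big (reindex (fun q : 'I_n.+1 * 'S_n => lift_perm q.1 j q.2)) //.
apply: onW_bij; apply: inj_card_bij; last first.
  by rewrite card_prod card_ord !card_Sn factS.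
move=> [i t] [i' t'] /= h; have ii : i = i'.
  apply: (@perm_inj _ (lift_perm i j t)); rewrite lift_perm_id h.
  by rewrite lift_perm_id.
rewrite -ii in h *; congr (_, _); apply/permP => l; apply: (@lift_inj _ j).
by have /permP/(_ (lift i l)) := h; rewrite !lift_perm_lift.
Qed.

Lemma sum_lift n (i : 'I_n.+1) (F : 'I_n.+1 -> V) :
  \sum_(j | j != i) F j = \sum_l F (lift i l).
Proof.
case: n i F => [|n] i F.
  by rewrite big_pred0 ?big_ord0// => j; rewrite !ord1.
rewrite (reindex (lift i)).
  by apply: eq_bigl => l; rewrite eq_sym neq_lift.
exists (fun k => odflt ord0 (unlift i k)) => k; first by rewrite liftK.
by rewrite inE eq_sym => /unlift_some[l -> ->].
Qed.

Lemma sum_ins (I : finType) n (i : 'I_n.+1) (F : {ffun 'I_n.+1 -> I} -> V) :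
  \sum_s F s = \sum_a \sum_(s : {ffun 'I_n -> I}) F [ffun l => ins i a s l].
Proof.
rewrite pair_big (reindex (fun q : I * {ffun 'I_n -> I} => [ffun l => ins i q.1 q.2 l])) //.
exists (fun s : {ffun 'I_n.+1 -> I} => (s i, [ffun l => s (lift i l)])) => [[a s] _|s _] /=.
  rewrite ffunE ins_id; congr (_, _); apply/ffunP => l.
  by rewrite !ffunE ins_lift.
apply/ffunP => l; rewrite ffunE; case: (unliftP i l) => [q|] ->.
  by rewrite ins_lift ffunE.
by rewrite ins_id.
Qed.

End Reindexing.

Section Alternation.
Variables (R : numFieldType) (T : Type) (V : lmodType R).

Definition altsum n (Psi : ('I_n -> T) -> V) (Y : 'I_n -> T) : V :=
  \sum_(s : 'S_n) (-1) ^+ s *: Psi (Y \o s).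

(** Antisymmetry under all permutations. For multilinear maps it is equivalent to [alternating_map],
    and it suits reindexed sums better. *)
Definition signed n (f : ('I_n -> T) -> V) :=
  forall X (s : 'S_n), f (X \o s) = (-1) ^+ s *: f X.

Lemma eq_altsum n (Psi Psi' : ('I_n -> T) -> V) Y : Psi =1 Psi' -> altsum Psi Y = altsum Psi' Y.
Proof. by move=> h; apply: eq_bigr => s _; rewrite h. Qed.

Lemma altsum_sum n (I : Type) (r : seq I) (P : pred I) (Psi : I -> ('I_n -> T) -> V) Y :
  altsum (fun X => \sum_(i <- r | P i) Psi i X) Y = \sum_(i <- r | P i) altsum (Psi i) Y.
Proof.
rewrite /altsum exchange_big/=; apply: eq_bigr => s _; by rewrite scaler_sumr.
Qed.

Lemma altsumZ n (Psi : ('I_n -> T) -> V) (c : R) Y :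
  altsum (fun X => c *: Psi X) Y = c *: altsum Psi Y.
Proof.
by rewrite /altsum scaler_sumr; apply: eq_bigr => s _; rewrite !scalerA mulrC.
Qed.

Lemma altsum_perm n (Psi : ('I_n -> T) -> V) (t : 'S_n) Y :
  altsum (fun X => Psi (X \o t)) Y = (-1) ^+ t *: altsum Psi Y.
Proof.
rewrite /altsum scaler_sumr [RHS](reindex_inj (mulgI t))/=.
apply: eq_bigr => s _; rewrite odd_permM signr_addb scalerA mulrA -expr2 sqrr_sign mul1r.
by congr (_ *: Psi _); apply/funext => i; rewrite /= permM.
Qed.

Lemma altsum_signed n (Psi : ('I_n -> T) -> V) : signed (altsum Psi).
Proof.
move=> Y t; rewrite /altsum scaler_sumr [RHS](reindex_inj (mulIg t))/=.
apply: eq_bigr => s _; rewrite odd_permM signr_addb scalerA mulrCA -expr2 sqrr_sign mulr1.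
by congr (_ *: Psi _); apply/funext => i; rewrite /= permM.
Qed.

Lemma altsum_of_signed n (f : ('I_n -> T) -> V) Y : signed f -> altsum f Y = n`!%:R *: f Y.
Proof.
move=> h; rewrite /altsum (eq_bigr (fun=> f Y)) => [|s _].
  by rewrite sumr_const card_Sn scaler_nat.
by rewrite h scalerA -expr2 sqrr_sign scale1r.
Qed.

Lemma altsum_first n (Psi : ('I_n.+1 -> T) -> V) Y : altsum Psi Y =
  \sum_(i < n.+1) (-1) ^+ i *: altsum (fun X => Psi (ins ord0 (Y i) X)) (Y \o lift i).
Proof.
rewrite /altsum (sum_lift_perm_r ord0); apply: eq_bigr => i _; rewrite scaler_sumr.
apply: eq_bigr => t _; rewrite sign_lift_perm mul1r scalerA; congr (_ *: Psi _).
apply/funext => l /=; case: (unliftP ord0 l) => [q|] ->.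
  by rewrite lift_perm_lift ins_lift.
by rewrite lift_perm_id ins_id.
Qed.

Lemma altsum_ins n (Psi : ('I_n.+1 -> T) -> V) x Y : altsum Psi (ins ord0 x Y) =
  \sum_(i < n.+1) (-1) ^+ i *: altsum (fun X => Psi (ins i x X)) Y.
Proof.
rewrite /altsum (sum_lift_perm_l ord0); apply: eq_bigr => i _; rewrite scaler_sumr.
apply: eq_bigr => t _; rewrite sign_lift_perm mulr1 scalerA; congr (_ *: Psi _).
apply/funext => l /=; case: (unliftP i l) => [q|] ->.
  by rewrite lift_perm_lift !ins_lift.
by rewrite lift_perm_id !ins_id.
Qed.

(** Moving the distinguished slot from position i to the front costs the sign (-1)^i; the sum is
    then split according to the argument that lands in it. *)
Lemma altsum_extract n (Th : T -> ('I_n -> T) -> V) (i : 'I_n.+1) Y :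
  altsum (fun X => Th (X i) (X \o lift i)) Y =
  (-1) ^+ i *: \sum_(m < n.+1) (-1) ^+ m *: altsum (Th (Y m)) (Y \o lift m).
Proof.
transitivity ((-1) ^+ i *: altsum (fun X : 'I_n.+1 -> T => Th (X ord0) (X \o lift ord0)) Y).
  have := altsum_perm (fun X : 'I_n.+1 -> T => Th (X ord0) (X \o lift ord0)) (lift_perm ord0 i 1%g) Y.
  rewrite sign_lift_perm mul1r odd_perm1 mulr1 => <-; apply: eq_altsum => X /=.
  rewrite lift_perm_id; congr (Th _ _); apply/funext => l /=.
  by rewrite lift_perm_lift perm1.
rewrite altsum_first; congr (_ *: _); apply: eq_bigr => m _; congr (_ *: _).
by apply: eq_altsum => X; rewrite ins_id ins_liftE.
Qed.

Lemma signed_ins n (f : ('I_n.+1 -> T) -> V) (i : 'I_n.+1) x X : signed f ->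
  f (ins i x X) = (-1) ^+ i *: f (ins ord0 x X).
Proof. by move=> h; rewrite ins_perm h sign_lift_perm mulr1 odd_perm1 mulr1. Qed.

Lemma signed_front n (f : ('I_n.+1 -> T) -> V) (i : 'I_n.+1) X : signed f ->
  f X = (-1) ^+ i *: f (ins ord0 (X i) (X \o lift i)).
Proof. by move=> h; rewrite -signed_ins// insK. Qed.

Lemma signed_ins0 n (f : ('I_n.+1 -> T) -> V) x : signed f ->
  signed (fun X => f (ins ord0 x X)).
Proof.
move=> h X s; have -> : ins ord0 x (X \o s) = ins ord0 x X \o lift_perm ord0 ord0 s.
  apply/funext => l /=; case: (unliftP ord0 l) => [q|] ->.
    by rewrite lift_perm_lift !ins_lift.
  by rewrite lift_perm_id !ins_id.
by rewrite h sign_lift_perm !mul1r.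
Qed.

End Alternation.

Section Multilinear.
Variables (R : numFieldType) (a V : lmodType R).

Definition multilin n (f : ('I_n -> a) -> V) := forall X i (c : R) y z,
  f (upd X i (c *: y + z)) = c *: f (upd X i y) + f (upd X i z).

Lemma multilin0 n (f : ('I_n -> a) -> V) X i : multilin f -> X i = 0 -> f X = 0.
Proof.
move=> h X0; have := h X i 1 0 0; rewrite scale1r addr0 -X0 upd_id scale1r => /eqP.
by rewrite -subr_eq0 opprD addNKr oppr_eq0 => /eqP.
Qed.

Lemma multilin_sum n (f : ('I_n -> a) -> V) X i (I : Type) (r : seq I) (P : pred I) (F : I -> a) :
  multilin f -> f (upd X i (\sum_(j <- r | P j) F j)) = \sum_(j <- r | P j) f (upd X i (F j)).
Proof.
move=> h; elim/big_rec2: _ => [|j y1 y2 _ <-].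
  by apply: (@multilin0 _ _ _ i) => //; rewrite /upd eqxx.
by have := h X i 1 (F j) y2; rewrite !scale1r.
Qed.

Lemma multilinZ n (f : ('I_n -> a) -> V) X i c y :
  multilin f -> f (upd X i (c *: y)) = c *: f (upd X i y).
Proof.
move=> h; have := h X i c y 0; rewrite addr0 => ->.
by rewrite [X in _ + X](@multilin0 _ _ _ i) ?addr0// /upd eqxx.
Qed.

Lemma multilinN n (f : ('I_n -> a) -> V) X i y :
  multilin f -> f (upd X i (- y)) = - f (upd X i y).
Proof. by move=> h; rewrite -scaleN1r multilinZ// scaleN1r. Qed.

Lemma multilinD n (f : ('I_n -> a) -> V) X i y z :
  multilin f -> f (upd X i (y + z)) = f (upd X i y) + f (upd X i z).
Proof. by move=> h; have := h X i 1 y z; rewrite !scale1r. Qed.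

Lemma multilin_ins n (f : ('I_n.+1 -> a) -> V) x : multilin f ->
  multilin (fun X => f (ins ord0 x X)).
Proof. by move=> h X i c y z; rewrite -!upd_ins_lift h. Qed.

Lemma multilin_ins_linear n (f : ('I_n.+1 -> a) -> V) X : multilin f ->
  linear (fun x => f (ins ord0 x X)).
Proof.
move=> h c y z; have E w : f (ins ord0 w X) = f (upd (ins ord0 0 X) ord0 w).
  by rewrite upd_ins.
by rewrite !E h.
Qed.

Lemma multilin_expand (I : finType) n (f : ('I_n -> a) -> V) (t : 'I_n -> I -> R)
    (v : I -> a) : multilin f ->
  f (fun l => \sum_b t l b *: v b) =
  \sum_(s : {ffun 'I_n -> I}) (\prod_l t l (s l)) *: f (fun l => v (s l)).
Proof.
elim: n f t => [|n IH] f t h.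
  have s0 : {ffun 'I_0 -> I} by exact: ffun0 (card_ord 0).
  rewrite (big_pred1 s0) => [|s]; last by apply/esym/eqP/ffunP; case.
  by rewrite big_ord0 scale1r; congr f; apply/funext; case.
rewrite (sum_ins ord0) -[X in f X](insK ord0).
have -> : f (ins ord0 (\sum_b t ord0 b *: v b) ((fun l => \sum_b t l b *: v b) \o lift ord0)) =
    \sum_b t ord0 b *: f (ins ord0 (v b) ((fun l => \sum_b t l b *: v b) \o lift ord0)).
  rewrite -(upd_ins ord0 0) multilin_sum//; apply: eq_bigr => b _.
  by rewrite multilinZ// upd_ins.
apply: eq_bigr => b _.
rewrite (IH (fun X => f (ins ord0 (v b) X)) (fun l => t (lift ord0 l)) (multilin_ins _ h)).
rewrite scaler_sumr; apply: eq_bigr => s _; rewrite scalerA big_ord_recl ffunE ins_id.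
congr (_ * _ *: f _).
  by apply: eq_bigr => l _; rewrite ffunE ins_lift.
apply/funext => l; rewrite ffunE; case: (unliftP ord0 l) => [q|] ->.
  by rewrite !ins_lift.
by rewrite !ins_id.
Qed.

Lemma altsum_multilin n (Psi : ('I_n -> a) -> V) : multilin Psi -> multilin (altsum Psi).
Proof.
move=> h X i c y z; rewrite /altsum scaler_sumr -big_split; apply: eq_bigr => s _ /=.
have u w : upd X i w \o s = upd (X \o s) (s^-1 i)%g w by rewrite -upd_perm permKV.
by rewrite !u h scalerDr !scalerA mulrC.
Qed.

End Multilinear.

Section AlternatingMap.
Variables (R : realType) (a : vectType R) (V : lmodType R).

Lemma alternating_multilin n (f : ('I_n -> a) -> V) : alternating_map f -> multilin f.
Proof. by move=> [h _] X i c y z; exact: h. Qed.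

Lemma alternating_signed n (f : ('I_n -> a) -> V) : alternating_map f -> signed f.
Proof.
move=> fA; have fM := alternating_multilin fA.
have sw X (i j : 'I_n) : i != j -> f (X \o tperm i j) = - f X.
  move=> ij; pose u x y := upd (upd X i x) j y.
  have uE x y : u x y = upd (upd X j y) i x.
    apply/funext => l; rewrite /u /upd; case: eqP => // ->.
    by rewrite eq_sym (negbTE ij).
  have u0 x : f (u x x) = 0.
    by have [_ h] := fA; apply: (h _ i j ij); rewrite /u/upd (negbTE ij) !eqxx.
  have := u0 (X i + X j); rewrite {1}/u multilinD// -/(u _ _) -/(u _ _) !uE.
  rewrite !multilinD// -!uE !u0 add0r addr0 => /eqP; rewrite addrC addr_eq0 => /eqP h.
  have -> : X \o tperm i j = u (X j) (X i).
    apply/funext => l; rewrite /u /upd /=; case: tpermP => [->|->|/eqP/negbTE -> /eqP/negbTE ->//].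
      by rewrite (negbTE ij) eqxx.
    by rewrite eqxx.
  have uX : u (X i) (X j) = X.
    apply/funext => l; rewrite /u /upd.
    by case: eqP => [->//|_]; case: eqP => [->|].
  by rewrite -[in RHS]uX h opprK.
move=> X s; have [ts -> tsd] := prod_tpermP s.
elim: ts tsd X => [_ X|[i j] ts IH /= /andP[ij tsd] X].
  by rewrite big_nil odd_perm1 scale1r; congr f; apply/funext => l; rewrite /= perm1.
rewrite big_cons odd_permM odd_tperm ij signr_addb expr1.
have -> : X \o (tperm i j * \prod_(t <- ts) tperm t.1 t.2)%g =
    (X \o (\prod_(t <- ts) tperm t.1 t.2)%g) \o tperm i j.
  by apply/funext => l; rewrite /= permM.
by rewrite sw// IH// mulN1r scaleNr.
Qed.

Lemma alternatingP n (f : ('I_n -> a) -> V) : multilin f -> signed f -> alternating_map f.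
Proof.
move=> fM fs; split=> [X i c y z|X i j ij Xij]; first exact: fM.
have := fs X (tperm i j); rewrite odd_tperm ij expr1 scaleN1r.
have -> : X \o tperm i j = X by apply/funext => l; rewrite /=; case: tpermP => [->|->|].
move=> /eqP; rewrite -addr_eq0 -mulr2n -scaler_nat scaler_eq0 pnatr_eq0/=.
by move=> /eqP.
Qed.

Lemma alternating_ins n (f : ('I_n.+1 -> a) -> V) x : alternating_map f ->
  alternating_map (fun X => f (ins ord0 x X)).
Proof.
move=> fA; apply: alternatingP.
  by apply: multilin_ins; exact: alternating_multilin.
by apply: signed_ins0; exact: alternating_signed.
Qed.

Variable h : {vspace a}.

Lemma alternating_modP n (f : ('I_n -> a) -> V) : multilin f -> signed f ->
  (forall X i, X i \in h -> f X = 0) -> alternating_mod h f.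
Proof. by move=> h1 h2 h3; split=> //; exact: alternatingP. Qed.

Lemma alternating_mod_ins n (f : ('I_n.+1 -> a) -> V) x : alternating_mod h f ->
  alternating_mod h (fun X => f (ins ord0 x X)).
Proof.
move=> [fA f0]; split; first exact: alternating_ins.
by move=> X i Xi; apply: (f0 _ (lift ord0 i)); rewrite ins_lift.
Qed.

Lemma alternating_mod_eq n (f : ('I_n -> a) -> V) X Y : alternating_mod h f ->
  (forall i, X i - Y i \in h) -> f X = f Y.
Proof.
move=> [fA f0]; have fM := alternating_multilin fA.
move=> XY; pose Z (k : nat) (i : 'I_n) := if (i < k)%N then X i else Y i.
have Zn : Z n = X by apply/funext => i; rewrite /Z ltn_ord.
have Z0 : Z 0%N = Y by apply/funext => i; rewrite /Z ltn0.
rewrite -Zn -Z0; have : (n <= n)%N by [].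
elim: {1 3}n => [//|k IH] kn; rewrite -IH; last exact: ltnW.
pose i := Ordinal kn; have -> : Z k.+1 = upd (Z k) i ((X i - Y i) + Y i).
  apply/funext => l; rewrite subrK /upd /Z ltnS leq_eqVlt.
  have -> : (l == k :> nat) = (l == i) by rewrite -(inj_eq val_inj).
  by have [->|] := eqVneq l i.
rewrite multilinD// [X in X + _](f0 _ i) ?add0r; last by rewrite /upd eqxx.
congr f; apply/funext => l; rewrite /upd; case: eqP => [->|//].
by rewrite /Z /= ltnn.
Qed.

Lemma alternating_mod_expand n (I : finType) (f : ('I_n -> a) -> V) (v : I -> a)
    (t : I -> a -> R) X : alternating_mod h f ->
  (forall w, w - \sum_b t b w *: v b \in h) ->
  f X = \sum_(s : {ffun 'I_n -> I}) (\prod_l t (s l) (X l)) *: f (fun l => v (s l)).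
Proof.
move=> fA vt; have [/alternating_multilin fM _] := fA.
rewrite -(multilin_expand (fun l b => t b (X l)) v fM).
by apply: alternating_mod_eq fA _ => i; exact: vt.
Qed.

Lemma alternating_repeat n (f : ('I_n -> a) -> V) (I : finType) (v : I -> a)
    (s : {ffun 'I_n -> I}) : alternating_map f -> ~~ injectiveb s -> f (fun l => v (s l)) = 0.
Proof.
move=> [_ h0] /injectivePn[i [j ij sij]]; apply: (h0 _ i j ij); by rewrite sij.
Qed.

(** Pigeonhole: after expansion in fewer than n vectors, every term repeats an argument. *)
Lemma alternating_mod_over n (f : ('I_n -> a) -> V) q (v : 'I_q -> a) (t : 'I_q -> a -> R) X :
  alternating_mod h f -> (forall w, w - \sum_b t b w *: v b \in h) -> (q < n)%N -> f X = 0.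
Proof.
move=> fA vt qn; rewrite (alternating_mod_expand X fA vt) big1// => s _.
have [fA' _] := fA; rewrite alternating_repeat ?scaler0//.
apply/negP => /injectiveP/leq_card; rewrite !card_ord => /(leq_trans qn).
by rewrite ltnn.
Qed.

End AlternatingMap.

Section Derivations.
Variables (R : realType) (a : vectType R).

Lemma alternating_mod_top (V : lmodType R) (h : {vspace a}) n (f : ('I_n -> a) -> V)
    (v : 'I_n -> a) (t : 'I_n -> a -> R) X :
  alternating_mod h f -> (forall w, w - \sum_b t b w *: v b \in h) -> f v = 0 -> f X = 0.
Proof.
move=> fA vt fv; rewrite (alternating_mod_expand X fA vt) big1// => s _.
have [fA' _] := fA; have [/injectiveP inj|ninj] := boolP (injectiveb s); last first.
  by rewrite alternating_repeat ?scaler0.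
have -> : (fun l => v (s l)) = v \o perm inj by apply/funext => l; rewrite /= permE.
by rewrite (alternating_signed fA') fv !scaler0.
Qed.

Lemma alternating_mod_comp (V W : lmodType R) (h : {vspace a}) n (f : ('I_n -> a) -> V)
  (T : {linear V -> W}) : alternating_mod h f -> alternating_mod h (fun X => T (f X)).
Proof.
move=> [fA f0]; apply: alternating_modP => [X i c y z|X s|X i Xi].
- by rewrite (alternating_multilin fA) linearP.
- by rewrite (alternating_signed fA) linearZ.
- by rewrite (f0 _ _ Xi) linear0.
Qed.

Variable V : lmodType R.

(** Up to sign, the action on forms of the endomorphism T of the space of arguments. *)
Definition slot_sum n (T : a -> a) (f : ('I_n -> a) -> V) X := \sum_l f (upd X l (T (X l))).

Lemma slot_sum_multilin n (T : {linear a -> a}) (f : ('I_n -> a) -> V) :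
  multilin f -> multilin (slot_sum T f).
Proof.
move=> fM X i c y z; rewrite /slot_sum scaler_sumr -big_split; apply: eq_bigr => l _ /=.
have [->|li] := eqVneq l i.
  have E w w' : upd (upd X i w) i w' = upd X i w'.
    by apply/funext => q; rewrite /upd; case: eqP.
  have U w : upd X i w i = w by rewrite /upd eqxx.
  by rewrite !U !E linearP fM.
have E w w' : upd (upd X i w) l w' = upd (upd X l w') i w.
  by apply/funext => q; rewrite /upd; case: eqP => // ->; rewrite (negbTE li).
have U w : upd X i w l = X l by rewrite /upd (negbTE li).
by rewrite !U !E fM.
Qed.

Lemma slot_sum_signed n T (f : ('I_n -> a) -> V) : signed f -> signed (slot_sum T f).
Proof.
move=> fs X s; rewrite /slot_sum scaler_sumr [RHS](reindex_inj (@perm_inj _ s))/=.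
by apply: eq_bigr => l _; rewrite -upd_perm fs.
Qed.

Lemma slot_sum_mod n (T : {linear a -> a}) (h : {vspace a}) (f : ('I_n -> a) -> V) :
  (forall w, w \in h -> T w \in h) ->
  alternating_mod h f -> alternating_mod h (slot_sum T f).
Proof.
move=> hT [fA f0]; apply: alternating_modP.
- by apply: slot_sum_multilin; exact: alternating_multilin.
- by apply: slot_sum_signed; exact: alternating_signed.
move=> X i Xi; apply: big1 => l _; apply: (f0 _ i); rewrite /upd; case: eqP => // <-.
exact: hT.
Qed.

Lemma slot_sum_ins n T (f : ('I_n.+1 -> a) -> V) x X : slot_sum T f (ins ord0 x X) =
  f (ins ord0 (T x) X) + slot_sum T (fun X => f (ins ord0 x X)) X.
Proof.
rewrite /slot_sum big_ord_recl upd_ins ins_id; congr (_ + _); apply: eq_bigr => l _.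
by rewrite upd_ins_lift ins_lift.
Qed.

Lemma altsum_slot_sum n T (f : ('I_n -> a) -> V) X :
  altsum (slot_sum T f) X = slot_sum T (altsum f) X.
Proof.
rewrite /altsum /slot_sum exchange_big/=; apply: eq_bigr => s _; rewrite scaler_sumr.
rewrite [RHS](reindex_inj (@perm_inj _ s))/=; apply: eq_bigr => l _.
by rewrite -upd_perm.
Qed.

End Derivations.

Section Omit.
Variables (R : numFieldType) (a V : lmodType R).

Lemma omit2_lift k (Z : 'I_k.+2 -> a) i l :
  omit2 Z i (lift i l) = [seq Z (lift i (lift l q)) | q <- enum 'I_k].
Proof.
rewrite /omit2 (map_comp Z (lift i \o lift l)); congr map.
apply: (inj_map val_inj); apply: (irr_sorted_eq ltn_trans ltnn).
- have : sorted ltn (map val (enum 'I_k.+2)) by rewrite val_enum_ord iota_ltn_sorted.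
  apply: subseq_sorted; first exact: ltn_trans.
  by apply: map_subseq; exact: filter_subseq.
- rewrite -map_comp sorted_map.
  have : sorted ltn (map val (enum 'I_k)) by rewrite val_enum_ord iota_ltn_sorted.
  rewrite sorted_map; apply: sub_sorted => x y /=; rewrite /relpre/= /bump.
  by do 4!(case: leqP => //=); lia.
move=> x; apply/mapP/mapP => -[y].
  rewrite mem_filter => /andP[/andP[yi yj] _] ->.
  have yi' : i != y by rewrite eq_sym.
  have [w yE _] := unlift_some yi'; rewrite yE in yj *.
  rewrite (inj_eq (@lift_inj _ i)) eq_sym in yj.
  have [q wE _] := unlift_some yj; rewrite wE.
  by exists (lift i (lift l q)) => //; apply/mapP; exists q => //; rewrite mem_enum.
move=> /mapP[q _ ->] ->; exists (lift i (lift l q)) => //.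
by rewrite mem_filter mem_enum/= (inj_eq (@lift_inj _ i)) ![lift _ _ == _]eq_sym !neq_lift.
Qed.

Lemma omit2C k (Z : 'I_k -> a) i j : omit2 Z i j = omit2 Z j i.
Proof. by rewrite /omit2; congr map; apply: eq_filter => l; rewrite andbC. Qed.

Definition rest2 k (Z : 'I_k.+2 -> a) (i j : 'I_k.+2) (q : 'I_k) : a := nth 0 (omit2 Z i j) q.

Lemma rest2C k (Z : 'I_k.+2 -> a) i j : rest2 Z i j = rest2 Z j i.
Proof. by rewrite /rest2 omit2C. Qed.

Lemma rest2_lift k (Z : 'I_k.+2 -> a) i l : rest2 Z i (lift i l) = (Z \o lift i) \o lift l.
Proof.
apply/funext => q; rewrite /rest2 omit2_lift (nth_map q) ?size_enum_ord//.
by rewrite nth_ord_enum.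
Qed.

Lemma nth_rest2 k (Z : 'I_k.+2 -> a) i j y :
  (fun l : 'I_k.+1 => nth 0 (y :: omit2 Z i j) l) = ins ord0 y (rest2 Z i j).
Proof.
apply/funext => l; case: (unliftP ord0 l) => [q|] ->; first by rewrite ins_lift.
by rewrite ins_id.
Qed.

(** With j = lift i l, the new entry A i j is moved to the front, followed by the arguments other
    than i and j; the terms of (i, j) and (j, i) then carry opposite signs. This serves the
    codifferential, the exterior derivative and, for symmetric A, the Stokes theorem. *)
Lemma sum_upd_rest2 k (D : ('I_k.+1 -> a) -> V) (Z : 'I_k.+2 -> a)
    (A : 'I_k.+2 -> 'I_k.+2 -> a) : signed D ->
  \sum_(i < k.+2) (-1) ^+ i *: \sum_l D (upd (Z \o lift i) l (A i (lift i l))) =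
  \sum_(i < k.+2) \sum_(j < k.+2 | (i < j)%N) (-1) ^+ (i + j) *:
    (D (ins ord0 (A j i) (rest2 Z i j)) - D (ins ord0 (A i j) (rest2 Z i j))).
Proof.
move=> sD; pose F (i j : 'I_k.+2) := D (ins ord0 (A i j) (rest2 Z i j)).
(* Once i is removed, the argument j stands at position j - 1 if it came after i, and at j
   otherwise. *)
pose sg (i j : 'I_k.+2) : R := (-1) ^+ (i + (if (i < j)%N then j.-1 else j)).
transitivity (\sum_i \sum_(j | j != i) sg i j *: F i j).
  apply: eq_bigr => i _; rewrite (sum_lift i) scaler_sumr; apply: eq_bigr => l _.
  rewrite updE signed_ins// -rest2_lift scalerA -/(F i (lift i l)); congr (_ *: _).
  rewrite /sg -exprD; congr (_ ^+ (_ + _)); rewrite /= /bump.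
  by case: leqP => il; case: ltnP => //; lia.
transitivity (\sum_(i < k.+2) (\sum_(j < k.+2 | (i < j)%N) sg i j *: F i j) +
    \sum_(i < k.+2) (\sum_(j < k.+2 | (j < i)%N) sg i j *: F i j)).
  rewrite -big_split; apply: eq_bigr => i _ /=; rewrite (bigID (fun j : 'I_k.+2 => i < j)%N)/=.
  by congr (_ + _); apply: eq_bigl => j; rewrite -(inj_eq val_inj)/=; lia.
rewrite [X in _ + X](exchange_big_dep xpredT)//= -big_split; apply: eq_bigr => i _ /=.
rewrite -big_split; apply: eq_bigr => j ij /=; rewrite scalerBr addrC; congr (_ + _).
  rewrite /sg ifN; last by rewrite -leqNgt ltnW.
  by rewrite addnC /F rest2C.
rewrite /sg ij -scaleNr; congr (_ *: _); case: (j : nat) ij => [//|q] _.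
by rewrite /= addnS exprS mulN1r opprK.
Qed.

End Omit.

(** * The codifferential and its adjoint *)

Section KillingDeterminant.
Variables (R : realType) (G : lieGroup R).

Definition killing_mx k (Z X : 'I_k -> lie G) : 'M[R]_k := \matrix_(i, j) killing (Z i) (X j).

Lemma det_killing_row k (Z X : 'I_k -> lie G) l y : \det (killing_mx (upd Z l y) X) =
  \sum_m killing y (X m) * cofactor (killing_mx Z X) l m.
Proof.
rewrite (expand_det_row _ l); apply: eq_bigr => m _; rewrite mxE /upd eqxx; congr (_ * _).
rewrite /cofactor; congr (_ * \det _); apply/matrixP => i j; rewrite !mxE.
by rewrite eq_sym (negbTE (neq_lift _ _)).
Qed.

Lemma det_killing_col k (Z X : 'I_k -> lie G) m y : \det (killing_mx Z (upd X m y)) =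
  \sum_l killing (Z l) y * cofactor (killing_mx Z X) l m.
Proof.
rewrite (expand_det_col _ m); apply: eq_bigr => l _; rewrite mxE /upd eqxx; congr (_ * _).
rewrite /cofactor; congr (_ * \det _); apply/matrixP => i j; rewrite !mxE.
by rewrite eq_sym (negbTE (neq_lift _ _)).
Qed.

Lemma det_killing_signed k (X : 'I_k -> lie G) :
  signed (fun Z : 'I_k -> lie G => \det (killing_mx Z X) : R^o).
Proof.
move=> Z s; have -> : killing_mx (Z \o s) X = row_perm s (killing_mx Z X).
  by apply/matrixP => i j; rewrite !mxE.
by rewrite row_permE det_mulmx det_perm.
Qed.

(** Invariance of the Killing form carries ad W from the rows to the columns, with a minus sign. *)
Lemma det_killing_br k (Z X : 'I_k -> lie G) W :
  \sum_l \det (killing_mx (upd Z l (br W (Z l))) X) =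
  - \sum_m \det (killing_mx Z (upd X m (br W (X m)))).
Proof.
under eq_bigr do rewrite det_killing_row.
under [in RHS]eq_bigr do rewrite det_killing_col.
rewrite exchange_big -sumrN; apply: eq_bigr => m _; rewrite -sumrN; apply: eq_bigr => l _.
by rewrite killing_inv mulNr.
Qed.

(** In the double sum over i and the remaining rows every pair occurs twice, whence the factor 1/2;
    [det_killing_br] then moves ad (Z i) to the arguments X. *)
Lemma det_killing_pairs k (Z : 'I_k.+1 -> lie G) (X : 'I_k -> lie G) :
  \sum_(i < k.+1) \sum_(j < k.+1 | (i < j)%N) (-1) ^+ (i.+1 + j.+1) *
    \det (killing_mx (fun l : 'I_k => nth 0 (br (Z i) (Z j) :: omit2 Z i j) l) X) =
  2^-1 * \sum_(i < k.+1) (-1) ^+ i *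
    \sum_m \det (killing_mx (Z \o lift i) (upd X m (br (Z i) (X m)))).
Proof.
case: k Z X => [|k] Z X.
  rewrite !big_ord_recl !big_ord0 /= big_mkcond big_ord_recl big_ord0/=.
  by rewrite !(mulr0, addr0).
have := sum_upd_rest2 Z (fun i j => br (Z i) (Z j)) (@det_killing_signed k.+1 X).
rewrite (eq_bigr (fun i : 'I_k.+2 => - ((-1) ^+ i * \sum_m
    \det (killing_mx (Z \o lift i) (upd X m (br (Z i) (X m))))))) => [|i _]; last first.
  by rewrite -mulrN -det_killing_br.
rewrite sumrN => /eqP; rewrite eqr_oppLR => /eqP ->.
rewrite mulrN mulr_sumr -sumrN; apply: eq_bigr => i _.
rewrite mulr_sumr -sumrN; apply: eq_bigr => j _; rewrite nth_rest2.
set y := br (Z i) (Z j); set r := rest2 Z i j.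
have -> : \det (killing_mx (ins ord0 (br (Z j) (Z i)) r) X) =
    - \det (killing_mx (ins ord0 y r) X).
  rewrite brC -/y -(upd_ins ord0 0) -[in RHS](upd_ins ord0 0) !det_killing_row -sumrN.
  apply: eq_bigr => m _; rewrite -mulNr; congr (_ * _).
  by rewrite killingC linearN killingC.
rewrite addSn addnS exprS exprS mulrA mulrNN mul1r mul1r.
rewrite /GRing.scale/= !mulrDr !mulrN; lra.
Qed.

End KillingDeterminant.

Section Codifferential.
Variables (R : realType) (G : lieGroup R) (m : nat) (gr : int -> {vspace lie G}).
Hypothesis grG : grading m gr.
Hypothesis ss : semisimple G.
Variables p pp : {vspace lie G}.
Hypothesis pE : p = (\sum_(i < m.+1) gr i%:Z)%VS.
Hypothesis ppN : nilradical p pp.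

Notation ppb a := (tnth (vbasis pp) a).
Notation xi a := (dual_basis pp a).

Let expand w : w - \sum_a killing (ppb a) w *: xi a \in p.
Proof. exact: (dual_expand grG ss pE ppN w). Qed.

(** This is the expansion of g in the frame xi, antisymmetrized by the determinant; as g is
    alternating, that costs a factor k!. *)
Lemma sum_det_killing (V : lmodType R) k (g : ('I_k -> lie G) -> V) X :
  alternating_mod p g ->
  \sum_(s : {ffun 'I_k -> 'I_(\dim pp)})
    \det (killing_mx (fun l => ppb (s l)) X) *: g (fun l => xi (s l)) = k`!%:R *: g X.
Proof.
move=> gA; have [gA' _] := gA.
rewrite -(altsum_of_signed X (alternating_signed gA')) /altsum.
under eq_bigr do rewrite /determinant scaler_suml.
rewrite exchange_big; apply: eq_bigr => t _ /=.
rewrite (alternating_mod_expand (X \o t) gA expand) scaler_sumr; apply: eq_bigr => s _.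
rewrite scalerA; congr (_ * _ *: _); apply: eq_bigr => l _; by rewrite mxE.
Qed.

Variables (V : lmodType R) (act : lie G -> V -> V).
Hypothesis actl : forall Z : lie G, linear (act Z).

Let actL Z : {linear V -> V} := HB.pack_for {linear V -> V} (act Z)
  (GRing.isLinear.Build R V V _ (act Z) (actl Z)).

Definition codiff_term k (f : ('I_k.+1 -> lie G) -> V) (X : 'I_k -> lie G) (Z x : lie G) : V :=
  act Z (f (ins ord0 x X)) - 2^-1 *: slot_sum (br Z) (fun X => f (ins ord0 x X)) X.

(* The codifferential as a sum over dual bases, with the bracket terms moved to
   the arguments by invariance of the Killing form. *)
Lemma codiffE k (f : ('I_k.+1 -> lie G) -> V) X : alternating_mod p f ->
  codiff pp act f X = - \sum_a codiff_term f X (ppb a) (xi a).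
Proof.
move=> fA; have [fA' _] := fA; have fs := alternating_signed fA'.
pose H (a : 'I_(\dim pp)) (t : {ffun 'I_k -> 'I_(\dim pp)}) : V :=
  - (\det (killing_mx (fun l => ppb (t l)) X) *:
      act (ppb a) (f (ins ord0 (xi a) (fun l => xi (t l))))) +
  2^-1 *: \sum_m \det (killing_mx (fun l => ppb (t l)) (upd X m (br (ppb a) (X m)))) *:
      f (ins ord0 (xi a) (fun l => xi (t l))).
have HE (s : {ffun 'I_k.+1 -> 'I_(\dim pp)}) :
    codiff_decomposable act (fun i => ppb (s i)) (f (fun i => xi (s i))) X =
    \sum_i H (s i) [ffun l => s (lift i l)].
  rewrite /codiff_decomposable /decomposable.
  have -> : \sum_(i < k.+1) \sum_(j < k.+1 | (i < j)%N) (- 1) ^+ (i.+1 + j.+1) *: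
      (\det (\matrix_(i0, j0) killing (nth 0 (br (ppb (s i)) (ppb (s j)) ::
         omit2 (fun i => ppb (s i)) i j) i0) (X j0)) *: f (fun i => xi (s i))) =
     (2^-1 * \sum_(i < k.+1) (-1) ^+ i * \sum_m \det (killing_mx ((fun i => ppb (s i)) \o lift i)
        (upd X m (br (ppb (s i)) (X m))))) *: f (fun i => xi (s i)).
    rewrite -det_killing_pairs scaler_suml; apply: eq_bigr => i _.
    by rewrite scaler_suml; apply: eq_bigr => j _; rewrite scalerA.
  rewrite mulr_sumr scaler_suml -big_split; apply: eq_bigr => i _ /=.
  rewrite (signed_front i _ fs) /H.
  have -> : (fun l => xi ([ffun l => s (lift i l)] l)) = (fun i => xi (s i)) \o lift i.
    by apply/funext => l; rewrite ffunE.
  have -> : (fun l => ppb ([ffun l => s (lift i l)] l)) = (fun i => ppb (s i)) \o lift i.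
    by apply/funext => l; rewrite ffunE.
  set F := f _; congr (_ + _).
    have -> : act (ppb (s i)) ((-1) ^+ i *: F) = (-1) ^+ i *: act (ppb (s i)) F.
      exact: (linearZ_LR (actL (ppb (s i)))).
    rewrite !scalerA -scaleNr; congr (_ *: _).
    by rewrite exprS mulN1r !mulNr mulrAC -expr2 sqrr_sign mul1r.
  rewrite scalerA -scaler_suml [RHS]scalerA; congr (_ *: _).
  by rewrite -[LHS]mulrA; congr (_ * _); rewrite mulrAC -expr2 sqrr_sign mul1r.
rewrite /codiff (eq_bigr (fun s : {ffun 'I_k.+1 -> 'I_(\dim pp)} =>
    \sum_i H (s i) [ffun l => s (lift i l)])) => [|s _]; last exact: HE.
(* Each of the k + 1 positions i contributes the same double sum, which turns the normalization
   1/(k+1)! into 1/k!. *)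
rewrite exchange_big/= (eq_bigr (fun=> \sum_a \sum_t H a t)) => [|i _]; last first.
  rewrite (sum_ins i); apply: eq_bigr => a _; apply: eq_bigr => t _; congr H.
    by rewrite ffunE ins_id.
  by apply/ffunP => l; rewrite !ffunE ins_lift.
rewrite sumr_const card_ord -[_ *+ k.+1]scaler_nat scalerA -sumrN scaler_sumr; apply: eq_bigr => a _.
pose g x X' := f (ins ord0 x X').
have gA x : alternating_mod p (g x) by exact: alternating_mod_ins.
have -> : \sum_t H a t = k`!%:R *: - codiff_term f X (ppb a) (xi a).
  rewrite /H big_split/= sumrN /codiff_term opprB addrC scalerBr; congr (_ - _).
    rewrite -scaler_sumr exchange_big scalerA mulrC -scalerA; congr (_ *: _).
    rewrite /slot_sum scaler_sumr; apply: eq_bigr => q _ /=.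
    by rewrite -(sum_det_killing (upd X q (br (ppb a) (X q))) (gA (xi a))).
  have := sum_det_killing X (alternating_mod_comp (actL (ppb a)) (gA (xi a))).
  by [].
by rewrite scalerA -mulrA -natrM -factS mulVf ?scale1r// pnatr_eq0 -lt0n fact_gt0.
Qed.

Let br_pp Z w : Z \in pp -> w \in p -> br Z w \in p.
Proof.
move=> /(nilradicalP grG ss pE ppN) hZ /(parabolicP grG pE) hw; apply/(parabolicP grG pE).
by have := deg_ge_br grG hZ hw; rewrite addr0 => h i i0; apply: h; lia.
Qed.

Lemma ppb_mem a : ppb a \in pp.
Proof. by apply: vbasis_mem; exact: mem_tnth. Qed.

Lemma codiff_term_mod k (f : ('I_k.+1 -> lie G) -> V) a : alternating_mod p f ->
  alternating_mod p (fun X => codiff_term f X (ppb a) (xi a)).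
Proof.
move=> fA; have gA := alternating_mod_ins (xi a) fA.
have [g1 g2] := alternating_mod_comp (actL (ppb a)) gA.
have [s1 s2] := slot_sum_mod (fun w => br_pp (ppb_mem a)) gA.
apply: alternating_modP => [X i c y z|X s|X i Xi]; rewrite /codiff_term.
- have := alternating_multilin g1 X i c y z; rewrite /= => ->.
  rewrite (alternating_multilin s1) [2^-1 *: (_ + _)]scalerDr opprD addrACA scalerBr.
  by rewrite !scalerA [2^-1 * c]mulrC.
- have := alternating_signed g1 X s; rewrite /= => ->.
  by rewrite (alternating_signed s1) scalerBr !scalerA [2^-1 * _]mulrC.
- by have := g2 X i Xi; rewrite /= => ->; rewrite (s2 X i Xi) scaler0 subr0.
Qed.

Lemma codiff_mod k (f : ('I_k.+1 -> lie G) -> V) : alternating_mod p f ->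
  alternating_mod p (codiff pp act f).
Proof.
move=> fA; have tA a := codiff_term_mod a fA.
have -> : codiff pp act f = fun X => - \sum_a codiff_term f X (ppb a) (xi a).
  by apply/funext => X; exact: codiffE.
apply: alternating_modP => [X i c y z|X s|X i Xi].
- rewrite scalerN scaler_sumr -opprD -big_split; congr (- _); apply: eq_bigr => a _.
  by have [/alternating_multilin h _] := tA a; exact: h.
- rewrite scalerN scaler_sumr; congr (- _); apply: eq_bigr => a _.
  by have [/alternating_signed h _] := tA a; exact: h.
- by rewrite big1 ?oppr0// => a _; have [_ h] := tA a; exact: h Xi.
Qed.

Hypothesis actZ : forall v, linear (act^~ v).

(** By [dual_basis_change], the sum over dual bases may be taken with Ad h applied to both factors,
    and Ad h respects brackets. *)
Lemma codiff_equivariant k (f f' : ('I_k.+1 -> lie G) -> V) (h : G) (r : {linear V -> V}) X :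
  normalizer p h -> alternating_mod p f -> alternating_mod p f' ->
  (forall Z v, act Z (r v) = r (act (Ad h Z) v)) ->
  (forall X, f' X = r (f (Ad h \o X))) ->
  codiff pp act f' X = r (codiff pp act f (Ad h \o X)).
Proof.
move=> hp fA fA' ar f'E; rewrite !codiffE// (linearN r)/=; congr (- _).
have [fA0 f0] := fA; have fM := alternating_multilin fA0.
have cins x (Y : 'I_k -> lie G) : Ad h \o ins ord0 x Y = ins ord0 (Ad h x) (Ad h \o Y).
  by apply/funext => l; rewrite /= /ins; case: (unlift _ _).
have cupd (Y : 'I_k -> lie G) l y : Ad h \o upd Y l y = upd (Ad h \o Y) l (Ad h y).
  by apply/funext => q; rewrite /= /upd; case: eqP.
transitivity (r (\sum_a codiff_term f (Ad h \o X) (Ad h (ppb a)) (Ad h (xi a)))).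
  rewrite linear_sum; apply: eq_bigr => a _; rewrite /codiff_term (linearB r) (linearZ_LR r)/=.
  rewrite f'E ar cins; congr (_ - _ *: _); rewrite /slot_sum linear_sum.
  by apply: eq_bigr => l _; rewrite f'E cins cupd Ad_br.
congr (r _).
apply: (dual_basis_change grG ss pE ppN (B := codiff_term f (Ad h \o X))) => //.
- move=> x c Z Z'; rewrite /codiff_term actZ.
  have -> : slot_sum (br (c *: Z + Z')) (fun X => f (ins ord0 x X)) (Ad h \o X) =
      c *: slot_sum (br Z) (fun X => f (ins ord0 x X)) (Ad h \o X) +
      slot_sum (br Z') (fun X => f (ins ord0 x X)) (Ad h \o X).
    rewrite /slot_sum scaler_sumr -big_split; apply: eq_bigr => l _ /=.
    by rewrite brDl brZl; exact: (multilin_ins x fM).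
  by rewrite [2^-1 *: (_ + _)]scalerDr opprD addrACA scalerBr !scalerA [2^-1 * c]mulrC.
- move=> Z c x x'; rewrite /codiff_term (multilin_ins_linear _ fM) actl.
  have -> : slot_sum (br Z) (fun X => f (ins ord0 (c *: x + x') X)) (Ad h \o X) =
      c *: slot_sum (br Z) (fun X => f (ins ord0 x X)) (Ad h \o X) +
      slot_sum (br Z) (fun X => f (ins ord0 x' X)) (Ad h \o X).
    rewrite /slot_sum scaler_sumr -big_split; apply: eq_bigr => l _ /=.
    exact: (multilin_ins_linear _ fM).
  by rewrite [2^-1 *: (_ + _)]scalerDr opprD addrACA scalerBr !scalerA [2^-1 * c]mulrC.
- move=> Z x xp; rewrite /codiff_term (f0 _ ord0) ?ins_id// -[act Z 0]/(actL Z 0) linear0.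
  rewrite sub0r /slot_sum big1 ?scaler0 ?oppr0// => l _; apply: (f0 _ ord0).
  by rewrite ins_id.
Qed.

End Codifferential.

(** * Wedge products by contraction *)

Section Wedge.
Variables (R : realType) (a V W : vectType R).

Definition wedge_arg j k (A : ('I_j -> a) -> 'Hom(V, W)) (B : ('I_k -> a) -> V)
    (X : 'I_(j + k) -> a) : W :=
  A (fun i => X (lshift k i)) (B (fun i => X (rshift j i))).

Lemma contract_wedgeE j k (A : ('I_j -> a) -> 'Hom(V, W)) (B : ('I_k -> a) -> V) Y :
  contract_wedge A B Y = (j`! * k`!)%:R^-1 *: altsum (wedge_arg A B) Y.
Proof. by []. Qed.

Lemma contract_wedge_linear_r j k (A : ('I_j -> a) -> 'Hom(V, W)) (B B' : ('I_k -> a) -> V) c Y :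
  contract_wedge A (fun X => c *: B X + B' X) Y =
  c *: contract_wedge A B Y + contract_wedge A B' Y.
Proof.
rewrite !contract_wedgeE scalerA [c * _]mulrC -scalerA -scalerDr; congr (_ *: _).
rewrite /altsum scaler_sumr -big_split; apply: eq_bigr => s _ /=.
by rewrite /wedge_arg linearP scalerDr !scalerA mulrC.
Qed.

Lemma contract_wedge_linear_l j k (A A' : ('I_j -> a) -> 'Hom(V, W)) (B : ('I_k -> a) -> V) c Y :
  contract_wedge (fun X => c *: A X + A' X) B Y =
  c *: contract_wedge A B Y + contract_wedge A' B Y.
Proof.
rewrite !contract_wedgeE scalerA [c * _]mulrC -scalerA -scalerDr; congr (_ *: _).
rewrite /altsum scaler_sumr -big_split; apply: eq_bigr => s _ /=.
by rewrite /wedge_arg add_lfunE scale_lfunE scalerDr !scalerA mulrC.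
Qed.

Lemma contract_wedge0r j k (A : ('I_j -> a) -> 'Hom(V, W)) Y :
  contract_wedge A (fun _ : 'I_k -> a => 0 : V) Y = 0.
Proof.
by rewrite contract_wedgeE /altsum big1 ?scaler0// => s _; rewrite /wedge_arg linear0 scaler0.
Qed.

Lemma contract_wedge0l j k (B : ('I_k -> a) -> V) Y :
  contract_wedge (fun _ : 'I_j -> a => 0 : 'Hom(V, W)) B Y = 0.
Proof.
by rewrite contract_wedgeE /altsum big1 ?scaler0// => s _; rewrite /wedge_arg zero_lfunE scaler0.
Qed.

Lemma contract_wedge_sum_r j k (A : ('I_j -> a) -> 'Hom(V, W)) (I : Type) (r : seq I)
    (B : I -> ('I_k -> a) -> V) Y :
  contract_wedge A (fun X => \sum_(i <- r) B i X) Y = \sum_(i <- r) contract_wedge A (B i) Y.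
Proof.
elim: r => [|i r IH].
  rewrite big_nil -[RHS](contract_wedge0r (k := k) A Y); congr contract_wedge.
  by apply/funext => X; rewrite big_nil.
rewrite big_cons -IH -[contract_wedge A (B i) Y]scale1r -contract_wedge_linear_r.
by congr contract_wedge; apply/funext => X; rewrite big_cons scale1r.
Qed.

Lemma contract_wedge_sum_l j k (I : Type) (r : seq I) (A : I -> ('I_j -> a) -> 'Hom(V, W))
    (B : ('I_k -> a) -> V) Y :
  contract_wedge (fun X => \sum_(i <- r) A i X) B Y = \sum_(i <- r) contract_wedge (A i) B Y.
Proof.
elim: r => [|i r IH].
  rewrite big_nil -[RHS](contract_wedge0l (j := j) B Y); congr contract_wedge.
  by apply/funext => X; rewrite big_nil.
rewrite big_cons -IH -[contract_wedge (A i) B Y]scale1r -contract_wedge_linear_l.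
by congr contract_wedge; apply/funext => X; rewrite big_cons scale1r.
Qed.

Lemma contract_wedgeZr j k (A : ('I_j -> a) -> 'Hom(V, W)) (B : ('I_k -> a) -> V) c Y :
  contract_wedge A (fun X => c *: B X) Y = c *: contract_wedge A B Y.
Proof.
rewrite -[RHS]addr0 -(contract_wedge0r (k := k) A Y) -contract_wedge_linear_r.
by congr contract_wedge; apply/funext => X; rewrite addr0.
Qed.

Lemma contract_wedgeZl j k (A : ('I_j -> a) -> 'Hom(V, W)) (B : ('I_k -> a) -> V) c Y :
  contract_wedge (fun X => c *: A X) B Y = c *: contract_wedge A B Y.
Proof.
rewrite -[RHS]addr0 -(contract_wedge0l (j := j) B Y) -contract_wedge_linear_l.
by congr contract_wedge; apply/funext => X; rewrite addr0.
Qed.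

Lemma upd_lshift j k (X : 'I_(j + k) -> a) i y :
  (fun l => upd X (lshift k i) y (lshift k l)) = upd (fun l => X (lshift k l)) i y.
Proof. by apply/funext => l; rewrite /upd (inj_eq (@lshift_inj _ _)). Qed.

Lemma upd_rshift j k (X : 'I_(j + k) -> a) i y :
  (fun l => upd X (rshift j i) y (rshift j l)) = upd (fun l => X (rshift j l)) i y.
Proof. by apply/funext => l; rewrite /upd (inj_eq (@rshift_inj _ _)). Qed.

Lemma upd_lrshift j k (X : 'I_(j + k) -> a) i y :
  (fun l => upd X (lshift k i) y (rshift j l)) = (fun l => X (rshift j l)).
Proof. by apply/funext => l; rewrite /upd eq_rlshift. Qed.

Lemma upd_rlshift j k (X : 'I_(j + k) -> a) i y :
  (fun l => upd X (rshift j i) y (lshift k l)) = (fun l => X (lshift k l)).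
Proof. by apply/funext => l; rewrite /upd eq_lrshift. Qed.

Lemma wedge_arg_multilin j k (A : ('I_j -> a) -> 'Hom(V, W)) (B : ('I_k -> a) -> V) :
  multilin A -> multilin B -> multilin (wedge_arg A B).
Proof.
move=> hA hB X i c y z; rewrite /wedge_arg; case: (split_ordP i) => l ->.
  by rewrite !upd_lshift !upd_lrshift hA add_lfunE scale_lfunE.
by rewrite !upd_rshift !upd_rlshift hB linearP.
Qed.

Lemma contract_wedge_mod j k (h : {vspace a}) (A : ('I_j -> a) -> 'Hom(V, W))
    (B : ('I_k -> a) -> V) : alternating_mod h A -> alternating_mod h B ->
  alternating_mod h (contract_wedge A B).
Proof.
move=> [hA A0] [hB B0].
have wM := wedge_arg_multilin (alternating_multilin hA) (alternating_multilin hB).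
apply: alternating_modP.
- move=> X i c y z; rewrite !contract_wedgeE (altsum_multilin wM) scalerDr.
  by rewrite !scalerA mulrC.
- by move=> X s; rewrite !contract_wedgeE altsum_signed !scalerA mulrC.
- move=> X i Xi; rewrite contract_wedgeE /altsum big1 ?scaler0// => s _.
  rewrite /wedge_arg; have Xs : (X \o s) (s^-1%g i) \in h by rewrite /= permKV.
  case: (split_ordP (s^-1%g i)) => l lE; rewrite lE in Xs.
    by rewrite (A0 _ l)// zero_lfunE scaler0.
  by rewrite (B0 _ l)// linear0 scaler0.
Qed.

Lemma wedge_arg_slot_sum j k T (A : ('I_j -> a) -> 'Hom(V, W)) (B : ('I_k -> a) -> V) X :
  slot_sum T (wedge_arg A B) X =
  wedge_arg (slot_sum T A) B X + wedge_arg A (slot_sum T B) X.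
Proof.
rewrite /slot_sum big_split_ord /wedge_arg sum_lfunE linear_sum; congr (_ + _).
  by apply: eq_bigr => l _; rewrite upd_lshift upd_lrshift.
by apply: eq_bigr => l _; rewrite upd_rshift upd_rlshift.
Qed.

Lemma contract_wedge_slot_sum j k T (A : ('I_j -> a) -> 'Hom(V, W)) (B : ('I_k -> a) -> V) Y :
  slot_sum T (contract_wedge A B) Y =
  contract_wedge (slot_sum T A) B Y + contract_wedge A (slot_sum T B) Y.
Proof.
rewrite !contract_wedgeE -scalerDr /slot_sum; under eq_bigr do rewrite contract_wedgeE.
rewrite -scaler_sumr -/(slot_sum T (altsum (wedge_arg A B)) Y) -altsum_slot_sum.
congr (_ *: _); rewrite /altsum -big_split; apply: eq_bigr => s _ /=.
by rewrite wedge_arg_slot_sum scalerDr.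
Qed.

Lemma altsum_cast (U : lmodType R) m n (e : m = n) (Psi : ('I_m -> a) -> U) (Y : 'I_n -> a) :
  altsum (fun X : 'I_n -> a => Psi (X \o cast_ord e)) Y = altsum Psi (Y \o cast_ord e).
Proof.
case: n / e Y => Y; have ce (X : 'I_m -> a) : X \o cast_ord (erefl m) = X.
  by apply/funext => l; rewrite /= cast_ord_id.
by rewrite ce; apply: eq_altsum => X; rewrite ce.
Qed.

(* Contracting the vanishing form A /\ B of degree j + k + 2 with x. *)
Lemma contract_wedge_ins j k (A : ('I_j.+1 -> a) -> 'Hom(V, W)) (B : ('I_k.+1 -> a) -> V)
    x (Y : 'I_(j + k.+1) -> a) : signed A -> signed B ->
  altsum (wedge_arg A B) (ins (ord0 : 'I_(j + k.+1).+1) x Y) = 0 ->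
  contract_wedge (fun X => A (ins ord0 x X)) B Y =
  (-1) ^+ j *: contract_wedge A (fun X => B (ins ord0 x X)) (Y \o cast_ord (addSnnS j k)).
Proof.
move=> sA sB; rewrite (@altsum_ins _ _ _ (j + k.+1)) (@big_split_ord _ _ _ j.+1 k.+1)/=.
have e1 (i : 'I_j.+1) : (-1) ^+ i *: altsum (fun X : 'I_(j + k.+1) -> a =>
      wedge_arg A B (ins (lshift k.+1 i : 'I_(j + k.+1).+1) x X)) Y =
    altsum (wedge_arg (fun X => A (ins ord0 x X)) B) Y.
  rewrite -altsumZ; apply: eq_altsum => X; rewrite /wedge_arg.
  have -> : (fun l : 'I_j.+1 => ins (lshift k.+1 i : 'I_(j + k.+1).+1) x X (lshift k.+1 l)) =
      ins i x (fun l : 'I_j => X (lshift k.+1 l)).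
    apply/funext => l; case: (unliftP i l) => [q|] ->; last by rewrite !ins_id.
    rewrite ins_lift.
    have -> : lshift k.+1 (lift i q) = lift (lshift k.+1 i : 'I_(j + k.+1).+1) (lshift k.+1 q).
      exact: val_inj.
    by rewrite ins_lift.
  have -> : (fun l : 'I_k.+1 => ins (lshift k.+1 i : 'I_(j + k.+1).+1) x X (rshift j.+1 l)) =
      (fun l : 'I_k.+1 => X (rshift j l)).
    apply/funext => l.
    have -> : rshift j.+1 l = lift (lshift k.+1 i : 'I_(j + k.+1).+1) (rshift j l).
      by apply: val_inj; rewrite /= /bump; have := ltn_ord i; lia.
    by rewrite ins_lift.
  by rewrite signed_ins// scale_lfunE scalerA -expr2 sqrr_sign scale1r.
have e2 (i : 'I_k.+1) : (-1) ^+ (j.+1 + i) *: altsum (fun X : 'I_(j + k.+1) -> a =>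
      wedge_arg A B (ins (rshift j.+1 i : 'I_(j + k.+1).+1) x X)) Y =
    (-1) ^+ j.+1 *: altsum (wedge_arg A (fun X => B (ins ord0 x X))) (Y \o cast_ord (addSnnS j k)).
  rewrite exprD -scalerA -altsumZ; congr (_ *: _).
  rewrite -(altsum_cast (addSnnS j k)); apply: eq_altsum => X; rewrite /wedge_arg.
  have -> : (fun l : 'I_j.+1 => ins (rshift j.+1 i : 'I_(j + k.+1).+1) x X (lshift k.+1 l)) =
      (fun l : 'I_j.+1 => (X \o cast_ord (addSnnS j k)) (lshift k l)).
    apply/funext => l.
    have -> : lshift k.+1 l = lift (rshift j.+1 i : 'I_(j + k.+1).+1) (cast_ord (addSnnS j k) (lshift k l)).
      by apply: val_inj; rewrite /= /bump; have := ltn_ord l; lia.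
    by rewrite ins_lift.
  have -> : (fun l : 'I_k.+1 => ins (rshift j.+1 i : 'I_(j + k.+1).+1) x X (rshift j.+1 l)) =
      ins i x (fun l : 'I_k => (X \o cast_ord (addSnnS j k)) (rshift j.+1 l)).
    apply/funext => l; case: (unliftP i l) => [q|] ->; last by rewrite !ins_id.
    rewrite ins_lift.
    have -> : rshift j.+1 (lift i q) = lift (rshift j.+1 i : 'I_(j + k.+1).+1)
        (cast_ord (addSnnS j k) (rshift j.+1 q)).
      by apply: val_inj; rewrite /= /bump; lia.
    by rewrite ins_lift.
  by rewrite signed_ins// linearZ/= scalerA -expr2 sqrr_sign scale1r.
(* All terms in the block of A agree, and so do those in the block of B; what remains is to compare
   the numbers of terms with the factorials. *)
rewrite (eq_bigr _ (fun i _ => e1 i)) (eq_bigr _ (fun i _ => e2 i)) !sumr_const !card_ord.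
rewrite !contract_wedgeE.
move: (altsum (wedge_arg (fun X => A (ins ord0 x X)) B) Y) => S1.
move: (altsum _ (Y \o _)) => S2 h0.
have {h0}h : j.+1%:R *: S1 = - ((k.+1%:R * (-1) ^+ j.+1) *: S2).
  by apply/eqP; rewrite -addr_eq0 -scalerA !scaler_nat; exact/eqP.
rewrite !scalerA.
have -> : (j`! * k.+1`!)%:R^-1 = (j.+1`! * k.+1`!)%:R^-1 * j.+1%:R :> R.
  by rewrite [j.+1`!]factS -mulnA [X in _ = X^-1 * _]natrM invfM mulrAC mulVf ?mul1r// pnatr_eq0.
rewrite -[LHS]scalerA h scalerN -scaleNr scalerA; congr (_ *: _).
have k0 : k.+1%:R != 0 :> R by rewrite pnatr_eq0.
have j0 : (j.+1`! * k`!)%:R != 0 :> R by rewrite pnatr_eq0 -lt0n muln_gt0 !fact_gt0.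
rewrite [k.+1`!]factS mulnCA natrM exprS.
move: k0 j0; move: (k.+1%:R : R) ((j.+1`! * k`!)%:R : R) ((-1) ^+ j : R) => K D s K0 D0.
by field; rewrite K0 D0.
Qed.

(** In slot q only the coordinate of T (v q) along v q survives, as any other vector of the frame
    would be repeated. *)
Lemma slot_sum_top (U : lmodType R) (h : {vspace a}) n (f : ('I_n -> a) -> U) (v : 'I_n -> a)
    (t : 'I_n -> a -> R) (T : a -> a) :
  alternating_mod h f -> (forall w, w - \sum_b t b w *: v b \in h) ->
  slot_sum T f v = (\sum_m t m (T (v m))) *: f v.
Proof.
move=> fA vt; have [fA' f0] := fA; have fM := alternating_multilin fA'.
rewrite /slot_sum scaler_suml; apply: eq_bigr => q _; set w := T _.
transitivity (f (upd v q (\sum_b t b w *: v b))).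
  apply: alternating_mod_eq fA _ => i; rewrite /upd; case: eqP => _ //.
  by rewrite subrr mem0v.
rewrite multilin_sum// (bigD1 q)//= big1 ?addr0 => [|b bq].
  by rewrite multilinZ// upd_id.
rewrite multilinZ//; have [_ h0] := fA'; rewrite (h0 _ q b) ?scaler0//.
  by rewrite eq_sym.
by rewrite /upd eqxx (negbTE bq).
Qed.

End Wedge.

(** * Adjointness of the codifferential under the wedge product *)

Section Adjoint.
Variables (R : realType) (G : lieGroup R) (m : nat) (gr : int -> {vspace lie G}).
Hypothesis grG : grading m gr.
Hypothesis ss : semisimple G.
Variables p pp : {vspace lie G}.
Hypothesis pE : p = (\sum_(i < m.+1) gr i%:Z)%VS.
Hypothesis ppN : nilradical p pp.

Notation ppb a := (tnth (vbasis pp) a).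
Notation xi a := (dual_basis pp a).

Let expand w : w - \sum_a killing (ppb a) w *: xi a \in p.
Proof. exact: (dual_expand grG ss pE ppN w). Qed.

Let br_pp Z w : Z \in pp -> w \in p -> br Z w \in p.
Proof.
move=> /(nilradicalP grG ss pE ppN) hZ /(parabolicP grG pE) hw; apply/(parabolicP grG pE).
by have := deg_ge_br grG hZ hw; rewrite addr0 => h i i0; apply: h; lia.
Qed.

(** The frame is the one dual to the basis of pp. The last sum is the trace of ad Z on g/p, and
    [dual_trace] makes it vanish. *)
Lemma top_frame n : \dim pp = n -> exists (v : 'I_n -> lie G) (t : 'I_n -> lie G -> R),
  (forall w, w - \sum_b t b w *: v b \in p) /\
  (forall Z, Z \in pp -> \sum_b t b (br Z (v b)) = 0).
Proof.
move=> e; case: n / e; exists (fun b => xi b), (fun b w => killing (ppb b) w); split=> // Z Zpp.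
have /(perp_positiveP grG ss pE)/(_ Z) := dual_trace grG ss pE ppN.
move=> /(_ (proj1 (nilradicalP grG ss pE ppN Z) Zpp)); rewrite (linear_sum (killing Z)) => h.
rewrite -[RHS]oppr0 -[in RHS]h -sumrN; apply: eq_bigr => b _ /=.
rewrite -[LHS]opprK -killing_inv (brC Z) killingC (linearN (killing (xi b)))/=.
by rewrite [in LHS]killingC killing_inv opprK.
Qed.

(** The Killing form identifies pp with the dual of g/p: this is rank and nullity of the map w |->
    (killing Z_a w), whose kernel is p. *)
Lemma dim_nilradical : \dim pp = (\dim {:lie G} - \dim p)%N.
Proof.
pose phi (w : lie G) : 'rV[R]_(\dim pp) := \row_a killing (ppb a) w.
have phil : linear phi.
  by move=> c u v; apply/rowP => a; rewrite !mxE (linearP (killing (ppb a))).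
pose Phi : {linear lie G -> 'rV[R]_(\dim pp)} :=
  HB.pack_for {linear lie G -> 'rV[R]_(\dim pp)} phi
  (GRing.isLinear.Build R (lie G) _ _ phi phil).
have phiE w : linfun Phi w = phi w by rewrite lfunE.
have kerE : lker (linfun Phi) = p.
  apply/vspaceP => w; rewrite memv_ker phiE; apply/eqP/idP => [h|wp].
    have := expand w; rewrite big1 ?subr0// => a _.
    by have /rowP/(_ a) := h; rewrite !mxE => ->; rewrite scale0r.
  apply/rowP => a; rewrite !mxE.
  have /(perp_positiveP grG ss pE) := wp; apply.
  by apply/(nilradicalP grG ss pE ppN); exact: ppb_mem.
have imE : (linfun Phi @: {:lie G})%VS = {:'rV[R]_(\dim pp)}%VS.
  apply/eqP; rewrite eqEsubv subvf/=; apply/subvP => r _.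
  apply/memv_imgP; exists (\sum_a r 0 a *: xi a); first exact: memvf.
  rewrite phiE; apply/rowP => a; rewrite mxE (linear_sum (killing (ppb a))).
  rewrite (bigD1 a)//= big1 ?addr0 => [|b ba].
    by rewrite linearZ/= (dual_basisP ss) eqxx [RHS]mulr1.
  by rewrite linearZ/= (dual_basisP ss) eq_sym (negbTE ba) [LHS]mulr0.
have dV : \dim {:'rV[R]_(\dim pp)} = \dim pp by rewrite dimvf /dim/= mul1n.
by have := limg_ker_dim (linfun Phi) {:lie G}; rewrite capfv kerE imE dV => <-; rewrite addKn.
Qed.

Variables (V W : vectType R) (aV : lie G -> V -> V)
  (aE : lie G -> 'Hom(V, W) -> 'Hom(V, W)).
Hypothesis aVl : forall Z, linear (aV Z).
Hypothesis aEE : forall Z T v, aE Z T v = - T (aV Z v).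

Let aEl Z : linear (aE Z).
Proof.
move=> c T T'; apply/lfunP => v; rewrite aEE !(add_lfunE, scale_lfunE) !aEE.
by rewrite opprD scalerN.
Qed.

Let aVL Z : {linear V -> V} := HB.pack_for {linear V -> V} (aV Z)
  (GRing.isLinear.Build R V V _ (aV Z) (aVl Z)).

Lemma contract_wedge_over j k (A : ('I_j -> lie G) -> 'Hom(V, W)) (B : ('I_k -> lie G) -> V) Y :
  alternating_mod p A -> alternating_mod p B -> (\dim pp < j + k)%N ->
  altsum (wedge_arg A B) Y = 0.
Proof.
move=> hA hB lt; have hC := contract_wedge_mod hA hB.
have := alternating_mod_over Y hC expand lt; rewrite contract_wedgeE => /eqP.
have c0 : (j`! * k`!)%:R^-1 != 0 :> R.
  by rewrite invr_eq0 pnatr_eq0 -lt0n muln_gt0 !fact_gt0.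
by rewrite scaler_eq0 (negbTE c0) => /eqP.
Qed.

(** Two error terms arise when Z_b and xi_b move from B to A: the derivation by ad Z_b of a top
    form, and A contracted with [Z_b, xi_b]. The first vanishes for each b because the trace is
    zero, the second after summation over b because the sum of the brackets lies in p. *)
Lemma codiff_adjoint j k (A : ('I_j.+1 -> lie G) -> 'Hom(V, W)) (B : ('I_k.+1 -> lie G) -> V)
    (Y : 'I_(j + k.+1) -> lie G) : alternating_mod p A -> alternating_mod p B ->
  \dim pp = (j + k.+1)%N ->
  contract_wedge A (codiff pp aV B) (Y \o cast_ord (addSnnS j k)) =
  (-1) ^+ j.+1 *: contract_wedge (codiff pp aE A) B Y.
Proof.
move=> hA hB dimE; set Y' := _ \o cast_ord _.
have lt : (\dim pp < j.+1 + k.+1)%N by rewrite dimE.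
have -> : codiff pp aV B = fun X => - \sum_b codiff_term aV B X (ppb b) (xi b).
  by apply/funext => X; exact: (codiffE grG ss pE ppN aVl).
have -> : codiff pp aE A = fun X => - \sum_b codiff_term aE A X (ppb b) (xi b).
  by apply/funext => X; exact: (codiffE grG ss pE ppN aEl).
pose iA b X := A (ins ord0 (xi b) X); pose iB b X := B (ins ord0 (xi b) X).
have iAm b : alternating_mod p (iA b) by exact: alternating_mod_ins.
have iBm b : alternating_mod p (iB b) by exact: alternating_mod_ins.
have brm b : forall w, w \in p -> br (ppb b) w \in p.
  by move=> w; apply: br_pp; exact: ppb_mem.
(* The form that is contracted has degree dim G/P + 1 and is zero. *)
have I1 (A' : ('I_j.+1 -> lie G) -> 'Hom(V, W)) (B' : ('I_k.+1 -> lie G) -> V) x :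
    alternating_mod p A' -> alternating_mod p B' ->
    contract_wedge A' (fun X => B' (ins ord0 x X)) Y' =
    (-1) ^+ j *: contract_wedge (fun X => A' (ins ord0 x X)) B' Y.
  move=> hA' hB'; have [/alternating_signed sA _] := hA'; have [/alternating_signed sB _] := hB'.
  have h0 : altsum (wedge_arg A' B') (ins (ord0 : 'I_(j + k.+1).+1) x Y) = 0.
    exact: (@contract_wedge_over j.+1 k.+1 A' B' _ hA' hB' lt).
  by rewrite (contract_wedge_ins sA sB h0) scalerA -expr2 sqrr_sign scale1r.
have negZ (U : lmodType R) (F : U) : - F = (-1) *: F by rewrite scaleN1r.
(* The action on Hom(V, W) is minus the transpose of the action on V, which turns (-1)^j into
   (-1)^(j+1). *)
have F1 b : contract_wedge A (fun X => aV (ppb b) (iB b X)) Y' =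
    (-1) ^+ j.+1 *: contract_wedge (fun X => aE (ppb b) (iA b X)) B Y.
  rewrite (I1 A (fun X => aV (ppb b) (B X)) (xi b) hA (alternating_mod_comp (aVL (ppb b)) hB)).
  rewrite exprS mulN1r scaleNr -scalerN; congr (_ *: _); rewrite negZ -contract_wedgeZl.
  rewrite !contract_wedgeE; congr (_ *: _); apply: eq_altsum => X.
  by rewrite /wedge_arg scale_lfunE aEE scaleN1r opprK.
(* The wedge product of A with [iB b] is a top form, so the derivation by ad Z_b moves to A with a
   sign; contracting afterwards with xi_b produces the additional term in [Z_b, xi_b]. *)
have F2 b : contract_wedge A (slot_sum (br (ppb b)) (iB b)) Y' =
    (-1) ^+ j.+1 *: (contract_wedge (fun X => A (ins ord0 (br (ppb b) (xi b)) X)) B Y +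
      contract_wedge (slot_sum (br (ppb b)) (iA b)) B Y).
  have dimE' : \dim pp = (j.+1 + k)%N by rewrite dimE addSnnS.
  have [v [t [vt tr]]] := top_frame dimE'.
  have hC := contract_wedge_mod hA (iBm b).
  have top0 : slot_sum (br (ppb b)) (contract_wedge A (iB b)) Y' = 0.
    apply: (alternating_mod_top Y' (slot_sum_mod (brm b) hC) vt).
    by rewrite (slot_sum_top _ hC vt) tr ?scale0r//; exact: ppb_mem.
  move: top0; rewrite contract_wedge_slot_sum => /eqP; rewrite addrC addr_eq0 => /eqP ->.
  rewrite (I1 (slot_sum (br (ppb b)) A) B (xi b) (slot_sum_mod (brm b) hA) hB).
  rewrite exprS mulN1r scaleNr; congr (- (_ *: _)).
  rewrite -[X in X + _]scale1r -contract_wedge_linear_l; congr contract_wedge.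
  by apply/funext => X; rewrite slot_sum_ins scale1r.
have term1 b : contract_wedge A (fun X => codiff_term aV B X (ppb b) (xi b)) Y' =
    contract_wedge A (fun X => aV (ppb b) (iB b X)) Y' -
    2^-1 *: contract_wedge A (slot_sum (br (ppb b)) (iB b)) Y'.
  rewrite addrC -scaleNr -contract_wedge_linear_r; congr contract_wedge.
  by apply/funext => X; rewrite /codiff_term addrC scaleNr.
have term2 b : contract_wedge (fun X => codiff_term aE A X (ppb b) (xi b)) B Y =
    contract_wedge (fun X => aE (ppb b) (iA b X)) B Y -
    2^-1 *: contract_wedge (slot_sum (br (ppb b)) (iA b)) B Y.
  rewrite addrC -scaleNr -contract_wedge_linear_l; congr contract_wedge.
  by apply/funext => X; rewrite /codiff_term addrC scaleNr.
have L : contract_wedge A (fun X => - \sum_b codiff_term aV B X (ppb b) (xi b)) Y' =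
    - \sum_b contract_wedge A (fun X => codiff_term aV B X (ppb b) (xi b)) Y'.
  rewrite -contract_wedge_sum_r negZ -contract_wedgeZr; congr contract_wedge.
  by apply/funext => X; rewrite scaleN1r.
have L' : contract_wedge (fun X => - \sum_b codiff_term aE A X (ppb b) (xi b)) B Y =
    - \sum_b contract_wedge (fun X => codiff_term aE A X (ppb b) (xi b)) B Y.
  rewrite -contract_wedge_sum_l negZ -contract_wedgeZl; congr contract_wedge.
  by apply/funext => X; rewrite scaleN1r.
rewrite L L' scalerN; congr (- _).
have tr0 : \sum_b contract_wedge (fun X => A (ins ord0 (br (ppb b) (xi b)) X)) B Y = 0.
  rewrite -contract_wedge_sum_l -[RHS](contract_wedge0l W (j := j) B Y).
  congr contract_wedge; apply/funext => X; have [hA' A0] := hA.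
  transitivity (A (ins ord0 (\sum_b br (ppb b) (xi b)) X)); last first.
    by apply: (A0 _ ord0); rewrite ins_id; exact: (dual_trace grG ss pE ppN).
  rewrite -(upd_ins ord0 0) (multilin_sum _ _ _ _ _ (alternating_multilin hA')).
  by apply: eq_bigr => b _; rewrite upd_ins.
rewrite scaler_sumr; apply/eqP; rewrite -subr_eq0 -sumrB; apply/eqP.
rewrite -[RHS](scaler0 _ (- (2^-1 * (-1) ^+ j.+1))) -[in RHS]tr0 scaler_sumr.
apply: eq_bigr => b _; rewrite term1 term2 F1 F2.
move: (contract_wedge (fun X => aE (ppb b) (iA b X)) B Y)
  (contract_wedge (slot_sum (br (ppb b)) (iA b)) B Y)
  (contract_wedge (fun X => A (ins ord0 (br (ppb b) (xi b)) X)) B Y) => p1 p2 p3.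
rewrite scalerBr !scalerA [(-1) ^+ _ * 2^-1]mulrC scalerDr scaleNr.
by rewrite opprB opprD [X in _ + X]addrC addrACA subrr add0r subrK.
Qed.

End Adjoint.

(** * Exterior derivatives *)

Section ExteriorDerivative.
Variables (R : realType) (T : Type) (a V : vectType R).
Variables (brk : a -> a -> a) (lv : a -> (T -> R) -> T -> R).
Hypothesis brkC : forall x y, brk x y = - brk y x.

(* Splitting each bracket term of [ext_d] evenly between its two arguments makes
   every summand a derivation of the wedge product. *)
Definition ext_term k (f : T -> ('I_k -> a) -> V) (t : T) (Z : a) (X : 'I_k -> a) : V :=
  vderiv lv Z (fun u => f u X) t - 2^-1 *: slot_sum (brk Z) (f t) X.

Lemma ext_dE k (f : T -> ('I_k -> a) -> V) t X : alternating_map (f t) ->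
  ext_d brk lv f t X = \sum_(i < k.+1) (-1) ^+ i *: ext_term f t (X i) (X \o lift i).
Proof.
move=> fA; have fs := alternating_signed fA; have fM := alternating_multilin fA.
rewrite /ext_d /ext_term; under [RHS]eq_bigr do rewrite scalerBr.
rewrite sumrB; congr (_ + _).
case: k f X fA fs fM => [|k] f X fA fs fM.
  rewrite [in RHS]big1 => [|i _]; last by rewrite /slot_sum big_ord0 !scaler0.
  by rewrite oppr0 big1// => i _; rewrite big1// => j; rewrite !ord1.
have := sum_upd_rest2 X (fun i j => brk (X i) (X j)) fs.
under eq_bigr do rewrite -/(slot_sum (brk (X _)) (f t) (X \o lift _)).
move=> H; rewrite -sumrN.
transitivity (- (2^-1 *: \sum_(i < k.+2) (-1) ^+ i *: slot_sum (brk (X i)) (f t) (X \o lift i))).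
  have -> : \sum_(i < k.+2) (-1) ^+ i *: slot_sum (brk (X i)) (f t) (X \o lift i) =
    \sum_(i < k.+2) \sum_(j < k.+2 | (i < j)%N) (-1) ^+ (i + j) *:
      (f t (ins ord0 (brk (X j) (X i)) (rest2 X i j)) -
       f t (ins ord0 (brk (X i) (X j)) (rest2 X i j))) by exact: H.
  rewrite scaler_sumr -sumrN; apply: eq_bigr => i _.
  rewrite scaler_sumr -sumrN; apply: eq_bigr => j _; rewrite nth_rest2.
  set r := rest2 X i j; rewrite (brkC (X j)) -(upd_ins ord0 0 r (- _)) multilinN// upd_ins.
  set u := f t _; rewrite -opprD !scalerN opprK scalerA scalerDr -scalerDl.
  by congr (_ *: _); move: ((-1) ^+ (i + j) : R) => c; lra.
rewrite scaler_sumr -sumrN; apply: eq_bigr => i _.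
by rewrite !scalerA mulrC.
Qed.

End ExteriorDerivative.

(** * Derivatives of vector-valued functions *)

Section VectorDerivative.
Variables (R : realType) (G : lieGroup R).
Implicit Types (Z : lie G) (x : G).

Lemma vcoordP (V : vectType R) b c (u v : V) : vcoord b (c *: u + v) = c * vcoord b u + vcoord b v.
Proof. by rewrite linearP. Qed.

Lemma vcoordZ (V : vectType R) b c (u : V) : vcoord b (c *: u) = c * vcoord b u.
Proof. by rewrite linearZ. Qed.

Lemma vcoordS (V : vectType R) b (I : Type) (r : seq I) (P : pred I) (F : I -> V) :
  vcoord b (\sum_(i <- r | P i) F i) = \sum_(i <- r | P i) vcoord b (F i).
Proof. by rewrite (linear_sum (vcoord b)). Qed.

Definition smoothv (V : vectType R) (F : G -> V) := forall b, smooth (fun x => vcoord b (F x)).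

Local Notation vd := (vderiv (@lvf R G)).

Lemma vcoord_vderiv (V : vectType R) Z (F : G -> V) x b :
  vcoord b (vd Z F x) = lvf Z (fun y => vcoord b (F y)) x.
Proof.
rewrite /vderiv (linear_sum (vcoord b)) (bigD1 b)//= big1 ?addr0 => [|c cb].
  by rewrite linearZ/= vcoord_vbase eqxx [LHS]mulr1.
by rewrite linearZ/= vcoord_vbase eq_sym (negbTE cb) [LHS]mulr0.
Qed.

Lemma smoothv_functional (V : vectType R) (F : G -> V) (l : {linear V -> R^o}) :
  smoothv F -> smooth (fun x => l (F x)).
Proof.
move=> sF; rewrite [X in smooth X](_ : _ = fun x => \sum_b l (vbase b) * vcoord b (F x)).
  by apply: smooth_sum => b; apply: smooth_scale.
apply/funext => x; rewrite {1}(vcoord_sum (F x)) linear_sum; apply: eq_bigr => b _.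
by rewrite linearZ/= [LHS]mulrC.
Qed.

Lemma vderiv_functional (V : vectType R) Z (F : G -> V) (l : {linear V -> R^o}) x :
  smoothv F -> l (vd Z F x) = lvf Z (fun y => l (F y)) x.
Proof.
move=> sF; rewrite [in RHS](_ : (fun y => _) = fun x => \sum_b l (vbase b) * vcoord b (F x)).
  rewrite lvf_sum => [|b]; last exact: smooth_scale.
  rewrite (vcoord_sum (vd Z F x)) linear_sum; apply: eq_bigr => b _.
  by rewrite lvf_scale// linearZ/= vcoord_vderiv [LHS]mulrC.
apply/funext => y; rewrite {1}(vcoord_sum (F y)) linear_sum; apply: eq_bigr => b _.
by rewrite linearZ/= [LHS]mulrC.
Qed.

Lemma smoothv_linear (V W : vectType R) (L : {linear V -> W}) (F : G -> V) :
  smoothv F -> smoothv (fun x => L (F x)).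
Proof.
move=> sF b; pose l (v : V) : R^o := vcoord b (L v).
have ll : linear l by move=> c u v; rewrite /l !linearP.
exact: (smoothv_functional (HB.pack_for {linear V -> R^o} l
  (GRing.isLinear.Build R V R^o _ l ll)) sF).
Qed.

Lemma vderiv_linear (V W : vectType R) Z (L : {linear V -> W}) (F : G -> V) x :
  smoothv F -> vd Z (fun y => L (F y)) x = L (vd Z F x).
Proof.
move=> sF; apply: vcoord_inj => b; rewrite vcoord_vderiv.
pose l (v : V) : R^o := vcoord b (L v).
have ll : linear l by move=> c u v; rewrite /l !linearP.
exact/esym/(vderiv_functional Z (HB.pack_for {linear V -> R^o} l
  (GRing.isLinear.Build R V R^o _ l ll)) x sF).
Qed.

Lemma smoothv_cst (V : vectType R) (v : V) : smoothv (fun=> v).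
Proof. by move=> b; exact: smooth_cst. Qed.

Lemma smoothv_comb (V : vectType R) (c : R) (F F' : G -> V) :
  smoothv F -> smoothv F' -> smoothv (fun x => c *: F x + F' x).
Proof.
move=> sF sF' b; under eq_fun do rewrite vcoordP.
by apply: smooth_add => //; exact: smooth_scale.
Qed.

Lemma smoothv_sum (V : vectType R) (I : Type) (r : seq I) (P : pred I) (F : I -> G -> V) :
  (forall i, smoothv (F i)) -> smoothv (fun x => \sum_(i <- r | P i) F i x).
Proof.
move=> sF b; under eq_fun do rewrite vcoordS.
by apply: smooth_sum => i; exact: sF.
Qed.

Lemma smoothvZ (V : vectType R) (h : G -> R) (F : G -> V) :
  smooth h -> smoothv F -> smoothv (fun x => h x *: F x).
Proof.
move=> sh sF b; under eq_fun do rewrite vcoordZ.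
by apply: smooth_mul => //; exact: sF.
Qed.

Lemma vderiv_comb (V : vectType R) Z (c : R) (F F' : G -> V) x :
  smoothv F -> smoothv F' -> vd Z (fun y => c *: F y + F' y) x = c *: vd Z F x + vd Z F' x.
Proof.
move=> sF sF'; apply: vcoord_inj => b; rewrite vcoordP !vcoord_vderiv.
under eq_fun do rewrite vcoordP.
by rewrite lvf_add ?lvf_scale//; exact: smooth_scale.
Qed.

Lemma vderiv_sum (V : vectType R) Z (I : Type) (r : seq I) (P : pred I) (F : I -> G -> V) x :
  (forall i, smoothv (F i)) ->
  vd Z (fun y => \sum_(i <- r | P i) F i y) x = \sum_(i <- r | P i) vd Z (F i) x.
Proof.
move=> sF; apply: vcoord_inj => b; rewrite vcoordS vcoord_vderiv.
under eq_fun do rewrite vcoordS.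
rewrite lvf_sum; last by move=> i; exact: sF.
by apply: eq_bigr => i _; rewrite vcoord_vderiv.
Qed.

Lemma vderivZ (V : vectType R) Z (c : R) (F : G -> V) x :
  smoothv F -> vd Z (fun y => c *: F y) x = c *: vd Z F x.
Proof.
move=> sF; apply: vcoord_inj => b; rewrite vcoordZ !vcoord_vderiv.
by under eq_fun do rewrite vcoordZ; rewrite lvf_scale.
Qed.

Lemma vderiv_linX (V : vectType R) (F : G -> V) x : smoothv F -> linear (fun Z => vd Z F x).
Proof.
move=> sF c Z Z'; apply: vcoord_inj => b; rewrite vcoordP !vcoord_vderiv.
by rewrite lvf_linX.
Qed.

Section Hom.
Variables V W : vectType R.

Definition hom_unit (c : 'I_(\dim {:V})) (b : 'I_(\dim {:W})) : 'Hom(V, W) :=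
  linfun (fun v : V => vcoord c v *: (vbase b : W)).

Lemma hom_unitE c b v : hom_unit c b v = vcoord c v *: vbase b.
Proof.
pose g (v : V) : W := vcoord c v *: vbase b.
have gl : linear g by move=> t u w; rewrite /g linearP scalerDl scalerA.
exact: (lfunE (HB.pack_for {linear V -> W} g (GRing.isLinear.Build R V W _ g gl))).
Qed.

Lemma hom_expand (T : 'Hom(V, W)) :
  T = \sum_c \sum_b vcoord b (T (vbase c)) *: hom_unit c b.
Proof.
apply/lfunP => v; rewrite sum_lfunE {1}(vcoord_sum v) linear_sum; apply: eq_bigr => c _.
rewrite sum_lfunE linearZ/= {1}(vcoord_sum (T _)) scaler_sumr; apply: eq_bigr => b _.
by rewrite scale_lfunE hom_unitE !scalerA mulrC.
Qed.

Lemma smoothv_hom (T : G -> 'Hom(V, W)) :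
  (forall v, smoothv (fun x => T x v)) -> smoothv T.
Proof.
move=> h; rewrite [X in smoothv X](_ : _ = fun x => \sum_c \sum_b vcoord b (T x (vbase c)) *: hom_unit c b).
  apply: smoothv_sum => c; apply: smoothv_sum => b; apply: smoothvZ; first exact: h.
  exact: smoothv_cst.
by apply/funext => x; exact: hom_expand.
Qed.

Lemma vcoord_eval (T : 'Hom(V, W)) (v : V) b : vcoord b (T v) = \sum_e \sum_c
    (vcoord e T * vcoord c v) * vcoord b ((vbase e : 'Hom(V, W)) (vbase c)).
Proof.
rewrite {1}(vcoord_sum T) sum_lfunE vcoordS; apply: eq_bigr => e _.
rewrite scale_lfunE {1}(vcoord_sum v) linear_sum vcoordZ vcoordS mulr_sumr.
by apply: eq_bigr => c _; rewrite linearZ/= vcoordZ mulrA.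
Qed.

Lemma smoothv_eval (T : G -> 'Hom(V, W)) (F : G -> V) :
  smoothv T -> smoothv F -> smoothv (fun x => T x (F x)).
Proof.
move=> sT sF b; rewrite [X in smooth X](_ : _ = fun x => \sum_e \sum_c
    (vcoord e (T x) * vcoord c (F x)) * vcoord b ((vbase e : 'Hom(V, W)) (vbase c))).
  apply: smooth_sum => e; apply: smooth_sum => c; apply: smooth_mul; last exact: smooth_cst.
  by apply: smooth_mul; [exact: sT|exact: sF].
by apply/funext => x; exact: vcoord_eval.
Qed.

Lemma vderiv_eval Z (T : G -> 'Hom(V, W)) (F : G -> V) x : smoothv T -> smoothv F ->
  vd Z (fun y => T y (F y)) x = (vd Z T x) (F x) + T x (vd Z F x).
Proof.
move=> sT sF; apply: vcoord_inj => b; rewrite vcoord_vderiv linearD/=.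
under eq_fun do rewrite vcoord_eval.
rewrite !vcoord_eval -big_split lvf_sum => [|e]; last first.
  apply: smooth_sum => c; apply: smooth_mul; last exact: smooth_cst.
  by apply: smooth_mul; [exact: sT|exact: sF].
apply: eq_bigr => e _; rewrite -big_split lvf_sum => [|c]; last first.
  apply: smooth_mul; last exact: smooth_cst.
  by apply: smooth_mul; [exact: sT|exact: sF].
apply: eq_bigr => c _ /=; rewrite -mulrDl !vcoord_vderiv -(lvf_mul _ _ (sT e) (sF c)).
under eq_fun do rewrite mulrC.
rewrite lvf_scale 1?mulrC//; apply: smooth_mul; [exact: sT|exact: sF].
Qed.

End Hom.

End VectorDerivative.

(** * The Leibniz rule for the exterior derivative *)

Section Leibniz.
Variables (R : realType) (G : lieGroup R) (V W : vectType R).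
Local Notation vd := (vderiv (@lvf R G)).
Local Notation et := (ext_term (@br R G) (@lvf R G)).
Local Notation ed := (ext_d (@br R G) (@lvf R G)).

Lemma smoothv_wedge j k (f : G -> ('I_j -> lie G) -> 'Hom(V, W)) (g : G -> ('I_k -> lie G) -> V) Y :
  (forall X, smoothv (fun x => f x X)) -> (forall X, smoothv (fun x => g x X)) ->
  smoothv (fun x => contract_wedge (f x) (g x) Y).
Proof.
move=> sf sg b; rewrite /contract_wedge; under eq_fun do rewrite linearZ/=.
apply: smooth_scale; move: b; rewrite -/(smoothv _); apply: smoothv_sum => s.
by apply: smoothvZ; [exact: smooth_cst|exact: smoothv_eval].
Qed.

Lemma ext_term_wedge j k (f : G -> ('I_j -> lie G) -> 'Hom(V, W))
    (g : G -> ('I_k -> lie G) -> V) x Z X :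
  (forall X, smoothv (fun x => f x X)) -> (forall X, smoothv (fun x => g x X)) ->
  et (fun y => contract_wedge (f y) (g y)) x Z X =
  contract_wedge (et f x Z) (g x) X + contract_wedge (f x) (et g x Z) X.
Proof.
move=> sf sg; rewrite /ext_term contract_wedge_slot_sum.
have -> : vd Z (fun y => contract_wedge (f y) (g y) X) x =
    contract_wedge (fun X => vd Z (fun y => f y X) x) (g x) X +
    contract_wedge (f x) (fun X => vd Z (fun y => g y X) x) X.
  rewrite !contract_wedgeE -scalerDr.
  rewrite (@vderivZ R G W Z _ (fun y => altsum (wedge_arg (f y) (g y)) X) x); last first.
    by apply: smoothv_sum => s; apply: smoothvZ; [exact: smooth_cst|exact: smoothv_eval].
  congr (_ *: _); rewrite /altsum (@vderiv_sum R G W Z _ _ _ (fun (s : 'S_(j + k)) y =>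
      (-1) ^+ s *: wedge_arg (f y) (g y) (X \o s)) x); last first.
    by move=> s; apply: smoothvZ; [exact: smooth_cst|exact: smoothv_eval].
  rewrite -big_split; apply: eq_bigr => s _ /=.
  rewrite (@vderivZ R G W Z _ (fun y => wedge_arg (f y) (g y) (X \o s)) x); last exact: smoothv_eval.
  by rewrite /wedge_arg vderiv_eval// scalerDr.
have E1 : contract_wedge (fun X => vd Z (fun y => f y X) x - 2^-1 *: slot_sum (br Z) (f x) X) (g x) X
    = contract_wedge (fun X => vd Z (fun y => f y X) x) (g x) X -
      2^-1 *: contract_wedge (slot_sum (br Z) (f x)) (g x) X.
  rewrite addrC -scaleNr -contract_wedge_linear_l; congr contract_wedge.
  by apply/funext => X'; rewrite addrC scaleNr.
have E2 : contract_wedge (f x) (fun X => vd Z (fun y => g y X) x - 2^-1 *: slot_sum (br Z) (g x) X) X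
    = contract_wedge (f x) (fun X => vd Z (fun y => g y X) x) X -
      2^-1 *: contract_wedge (f x) (slot_sum (br Z) (g x)) X.
  rewrite addrC -scaleNr -contract_wedge_linear_r; congr contract_wedge.
  by apply/funext => X'; rewrite addrC scaleNr.
by rewrite E1 E2 scalerDr opprD addrACA.
Qed.

(** By [altsum_extract], the j + 1 positions of the differentiated argument contribute equally,
    which accounts for the quotient of (j+1)! by j!. *)
Lemma contract_ext_d_l j k (f : G -> ('I_j -> lie G) -> 'Hom(V, W)) (B : ('I_k -> lie G) -> V) x
    (Y : 'I_(j + k).+1 -> lie G) : alternating_map (f x) ->
  contract_wedge (ed f x) B (Y : 'I_(j.+1 + k) -> lie G) =
  \sum_(q < (j + k).+1) (-1) ^+ q *: contract_wedge (et f x (Y q)) B (Y \o lift q).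
Proof.
move=> fA; pose Th z (X : 'I_(j + k) -> lie G) := wedge_arg (et f x z) B X.
have E (i : 'I_j.+1) : altsum (fun X : 'I_(j + k).+1 -> lie G => Th (X (lshift k i : 'I_(j + k).+1))
    (X \o lift (lshift k i : 'I_(j + k).+1))) Y =
    (-1) ^+ i *: \sum_(q < (j + k).+1) (-1) ^+ q *: altsum (Th (Y q)) (Y \o lift q).
  by rewrite altsum_extract.
transitivity ((j.+1`! * k`!)%:R^-1 *: \sum_(i < j.+1) (-1) ^+ i *:
    altsum (fun X : 'I_(j + k).+1 -> lie G => Th (X (lshift k i : 'I_(j + k).+1))
    (X \o lift (lshift k i : 'I_(j + k).+1))) Y).
  rewrite contract_wedgeE; congr (_ *: _); under [RHS]eq_bigr do rewrite -altsumZ.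
  rewrite -altsum_sum; apply: eq_altsum => X; rewrite /wedge_arg.
  rewrite (ext_dE (@lvf R G) (@brC R G))// sum_lfunE; apply: eq_bigr => i _.
  rewrite scale_lfunE; congr (_ *: _); rewrite /Th /wedge_arg; congr (et f x _ _ (B _)).
    by apply/funext => l; congr X; apply: val_inj.
  by apply/funext => l; congr X; apply: val_inj; rewrite /= /bump; have := ltn_ord i; lia.
rewrite (eq_bigr (fun=> \sum_(q < (j + k).+1) (-1) ^+ q *: altsum (Th (Y q)) (Y \o lift q))) => [|i _]; last first.
  by rewrite E scalerA -expr2 sqrr_sign scale1r.
rewrite sumr_const card_ord -[_ *+ j.+1]scaler_nat scalerA [j.+1`!]factS -mulnA natrM invfM mulrAC.
rewrite mulVf ?pnatr_eq0// mul1r scaler_sumr; apply: eq_bigr => q _.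
by rewrite contract_wedgeE !scalerA mulrC.
Qed.

(** As in [contract_ext_d_l]; the differentiated argument now comes after the j arguments of A,
    whence the sign. *)
Lemma contract_ext_d_r j k (A : ('I_j -> lie G) -> 'Hom(V, W)) (g : G -> ('I_k -> lie G) -> V) x
    (Y : 'I_(j + k).+1 -> lie G) : alternating_map (g x) ->
  contract_wedge A (ed g x) (Y \o cast_ord (addnS j k)) =
  (-1) ^+ j *: \sum_(q < (j + k).+1) (-1) ^+ q *: contract_wedge A (et g x (Y q)) (Y \o lift q).
Proof.
move=> gA; pose Th z (X : 'I_(j + k) -> lie G) := wedge_arg A (et g x z) X.
pose id i := cast_ord (addnS j k) (rshift j (i : 'I_k.+1)).
have E (i : 'I_k.+1) : altsum (fun X : 'I_(j + k).+1 -> lie G => Th (X (id i)) (X \o lift (id i))) Y =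
    (-1) ^+ (j + i) *: \sum_(q < (j + k).+1) (-1) ^+ q *: altsum (Th (Y q)) (Y \o lift q).
  by rewrite altsum_extract.
transitivity ((j`! * k.+1`!)%:R^-1 *: \sum_(i < k.+1) (-1) ^+ i *:
    altsum (fun X : 'I_(j + k).+1 -> lie G => Th (X (id i)) (X \o lift (id i))) Y).
  rewrite contract_wedgeE; congr (_ *: _); under [RHS]eq_bigr do rewrite -altsumZ.
  rewrite -altsum_sum -altsum_cast; apply: eq_altsum => X; rewrite /wedge_arg.
  rewrite (ext_dE (@lvf R G) (@brC R G))// linear_sum; apply: eq_bigr => i _.
  rewrite linearZ/=; congr (_ *: _); rewrite /Th /wedge_arg; congr (A _ (et g x _ _)).
    by apply/funext => l; congr X; apply: val_inj; rewrite /= /bump; have := ltn_ord l; lia.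
  by apply/funext => l; congr X; apply: val_inj; rewrite /= /bump; lia.
rewrite (eq_bigr (fun=> (-1) ^+ j *: \sum_(q < (j + k).+1) (-1) ^+ q *: altsum (Th (Y q)) (Y \o lift q))) => [|i _]; last first.
  by rewrite E exprD mulrC -scalerA [in LHS]scalerA -expr2 sqrr_sign scale1r.
rewrite sumr_const card_ord -[_ *+ k.+1]scaler_nat !scalerA factS mulnCA natrM invfM.
rewrite mulrACA mulVf ?pnatr_eq0// mul1r mulrC.
rewrite -scalerA; congr (_ *: _); rewrite scaler_sumr; apply: eq_bigr => q _.
by rewrite contract_wedgeE !scalerA mulrC.
Qed.

Lemma ext_d_wedge j k (f : G -> ('I_j -> lie G) -> 'Hom(V, W)) (g : G -> ('I_k -> lie G) -> V) x
    (Y : 'I_(j + k).+1 -> lie G) :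
  (forall X, smoothv (fun x => f x X)) -> (forall X, smoothv (fun x => g x X)) ->
  alternating_map (f x) -> alternating_map (g x) ->
  ed (fun y => contract_wedge (f y) (g y)) x Y =
  contract_wedge (ed f x) (g x) (Y : 'I_(j.+1 + k) -> lie G) +
  (-1) ^+ j *: contract_wedge (f x) (ed g x) (Y \o cast_ord (addnS j k)).
Proof.
move=> sf sg fA gA; rewrite contract_ext_d_l// contract_ext_d_r// scalerA -expr2 sqrr_sign scale1r.
have md (U : lmodType R) n (F : ('I_n -> lie G) -> U) : alternating_map F ->
    alternating_mod 0%VS F.
  move=> FA; split=> // X i; rewrite memv0 => /eqP X0.
  exact: multilin0 (alternating_multilin FA) X0.
have [cA _] := contract_wedge_mod (md _ _ _ fA) (md _ _ _ gA).
rewrite (ext_dE (@lvf R G) (@brC R G))// -big_split; apply: eq_bigr => q _ /=.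
by rewrite ext_term_wedge// scalerDr.
Qed.

End Leibniz.

(** * Forms on G/P as equivariant horizontal forms on G *)

Section BasicForms.
Variables (R : realType) (G : lieGroup R).
Local Notation vd := (vderiv (@lvf R G)).
Local Notation et := (ext_term (@br R G) (@lvf R G)).
Local Notation ed := (ext_d (@br R G) (@lvf R G)).

Lemma lvf_prod Z n (F : 'I_n -> G -> R) x : (forall l, smooth (F l)) ->
  lvf Z (fun y => \prod_l F l y) x =
  \sum_l \prod_q (if q == l then lvf Z (F q) x else F q x).
Proof.
elim: n F => [|n IH] F sF.
  by rewrite big_ord0; under eq_fun do rewrite big_ord0; exact: lvf_cst.
under eq_fun do rewrite big_ord_recl.
have sP : smooth (fun y => \prod_(i < n) F (lift ord0 i) y).
  apply/smooth_inT; apply: smooth_in_prod; first exact: openT.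
  by move=> i; apply/smooth_inT.
rewrite lvf_mul// (IH (fun l => F (lift ord0 l)))// [in RHS]big_ord_recl.
rewrite [X in _ = X + _]big_ord_recl eqxx; congr (_ + _).
rewrite mulr_sumr; apply: eq_bigr => l _; by rewrite big_ord_recl.
Qed.

Section MultilinAd.
Variables (k : nat) (g : ('I_k -> lie G) -> R^o) (X : 'I_k -> lie G).
Hypothesis gM : multilin g.
Local Notation d := (\dim {:lie G}).

Let expand (Y : 'I_k -> lie G) : g Y = \sum_(s : {ffun 'I_k -> 'I_d})
  (\prod_l vcoord (s l) (Y l)) * g (fun l => vbase (s l)).
Proof.
rewrite -[RHS](multilin_expand (fun l b => vcoord b (Y l)) (fun b => vbase b) gM).
by congr g; apply/funext => l; exact: vcoord_sum.
Qed.

Let sprod (s : {ffun 'I_k -> 'I_d}) : smooth (fun q : G => \prod_l vcoord (s l) (Ad q (X l))).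
Proof.
apply/smooth_inT; apply: smooth_in_prod; first exact: openT.
by move=> l; apply/smooth_inT; exact: smooth_Ad.
Qed.

Lemma smooth_multilin_Ad : smooth (fun q : G => g (Ad q \o X)).
Proof.
under eq_fun do rewrite expand; apply: smooth_sum => s.
by apply: smooth_mul; [exact: sprod|exact: smooth_cst].
Qed.

Lemma lvf_multilin_Ad Z : lvf Z (fun q : G => g (Ad q \o X)) 1%g = slot_sum (br Z) g X.
Proof.
under eq_fun do rewrite expand; rewrite lvf_sum => [|s]; last first.
  by apply: smooth_mul; [exact: sprod|exact: smooth_cst].
rewrite /slot_sum; under [RHS]eq_bigr do rewrite expand.
rewrite exchange_big; apply: eq_bigr => s _ /=.
under eq_fun do rewrite mulrC; rewrite lvf_scale; last exact: sprod.
rewrite mulrC -mulr_suml; congr (_ * _).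
rewrite (lvf_prod Z 1%g (F := fun l q => vcoord (s l) (Ad q (X l)))); last first.
  by move=> l; exact: smooth_Ad.
apply: eq_bigr => l _; apply: eq_bigr => q _; rewrite /upd.
by case: eqP => [->|_]; [exact: lvf_Ad|rewrite Ad1].
Qed.

End MultilinAd.

Variables (P : set G) (p : {vspace lie G}).
Hypothesis Pnorm : P `<=` normalizer p.
(** Tangency of p to P, phrased by functions that vanish on P; it is established in
    [lvf_subgroup]. *)
Hypothesis lvfP : forall Z h, Z \in p -> smooth h -> (forall q : G, P q -> h q = 0) ->
  lvf Z h 1%g = 0.

Section Basic.
Variables (V : vectType R) (k : nat) (w : G -> ('I_k -> lie G) -> V).
Hypothesis wB : bundle_form P p (fun _ => @id V) w.

Let wmod x : alternating_mod p (w x). Proof. by have [h _ _] := wB. Qed.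
Let walt x : alternating_map (w x). Proof. by have [] := wmod x. Qed.
Let wM x : multilin (w x). Proof. exact: alternating_multilin. Qed.
Let ws x : signed (w x). Proof. exact: alternating_signed. Qed.
Let wsm X : smoothv (fun x => w x X). Proof. by have [_ h _] := wB; exact: h. Qed.
Let weq x h X : P h -> w (x * h)%g X = w x (Ad h \o X).
Proof. by have [_ _ H] := wB; exact: H. Qed.

(** The function q |-> w (x q) X - w x (Ad q X) vanishes on P by equivariance, so [lvfP] applies;
    the derivative of its second part is the [slot_sum]. *)
Lemma infinitesimal_invariance Z x X : Z \in p ->
  vd Z (fun y => w y X) x = slot_sum (br Z) (w x) X.
Proof.
move=> Zp; apply: vcoord_inj => b; rewrite vcoord_vderiv.
pose g (Y : 'I_k -> lie G) : R^o := vcoord b (w x Y).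
have gM : multilin g by move=> Y i c y z; rewrite /g wM linearP.
have -> : vcoord b (slot_sum (br Z) (w x) X) = slot_sum (br Z) g X by rewrite vcoordS.
rewrite -(lvf_multilin_Ad X gM) -[in LHS](mulg1 x) -lvf_left; last exact: wsm.
have s1 : smooth (fun q : G => vcoord b (w (x * q)%g X)).
  exact: (smooth_lmul x (wsm X b)).
have s2 := smooth_multilin_Ad X gM.
have := lvfP (h := fun q => vcoord b (w (x * q)%g X) + (- 1) * g (Ad q \o X)) Zp.
rewrite lvf_add ?lvf_scale ?mulN1r//; last exact: smooth_scale.
move=> H; apply/eqP; rewrite -subr_eq0; apply/eqP; apply: H.
  by apply: smooth_add => //; exact: smooth_scale.
by move=> q Pq; rewrite weq// mulN1r subrr.
Qed.

Lemma ext_term_linear x X : linear (fun Z => et w x Z X).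
Proof.
move=> c Z Z'; rewrite /ext_term (vderiv_linX _ (wsm X)).
have -> : slot_sum (br (c *: Z + Z')) (w x) X =
    c *: slot_sum (br Z) (w x) X + slot_sum (br Z') (w x) X.
  rewrite /slot_sum scaler_sumr -big_split; apply: eq_bigr => l _ /=.
  by rewrite brDl brZl; exact: wM.
by rewrite [2^-1 *: (_ + _)]scalerDr opprD addrACA scalerBr !scalerA [2^-1 * c]mulrC.
Qed.

Lemma ext_term_alternating x Z : alternating_map (et w x Z).
Proof.
have sM := slot_sum_multilin (br Z) (wM x); have sS := slot_sum_signed (br Z) (ws x).
apply: alternatingP => [X i c y z|X s]; rewrite /ext_term.
  have -> : (fun u => w u (upd X i (c *: y + z))) =
      fun u => c *: w u (upd X i y) + w u (upd X i z) by apply/funext => u; exact: wM.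
  rewrite sM.
  rewrite vderiv_comb//.
  by rewrite [2^-1 *: (_ + _)]scalerDr opprD addrACA scalerBr !scalerA [2^-1 * c]mulrC.
rewrite sS scalerBr !scalerA [2^-1 * _]mulrC; congr (_ - _).
rewrite -vderivZ//; congr (vd Z _ x); apply/funext => y; exact: ws.
Qed.

Lemma ext_d_altsum x X : ed w x X =
  k`!%:R^-1 *: altsum (fun Y : 'I_k.+1 -> lie G => et w x (Y ord0) (Y \o lift ord0)) X.
Proof.
rewrite (ext_dE (@lvf R G) (@brC R G))// altsum_first scaler_sumr.
apply: eq_bigr => i _; rewrite scalerA mulrC -scalerA; congr (_ *: _).
rewrite (eq_altsum (Psi' := et w x (X i))) => [|Y]; last by rewrite ins_id ins_liftE.
rewrite (altsum_of_signed _ (alternating_signed (ext_term_alternating x (X i)))).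
by rewrite scalerA mulVf ?scale1r// pnatr_eq0 -lt0n fact_gt0.
Qed.

Lemma ext_d_alternating x : alternating_map (ed w x).
Proof.
have PsiM : multilin (fun Y : 'I_k.+1 -> lie G => et w x (Y ord0) (Y \o lift ord0)).
  move=> Y i c y z; case: (unliftP ord0 i) => [l|] ->.
    have E u : upd Y (lift ord0 l) u \o lift ord0 = upd (Y \o lift ord0) l u.
      by apply/funext => q; rewrite /upd /= (inj_eq (@lift_inj _ ord0)).
    rewrite !E /upd (negbTE (neq_lift _ _)).
    exact: (alternating_multilin (ext_term_alternating x (Y ord0))).
  by rewrite !updE !ins_id !ins_liftE ext_term_linear.
apply: alternatingP => [X i c y z|X s]; rewrite !ext_d_altsum.
  by rewrite (altsum_multilin PsiM) scalerDr !scalerA mulrC.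
by rewrite altsum_signed !scalerA mulrC.
Qed.

(** Move the argument Z in p to the front. By infinitesimal invariance, its own term is half of the
    [slot_sum] for ad Z. In the term of another argument Y, the slot of Z is differentiated away and
    only the bracket [Y, Z] survives; these terms give the opposite half. *)
Lemma ext_d_mod x : alternating_mod p (ed w x).
Proof.
split; first exact: ext_d_alternating.
move=> X i Xi; rewrite (signed_front i X (alternating_signed (ext_d_alternating x))).
move: (X i) Xi (X \o lift i) => Z Zp Y.
suff -> : ed w x (ins ord0 Z Y) = 0 by rewrite scaler0.
rewrite (ext_dE (@lvf R G) (@brC R G))// big_ord_recl expr0 scale1r ins_id ins_liftE.
rewrite /ext_term infinitesimal_invariance//.
have half (U : lmodType R) (u : U) : u - 2^-1 *: u = 2^-1 *: u.
  rewrite -[X in X - _]scale1r -scalerBl; congr (_ *: _); lra.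
rewrite half {1}/slot_sum scaler_sumr -big_split big1// => l _ /=.
rewrite ins_lift.
case: k w wB wmod walt wM ws wsm weq Y l => [|k'] w' wB' wmod' walt' wM' ws' wsm' weq' Y l.
  by case: l.
rewrite updE (signed_ins _ _ _ (ws' x)).
have -> : ins ord0 Z Y \o lift (lift ord0 l) = ins ord0 Z (Y \o lift l).
  apply/funext => q; case: (unliftP ord0 q) => [q'|] ->.
    have E : lift (lift ord0 l) (lift ord0 q') = lift ord0 (lift l q').
      by apply: val_inj; rewrite /= /bump; case: leqP; case: leqP => //=; lia.
    by rewrite /= E !ins_lift.
  have E : lift (lift ord0 l) ord0 = ord0 by apply: val_inj.
  by rewrite /= E !ins_id.
have [_ w0] := wmod' x.
have -> : vd (Y l) (fun u => w' u (ins ord0 Z (Y \o lift l))) x = 0.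
  rewrite (_ : (fun u => _) = fun=> 0); last first.
    apply/funext => u; have [_ h] := wmod' u; apply: (h _ ord0); by rewrite ins_id.
  by rewrite /vderiv big1// => b _; under eq_fun do rewrite linear0; rewrite lvf_cst scale0r.
rewrite slot_sum_ins.
rewrite [slot_sum _ _ (Y \o _)]big1 => [|q _]; last by apply: (w0 _ ord0); rewrite ins_id.
rewrite addr0 sub0r (brC (Y l)).
have -> : w' x (ins ord0 (- br Z (Y l)) (Y \o lift l)) = - w' x (ins ord0 (br Z (Y l)) (Y \o lift l)).
  by rewrite -(upd_ins ord0 0) (multilinN _ _ _ (wM' x)) upd_ins.
rewrite [2^-1 *: - _]scalerN opprK.
rewrite exprS mulN1r scaleNr; move: (w' x _) => u; rewrite !scalerA mulrC.
exact: subrr.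
Qed.

Lemma smoothv_ext_d X : smoothv (fun x => ed w x X).
Proof.
rewrite (_ : (fun x => _) = fun x => \sum_(i < k.+1) (-1) ^+ i *:
    et w x (X i) (X \o lift i)); last first.
  by apply/funext => x; exact: (ext_dE (@lvf R G) (@brC R G)).
apply: smoothv_sum => i; apply: smoothvZ; first exact: smooth_cst.
rewrite /ext_term; under eq_fun do rewrite addrC -scaleNr.
apply: smoothv_comb; first by apply: smoothv_sum => l; exact: wsm.
move=> b; under eq_fun do rewrite vcoord_vderiv.
by apply: lvf_smooth; exact: wsm.
Qed.

Lemma ext_d_equivariant x h X : P h -> ed w (x * h)%g X = ed w x (Ad h \o X).
Proof.
move=> Ph; rewrite !(ext_dE (@lvf R G) (@brC R G))//; apply: eq_bigr => i _; congr (_ *: _).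
rewrite /ext_term; congr (_ - _ *: _).
  apply: vcoord_inj => b; rewrite !vcoord_vderiv AdE; last exact: wsm.
  congr (lvf _ _ _); apply/funext => y; rewrite -weq//; first by rewrite mulgVK.
rewrite /slot_sum; apply: eq_bigr => l _; rewrite weq//; congr (w x _).
by apply/funext => q; rewrite /= /upd; case: eqP => //= _; rewrite Ad_br.
Qed.

Lemma ext_d_basic : bundle_form P p (fun _ => @id V) (ed w).
Proof.
split; [exact: ext_d_mod|exact: smoothv_ext_d|].
by move=> x h X Ph; exact: ext_d_equivariant.
Qed.

End Basic.

Section Representation.
Variables (V : vectType R) (r : G -> 'End(V)).
Hypothesis rr : representation r.

Lemma rep1 v : r 1%g v = v.
Proof. by have [-> _ _] := rr; rewrite id_lfunE. Qed.

Lemma repM x y v : r (x * y)%g v = r x (r y v).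
Proof. by have [_ -> _] := rr; rewrite comp_lfunE. Qed.

Lemma repVK x v : r (x^-1)%g (r x v) = v.
Proof. by rewrite -repM mulVg rep1. Qed.

Lemma repKV x v : r x (r (x^-1)%g v) = v.
Proof. by rewrite -repM mulgV rep1. Qed.

Lemma smoothv_rep : smoothv r.
Proof. by apply: smoothv_hom => v b; have [_ _ h] := rr; exact: h. Qed.

Lemma smoothv_repV : smoothv (fun x => r (x^-1)%g).
Proof. by move=> b; exact: (smooth_inv (smoothv_rep b)). Qed.

Lemma drep_linear Z : linear (drep (fun g => r g) Z).
Proof.
move=> c u v; rewrite /drep -vderiv_comb; last first.
- by move=> b; have [_ _ h] := rr; exact: h.
- by move=> b; have [_ _ h] := rr; exact: h.
by congr (vd Z _ _); apply/funext => x; rewrite linearP.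
Qed.

Lemma drep_linear_l v : linear (fun Z => drep (fun g => r g) Z v).
Proof. by apply: vderiv_linX => b; have [_ _ h] := rr; exact: h. Qed.

Lemma drepE Z v : drep (fun g => r g) Z v = (vd Z r 1%g) v.
Proof.
pose ev (T : 'End(V)) : V := T v.
have evl : linear ev by move=> c T T'; rewrite /ev add_lfunE scale_lfunE.
exact: (vderiv_linear Z (HB.pack_for {linear 'End(V) -> V} ev
  (GRing.isLinear.Build R 'End(V) V _ ev evl)) 1%g smoothv_rep).
Qed.

Lemma drep_Ad h Z v :
  drep (fun g => r g) Z (r (h^-1)%g v) = r (h^-1)%g (drep (fun g => r g) (Ad h Z) v).
Proof.
have sv : smoothv (fun x => r x v) by move=> b; have [_ _ H] := rr; exact: H.
rewrite /drep -(vderiv_linear (Ad h Z) (r (h^-1)%g))//; apply: vcoord_inj => b.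
rewrite !vcoord_vderiv AdE; last exact: (smoothv_linear (r (h^-1)%g) sv).
pose F (y : G) := vcoord b (r (h^-1)%g (r (y * h^-1)%g v)).
have sF : smooth F.
  exact: (smooth_rmul (h^-1)%g (smoothv_linear (r (h^-1)%g) sv b)).
have sE := lvf_left Z h 1%g sF; rewrite mulg1 in sE.
rewrite mul1g -[RHS]/(lvf Z F h) -sE; congr (lvf Z _ _).
by apply/funext => y; rewrite /F -!repM -mulgA mulKg.
Qed.

Variables (k : nat) (f : G -> ('I_k -> lie G) -> V).
Hypothesis fB : bundle_form P p (fun x => r x) f.

Definition trivialized (y : G) (Y : 'I_k -> lie G) : V := r y (f y Y).

Lemma trivialized_basic : bundle_form P p (fun _ => @id V) trivialized.
Proof.
have [fm fs fe] := fB; split.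
- by move=> x; exact: (alternating_mod_comp (r x) (fm x)).
- by move=> X; apply: smoothv_eval; [exact: smoothv_rep|move=> b; exact: fs].
- by move=> x h X Ph; rewrite /trivialized repM fe// repKV.
Qed.

Lemma dV_bundle : bundle_form P p (fun x => r x) (dV r f).
Proof.
have [fm fs fe] := ext_d_basic trivialized_basic; split.
- by move=> x; exact: (alternating_mod_comp (r (x^-1)%g) (fm x)).
- move=> X; apply: (smoothv_eval smoothv_repV) => b; exact: fs.
- move=> x h X Ph; rewrite /dV; have := fe x h X Ph; rewrite /trivialized => ->.
  by rewrite invgM repM.
Qed.

End Representation.

Section HomRepresentation.
Variables (V W : vectType R) (r : G -> 'End(V)).
Hypothesis rr : representation r.

(** G acts through V alone: over a fixed point of G/K, the fibre of W is a constant vector space.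
    For W = R this is the dual representation. *)
Definition hom_rep (x : G) : 'End('Hom(V, W)) := linfun (fun T : 'Hom(V, W) => (T \o r (x^-1)%g)%VF).

Lemma hom_repE x T v : hom_rep x T v = T (r (x^-1)%g v).
Proof.
pose g (T : 'Hom(V, W)) : 'Hom(V, W) := (T \o r (x^-1)%g)%VF.
have gl : linear g.
  by move=> c A B; apply/lfunP => u; rewrite !(comp_lfunE, add_lfunE, scale_lfunE).
have -> : hom_rep x T = g T.
  exact: (lfunE (HB.pack_for {linear 'Hom(V, W) -> 'Hom(V, W)} g
    (GRing.isLinear.Build R _ _ _ g gl))).
by rewrite /g comp_lfunE.
Qed.

Lemma hom_rep_representation : representation hom_rep.
Proof.
split.
- by apply/lfunP => T; apply/lfunP => v; rewrite hom_repE invg1 (rep1 rr) id_lfunE.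
- move=> x y; apply/lfunP => T; apply/lfunP => v.
  by rewrite comp_lfunE !hom_repE invgM (repM rr).
- move=> T; rewrite -/(smoothv _); apply: smoothv_hom => v.
  under eq_fun do rewrite hom_repE.
  apply: smoothv_linear => b; have [_ _ h] := rr; exact: (smooth_inv (h v b)).
Qed.

Lemma drep_hom Z T v : drep (fun g => hom_rep g) Z T v = - T (drep (fun g => r g) Z v).
Proof.
have sV : smoothv (fun x => r (x^-1)%g v).
  by move=> b; have [_ _ h] := rr; exact: (smooth_inv (h v b)).
pose ev (T : 'Hom(V, W)) : W := T v.
have evl : linear ev by move=> c A B; rewrite /ev add_lfunE scale_lfunE.
pose Ev : {linear 'Hom(V, W) -> W} := HB.pack_for {linear 'Hom(V, W) -> W} ev
  (GRing.isLinear.Build R _ _ _ ev evl).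
have sT : smoothv (fun x => hom_rep x T).
  by move=> b; have [_ _ h] := hom_rep_representation; exact: h.
rewrite -[LHS]/(Ev _) /drep -(vderiv_linear Z Ev 1%g sT).
under [X in vd Z X]eq_fun do rewrite /Ev/= /ev hom_repE.
rewrite (vderiv_linear Z T 1%g sV) -linearN; congr (T _).
have H : vd Z (fun x => r x (r (x^-1)%g v)) 1%g = 0.
  under eq_fun do rewrite (repKV rr).
  by rewrite /vderiv big1// => b _; rewrite lvf_cst scale0r.
move: H; rewrite (vderiv_eval Z 1%g (smoothv_rep rr) sV) invg1 !(rep1 rr) -(drepE rr) => /eqP.
by rewrite addr_eq0 -eqr_oppLR => /eqP.
Qed.

Lemma contract_wedge_basic j k (f : G -> ('I_j -> lie G) -> 'Hom(V, W))
    (g : G -> ('I_k -> lie G) -> V) :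
  bundle_form P p (fun x => hom_rep x) f -> bundle_form P p (fun x => r x) g ->
  bundle_form P p (fun _ => @id W) (fun y => contract_wedge (f y) (g y)).
Proof.
move=> [fm fs fe] [gm gs ge]; split.
- by move=> x; exact: contract_wedge_mod.
- by move=> X; apply: smoothv_wedge => Y b; [exact: fs|exact: gs].
- move=> x h X Ph; rewrite /contract_wedge; congr (_ *: _); apply: eq_bigr => s _.
  by congr (_ *: _); rewrite fe// ge// hom_repE invgK (repKV rr).
Qed.

(** Contraction is invariant, so the trivialized forms have the same wedge product as the forms
    themselves, and the Leibniz rule applies in the trivialization. *)
Lemma dV_wedge j k (f : G -> ('I_j -> lie G) -> 'Hom(V, W)) (g : G -> ('I_k -> lie G) -> V) x
    (Y : 'I_(j + k).+1 -> lie G) :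
  bundle_form P p (fun x => hom_rep x) f -> bundle_form P p (fun x => r x) g ->
  ed (fun y => contract_wedge (f y) (g y)) x Y =
  contract_wedge (dV hom_rep f x) (g x) (Y : 'I_(j.+1 + k) -> lie G) +
  (-1) ^+ j *: contract_wedge (f x) (dV r g x) (Y \o cast_ord (addnS j k)).
Proof.
move=> fB gB; have hr := hom_rep_representation.
have [fm fs fe] := trivialized_basic hr fB; have [gm gs ge] := trivialized_basic rr gB.
have -> : (fun y => contract_wedge (f y) (g y)) =
    fun y => contract_wedge (trivialized hom_rep f y) (trivialized r g y).
  apply/funext => y; apply/funext => X; rewrite /contract_wedge; congr (_ *: _).
  apply: eq_bigr => s _; congr (_ *: _).
  by rewrite /trivialized hom_repE (repVK rr).
rewrite ext_d_wedge; first last.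
- by have [] := gm x.
- by have [] := fm x.
- by move=> X b; exact: gs.
- by move=> X b; exact: fs.
congr (_ + _ *: _); rewrite /contract_wedge; congr (_ *: _); apply: eq_bigr => s _; congr (_ *: _).
  by rewrite /trivialized /dV hom_repE invgK.
by rewrite /trivialized /dV hom_repE.
Qed.

End HomRepresentation.

Lemma dual_rep_hom (V : vectType R) (r : G -> 'End(V)) :
  dual_rep r = fun x => hom_rep R^o r x.
Proof.
by apply/funext => x; apply/funext => l; apply/lfunP => v; rewrite hom_repE comp_lfunE.
Qed.

Section CodifferentialForms.
Variables (m : nat) (gr : int -> {vspace lie G}).
Hypothesis grG : grading m gr.
Hypothesis ss : semisimple G.
Variable pp : {vspace lie G}.
Hypothesis pE : p = (\sum_(i < m.+1) gr i%:Z)%VS.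
Hypothesis ppN : nilradical p pp.

Lemma dstar_bundle (V : vectType R) (r : G -> 'End(V)) k (f : G -> ('I_k.+1 -> lie G) -> V) :
  representation r -> bundle_form P p (fun x => r x) f ->
  bundle_form P p (fun x => r x) (dstar pp r f).
Proof.
move=> rr [fm fs fe]; have al := drep_linear rr; split.
- by move=> x; exact: (codiff_mod grG ss pE ppN al (fm x)).
- move=> X; rewrite -/(smoothv _) /dstar.
  under eq_fun do rewrite (codiffE grG ss pE ppN al _ (fm _)) -sumrN.
  apply: smoothv_sum => a; rewrite /codiff_term.
  under eq_fun do rewrite opprB -scaleN1r addrC scaleN1r addrC -scaleN1r addrC.
  apply: smoothv_comb; last first.
    under eq_fun do rewrite -[_ *: _]addr0; apply: smoothv_comb; last exact: smoothv_cst.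
    by apply: smoothv_sum => l b; exact: fs.
  pose L := HB.pack_for {linear V -> V} (drep (fun g => r g) (tnth (vbasis pp) a))
    (GRing.isLinear.Build R V V _ (drep (fun g => r g) (tnth (vbasis pp) a)) (al _)).
  by apply: (smoothv_linear L) => b; exact: fs.
- move=> x h X Ph; rewrite /dstar.
  apply: (codiff_equivariant grG ss pE ppN al (drep_linear_l rr) (r := r (h^-1)%g) X
    (Pnorm Ph) (fm x) (fm _)); first by move=> Z v; exact: drep_Ad.
  by move=> Y; exact: fe.
Qed.

(** The expansion over a basis of W commutes with the codifferential because the action on Hom(V, W)
    goes through V only. *)
Lemma dPstarE (V W : vectType R) (r : G -> 'End(V)) l q
    (phi : G -> G -> ('I_l -> lie G) -> ('I_q.+1 -> lie G) -> 'Hom(V, W)) x y X Y :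
  representation r -> alternating_mod p (phi x y X) ->
  dPstar pp r phi x y X Y =
  (-1) ^+ l *: codiff pp (drep (fun g => hom_rep W r g)) (phi x y X) Y.
Proof.
move=> rr fm; rewrite /dPstar; congr (_ *: _); apply/lfunP => v.
rewrite sum_lfunE dual_rep_hom.
have hr := hom_rep_representation R^o rr; have hr' := hom_rep_representation W rr.
rewrite (codiffE grG ss pE ppN (drep_linear hr') Y fm).
rewrite [RHS]vcoord_sum; apply: eq_bigr => b _.
pose cb (T : 'Hom(V, W)) : 'Hom(V, R^o) := linfun (fun v' : V => vcoord b (T v') : R^o).
have cbE T v' : cb T v' = vcoord b (T v').
  pose g (v' : V) : R^o := vcoord b (T v').
  have gl : linear g by move=> c u w; rewrite /g !linearP.
  exact: (lfunE (HB.pack_for {linear V -> R^o} g (GRing.isLinear.Build R V R^o _ g gl))).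
have cbl : linear cb.
  move=> c T T'; apply/lfunP => v'.
  by rewrite add_lfunE scale_lfunE !cbE add_lfunE scale_lfunE linearP.
pose CB : {linear 'Hom(V, W) -> 'Hom(V, R^o)} := HB.pack_for {linear 'Hom(V, W) -> 'Hom(V, R^o)} cb
  (GRing.isLinear.Build R _ _ _ cb cbl).
have cm : alternating_mod p (fun Y' => cb (phi x y X Y')) by exact: (alternating_mod_comp CB fm).
pose F (v : V) : W := codiff pp (drep (fun g => hom_rep R^o r g))
        (fun Y' => cb (phi x y X Y')) Y v *: vbase b.
have Fl : linear F by move=> c u w; rewrite /F linearP scalerDl scalerA.
transitivity (F v).
  exact: (lfunE (HB.pack_for {linear V -> W} F (GRing.isLinear.Build R V W _ F Fl)) v).
rewrite /F (codiffE grG ss pE ppN (drep_linear hr) Y cm); congr (_ *: _).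
rewrite !opp_lfunE !sum_lfunE linearN/= vcoordS; congr (- _); apply: eq_bigr => a _.
rewrite /codiff_term !(add_lfunE, opp_lfunE, scale_lfunE) !(drep_hom rr) !sum_lfunE.
rewrite linearB/= linearN/= cbE vcoordZ vcoordS; congr (_ - _ *: _).
by apply: eq_bigr => i _; rewrite cbE.
Qed.

End CodifferentialForms.
End BasicForms.

(** * Bidegree: (p,q)-forms as forms on the product *)

Section TotalForm.
Variables (R : realType) (a E : vectType R).

Definition split_arg p q (X : 'I_p -> a) (Y : 'I_q -> a) (i : 'I_(p + q)) : a * a :=
  match fintype.split i with inl l => (X l, 0) | inr l => (0, Y l) end.

Lemma split_arg_l p q (X : 'I_p -> a) (Y : 'I_q -> a) l :
  split_arg X Y (lshift q l) = (X l, 0).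
Proof. by rewrite /split_arg -[lshift q l]/(unsplit (inl l)) unsplitK. Qed.

Lemma split_arg_r p q (X : 'I_p -> a) (Y : 'I_q -> a) l :
  split_arg X Y (rshift p l) = (0, Y l).
Proof. by rewrite /split_arg -[rshift p l]/(unsplit (inr l)) unsplitK. Qed.

Definition bi_arg p q (phi : ('I_p -> a) -> ('I_q -> a) -> E) (Z : 'I_(p + q) -> a * a) : E :=
  phi (fun i => (Z (lshift q i)).1) (fun j => (Z (rshift p j)).2).

Lemma bi_arg_multilin p q (phi : ('I_p -> a) -> ('I_q -> a) -> E) :
  (forall Y, multilin (phi^~ Y)) -> (forall X, multilin (phi X)) -> multilin (bi_arg phi).
Proof.
move=> h1 h2 Z i c y z; rewrite /bi_arg; case: (split_ordP i) => l ->.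
  have E1 w : (fun i => (upd Z (lshift q l) w (lshift q i)).1) =
      upd (fun i => (Z (lshift q i)).1) l w.1.
    by apply/funext => j; rewrite /upd (inj_eq (@lshift_inj _ _)); case: eqP.
  have E2 w : (fun j => (upd Z (lshift q l) w (rshift p j)).2) = (fun j => (Z (rshift p j)).2).
    by apply/funext => j; rewrite /upd eq_rlshift.
  by rewrite !E1 !E2 h1.
have E1 w : (fun i => (upd Z (rshift p l) w (lshift q i)).1) = (fun i => (Z (lshift q i)).1).
  by apply/funext => j; rewrite /upd eq_lrshift.
have E2 w : (fun j => (upd Z (rshift p l) w (rshift p j)).2) =
    upd (fun j => (Z (rshift p j)).2) l w.2.
  by apply/funext => j; rewrite /upd (inj_eq (@rshift_inj _ _)); case: eqP.
by rewrite !E1 !E2 h2.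
Qed.

(** A vector tangent to the second factor has first component 0, so it cannot fill a slot of the
    first block; only permutations that preserve the blocks contribute, and there are p! q! of
    them. *)
Lemma altsum_split_arg p q (phi : ('I_p -> a) -> ('I_q -> a) -> E) X Y :
  (forall Y, multilin (phi^~ Y)) -> (forall Y, signed (phi^~ Y)) -> (forall X, signed (phi X)) ->
  altsum (bi_arg phi) (split_arg X Y) = (p`! * q`!)%:R *: phi X Y.
Proof.
elim: p phi X => [|p IH] phi X h1 s1 s2.
  rewrite mul1n -(altsum_of_signed Y (s2 X)); apply: eq_bigr => s _; congr (_ *: _).
  rewrite /bi_arg; congr phi; first by apply/funext; case.
  apply/funext => j /=; have E0 (l : 'I_(0 + q)) : split_arg X Y l = (0, Y l).
    by case: (split_ordP l) => [[]//|l' ->]; rewrite split_arg_r; congr (_, Y _); apply: val_inj.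
  by rewrite E0; congr (Y (s _)); apply: val_inj.
rewrite (@altsum_first _ _ _ (p + q)) (@big_split_ord _ _ _ p.+1 q)/= [X in _ + X]big1 ?addr0 => [|b _]; last first.
  rewrite (_ : altsum _ _ = 0) ?scaler0// /altsum big1// => s _.
  rewrite /bi_arg [phi _ _](multilin0 (i := ord0) (h1 _)) ?scaler0//.
  have -> : lshift q (ord0 : 'I_p.+1) = (ord0 : 'I_(p + q).+1) by apply: val_inj.
  by rewrite ins_id split_arg_r.
have T (i : 'I_p.+1) : (-1) ^+ i *: altsum (fun Z : 'I_(p + q) -> a * a =>
     bi_arg phi (ins (ord0 : 'I_(p + q).+1) (split_arg X Y (lshift q i)) Z))
     (split_arg X Y \o lift (lshift q i : 'I_(p + q).+1)) = (p`! * q`!)%:R *: phi X Y.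
  have -> : split_arg X Y \o lift (lshift q i : 'I_(p + q).+1) = split_arg (X \o lift i) Y.
    apply/funext => l; rewrite /=; case: (split_ordP l) => [l'|l'] ->.
      have -> : lift (lshift q i : 'I_(p + q).+1) (lshift q l') = lshift q (lift i l').
        exact: val_inj.
      by rewrite !split_arg_l.
    have -> : lift (lshift q i : 'I_(p + q).+1) (rshift p l') = rshift p.+1 l'.
      by apply: val_inj; rewrite /= /bump; have := ltn_ord i; lia.
    by rewrite !split_arg_r.
  pose phi' X' Y' := phi (ins ord0 (X i) X') Y'.
  rewrite (eq_altsum (Psi' := bi_arg phi')) => [|Z]; last first.
    rewrite /bi_arg /phi' split_arg_l; congr phi; apply/funext => l.
      case: (unliftP ord0 l) => [l'|] ->.
        have -> : lshift q (lift ord0 l') = lift (ord0 : 'I_(p + q).+1) (lshift q l').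
          exact: val_inj.
        by rewrite !ins_lift.
      have -> : lshift q (ord0 : 'I_p.+1) = (ord0 : 'I_(p + q).+1) by apply: val_inj.
      by rewrite !ins_id.
    have -> : rshift p.+1 l = lift (ord0 : 'I_(p + q).+1) (rshift p l) by apply: val_inj.
    by rewrite ins_lift.
  rewrite IH; first last.
  - by move=> X'; exact: s2.
  - by move=> Y'; exact: (signed_ins0 (X i) (s1 Y')).
  - by move=> Y'; exact: (multilin_ins (X i) (h1 Y')).
  rewrite scalerA mulrC -scalerA /phi'; congr (_ *: _).
  by rewrite -(signed_ins i (X i) _ (s1 Y)) insK.
rewrite (eq_bigr _ (fun i _ => T i)) sumr_const card_ord -[_ *+ p.+1]scaler_nat scalerA.
by rewrite -natrM mulnA -factS.
Qed.

(** Pigeonhole: at most p - 1 arguments have a nonzero first component, and there are p slots to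
    fill with them. *)
Lemma altsum_bi_arg0 p q (phi : ('I_p -> a) -> ('I_q -> a) -> E) (Z : 'I_(p + q) -> a * a) :
  (forall Y, multilin (phi^~ Y)) -> (0 < p)%N ->
  (forall i : 'I_(p + q), (p.-1 <= i)%N -> (Z i).1 = 0) -> altsum (bi_arg phi) Z = 0.
Proof.
move=> h1 p0 Z0; rewrite /altsum big1// => s _.
suff [i hi] : exists i : 'I_p, (p.-1 <= s (lshift q i))%N.
  by rewrite /bi_arg [phi _ _](multilin0 (i := i) (h1 _)) ?scaler0//= Z0.
apply: contrapT => /forallNP h.
have lt (i : 'I_p) : (s (lshift q i) < p.-1)%N by rewrite ltnNge; apply/negP; exact: h.
have inj : injective (fun i : 'I_p => Ordinal (lt i)).
  by move=> i i' /(congr1 val)/= /val_inj/perm_inj/lshift_inj.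
by have := leq_card _ inj; rewrite !card_ord; lia.
Qed.

Lemma nth_split_arg p q (X : 'I_p -> a) (Y : 'I_q -> a) (i : 'I_(p + q)) :
  nth 0 ([seq (X l, 0) | l <- enum 'I_p] ++ [seq (0, Y b) | b <- enum 'I_q]) i =
  split_arg X Y i.
Proof.
rewrite nth_cat size_map size_enum_ord; case: (split_ordP i) => l -> /=.
  rewrite split_arg_l (nth_map l) ?size_enum_ord ?ltn_ord//.
  by rewrite nth_ord_enum.
rewrite split_arg_r addKn (nth_map l) ?size_enum_ord ?ltn_ord//.
by rewrite nth_ord_enum.
Qed.

End TotalForm.

Lemma sum_cast_ord (V : nmodType) m n (e : m = n) (F : 'I_n -> V) :
  \sum_(i < n) F i = \sum_(i < m) F (cast_ord e i).
Proof. by case: n / e F => F; apply: eq_bigr => i _; rewrite cast_ord_id. Qed.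

(** * The operator d_P as a covariant derivative in the second variable *)

Section PartialDerivative.
Variables (R : realType) (G : lieGroup R) (V W : vectType R).
Variables (K P : set G) (hK hP : {vspace lie G}) (rV : G -> 'End(V)) (rW : G -> 'End(W)).
Variables (p q : nat) (phi : G -> G -> ('I_p -> lie G) -> ('I_q -> lie G) -> 'Hom(V, W)).
Hypothesis phiB : biform K P hK hP rV rW phi.
Hypotheses (rVr : representation rV) (rWr : representation rW).

Lemma biform_bundle x X : K 1%g -> bundle_form P hP (fun y => hom_rep W rV y) (phi x ^~ X).
Proof.
move=> K1; have [h1 h2 h3 h4] := phiB; split.
- by move=> y; exact: h2.
- by move=> Y b; exact: (smooth2_r x (h3 X Y b)).
- move=> y h Y Ph; apply/lfunP => v; rewrite hom_repE invgK.
  have := h4 x y 1%g h X Y K1 Ph; rewrite mulg1 => ->.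
  rewrite invg1 !comp_lfunE (rep1 rWr); congr (phi x y _ _ _).
  by apply/funext => i; rewrite Ad1.
Qed.

Local Notation F := (fun (w : G * G) (Z : 'I_(p + q) -> lie G * lie G) =>
  (rW w.1 \o total_form phi w Z \o rV (w.2^-1)%g)%VF).

Let phi1 w Y : multilin (fun X => phi w.1 w.2 X Y).
Proof. by have [h _ _ _] := phiB; have [h1 _] := h w.1 w.2 Y; exact: alternating_multilin. Qed.
Let phi1s w Y : signed (fun X => phi w.1 w.2 X Y).
Proof. by have [h _ _ _] := phiB; have [h1 _] := h w.1 w.2 Y; exact: alternating_signed. Qed.
Let phi2 w X : multilin (phi w.1 w.2 X).
Proof. by have [_ h _ _] := phiB; have [h1 _] := h w.1 w.2 X; exact: alternating_multilin. Qed.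
Let phi2s w X : signed (phi w.1 w.2 X).
Proof. by have [_ h _ _] := phiB; have [h1 _] := h w.1 w.2 X; exact: alternating_signed. Qed.

Let total_formE w Z :
  total_form phi w Z = (p`! * q`!)%:R^-1 *: altsum (bi_arg (phi w.1 w.2)) Z.
Proof. by []. Qed.

Let total_form_split w X Y : total_form phi w (split_arg X Y) = phi w.1 w.2 X Y.
Proof.
rewrite total_formE altsum_split_arg ?scalerA ?mulVf ?scale1r ?pnatr_eq0 -?lt0n ?muln_gt0 ?fact_gt0//.
Qed.

Let F0 w (Z : 'I_(p + q) -> lie G * lie G) : (0 < p)%N ->
  (forall i : 'I_(p + q), (p.-1 <= i)%N -> (Z i).1 = 0) -> F w Z = 0.
Proof.
move=> p0 Z0; rewrite /= total_formE altsum_bi_arg0 ?scaler0//.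
by apply/lfunP => v; rewrite !comp_lfunE zero_lfunE zero_lfunE (linear0 (rW w.1)).
Qed.

Let F_alternating w : alternating_map (F w).
Proof.
apply: alternatingP => [Z i c y z|Z s]; apply/lfunP => v.
  rewrite total_formE (altsum_multilin (bi_arg_multilin (phi1 w) (phi2 w))).
  rewrite add_lfunE scale_lfunE !comp_lfunE !total_formE !scale_lfunE add_lfunE scale_lfunE.
  rewrite -(linearZ_LR (rW w.1)) -(linearD (rW w.1)); congr (rW _ _).
  by rewrite scalerDr !scalerA [c * _]mulrC.
rewrite scale_lfunE !comp_lfunE !total_formE altsum_signed !scale_lfunE -(linearZ_LR (rW w.1)).
by congr (rW _ _); rewrite !scalerA mulrC.
Qed.

Let F_multilin w : multilin (F w). Proof. exact: alternating_multilin. Qed.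

(** In the sum over the arguments of d^E, differentiating along one of the X leaves only p - 1
    vectors tangent to G/K, so that term vanishes. What remains is the sum over the Y, which follow
    the p vectors X, whence (-1)^p. *)
Lemma dPE x y X Y : K 1%g -> dP rV rW phi x y X Y =
  (-1) ^+ p *: dV (hom_rep W rV) (phi x ^~ X) y Y.
Proof.
move=> K1; have hr := hom_rep_representation W rVr.
have fB := trivialized_basic hr (biform_bundle x X K1).
set f := trivialized _ _ in fB; have [fm fs _] := fB.
pose Z (i : 'I_(p + q).+1) : lie G * lie G := split_arg X Y (cast_ord (esym (addnS p q)) i).
rewrite /dP (_ : (fun i : 'I_(p + q).+1 => nth _ _ i) = Z); last first.
  by apply/funext => i; rewrite /Z -nth_split_arg.
rewrite /dE /dV -/(trivialized _ _) -/f (ext_dE (@lvf R G) (@brC R G)); last by have [] := fm y.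
have br2C (z z' : lie G * lie G) : br2 z z' = - br2 z' z by rewrite /br2 (brC z.1) (brC z.2).
rewrite (ext_dE (@lvf2 R G) br2C); last exact: F_alternating.
pose L (T : 'Hom(V, W)) : 'Hom(V, W) := (rW x \o T)%VF.
have Ll : linear L.
  by move=> c A B; apply/lfunP => v; rewrite !(comp_lfunE, add_lfunE, scale_lfunE) linearP.
pose LL : {linear 'Hom(V, W) -> 'Hom(V, W)} := HB.pack_for {linear 'Hom(V, W) -> 'Hom(V, W)} L
  (GRing.isLinear.Build R _ _ _ L Ll).
have FE y' Y' : F (x, y') (split_arg X Y') = LL (f y' Y').
  by apply/lfunP => v; rewrite total_form_split /LL/= /L !comp_lfunE /f /trivialized hom_repE.
rewrite (sum_cast_ord (esym (esym (addnS p q)))) big_split_ord/= [X in X + _]big1 ?add0r => [|l _]; last first.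
  set i := cast_ord _ _; rewrite /ext_term.
  have p0 : (0 < p)%N by have := ltn_ord l; lia.
  have Zi : Z i = (X l, 0).
    by rewrite /Z -(split_arg_l X Y); congr split_arg; apply: val_inj.
  have Z0 (q' : 'I_(p + q)) : (p.-1 <= q')%N -> (Z (lift i q')).1 = 0.
    move=> pq; have q'E : (q' - p.-1 < q.+1)%N by have := ltn_ord q'; lia.
    rewrite /Z (_ : cast_ord _ _ = rshift p (Ordinal q'E)) ?split_arg_r//.
    by apply: val_inj; rewrite /= /bump; have := ltn_ord l; lia.
  have -> : (fun w => F w (Z \o lift i)) = fun=> 0.
    by apply/funext => w; exact: F0.
  rewrite /slot_sum big1 => [|q' _]; last first.
    apply: F0 => // q'' pq; rewrite /upd; case: eqP => [<-|_]; last exact: Z0.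
    by rewrite /= Z0// linear0.
  rewrite scaler0 subr0 /vderiv big1 ?scaler0// => b _.
  by rewrite (linear0 (vcoord b)) /lvf2 !lvf_cst addr0 scale0r.
rewrite (eq_bigr (fun b : 'I_q.+1 => (-1) ^+ p *: LL ((-1) ^+ b *:
    ext_term (@br R G) (@lvf R G) f y (Y b) (Y \o lift b)))) => [|b _]; last first.
  set i := cast_ord _ _; rewrite [in RHS]linearZ/= scalerA -exprD; congr (_ *: _).
  have Zi : Z i = (0, Y b).
    by rewrite /Z -(split_arg_r X Y); congr split_arg; apply: val_inj.
  have Zl : Z \o lift i = split_arg X (Y \o lift b).
    apply/funext => l; rewrite /= /Z; case: (split_ordP l) => l' ->.
      rewrite (_ : cast_ord _ _ = lshift q.+1 l') ?split_arg_l//.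
      by apply: val_inj; rewrite /= /bump; have := ltn_ord l'; lia.
    rewrite (_ : cast_ord _ _ = rshift p (lift b l')) ?split_arg_r//.
    by apply: val_inj; rewrite /= /bump; lia.
  rewrite Zi Zl /ext_term -[L _]/(LL _) linearB (linearZ_LR LL); congr (_ - _ *: _).
    rewrite -(vderiv_linear _ LL); last by move=> c; exact: fs.
    apply: vcoord_inj => c; rewrite vcoord_vderiv.
    rewrite /vderiv vcoordS (bigD1 c)//= vcoordZ vcoord_vbase eqxx mulr1.
    rewrite big1 ?addr0 => [|d dc]; last by rewrite vcoordZ vcoord_vbase eq_sym (negbTE dc) mulr0.
    rewrite /lvf2/= lvf0X ?add0r; last first.
      under [X in smooth X]eq_fun do rewrite total_form_split /=.
      move: c; rewrite -/(smoothv _); apply: smoothv_hom => v; under eq_fun do rewrite !comp_lfunE.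
      apply: smoothv_eval; first exact: smoothv_rep.
      apply: smoothv_eval; last exact: smoothv_cst.
      by have [_ _ h _] := phiB; move=> d; exact: (smooth2_l y (h X (Y \o lift b) d)).
    congr (lvf _ _ _); apply/funext => y'; congr (vcoord c _); exact: FE.
  rewrite /slot_sum linear_sum big_split_ord/= big1 ?add0r => [|l _]; last first.
    apply: (multilin0 (i := lshift q l) (F_multilin (x, y))).
    by rewrite /upd eqxx split_arg_l /br2/= br0l linear0.
  apply: eq_bigr => l _; rewrite split_arg_r -[L _]/(LL _) -FE; congr (F (x, y) _).
  apply/funext => l'; rewrite /upd; case: (split_ordP l') => l'' ->.
    by rewrite eq_lrshift !split_arg_l.
  rewrite (inj_eq (@rshift_inj _ _)) !split_arg_r; case: eqP => // _.
  by rewrite /br2/= br0l.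
rewrite -scaler_sumr -linear_sum; apply/lfunP => v.
rewrite [RHS]scale_lfunE hom_repE invgK comp_lfunE comp_lfunE scale_lfunE linearZ/=.
congr (_ *: _); by rewrite /L comp_lfunE (repVK rWr).
Qed.

End PartialDerivative.

(** * The big cell and its coordinate functions *)

Section ImplicitFunction.
Variables (R : realType) (N n : nat).
Implicit Types (z : 'rV[R]_N) (u v w : 'rV[R]_n).

(** The distance |u - T u| attains its minimum on the compact ball; at T u it is at most half as
    large, so the minimum is 0. *)
Lemma contraction_fixpoint (T : 'rV[R]_n -> 'rV[R]_n) (r : R) : 0 < r ->
  (forall u v, `|u| <= r -> `|v| <= r -> `|T u - T v| <= 2^-1 * `|u - v|) ->
  (forall u, `|u| <= r -> `|T u| <= r) -> exists2 u, `|u| <= r & T u = u.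
Proof.
move=> r0 lip stab; pose B := [set u : 'rV[R]_n | `|u| <= r].
have BE : B = closed_ball_ Num.Def.normr (0 : 'rV[R]_n) r.
  by rewrite eqEsubset; split=> u; rewrite /B/closed_ball_/= sub0r normrN.
have cB : compact B by rewrite BE; exact: compact_closed_ball.
have Tc : {within B, continuous (fun u => `|u - T u| : R)}.
  apply/subspace_continuousP => u Bu; apply/cvgrPdist_lt => e e0.
  have : \forall v \near u, `|u - v| < e / 2.
    by apply/nbhs_ballP; exists (e / 2) => [|v]; rewrite /= ?divr_gt0// -ball_normE.
  apply: filterS => v uv Bv.
  have h := lip u v Bu Bv.
  change (`|(`|u - T u| : R) - (`|v - T v| : R)| < e).
  set a := `|u - T u|; set b := `|v - T v|.
  have : `|a - b| <= `|u - v| + `|T u - T v|.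
    apply: le_trans (ler_dist_dist _ _) _.
    have -> : u - T u - (v - T v) = (u - v) - (T u - T v).
      by apply/rowP => i; rewrite !mxE; ring.
    exact: ler_normB.
  lra.
have B0 : B !=set0 by exists 0; rewrite /B/= normr0 ltW.
have [u] := EVT_min_rV B0 cB Tc.
rewrite inE => Bu umin; exists u => //; apply/eqP; rewrite eq_sym -subr_eq0 -normr_eq0.
have BT : B (T u) by exact: stab.
have h1 := umin _ (mem_set BT); have h2 := lip u (T u) Bu BT.
have := normr_ge0 (u - T u); rewrite le_eqVlt => /orP[/eqP <-//|h3].
lra.
Qed.

Definition mx_bound (B : 'M[R]_(n, N)) : R := \sum_i \sum_j `|B i j|.

Lemma mx_bound_ge0 B : 0 <= mx_bound B.
Proof. by apply: sumr_ge0 => i _; apply: sumr_ge0 => j _. Qed.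

Lemma mulmx_norm u B : `|u *m B| <= mx_bound B * `|u|.
Proof.
apply: row_norm_le => [|j]; first by rewrite mulr_ge0// mx_bound_ge0.
rewrite mxE (le_trans (ler_norm_sum _ _ _))// /mx_bound mulr_suml.
apply: ler_sum => i _; rewrite normrM mulrC ler_pM// ?coord_norm//.
by rewrite (bigD1 j)//= lerDl sumr_ge0.
Qed.

Variables (phi : 'I_n -> 'rV[R]_N -> R) (W : set 'rV[R]_N) (z0 : 'rV[R]_N).
Variable B : 'M[R]_(n, N).
Hypotheses (oW : open W) (Wz0 : W z0) (phiC : forall a, Ck_on 1 W (phi a)).
Hypothesis phiB : forall a i, \sum_j B i j * pderiv j (phi a) z0 = (a == i)%:R.

Let Phi z : 'rV[R]_n := \row_a phi a z.

(** Along the rows of B the differential of Phi at z0 is the identity, so nearby Phi minus the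
    identity has Lipschitz constant 1/2 in these directions, uniformly in z. *)
Lemma local_affine : exists2 r : R, 0 < r & forall z u v,
  `|z - z0| <= r -> `|u| <= r -> `|v| <= r ->
  W (z + u *m B) /\ `|Phi (z + u *m B) - Phi (z + v *m B) - (u - v)| <= 2^-1 * `|u - v|.
Proof.
(* Each of the n coordinates contributes an error of at most e times the distance, and n e <=
   1/2. *)
pose e : R := (2 * n.+1%:R)^-1.
have e0 : 0 < e by rewrite invr_gt0 mulr_gt0// ltr0Sn.
have near1 a i : \forall z \near z0,
    `|\sum_j B i j * pderiv j (phi a) z - (a == i)%:R| <= e.
  have : {for z0, continuous (fun z => \sum_j B i j * pderiv j (phi a) z)}.
    apply: sum_continuous => j; apply: (@continuousM R); first exact: cst_continuous.
    exact: Ck_on_cont (Ck_on_pderiv _ (phiC a)) _ Wz0.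
  move=> /cvgrPdist_le/(_ e e0); rewrite /= phiB; apply: filterS => z.
  by rewrite distrC.
have : \forall z \near z0, W z /\ forall a i,
    `|\sum_j B i j * pderiv j (phi a) z - (a == i)%:R| <= e.
  apply: filterI; first exact: open_nbhs_nbhs.
  apply: (@filter_forall 'rV[R]_N 'I_n (fun a z => forall i,
    `|\sum_j B i j * pderiv j (phi a) z - (a == i)%:R| <= e) (nbhs z0) _) => a.
  apply: (@filter_forall 'rV[R]_N 'I_n (fun i z =>
    `|\sum_j B i j * pderiv j (phi a) z - (a == i)%:R| <= e) (nbhs z0) _) => i.
  exact: near1.
move=> /nbhs_ballP[rho /= rho0 hrho].
pose C := mx_bound B; have C0 : 0 <= C := mx_bound_ge0 B.
(* [mean_value_bound] covers -1 <= t <= 1, where v + t (u - v) has norm up to 3 r; the points z + w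
   B then stay within r + 3 r C < rho of z0. *)
pose r := rho / (3 * C + 2).
have den0 : 0 < 3 * C + 2 by lra.
have r0 : 0 < r by rewrite divr_gt0.
have rrho : r * (3 * C + 2) = rho by rewrite /r divfK// gt_eqF.
exists r => // z u v zr ur vr.
have inb w : `|w| <= 3 * r -> ball z0 rho (z + w *m B).
  move=> wr; rewrite -ball_normE/= distrC.
  have -> : z + w *m B - z0 = (z - z0) + w *m B by rewrite addrAC.
  apply: le_lt_trans (ler_normD _ _) _; rewrite -rrho.
  have := mulmx_norm w B; rewrite -/C => h.
  have : C * `|w| <= C * (3 * r) by rewrite ler_wpM2l.
  nra.
split; first by apply: (hrho _ _).1; apply: inb; lra.
apply: row_norm_le => [|a]; first by rewrite mulr_ge0.
pose g (t : R) := phi a (z + v *m B + t *: ((u - v) *m B)) - t * (u - v) 0 a.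
pose dg (t : R) := \sum_j ((u - v) *m B) 0 j * pderiv j (phi a) (z + v *m B + t *: ((u - v) *m B)) - (u - v) 0 a.
have ptE (t : R) : z + v *m B + t *: ((u - v) *m B) = z + (v + t *: (u - v)) *m B.
  by rewrite -addrA scalemxAl -mulmxDl.
have ptb (t : R) : `|t| <= 1 -> `|v + t *: (u - v)| <= 3 * r.
  move=> t1; rewrite (le_trans (ler_normD _ _))// normrZ.
  have : `|t| * `|u - v| <= 1 * (`|u| + `|v|) by rewrite ler_pM// ler_normB.
  lra.
have dgP (t : R) : `|t| <= `|1 : R| -> is_derive t 1 g (dg t).
  rewrite normr1 => t1; have [Wt _] := hrho _ (inb _ (ptb t t1)); rewrite -ptE in Wt.
  have H : is_derive t 1 (fun t : R => phi a (z + v *m B + t *: ((u - v) *m B)))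
     (\sum_j ((u - v) *m B) 0 j * pderiv j (phi a) (z + v *m B + t *: ((u - v) *m B))).
    apply: (is_derive_comp_row (g := fun t : R => z + v *m B + t *: ((u - v) *m B))
      (dg := fun j => ((u - v) *m B) 0 j) oW (phiC a) Wt) => j.
    have := is_derive_affine ((z + v *m B) 0 j) (((u - v) *m B) 0 j) t.
    by congr is_derive; apply/funext => s; rewrite !mxE.
  have H2 : is_derive t 1 (fun t : R => 0 + t * (u - v) 0 a) ((u - v) 0 a) by exact: is_derive_affine.
  have := is_deriveB H H2; congr is_derive.
  apply/funext => s; change (phi a (z + v *m B + s *: ((u - v) *m B)) - (0 + s * (u - v) 0 a) = g s).
  by rewrite add0r.
have dgb (t : R) : `|t| <= `|1 : R| -> `|dg t| <= 2^-1 * `|u - v|.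
  rewrite normr1 => t1; have [_ hd] := hrho _ (inb _ (ptb t t1)).
  have -> : dg t = \sum_i (u - v) 0 i * (\sum_j B i j * pderiv j (phi a) (z + (v + t *: (u - v)) *m B) - (a == i)%:R).
    transitivity (\sum_i ((u - v) 0 i * (\sum_j B i j * pderiv j (phi a) (z + (v + t *: (u - v)) *m B))) - \sum_i (u - v) 0 i * (a == i)%:R).
      rewrite /dg ptE; congr (_ - _).
        under eq_bigr => j _ do rewrite mxE mulr_suml.
        rewrite exchange_big; apply: eq_bigr => i _ /=; rewrite mulr_sumr.
        by apply: eq_bigr => j _; rewrite mulrA.
      rewrite (bigD1 a)//= eqxx mulr1 big1 ?addr0// => i ia.
      by rewrite eq_sym (negbTE ia) mulr0.
    by rewrite -sumrB; apply: eq_bigr => i _; rewrite mulrBr.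
  apply: (le_trans (ler_norm_sum _ _ _)).
  apply: (@le_trans _ _ (\sum_(i < n) `|u - v| * e)).
    by apply: ler_sum => i _; rewrite normrM ler_pM// coord_norm.
  rewrite sumr_const card_ord -[_ *+ n]mulr_natr -mulrA mulrC ler_wpM2r//.
  rewrite /e invfM -mulrA ler_piMr ?invr_ge0// mulrC ler_pdivrMr ?ltr0Sn// mul1r.
  by rewrite ler_nat.
have := mean_value_bound dgP dgb; rewrite normr1 mulr1.
rewrite /g !scale1r !scale0r addr0 mul1r mul0r subr0 !mxE.
have -> : z + v *m B + (u - v) *m B = z + u *m B by rewrite -addrA -mulmxDl subrKC.
by rewrite addrAC.
Qed.

(* The inverse function theorem in the directions of B, with z as parameter. *)
Lemma implicit_function : Phi z0 = 0 -> exists2 r : R, 0 < r &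
  (forall z u, `|z - z0| <= r -> `|u| <= r -> W (z + u *m B)) /\
  (forall z u v, `|z - z0| <= r -> `|u| <= r -> `|v| <= r ->
     `|u - v| <= 2 * `|Phi (z + u *m B) - Phi (z + v *m B)|) /\
  (forall z w, `|z - z0| <= r -> `|w - Phi z| <= r / 2 ->
     exists2 u, `|u| <= 2 * `|w - Phi z| & Phi (z + u *m B) = w).
Proof.
move=> Phi0; have [r r0 hr] := local_affine.
exists r => //; split; [|split].
- by move=> z u zr ur; exact: (hr z u u zr ur ur).1.
- move=> z u v zr ur vr; have [_ h] := hr z u v zr ur vr.
  set D := Phi _ - Phi _ in h *; have := ler_normB D (D - (u - v)).
  have -> : D - (D - (u - v)) = u - v by rewrite opprB addrC subrK.
  move=> h2; lra.
move=> z w zr wr.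
pose T u := u - (Phi (z + u *m B) - w).
have lip u v : `|u| <= r -> `|v| <= r -> `|T u - T v| <= 2^-1 * `|u - v|.
  move=> ur vr; have [_] := hr z u v zr ur vr; congr (_ <= _).
  rewrite -normrN; congr `| _ |; apply/rowP => a; rewrite !mxE; ring.
have T0 : T 0 = w - Phi z by rewrite /T mul0mx addr0 sub0r opprB.
have stab u : `|u| <= r -> `|T u| <= r.
  move=> ur; have := lip u 0 ur; rewrite normr0 subr0 => /(_ (ltW r0)).
  by have := ler_normD (T u - T 0) (T 0); rewrite subrK T0 => h1 h2; lra.
have [u ur Tu] := contraction_fixpoint r0 lip stab.
have PE : Phi (z + u *m B) = w.
  apply/eqP; rewrite -subr_eq0; apply/eqP.
  by have /eqP := Tu; rewrite -subr_eq0 /T addrAC subrr sub0r oppr_eq0 => /eqP.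
exists u => //.
have n0 : `|0 : 'rV[R]_n| <= r by rewrite normr0 ltW.
have [_] := hr z u 0 zr ur n0; rewrite mul0mx addr0 subr0 PE => h.
have := ler_normB (w - Phi z) (w - Phi z - u).
have -> : w - Phi z - (w - Phi z - u) = u by rewrite opprB addrC subrK.
by move=> h2; lra.
Qed.

End ImplicitFunction.

(** * The big cell: elements y with Ad(y) p complementary to g_- *)

Section Flag.
Variables (R : realType) (G : lieGroup R) (m : nat) (gr : int -> {vspace lie G}).
Hypothesis grG : grading m gr.
Hypothesis ss : semisimple G.
Variable p : {vspace lie G}.
Hypothesis pE : p = (\sum_(i < m.+1) gr i%:Z)%VS.
Variable E : lie G.
Hypothesis EE : forall v, br E v = weight_op m gr v.
Implicit Types (X Y Z v w : lie G) (x y : G).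

Local Notation d := (\dim {:lie G}).
Local Notation negp := (negproj m gr).
Local Notation is_neg := (deg_le m gr (- 1)).

Lemma weight_op_neg_inj v : is_neg v -> br E v \in p -> v = 0.
Proof.
move=> hv; rewrite EE => /(parabolicP grG pE) h; apply: (gcomp_eq0 grG) => i.
have [i0|i0] := ltP i 0; last by apply: hv; lia.
have := h i i0; rewrite (gcomp_weight grG) => /eqP.
by rewrite scaler_eq0 intr_eq0 => /orP[|/eqP//]; lia.
Qed.

(** Two coframes are needed: c is dual to e, while lam is dual to the vectors [E, e_b], since the
    projection of E to g_- along Ad(y) p has derivative [E, X] modulo p at y = 1 in direction X. *)
Lemma weight_frame n : (n = d - \dim p)%N ->
  exists (e : 'I_n -> lie G) (c lam : 'I_n -> {linear lie G -> R^o}),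
  [/\ forall a b, c a (e b) = (a == b)%:R,
      forall v, v \in p <-> forall a, c a v = 0,
      forall v, v \in p <-> forall a, lam a v = 0,
      forall a b, lam a (br E (e b)) = (a == b)%:R
    & forall a, is_neg (e a)].
Proof.
move=> /(complement_frame grG pE)[e0 [c0 [ce cp cD cN en]]].
have ex b : exists2 v, is_neg v & br E v = e0 b.
  pose wt (s : 'I_m.*2.+1) : int := s%:Z - m%:Z.
  (* On g_- all weights are nonzero, so ad E is inverted degree by degree. *)
  exists (\sum_(s < m.*2.+1 | wt s < 0) ((wt s)%:~R)^-1 *: gcomp m gr (wt s) (e0 b)).
    elim/big_ind: _ => [|u w|s s0]; [exact: deg_le0|exact: deg_leD|].
    by apply: deg_leZ; apply: (deg_le_gr grG (gcomp_mem _ _ _ _)); lia.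
  rewrite -[RHS](negproj_id grG pE (en b)) linear_sum; apply: eq_bigr => s s0 /=.
  rewrite linearZ/= EE (weight_op_gr grG (gcomp_mem _ _ _ _)) scalerA mulVf ?scale1r//.
  by rewrite intr_eq0; move: s0; rewrite /wt; lia.
have [e he] := choice (fun b => let: ex_intro2 v h1 h2 := ex b in ex_intro _ v (conj h1 h2)).
pose c a v : R^o := c0 a (br E (negp v)).
have cl a : linear (c a) by move=> t u v; rewrite /c !linearP.
pose C a : {linear lie G -> R^o} := HB.pack_for {linear lie G -> R^o} (c a)
  (GRing.isLinear.Build R (lie G) R^o _ (c a) (cl a)).
exists e, C, c0; split=> //.
- by move=> a b; rewrite /C/= /c (negproj_id grG pE (he b).1) (he b).2.
- move=> v; split=> [/(negproj_p grG pE) h a|h]; first by rewrite /C/= /c h !linear0.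
  apply/(negproj_p grG pE); apply: weight_op_neg_inj; first exact: negproj_deg.
  by apply/cp => a; exact: h.
- by move=> a b; rewrite (he b).2.
- by move=> a; exact: (he a).1.
Qed.

(** Ad y on p and the identity on g_-; it is invertible exactly when Ad(y) p is a complement of
    g_-. *)
Definition flag_op y v : lie G := Ad y (v - negp v) + negp v.

Lemma flag_op_linear y : linear (flag_op y).
Proof.
move=> c u v; rewrite /flag_op (linearP (negproj m gr)) opprD addrACA -scalerBr.
by rewrite linearP scalerDr addrACA.
Qed.

HB.instance Definition _ y := GRing.isLinear.Build R (lie G) (lie G) _ (flag_op y)
  (flag_op_linear y).

Definition flag_mx y : 'M[R]_d := \matrix_(i, j) vcoord j (flag_op y (vbase i)).

(** The g_- part of this vector is the projection of v to g_- along Ad(y) p. The inverse is taken on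
    matrices, so that it depends smoothly on y in the big cell. *)
Definition flag_inv y v : lie G :=
  \sum_j (\sum_i vcoord i v * invmx (flag_mx y) i j) *: vbase j.

Definition big_cell : set G := [set y | flag_mx y \in unitmx].

Let rv v : 'rV[R]_d := \row_j vcoord j v.

Let rvK v : \sum_j rv v 0 j *: vbase j = v.
Proof. by rewrite [RHS]vcoord_sum; apply: eq_bigr => j _; rewrite mxE. Qed.

Let vrK (r : 'rV[R]_d) : rv (\sum_j r 0 j *: vbase j) = r.
Proof.
apply/rowP => j; rewrite mxE (linear_sum (vcoord j)) (bigD1 j)//= big1 ?addr0 => [|i ij].
  by rewrite linearZ/= vcoord_vbase eqxx [LHS]mulr1.
by rewrite linearZ/= vcoord_vbase eq_sym (negbTE ij) [LHS]mulr0.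
Qed.

Let rv_op y v : rv (flag_op y v) = rv v *m flag_mx y.
Proof.
apply/rowP => k; rewrite !mxE {1}(vcoord_sum v) linear_sum (linear_sum (vcoord k)).
by apply: eq_bigr => j _; rewrite !mxE linearZ/= linearZ.
Qed.

Let inv_rv y v : flag_inv y v = \sum_j (rv v *m invmx (flag_mx y)) 0 j *: vbase j.
Proof.
by apply: eq_bigr => j _; congr (_ *: _); rewrite mxE; apply: eq_bigr => i _; rewrite mxE.
Qed.

Lemma flag_inv_linear y : linear (flag_inv y).
Proof.
move=> c u v; rewrite !inv_rv scaler_sumr -big_split; apply: eq_bigr => j _ /=.
have -> : rv (c *: u + v) = c *: rv u + rv v.
  by apply/rowP => i; rewrite !mxE linearP.
by rewrite mulmxDl -scalemxAl !mxE scalerDl scalerA.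
Qed.

HB.instance Definition _ y := GRing.isLinear.Build R (lie G) (lie G) _ (flag_inv y)
  (flag_inv_linear y).

Lemma flag_opK y v : big_cell y -> flag_inv y (flag_op y v) = v.
Proof. by move=> hy; rewrite inv_rv rv_op mulmxK// rvK. Qed.

Lemma flag_invK y v : big_cell y -> flag_op y (flag_inv y v) = v.
Proof.
move=> hy; rewrite -[LHS]rvK -[RHS]rvK; apply: eq_bigr => j _.
by rewrite rv_op inv_rv vrK mulmxKV.
Qed.

Lemma big_cellP y : (forall v, flag_op y v = 0 -> v = 0) -> big_cell y.
Proof.
move=> h; rewrite /big_cell/= -row_free_unit -kermx_eq0; apply/eqP/row_matrixP => i.
rewrite row0; have /eqP := mulmx_ker (flag_mx y).
move=> /eqP/(congr1 (row i)); rewrite row_mul row0; set r := row i _.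
rewrite -(vrK r) -rv_op => h0; have := h (\sum_j r 0 j *: vbase j).
have -> : flag_op y (\sum_j r 0 j *: vbase j) = 0.
  by rewrite -[LHS]rvK h0 big1// => j _; rewrite mxE scale0r.
by move=> /(_ erefl) ->; apply/rowP => j; rewrite !mxE linear0.
Qed.

Lemma big_cell1 : big_cell 1%g.
Proof. by apply: big_cellP => v; rewrite /flag_op Ad1 subrK. Qed.

Lemma smooth_flag_mx i j : smooth (fun y => flag_mx y i j).
Proof.
rewrite [X in smooth X](_ : _ = fun y : G => vcoord j (Ad y (vbase i - negp (vbase i)))
    + vcoord j (negp (vbase i))).
  by apply: smooth_add; [exact: smooth_Ad|exact: smooth_cst].
by apply/funext => y; rewrite mxE /flag_op linearD.
Qed.

Lemma open_big_cell : open big_cell.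
Proof.
have dc : continuous (fun y : G => \det (flag_mx y) : R).
  apply: smooth_continuous; apply/smooth_inT; apply: smooth_in_det; first exact: openT.
  by move=> i j; apply: smooth_smooth_in; exact: smooth_flag_mx.
rewrite (_ : big_cell = (fun y : G => \det (flag_mx y) : R) @^-1` [set t | t != 0]).
  by apply: open_comp => [y _|]; [exact: dc|exact: open_neq].
by apply/seteqP; split=> y; rewrite /big_cell/= unitmxE unitfE.
Qed.

Lemma smooth_flag_inv (l : {linear lie G -> R^o}) v :
  smooth_in big_cell (fun y : G => l (flag_inv y v)).
Proof.
rewrite [X in smooth_in _ X](_ : _ = fun y : G =>
    \sum_j (\sum_i vcoord i v * invmx (flag_mx y) i j) * l (vbase j)).
  apply: smooth_in_sum; first exact: open_big_cell.
  move=> j; apply: smooth_in_mul; first exact: open_big_cell.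
    apply: smooth_in_sum; first exact: open_big_cell.
    move=> i; apply: smooth_in_mul; first exact: open_big_cell.
      by apply: smooth_in_cst; exact: open_big_cell.
    apply: smooth_in_invmx => //; first exact: open_big_cell.
    by move=> a b; apply: smooth_smooth_in; exact: smooth_flag_mx.
  by apply: smooth_in_cst; exact: open_big_cell.
by apply/funext => y; rewrite linear_sum; apply: eq_bigr => j _; rewrite linearZ.
Qed.

Lemma smooth_flag_inv_Ad (l : {linear lie G -> R^o}) v :
  smooth_in big_cell (fun y : G => l (flag_inv y (Ad y v))).
Proof.
rewrite [X in smooth_in _ X](_ : _ = fun y : G =>
    \sum_b vcoord b (Ad y v) * l (flag_inv y (vbase b))).
  apply: smooth_in_sum; first exact: open_big_cell.
  move=> j; apply: smooth_in_mul; first exact: open_big_cell.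
    by apply: smooth_smooth_in; exact: smooth_Ad.
  exact: smooth_flag_inv.
apply/funext => y; rewrite {1}(vcoord_sum (Ad y v)) (linear_sum (flag_inv y)) (linear_sum l).
by apply: eq_bigr => b _; rewrite linearZ/= [LHS]linearZ.
Qed.

Lemma flag_inv_Ad y w : big_cell y -> w \in p -> flag_inv y (Ad y w) = w.
Proof.
move=> hy /(negproj_p grG pE) h; rewrite -[RHS](flag_opK w hy) /flag_op h.
by rewrite subr0 addr0.
Qed.

Lemma flag_inv_neg y v : big_cell y -> is_neg v -> flag_inv y v = v.
Proof.
move=> hy hv; rewrite -[RHS](flag_opK v hy) /flag_op (negproj_id grG pE hv).
by rewrite subrr linear0 add0r.
Qed.

Lemma flag_inv_mem y v : big_cell y -> flag_inv y v \in p -> v = Ad y (flag_inv y v).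
Proof.
move=> hy /(negproj_p grG pE) h; rewrite -{1}(flag_invK v hy) /flag_op h.
by rewrite subr0 addr0.
Qed.

Lemma big_cell_mul y h : normalizer p h -> big_cell y -> big_cell (y * h)%g.
Proof.
move=> hp hy; apply: big_cellP => v; rewrite /flag_op AdM.
set w := Ad h _ => h0; have wp : w \in p by rewrite /w hp; exact: negproj_sub.
have H : flag_op y (w + negp v) = 0.
  rewrite /flag_op (linearD (negproj m gr))/= ((negproj_p grG pE w).2 wp) add0r.
  by rewrite (negproj_id grG pE (negproj_deg grG v)) addrK.
have H2 : w + negp v = 0 by rewrite -(flag_opK (w + negp v) hy) H linear0.
have n0 : negp v = 0.
  have := congr1 negp H2; rewrite linearD/= ((negproj_p grG pE w).2 wp) add0r linear0.
  by rewrite (negproj_id grG pE (negproj_deg grG v)).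
have w0 : w = 0 by rewrite -H2 n0 addr0.
by have := AdK h (v - negp v); rewrite -/w w0 linear0 n0 subr0.
Qed.

(** Ad(y h) p = Ad(y) p, so the projection to g_- along it is unchanged, and l sees nothing else. *)
Lemma flag_inv_mul (l : {linear lie G -> R^o}) y h v : (forall w, w \in p -> l w = 0) ->
  normalizer p h -> big_cell y -> l (flag_inv (y * h)%g v) = l (flag_inv y v).
Proof.
move=> lp hp hy; have hyh := big_cell_mul hp hy.
set w := flag_inv y v; rewrite -(flag_invK v hy) -/w /flag_op linearD/=.
rewrite (flag_inv_neg hyh (negproj_deg grG w)).
have -> : Ad y (w - negp w) = Ad (y * h)%g (Ad (h^-1)%g (w - negp w)).
  by rewrite AdM AdVK.
have ap : Ad (h^-1)%g (w - negp w) \in p by rewrite -hp AdVK; exact: negproj_sub.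
rewrite (flag_inv_Ad hyh ap) linearD/= lp// add0r.
by rewrite -{2}(subrK (negp w) w) linearD/= (lp (w - negp w)) ?add0r//; exact: negproj_sub.
Qed.

Hypothesis E0 : E \in gr 0.

Lemma grading_element_p : E \in p.
Proof. by apply/(parabolicP grG pE); exact: (deg_ge_gr grG E0). Qed.

Let p_br X Y : X \in p -> Y \in p -> br X Y \in p.
Proof.
move=> /(parabolicP grG pE) hX /(parabolicP grG pE) hY; apply/(parabolicP grG pE).
by have := deg_ge_br grG hX hY; rewrite addr0.
Qed.

(** Let Z be the common projection of E. Both Ad(y1) p and Ad(y2) p are subalgebras complementary to
    g_- that contain E - Z, so [complement_unique] makes them equal. *)
Lemma flag_inv_sep y1 y2 : big_cell y1 -> big_cell y2 ->
  negp (flag_inv y1 E) = negp (flag_inv y2 E) -> normalizer p (y1^-1 * y2)%g.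
Proof.
move=> h1 h2 eqn; set Z := negp (flag_inv y1 E).
pose q y : {vspace lie G} := (linfun (Ad y) @: p)%VS.
have qP y v : v \in q y <-> Ad (y^-1)%g v \in p.
  split=> [/memv_imgP[w wp ->]|h]; first by rewrite lfunE/= AdK.
  by apply/memv_imgP; exists (Ad (y^-1)%g v) => //; rewrite lfunE/= AdVK.
have br_q y X Y : X \in q y -> Y \in q y -> br X Y \in q y.
  by move=> /qP hX /qP hY; apply/qP; rewrite Ad_br p_br.
have E_q y : big_cell y -> negp (flag_inv y E) = Z -> E - Z \in q y.
  move=> hy hZ; apply/qP.
  have Zn : is_neg Z by exact: negproj_deg.
  have k : flag_inv y (E - Z) \in p.
    by rewrite linearB/= (flag_inv_neg hy Zn) -hZ; exact: negproj_sub.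
  by rewrite (flag_inv_mem hy k) AdK.
have d_q y v : big_cell y -> v \in q y -> is_neg v -> v = 0.
  move=> hy /qP hv vn; apply: (deg_le_p grG pE) => //.
  by rewrite -(flag_inv_neg hy vn) -[v](AdVK y) flag_inv_Ad.
have s_q y v : big_cell y -> exists2 a, a \in q y & is_neg (v - a).
  move=> hy; exists (Ad y (flag_inv y v - negp (flag_inv y v))).
    by apply/qP; rewrite AdK; exact: negproj_sub.
  by rewrite -{1}(flag_invK v hy) /flag_op addrAC subrr add0r; exact: negproj_deg.
have sub y y' : big_cell y -> big_cell y' -> negp (flag_inv y E) = Z ->
    negp (flag_inv y' E) = Z -> (q y <= q y')%VS.
  move=> hy hy' hZ hZ'; apply: (complement_unique grG EE (negproj_deg grG _) (br_q y) (br_q y')).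
  - exact: E_q.
  - exact: E_q.
  - by move=> v; exact: d_q.
  - by move=> v; exact: d_q.
  - by move=> v; exact: s_q.
have /subvP s12 := sub _ _ h1 h2 erefl (esym eqn).
have /subvP s21 := sub _ _ h2 h1 (esym eqn) erefl.
move=> X; rewrite AdM; apply/idP/idP => hX.
  have /s12/qP : Ad y2 X \in q y1 by apply/qP.
  by rewrite AdK.
have /s21/qP : Ad y2 X \in q y2 by apply/qP; rewrite AdK.
by [].
Qed.

(** Differentiate flag_op y (flag_inv y E) = E at y = 1. As E lies in p, varying y in [flag_op]
    alone gives [X, E], and the derivative of flag_inv y E must compensate it. *)
Lemma is_derive_flag_inv X (b : 'rV[R]_(lg_dim G)) (l : {linear lie G -> R^o}) :
  velocity X b ->
  \sum_k b 0 k * pderiv k (fun u => l (flag_inv (upt u) E)) (ucoord G) = l (br E X).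
Proof.
move=> Xb; pose W := chart_part (uchart G) big_cell.
have oW : open W by apply: open_chart_part; [exact: uchart_atlas|exact: open_big_cell].
have W0 : W (ucoord G).
  split; first exact: ucoord_img.
  by change (big_cell (upt (ucoord G))); rewrite upt_ucoord; exact: big_cell1.
have phiC (l' : {linear lie G -> R^o}) : Ck_on 1 W (fun u => l' (flag_inv (upt u) E)).
  exact: (smooth_flag_inv l' E (uchart_atlas G) 1%N).
have line (f : 'rV[R]_(lg_dim G) -> R) : Ck_on 1 W f ->
    is_derive (0 : R) 1 (fun t : R => f (ucoord G + t *: b))
    (\sum_k b 0 k * pderiv k f (ucoord G)).
  move=> fC; exact: (proj1 (is_derive_lineP f (ucoord G) b _) (is_derive_dir b oW fC W0)).
pose D (j : 'I_d) := \sum_k b 0 k *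
  pderiv k (fun u => vcoord j (flag_inv (upt u) E)) (ucoord G).
have crv h : smooth h ->
    is_derive (0 : R) 1 (fun t : R => h (upt (ucoord G + t *: b))) (lvf X h 1%g).
  move=> sh; have := @is_derive_curve R G X b (fun t => ucoord G + t *: b) h 1%g Xb.
  rewrite scale0r addr0 => /(_ erefl) H.
  have := H _ sh; under eq_fun do rewrite mul1g.
  apply => j; have := is_derive_affine (ucoord G 0 j) (b 0 j) 0.
  by congr is_derive; apply/funext => s; rewrite !mxE.
have DE k : D k = vcoord k (br E X).
  pose Mt j k (t : R) := flag_mx (upt (ucoord G + t *: b)) j k.
  pose mt j (t : R) : R := vcoord j (flag_inv (upt (ucoord G + t *: b)) E).
  have mt0 j : mt j 0 = vcoord j E.
    rewrite /mt scale0r addr0 upt_ucoord -{1}(Ad1 E) flag_inv_Ad//; first exact: big_cell1.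
    exact: grading_element_p.
  have Mt0 j i : Mt j i 0 = (j == i)%:R.
    by rewrite /Mt scale0r addr0 upt_ucoord mxE /flag_op Ad1 subrK vcoord_vbase eq_sym.
  have dM j i : is_derive (0 : R) 1 (Mt j i) (vcoord i (br X (vbase j - negp (vbase j)))).
    have := crv _ (smooth_flag_mx j i); congr is_derive.
    rewrite -lvf_Ad; transitivity (lvf X (fun y : G => vcoord i (Ad y (vbase j - negp (vbase j)))
      + cst (vcoord i (negp (vbase j))) y) 1%g).
      by congr (lvf X _ _); apply/funext => y; rewrite mxE /flag_op linearD.
    rewrite lvf_add ?lvf_cst ?addr0//; [exact: smooth_Ad|exact: smooth_cst].
  have dm j : is_derive (0 : R) 1 (mt j) (D j).
    exact: (line (fun u => vcoord j (flag_inv (upt u) E)) (phiC (vcoord j))).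
  have dS : is_derive (0 : R) 1 (\sum_j (mt j \* Mt j k))
      (\sum_j (mt j 0 *: vcoord k (br X (vbase j - negp (vbase j))) + Mt j k 0 *: D j)).
    by apply: is_derive_sum => j; exact: is_deriveM.
  have dC : is_derive (0 : R) 1 (\sum_j (mt j \* Mt j k)) 0.
    have : is_derive (0 : R) 1 (cst (vcoord k E) : R -> R) 0 by exact: is_derive_cst.
    apply: near_eq_is_derive.
    have : \forall t \near (0 : R), W (ucoord G + t *: b).
      have ct : {for (0 : R), continuous (fun t : R => ucoord G + t *: b)}.
        by apply: cvgD; [exact: cvg_cst|apply: cvgZr_tmp; exact: cvg_id].
      apply: ct; rewrite /= scale0r addr0; exact: open_nbhs_nbhs.
    apply: filterS => t [_ hy]; rewrite fct_sumE /cst.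
    rewrite -[in LHS](flag_invK E hy).
    set w := flag_inv _ E; rewrite {1}(vcoord_sum w) linear_sum (linear_sum (vcoord k)).
    by apply: eq_bigr => j _; rewrite /= linearZ/= linearZ/= /Mt mxE.
  have : \sum_j (mt j 0 *: vcoord k (br X (vbase j - negp (vbase j))) + Mt j k 0 *: D j) = 0.
    by rewrite -(@derive_val _ _ _ _ _ _ _ dS) (@derive_val _ _ _ _ _ _ _ dC).
  rewrite big_split/= [X in _ + X](bigD1 k)//= Mt0 eqxx scale1r [X in _ + (_ + X)]big1 ?addr0 => [|j jk]; last first.
    by rewrite Mt0 (negbTE jk) scale0r.
  move=> /eqP; rewrite addrC addr_eq0 => /eqP ->.
  rewrite brC [RHS]linearN/=; congr (- _).
  have En : negp E = 0 by apply/(negproj_p grG pE); exact: grading_element_p.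
  have h0 : \sum_j vcoord j E *: negp (vbase j) = 0.
    rewrite -[RHS]En [in RHS](vcoord_sum E) (linear_sum (negproj m gr)).
    by apply: eq_bigr => j _; rewrite linearZ.
  have ES : E = \sum_j vcoord j E *: (vbase j - negp (vbase j)).
    by under eq_bigr do rewrite scalerBr; rewrite sumrB h0 subr0 -vcoord_sum.
  rewrite [in RHS]ES (linear_sum (br X)) (linear_sum (vcoord k)).
  by apply: eq_bigr => j _; rewrite mt0 /= linearZ/= linearZ.
pose phi (u : 'rV[R]_(lg_dim G)) : R := l (flag_inv (upt u) E).
pose psi (j : 'I_d) (u : 'rV[R]_(lg_dim G)) : R := vcoord j (flag_inv (upt u) E).
have H := line phi (phiC l).
have H1 j : is_derive (0 : R) 1 (fun t : R => psi j (ucoord G + t *: b)) (D j).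
  exact: (line (psi j) (phiC (vcoord j))).
have H2 : is_derive (0 : R) 1
    (\sum_j ((l (vbase j) : R) \*: (fun t : R => psi j (ucoord G + t *: b))))
    (\sum_j (l (vbase j) : R) *: D j).
  by apply: is_derive_sum => j; exact: is_deriveZ.
have HE : (fun t : R => phi (ucoord G + t *: b)) =
    (\sum_j ((l (vbase j) : R) \*: (fun t : R => psi j (ucoord G + t *: b)))).
  apply/funext => t; rewrite fct_sumE /phi {1}(vcoord_sum (flag_inv _ _)) linear_sum.
  by apply: eq_bigr => j _; rewrite linearZ/= [LHS]mulrC.
rewrite -[LHS](@derive_val _ _ _ _ _ _ _ H) HE (@derive_val _ _ _ _ _ _ _ H2).
rewrite [in RHS](vcoord_sum (br E X)) linear_sum.
by apply: eq_bigr => j _; rewrite DE linearZ/= [RHS]mulrC.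
Qed.

End Flag.

Lemma is_derive_bound (R : realType) (f : R -> R) : is_derive (0 : R) 1 f 0 -> f 0 = 0 ->
  forall eps, 0 < eps -> \forall t \near (0 : R), `|f t| <= eps * `|t|.
Proof.
move=> [dv D0] f0 eps eps0.
have : h^-1 *: ((f \o shift 0) (h *: (1 : R)) - f 0) @[h --> (0 : R)^'] --> (0 : R).
  by rewrite -[X in _ --> X]D0; exact: dv.
move=> /cvgrPdist_le/(_ eps eps0); rewrite near_withinE; apply: filterS => t h.
have [->|t0] := eqVneq t 0; first by rewrite f0 !normr0 mulr0.
have := h t0; rewrite /= f0 subr0 sub0r normrN addr0 /GRing.scale/= mulr1 normrM normfV.
by rewrite mulrC ler_pdivrMr ?normr_gt0.
Qed.

Lemma smooth_in_continuous (R : realType) (G : lieGroup R) (O : set G) (h : G -> R) y :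
  smooth_in O h -> O y -> {for y, continuous h}.
Proof.
move=> H Oy; have [c ac cd] := exists_chart y.
have : {for y, continuous ((h \o chart_inv c) \o chart_map c)}.
  apply: continuous_comp; first exact: chart_map_cont.
  apply: Ck_on_cont (H c ac 0%N) _ _; split; first exact: chart_img_map.
  by rewrite /= chart_invK.
apply: near_continuous; have : nbhs y (chart_dom c).
  by apply: open_nbhs_nbhs; split=> //; exact: open_chart_dom.
by apply: filterS => z hz /=; rewrite chart_invK.
Qed.

(** * P near the identity *)

Section Slice.
Variables (R : realType) (G : lieGroup R) (m : nat) (gr : int -> {vspace lie G}).
Hypothesis grG : grading m gr.
Hypothesis ss : semisimple G.
Variable p : {vspace lie G}.
Hypothesis pE : p = (\sum_(i < m.+1) gr i%:Z)%VS.
Variable E : lie G.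
Hypothesis EE : forall v, br E v = weight_op m gr v.
Hypothesis E0 : E \in gr 0.
Variable P : set G.
Hypothesis Psub : is_subgroup P.
Hypothesis Pconn : connected_component (normalizer p) 1%g `<=` P.
Hypothesis Pnorm : P `<=` normalizer p.
Variables (n : nat) (e : 'I_n -> lie G) (lam : 'I_n -> {linear lie G -> R^o}).
Hypothesis lp : forall v, v \in p <-> forall a, lam a v = 0.
Hypothesis lE : forall a b, lam a (br E (e b)) = (a == b)%:R.
Implicit Types (X Y Z v w : lie G) (x y : G) (z : 'rV[R]_(lg_dim G)) (u : 'rV[R]_n).

Local Notation N := (lg_dim G).
Local Notation negp := (negproj m gr).

(** Coordinates of the projection of E to g_- along Ad(y) p. They depend on yP only and separate the
    points of the cell up to the normalizer of p. *)
Definition cell_fun (a : 'I_n) y : R := lam a (flag_inv m gr y E).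

Let P1 : P 1%g. Proof. by have [] := Psub. Qed.
Let PM x y : P x -> P y -> P (x * y)%g. Proof. by have [_ h _] := Psub; exact: h. Qed.
Let PV x : P x -> P (x^-1)%g. Proof. by have [_ _ h] := Psub; exact: h. Qed.

Let lam0 a w : w \in p -> lam a w = 0.
Proof. by move=> h; exact: (proj1 (lp w) h a). Qed.

Let c1 : big_cell m gr (1%g : G) := big_cell1 m gr.

Lemma cell_fun_mul a y h : normalizer p h -> big_cell m gr y ->
  cell_fun a (y * h)%g = cell_fun a y.
Proof. by move=> hp hy; apply: (flag_inv_mul grG pE) => // w; exact: lam0. Qed.

Lemma cell_fun1 a : cell_fun a 1%g = 0.
Proof.
rewrite /cell_fun -{1}(Ad1 E) (flag_inv_Ad grG pE) //.
  by apply: lam0; exact: (grading_element_p grG pE E0).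
exact: (grading_element_p grG pE E0).
Qed.

Lemma cell_fun_norm a h : normalizer p h -> cell_fun a h = 0.
Proof. by move=> hp; rewrite -[h]mul1g cell_fun_mul// cell_fun1. Qed.

Lemma cell_fun_sep y1 y2 : big_cell m gr y1 -> big_cell m gr y2 ->
  (forall a, cell_fun a y1 = cell_fun a y2) -> normalizer p (y1^-1 * y2)%g.
Proof.
move=> h1 h2 h; apply: (flag_inv_sep grG pE EE h1 h2).
apply/eqP; rewrite -subr_eq0; apply/eqP; rewrite -(linearB (negproj m gr)).
apply/(negproj_p grG pE)/lp => a; rewrite linearB/=.
by apply/eqP; rewrite subr_eq0; apply/eqP; exact: h.
Qed.

Lemma smooth_cell_fun a : smooth_in (big_cell m gr : set G) (cell_fun a).
Proof. exact: smooth_flag_inv. Qed.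

(** Row i is the coordinate vector at the identity of the field e_i. *)
Definition cell_dirs : 'M[R]_(n, N) := \matrix_(i, j) sval (cid (ex_velocity (e i))) 0 j.

Local Notation B := cell_dirs.

Lemma cell_dirsP i : velocity (e i) (row i B).
Proof.
have -> : row i B = sval (cid (ex_velocity (e i))) by apply/rowP => j; rewrite !mxE.
exact: svalP (cid (ex_velocity (e i))).
Qed.

Definition cell_img : set 'rV[R]_N := chart_part (uchart G) (big_cell m gr).

Lemma open_cell_img : open cell_img.
Proof. by apply: open_chart_part; [exact: uchart_atlas|exact: open_big_cell]. Qed.

Lemma cell_img0 : cell_img (ucoord G).
Proof.
split; first exact: ucoord_img.
by change (big_cell m gr (upt (ucoord G))); rewrite upt_ucoord.
Qed.

Definition cell_map (z : 'rV[R]_N) : 'rV[R]_n := \row_a cell_fun a (upt z).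

Lemma Ck_cell_map k a : Ck_on k cell_img (fun z => cell_fun a (upt z)).
Proof. exact: (smooth_cell_fun a (uchart_atlas G) k). Qed.

Lemma cell_map0 : cell_map (ucoord G) = 0.
Proof. by apply/rowP => a; rewrite !mxE upt_ucoord cell_fun1. Qed.

Lemma cell_map_continuous z : cell_img z -> {for z, continuous cell_map}.
Proof.
move=> hz; apply: (@row_continuous R _ n cell_map z) => a.
rewrite (_ : (fun z : 'rV[R]_N => cell_map z 0 a) = (fun z => cell_fun a (upt z))).
  exact: Ck_on_cont (Ck_cell_map 0 a) _ hz.
by apply/funext => u; rewrite mxE.
Qed.

(** The derivative of [cell_fun a] at 1 along e_i is lam_a [E, e_i], which [lE] makes the identity
    matrix; the implicit function theorem applies. *)
Lemma cell_map_local : exists2 r : R, 0 < r &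
  (forall z (u : 'rV[R]_n), `|z - ucoord G| <= r -> `|u| <= r -> cell_img (z + u *m B)) /\
  (forall z (u v : 'rV[R]_n), `|z - ucoord G| <= r -> `|u| <= r -> `|v| <= r ->
     `|u - v| <= 2 * `|cell_map (z + u *m B) - cell_map (z + v *m B)|) /\
  (forall z (w : 'rV[R]_n), `|z - ucoord G| <= r -> `|w - cell_map z| <= r / 2 ->
     exists2 u, `|u| <= 2 * `|w - cell_map z| & cell_map (z + u *m B) = w).
Proof.
apply: (implicit_function open_cell_img cell_img0 (Ck_cell_map 1) _ cell_map0).
move=> a i; rewrite -lE -(is_derive_flag_inv grG pE E0 (lam a) (cell_dirsP i)).
by apply: eq_bigr => j _; congr (_ * _); rewrite [RHS]mxE.
Qed.

Let r := s2val (cid2 cell_map_local).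
Let r0 : 0 < r := s2valP (cid2 cell_map_local).
Let rP := s2valP' (cid2 cell_map_local).

(** r / 2 is the distance within which [cell_map_local] can reach the value 0. *)
Lemma cell_small : exists2 s : R, 0 < s <= r & forall z, `|z - ucoord G| <= s ->
  cell_img z /\ `|cell_map z| <= r / 2.
Proof.
have : \forall z \near ucoord G, cell_img z /\ `|cell_map z| <= r / 2.
  apply: filterI; first by apply: open_nbhs_nbhs; split; [exact: open_cell_img|exact: cell_img0].
  have /cvgrPdist_le := cell_map_continuous cell_img0.
  move=> /(_ (r / 2)); rewrite divr_gt0// => /(_ isT); apply: filterS => z.
  by rewrite cell_map0 sub0r normrN.
move=> /nbhs_ballP[s /= s0 hs]; exists (Num.min r (s / 2)).
  by rewrite lt_min r0 divr_gt0//= ge_min lexx.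
move=> z; rewrite le_min => /andP[_ h]; apply: hs; rewrite -ball_normE/= distrC.
by apply: le_lt_trans h _; rewrite ltr_pdivrMr// ltr_pMr// ltr1n.
Qed.

Let s := s2val (cid2 cell_small).
Let s0 : 0 < s. Proof. by have /andP[] := s2valP (cid2 cell_small). Qed.
Let sr : s <= r. Proof. by have /andP[] := s2valP (cid2 cell_small). Qed.
Let sP := s2valP' (cid2 cell_small).

(* the point of the fibre of cell_map over 0 near z *)
Let sol (z : 'rV[R]_N) : 'rV[R]_n :=
  xget 0 [set u | `|u| <= 2 * `|cell_map z| /\ cell_map (z + u *m B) = 0].

Let solP z : `|z - ucoord G| <= s ->
  `|sol z| <= 2 * `|cell_map z| /\ cell_map (z + sol z *m B) = 0.
Proof.
move=> zs; have [_ hz] := sP zs; have [_ [_ ex]] := rP.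
have zr : `|z - ucoord G| <= r by exact: le_trans zs sr.
have hz' : `|0 - cell_map z| <= r / 2 by rewrite sub0r normrN.
have [u ub uE] := ex z 0 zr hz'; rewrite sub0r normrN in ub.
pose Q := [set u | `|u| <= 2 * `|cell_map z| /\ cell_map (z + u *m B) = 0].
exact: (@xgetPex _ 0 Q (ex_intro _ u (conj ub uE))).
Qed.

Let sol_le z : `|z - ucoord G| <= s -> `|sol z| <= r.
Proof. by move=> zs; have [_ h] := sP zs; have [h2 _] := solP zs; lra. Qed.

Let sol_img z : `|z - ucoord G| <= s -> cell_img (z + sol z *m B).
Proof.
move=> zs; have [h _] := rP; apply: h; last exact: sol_le.
exact: le_trans zs sr.
Qed.

Let sol_norm z : `|z - ucoord G| <= s -> normalizer p (upt (z + sol z *m B)).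
Proof.
move=> zs; rewrite -[upt _]mul1g -[X in (X * _)%g]invg1; apply: cell_fun_sep => //.
  by have [_] := sol_img zs.
move=> a; rewrite cell_fun1; have [_ /rowP/(_ a)] := solP zs.
by rewrite !mxE.
Qed.

Let sol0 z : `|z - ucoord G| <= s -> cell_map z = 0 -> sol z = 0.
Proof.
move=> zs z0; have [h _] := solP zs; move: h; rewrite z0 normr0 mulr0 normr_le0.
by move/eqP.
Qed.

Let sol_near z : `|z - ucoord G| <= s -> forall eps, 0 < eps ->
  \forall z' \near z, `|z' - ucoord G| <= s -> `|sol z' - sol z| < eps.
Proof.
move=> zs eps eps0.
have ct : {for z, continuous (fun z' : 'rV[R]_N => cell_map (z' + sol z *m B))}.
  apply: (@continuous_comp _ _ _ (fun z' : 'rV[R]_N => z' + sol z *m B) cell_map).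
    have := @cvgD _ _ _ (nbhs z) _ (fun z : 'rV[R]_N => z) (fun=> sol z *m B) z (sol z *m B).
    by apply; [exact: cvg_id|exact: cvg_cst].
  by apply: cell_map_continuous; exact: sol_img.
have /cvgrPdist_lt/(_ (eps / 2)) := ct; rewrite divr_gt0// => /(_ isT).
apply: filterS => z' h zs'; have [_ [inj _]] := rP.
have [_ e1] := solP zs; have [_ e2] := solP zs'.
have := inj z' (sol z') (sol z) (le_trans zs' sr) (sol_le zs') (sol_le zs).
move=> /le_lt_trans; apply; move: h; rewrite e1 sub0r normrN e2 sub0r normrN.
by rewrite ltr_pdivlMr// mulrC.
Qed.

(** A normalizer element y near 1 is joined to 1 by a path in the normalizer: the straight segment
    in the chart, corrected by [sol] into the zero set of the cell functions. So y lies in the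
    identity component of the normalizer, hence in P. *)
Lemma normalizer_near1 : \forall z \near (1%g : G), normalizer p z -> P z.
Proof.
have dc : {for (1%g : G), continuous (chart_map (uchart G))}.
  by apply: chart_map_cont; [exact: uchart_atlas|exact: uchart_dom].
have n1 : \forall z \near (1%g : G), chart_dom (uchart G) z /\
    `|chart_map (uchart G) z - ucoord G| < s.
  apply: filterI.
    apply: open_nbhs_nbhs; split; last exact: uchart_dom.
    by apply: open_chart_dom; exact: uchart_atlas.
  have /cvgrPdist_lt/(_ s s0) := dc; apply: filterS => z.
  by rewrite distrC.
apply: filterS n1 => y [yd ys] yn; set w := chart_map _ y in ys.
have yE : upt w = y by apply: chart_invK => //; exact: uchart_atlas.
pose z (t : R) := ucoord G + t *: (w - ucoord G).
have zs (t : R) : 0 <= t <= 1 -> `|z t - ucoord G| <= s.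
  move=> /andP[t0 t1]; rewrite /z addrAC subrr add0r normrZ ger0_norm//.
  have : t * `|w - ucoord G| <= 1 * `|w - ucoord G| by rewrite ler_wpM2r.
  lra.
pose g (t : R) : G := upt (z t + sol (z t) *m B).
have zc (t : R) : {for t, continuous z}.
  by apply: cvgD; [exact: cvg_cst|apply: cvgZr_tmp; exact: cvg_id].
have gc : {within `[0, 1], continuous g}.
  apply/subspace_continuousP => t; rewrite /= in_itv/= => t01.
  have h1 : (fun t' : R => z t' + sol (z t') *m B) @ within `[0, 1]%classic (nbhs t) -->
      z t + sol (z t) *m B.
    apply: cvgD.
      by apply: cvg_within_filter; exact: zc.
    apply: (@cvg_comp _ _ _ (fun t' => sol (z t')) (fun u : 'rV[R]_n => u *m B) _
      (nbhs (sol (z t)))); last first.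
      apply: (@row_continuous R _ N (fun u : 'rV[R]_n => u *m B)) => j.
      rewrite (_ : (fun y : 'rV[R]_n => (y *m B) 0 j) = dotp (fun i => B i j)).
        exact: dotp_continuous.
      by apply/funext => u; rewrite mxE.
    apply/cvgrPdist_lt => eps eps0; rewrite near_withinE.
    have H : \forall t' \near t, `|z t' - ucoord G| <= s -> `|sol (z t') - sol (z t)| < eps.
      exact: (zc t _ (sol_near (zs t t01) eps0)).
    apply: filterS H => t' h; rewrite /= in_itv/= => t'01.
    by rewrite distrC; apply: h; exact: zs.
  apply: cvg_comp h1 _.
  by apply: chart_inv_cont; [exact: uchart_atlas|have [] := sol_img (zs t t01)].
have gconn : connected (g @` `[0, 1]%classic).
  by apply: connected_continuous_connected gc; exact: segment_connected.
apply: Pconn.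
have zz (t : R) : t = 0 \/ t = 1 -> sol (z t) = 0.
  move=> ht; apply: sol0; first by apply: zs; case: ht => ->; rewrite ?lexx ?ler01.
  case: ht => ->; first by rewrite /z scale0r addr0 cell_map0.
  rewrite /z scale1r addrC subrK; apply/rowP => a; rewrite !mxE yE.
  exact: cell_fun_norm.
exists (g @` `[0, 1]%classic); last first.
  exists 1; first by rewrite /= in_itv/= ler01 lexx.
  by rewrite /g zz; [rewrite mul0mx addr0 /z scale1r addrC subrK|right].
split=> //.
  exists 0; first by rewrite /= in_itv/= ler01 lexx.
  by rewrite /g zz; [rewrite mul0mx addr0 /z scale0r addr0 upt_ucoord|left].
by move=> _ [t /= + <-]; rewrite in_itv/= => t01; exact: sol_norm (zs t t01).
Qed.

(** For y in the closure there is q in P with q^-1 y close to 1. The cell functions vanish on P,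
    hence by continuity at q^-1 y, which therefore normalizes p; being close to 1, it is in P. *)
Lemma subgroup_closed : closed P.
Proof.
move=> y Py.
have : \forall q \near y, big_cell m gr (q^-1 * y)%g /\ (normalizer p (q^-1 * y)%g -> P (q^-1 * y)%g).
  have qc : {for y, continuous (fun q : G => q^-1 * y)%g}.
    apply: (@continuous_comp _ _ _ (fun q : G => q^-1)%g (fun q => q * y)%g).
      exact: invg_continuous.
    exact: rmul_continuous.
  apply: (qc [set z | big_cell m gr z /\ (normalizer p z -> P z)]); rewrite mulVg.
  apply: filterI; last exact: normalizer_near1.
  by apply: open_nbhs_nbhs; split; [exact: open_big_cell|exact: c1].
move=> /Py[q [Pq [yc yn]]]; rewrite -[y](mulVKg q); apply: PM => //; apply: yn.
rewrite -[X in normalizer p X]mul1g -[X in (X * _)%g]invg1; apply: cell_fun_sep => // a.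
rewrite cell_fun1; apply/esym/eqP; apply: contraT => ne0.
have fc : {for y, continuous (fun y' : G => cell_fun a (q^-1 * y')%g)}.
  apply: (@continuous_comp _ _ _ (fun y' : G => q^-1 * y')%g (cell_fun a)).
    exact: lmul_continuous.
  exact: smooth_in_continuous (smooth_cell_fun a) yc.
have : \forall y' \near y, cell_fun a (q^-1 * y')%g != 0.
  have o : open_nbhs (cell_fun a (q^-1 * y)%g) [set t : R | t != 0].
    by split=> //; exact: open_neq.
  exact: (fc [set t : R | t != 0] (open_nbhs_nbhs o)).
move=> /Py[y' [Py' /eqP]]; case; apply: cell_fun_norm; apply: Pnorm.
by apply: PM => //; exact: PV.
Qed.

(** A curve in P with velocity Z takes the place of the exponential: the straight line in the chart
    with velocity Z, corrected by [sol]. *)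
Lemma lvf_subgroup Z h : Z \in p -> smooth h -> (forall q, P q -> h q = 0) ->
  lvf Z h 1%g = 0.
Proof.
move=> Zp sh h0; have [b Zb] := ex_velocity Z.
pose z (t : R) := ucoord G + t *: b.
pose gm (t : R) := z t + sol (z t) *m B.
have z0 : z 0 = ucoord G by rewrite /z scale0r addr0.
have ns0 : `|z 0 - ucoord G| <= s by rewrite z0 subrr normr0 ltW.
have sz0 : sol (z 0) = 0 by apply: sol0 => //; rewrite z0 cell_map0.
have g0 : gm 0 = ucoord G by rewrite /gm sz0 mul0mx addr0 z0.
have zc : {for (0 : R), continuous z}.
  by apply: cvgD; [exact: cvg_cst|apply: cvgZr_tmp; exact: cvg_id].
have nz : \forall t \near (0 : R), `|z t - ucoord G| <= s.
  have /cvgrPdist_le/(_ s s0) := zc; apply: filterS => t.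
  by rewrite z0 distrC.
have dz j : is_derive (0 : R) 1 (fun t : R => z t 0 j) (b 0 j).
  have := is_derive_affine (ucoord G 0 j) (b 0 j) 0.
  by congr is_derive; apply/funext => t; rewrite !mxE.
have dcell a : is_derive (0 : R) 1 (fun t : R => cell_fun a (upt (z t))) 0.
  have := is_derive_comp_row (g := z) (t0 := 0) open_cell_img (Ck_cell_map 1 a).
  rewrite z0 => /(_ (fun j => b 0 j) cell_img0 dz).
  have := is_derive_flag_inv grG pE E0 (lam a) Zb.
  rewrite -[X in _ = X -> _]/(lam a (br E Z)) lam0 => [->//|].
  have /(parabolicP grG pE) hZ := Zp; apply/(parabolicP grG pE).
  by have := deg_ge_br grG (deg_ge_gr grG E0 (lexx 0)) hZ; rewrite addr0.
(* The cell functions have derivative lam [E, Z] = 0 along the line, so the correction is o(t) and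
   does not change the velocity. *)
have dsol : forall eps, 0 < eps -> \forall t \near (0 : R), `|sol (z t)| <= eps * `|t|.
  move=> eps eps0.
  have H a : \forall t \near (0 : R), `|cell_fun a (upt (z t))| <= eps / 2 * `|t|.
    by apply: is_derive_bound => //; rewrite ?z0 ?upt_ucoord ?cell_fun1// divr_gt0.
  have H2 : \forall t \near (0 : R), forall a, `|cell_fun a (upt (z t))| <= eps / 2 * `|t|.
    exact: (@filter_forall _ _ (fun a (t : R) => `|cell_fun a (upt (z t))| <= eps / 2 * `|t|)
      (nbhs (0 : R)) _ H).
  apply: filterS2 nz H2 => t ts ha; have [hs _] := solP ts.
  have : `|cell_map (z t)| <= eps / 2 * `|t|.
    apply: row_norm_le => [|a]; first by rewrite mulr_ge0// ltW// divr_gt0.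
    by rewrite mxE.
  lra.
have dgm j : is_derive (0 : R) 1 (fun t : R => gm t 0 j) (b 0 j).
  have d2 : is_derive (0 : R) 1 (fun t : R => (sol (z t) *m B) 0 j) 0.
    apply: is_derive_of_bound => eps eps0.
    have C0 := mx_bound_ge0 B.
    have C1 : 0 < mx_bound B + 1 by lra.
    have := dsol (eps / (mx_bound B + 1)); rewrite divr_gt0// => /(_ isT).
    apply: filterS => t ht; rewrite sz0 mul0mx mulr0 subr0 [X in _ - X]mxE subr0.
    apply: le_trans (coord_norm _ _) (le_trans (mulmx_norm _ _) _).
    apply: (@le_trans _ _ (mx_bound B * (eps / (mx_bound B + 1) * `|t|))).
      by rewrite ler_wpM2l.
    rewrite !mulrA ler_wpM2r// ler_pdivrMr// mulrC ler_wpM2l ?ltW//; lra.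
  have := is_deriveD (dz j) d2; rewrite addr0; congr is_derive.
  by apply/funext => t; rewrite /gm mxE.
have := @is_derive_curve R G Z b gm h 1%g Zb g0 dgm sh.
under eq_fun do rewrite mul1g.
move=> dh; have near0 : \forall t \near (0 : R), 0 = h (upt (gm t)).
  have gmc : {for (0 : R), continuous (fun t => upt (gm t))}.
    apply: continuous_comp.
      apply: (@row_continuous R _ N gm) => j.
      have /derivable1_diffP := (@ex_derive _ _ _ _ _ _ _ (dgm j)).
      exact: differentiable_continuous.
    by rewrite g0; apply: chart_inv_cont; [exact: uchart_atlas|exact: ucoord_img].
  have := gmc [set z | normalizer p z -> P z]; rewrite /= g0 upt_ucoord => /(_ normalizer_near1).
  apply: filterS2 nz => t ts hP; rewrite h0//; apply: hP; exact: sol_norm.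
have d0 : is_derive (0 : R) 1 (cst 0 : R -> R) 0 by exact: is_derive_cst.
have d1 := near_eq_is_derive near0 d0.
by rewrite -(@derive_val _ _ _ _ _ _ _ dh) (@derive_val _ _ _ _ _ _ _ d1).
Qed.

End Slice.

(** * Charts and bump functions on G/P *)

Lemma Ck_on_affine (R : realType) n N k (U : set 'rV[R]_n) (z : 'rV[R]_N) (B : 'M[R]_(n, N)) j :
  open U -> Ck_on k U (fun u => (z + u *m B) 0 j).
Proof.
move=> oU; rewrite (_ : (fun u : 'rV[R]_n => _) = fun u => z 0 j + \sum_i u 0 i * B i j).
  apply: Ck_on_add => //; first exact: Ck_on_cst.
  by apply: Ck_on_sum => // i; apply: Ck_on_mul => //; [exact: Ck_on_coord|exact: Ck_on_cst].
by apply/funext => u; rewrite !mxE.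
Qed.

Lemma affine_continuous (R : realType) n N (z : 'rV[R]_N) (B : 'M[R]_(n, N)) :
  continuous (fun u : 'rV[R]_n => z + u *m B).
Proof.
move=> u; apply: (@row_continuous R _ N (fun u : 'rV[R]_n => z + u *m B)) => j.
exact: Ck_on_cont (Ck_on_affine 0 z B j openT) _ _.
Qed.

Lemma Ck_on_multilin (R : realType) (a : vectType R) n q k (U : set 'rV[R]_n)
    (w : 'rV[R]_n -> ('I_q -> a) -> R^o) (X : 'rV[R]_n -> 'I_q -> a) :
  open U -> (forall u, multilin (w u)) -> (forall Y, Ck_on k U (fun u => w u Y)) ->
  (forall l b, Ck_on k U (fun u => vcoord b (X u l))) -> Ck_on k U (fun u => w u (X u)).
Proof.
move=> oU wM wC XC; rewrite (_ : (fun u : 'rV[R]_n => _) =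
    fun u => \sum_(s : {ffun 'I_q -> 'I_(\dim {:a})})
     (\prod_l vcoord (s l) (X u l)) * w u (fun l => vbase (s l))).
  apply: Ck_on_sum => // s; apply: Ck_on_mul => //.
  have sP (r : seq 'I_q) : Ck_on k U (fun u => \prod_(l <- r) vcoord (s l) (X u l)).
    elim: r => [|l r IH].
      by under [X in Ck_on _ _ X]eq_fun do rewrite big_nil; exact: Ck_on_cst.
    by under [X in Ck_on _ _ X]eq_fun do rewrite big_cons; exact: Ck_on_mul.
  exact: sP.
apply/funext => u; rewrite -[RHS](multilin_expand (fun l b => vcoord b (X u l)) (fun b => vbase b) (wM u)).
by congr (w u _); apply/funext => l; exact: vcoord_sum.
Qed.

(** * Local sections of G over G/P and their logarithmic derivatives *)

Section LogDerivative.
Variables (R : realType) (G : lieGroup R) (n : nat) (B : 'M[R]_(n, lg_dim G)).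
Implicit Types (u : 'rV[R]_n) (h : G -> R) (O : set G).
Local Notation N := (lg_dim G).
Local Notation d := (\dim {:lie G}).

(** An affine subspace of the chart at the identity, in the directions of the rows of B; its left
    translates will lift charts of G/P. *)
Definition slice u : G := upt (ucoord G + u *m B).

Definition slice_dom O : set 'rV[R]_n := [set u | chart_part (uchart G) O (ucoord G + u *m B)].

Lemma open_slice_dom O : open O -> open (slice_dom O).
Proof.
move=> oO; apply: (open_comp (f := fun u : 'rV[R]_n => ucoord G + u *m B)).
  by move=> u _; exact: affine_continuous.
by apply: open_chart_part => //; exact: uchart_atlas.
Qed.

Lemma slice0 : slice 0 = 1%g. Proof. by rewrite /slice mul0mx addr0 upt_ucoord. Qed.

Lemma slice_dom0 O : O 1%g -> slice_dom O 0.
Proof.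
move=> O1; rewrite /slice_dom/= mul0mx addr0; split; first exact: ucoord_img.
by change (O (upt (ucoord G))); rewrite upt_ucoord.
Qed.

Lemma slice_continuous u : slice_dom setT u -> {for u, continuous slice}.
Proof.
move=> [hu _]; apply: continuous_comp; first exact: affine_continuous.
exact: (chart_inv_cont (uchart_atlas G)).
Qed.

Lemma smooth_slice O h : open O -> smooth_in O h -> smooth_on (slice_dom O) (h \o slice).
Proof.
move=> oO sh k; apply: (Ck_on_comp (V := chart_part (uchart G) O)
  (f := h \o chart_inv (uchart G)) (g := fun u => ucoord G + u *m B)) => //.
- exact: open_slice_dom.
- by apply: open_chart_part => //; exact: uchart_atlas.
- exact: (sh _ (uchart_atlas G)).
- by move=> j; apply: Ck_on_affine; exact: open_slice_dom.
Qed.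

Lemma slice_velocity i u : slice_dom setT u -> exists X, forall a h, smooth h ->
  pderiv i (fun v => h (a * slice v)%g) u = lvf X h (a * slice u)%g.
Proof.
move=> [hu _]; have [X hX] := frame_field (row i B) hu; exists X => a h sh.
rewrite (hX h sh) -mulgA mulgV mulg1 pderivE -!derive1_line; congr (derive1 _ 0); apply/funext => t.
by rewrite /slice mulmxDl -scalemxAl -rowE addrA.
Qed.

Lemma lvf_eq_at X Y y : (forall h, smooth h -> lvf X h y = lvf Y h y) -> X = Y :> lie G.
Proof.
move=> H; apply: lvf_eq1 => h sh; have sh' := smooth_lmul (y^-1)%g sh.
have := H _ sh'; rewrite !lvf_left//.
by rewrite mulVg.
Qed.

Local Notation L := (log_deriv slice).

Lemma log_derivP i u a h : slice_dom setT u -> smooth h ->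
  pderiv i (fun v => h (a * slice v)%g) u = lvf (L u i) h (a * slice u)%g.
Proof.
move=> Du sh; have [X hX] := slice_velocity i Du.
suff -> : L u i = X by exact: hX.
rewrite /log_deriv; set Q := [set _ | _].
have QX : Q X by move=> h' sh'; have := hX 1%g h' sh'; rewrite mul1g => <-; apply: eq_pderiv => v; rewrite /= mul1g.
have QL := @xgetPex _ 0 Q (ex_intro _ X QX).
by apply: (lvf_eq_at (y := slice u)) => h' sh'; rewrite -QL// -QX.
Qed.

Lemma log_deriv_translate a i u : slice_dom setT u ->
  log_deriv (fun v => a * slice v)%g u i = L u i.
Proof.
move=> Du; rewrite {1}/log_deriv; set Q := [set _ | _].
have QX : Q (L u i) by move=> h' sh'; exact: log_derivP.
have QL := @xgetPex _ 0 Q (ex_intro _ _ QX).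
by apply: (lvf_eq_at (y := (a * slice u)%g)) => h' sh'; rewrite -QL// -QX.
Qed.

Lemma log_deriv0 i X : velocity X (row i B) -> L 0 i = X.
Proof.
move=> hX; have D0 : slice_dom setT 0 by exact: slice_dom0.
apply: (lvf_eq_at (y := slice 0)) => h sh; have := log_derivP i 1%g D0 sh; rewrite mul1g => <-.
rewrite slice0 (hX h sh) pderivE -!derive1_line; congr (derive1 _ 0); apply/funext => t.
by rewrite /slice mulmxDl -scalemxAl -rowE mul0mx add0r.
Qed.

(** The matrix A of derivatives of the dual functions along the frame is invertible near 1, and its
    inverse expresses the coordinates of [log_deriv] by partial derivatives of smooth functions. *)
Lemma smooth_log_deriv : exists2 O : set G, open_nbhs 1%g O &
  forall i b, smooth_on (slice_dom O) (fun u => vcoord b (L u i)).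
Proof.
have [hd [shd hdE]] := dual_functions G.
pose A (y : G) : 'M[R]_d := \matrix_(b, c) lvf (vbase b) (hd c) y.
have sA b c : smooth (fun y => A y b c).
  rewrite (_ : (fun y => _) = lvf (vbase b) (hd c)); first exact: lvf_smooth.
  by apply/funext => y; rewrite mxE.
have cd : continuous (fun y => \det (A y)).
  apply: smooth_continuous; apply/smooth_inT; apply: smooth_in_det; first exact: openT.
  by move=> b c; apply/smooth_inT.
pose O : set G := [set y | A y \in unitmx].
have OE : O = (fun y => \det (A y)) @^-1` [set t : R | t != 0].
  by apply/seteqP; split=> y; rewrite /O/= unitmxE unitfE.
have oO : open O by rewrite OE; apply: open_comp => [y _|]; [exact: cd|exact: open_neq].
exists O.
  split=> //; rewrite /O/= (_ : A 1%g = 1%:M) ?unitmx1//.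
  by apply/matrixP => b c; rewrite !mxE hdE vcoord_vbase eq_sym.
move=> i b k; have oD := open_slice_dom oO.
have sub u : slice_dom O u -> slice_dom setT u by case.
apply: (@Ck_on_eq _ _ k _ (fun u => \sum_c pderiv i (hd c \o slice) u * invmx (A (slice u)) c b)) => //.
  move=> u Du; have DT := sub u Du; have [_ Ou] := Du.
  transitivity (\sum_c (\sum_e vcoord e (L u i) * A (slice u) e c) * invmx (A (slice u)) c b).
    apply: eq_bigr => c _; congr (_ * _).
    have := log_derivP i 1%g DT (shd c); rewrite mul1g.
    rewrite (_ : (fun v => _) = hd c \o slice) => [->|]; last first.
      by apply/funext => v; rewrite /= mul1g.
    rewrite {1}(vcoord_sum (L u i)) lvf_sumX//; apply: eq_bigr => e _.
    by rewrite lvf_scaleX// mxE.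
  under eq_bigr do rewrite mulr_suml; rewrite exchange_big/=.
  transitivity (\sum_e vcoord e (L u i) * (A (slice u) *m invmx (A (slice u))) e b).
    by apply: eq_bigr => e _; rewrite mxE mulr_sumr; apply: eq_bigr => c _; rewrite mulrA.
  rewrite mulmxV// (bigD1 b)//= mxE eqxx mulr1 big1 ?addr0// => e eb.
  by rewrite mxE (negbTE eb) mulr0.
apply: Ck_on_sum => // c; apply: Ck_on_mul => //.
  apply: Ck_on_pderiv; apply: (Ck_on_sub (U := slice_dom setT)) => [u /sub//|].
  by apply: (smooth_slice openT); apply/smooth_inT.
have H : smooth_in O (fun y => invmx (A y) c b).
  by apply: smooth_in_invmx => // e f; exact: smooth_smooth_in.
exact: (smooth_slice oO H).
Qed.

End LogDerivative.

(** What the integration on G/P needs: charts at all points by translation, with frame e at the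
    centre, and P-invariant bumps of arbitrarily small support. The last clause allows objects
    defined only on the big cell to be extended by zero after multiplication with chi. *)
Definition bump_charts (R : realType) (G : lieGroup R) n (P cell : set G)
    (o : ('I_n -> lie G) -> R^o) (e : 'I_n -> lie G) (B : 'M[R]_(n, lg_dim G)) (r : R) : Prop :=
  let U := [set u : 'rV[R]_n | `|u| < r] in
  [/\ forall a, oriented_chart P o U (fun u => a * slice B u)%g,
      forall u, U u -> slice_dom B setT u,
      forall i b, smooth_on U (fun u => vcoord b (log_deriv (slice B) u i)),
      log_deriv (slice B) 0 = e
    & forall d : R, 0 < d -> exists (chi : G -> R) (C : set 'rV[R]_n),
  [/\ smooth chi, forall y, 0 <= chi y, forall y h, P h -> chi (y * h)%g = chi y, 0 < chi 1%g &
   [/\ compact C, C `<=` U, forall u, C u -> `|u| <= d,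
    forall y, (forall u, C u -> ~ P ((slice B u)^-1 * y)%g) -> chi y = 0
    & forall y, cell y \/ \forall y' \near y, chi y' = 0]]].

(** * Construction of the charts and bumps *)

Section SliceChart.
Variables (R : realType) (G : lieGroup R) (m : nat) (gr : int -> {vspace lie G}).
Hypothesis grG : grading m gr.
Hypothesis ss : semisimple G.
Variable p : {vspace lie G}.
Hypothesis pE : p = (\sum_(i < m.+1) gr i%:Z)%VS.
Variable E : lie G.
Hypothesis EE : forall v, br E v = weight_op m gr v.
Hypothesis E0 : E \in gr 0.
Variable P : set G.
Hypothesis Psub : is_subgroup P.
Hypothesis Pconn : connected_component (normalizer p) 1%g `<=` P.
Hypothesis Pnorm : P `<=` normalizer p.
Variables (n : nat) (e : 'I_n -> lie G) (lam : 'I_n -> {linear lie G -> R^o}).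
Hypothesis lp : forall v, v \in p <-> forall a, lam a v = 0.
Hypothesis lE : forall a b, lam a (br E (e b)) = (a == b)%:R.
Variable o : ('I_n -> lie G) -> R^o.
Hypothesis oM : multilin o.
Hypothesis oe : 0 < o e.
Implicit Types (x y : G) (u v : 'rV[R]_n).

Local Notation cell := (big_cell m gr).
Local Notation sg := (slice (cell_dirs e)).
Local Notation L := (log_deriv sg).
Local Notation f := (cell_fun m gr E lam).

Definition cell_coord y : 'rV[R]_n := \row_a f a y.

Let P1 : P 1%g. Proof. by have [] := Psub. Qed.
Let PM x y : P x -> P y -> P (x * y)%g. Proof. by have [_ h _] := Psub; exact: h. Qed.
Let PV x : P x -> P (x^-1)%g. Proof. by have [_ _ h] := Psub; exact: h. Qed.

Let oc : open cell := open_big_cell m gr.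

Let cell_coord_continuous y : cell y -> {for y, continuous cell_coord}.
Proof.
move=> cy; apply: (@row_continuous R _ n cell_coord y) => a.
rewrite (_ : (fun z => _) = f a); last by apply/funext => z; rewrite mxE.
exact: (smooth_in_continuous (smooth_cell_fun m gr E lam a) cy).
Qed.

Let cell_coord0 : cell_coord (sg 0) = 0.
Proof. by apply/rowP => a; rewrite !mxE slice0 (cell_fun1 grG pE E0 lp). Qed.

(** The third property says that the saturation of the slice under P is open in G. It and the
    Lipschitz estimate come from the implicit function theorem for the cell functions. *)
Lemma slice_ball : exists2 r : R, 0 < r & let U := [set u : 'rV[R]_n | `|u| < r] in
  [/\ forall u, U u -> slice_dom (cell_dirs e) cell u,
      forall u v, U u -> U v -> `|u - v| <= 2 * `|cell_coord (sg u) - cell_coord (sg v)|,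
      forall u, U u -> \forall y \near sg u, exists2 v, U v & P ((sg v)^-1 * y)%g,
      forall u, U u -> 0 < o (L u)
    & forall i b, smooth_on U (fun u => vcoord b (L u i))].
Proof.
have [r r0 [ri [rl rs]]] := cell_map_local grG pE E0 lp lE.
have [T [oT T1] Ts] := smooth_log_deriv (cell_dirs e).
pose D := slice_dom (cell_dirs e) (cell `&` T).
have D0 : D 0 by apply: slice_dom0; split=> //; exact: big_cell1.
have oD : open D by apply: open_slice_dom; exact: openI.
have DO u : D u -> slice_dom (cell_dirs e) T u by case=> ? [].
have Dc u : D u -> slice_dom (cell_dirs e) cell u by case=> ? [].
have DT u : D u -> slice_dom (cell_dirs e) setT u by case.
have smL i b : smooth_on D (fun u => vcoord b (L u i)).
  by move=> k; apply: Ck_on_sub (Ts i b k) => u; exact: DO.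
have oC : Ck_on 0 D (fun u => o (L u)).
  apply: (@Ck_on_multilin R (lie G) n n 0 D (fun=> o) (fun u => L u)) => //.
    by move=> Y; exact: (Ck_on_cst 0 (o Y)).
  by move=> l b; exact: smL.
have oc0 := Ck_on_cont oC D0.
have L0 : L 0 = e.
  by apply/funext => i; apply: log_deriv0; exact: cell_dirsP.
have oL : \forall u \near (0 : 'rV[R]_n), 0 < o (L u).
  apply: (oc0 [set t : R | 0 < t]); rewrite /= L0.
  by apply: open_nbhs_nbhs; split=> //; exact: open_gt.
have wn : \forall u \near (0 : 'rV[R]_n), `|cell_coord (sg u)| < r / 2.
  have ct : {for 0, continuous (fun u => cell_coord (sg u))}.
    apply: continuous_comp; first by apply: slice_continuous; exact: DT.
    by apply: cell_coord_continuous; rewrite slice0; exact: big_cell1.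
  have /cvgrPdist_lt/(_ (r / 2)) := ct; rewrite divr_gt0// => /(_ isT); apply: filterS => u.
  by rewrite cell_coord0 sub0r normrN.
have Dn : \forall u \near (0 : 'rV[R]_n), D u by exact: open_nbhs_nbhs.
have [r2 /= r20 hr2] := proj1 (nbhs_ballP _ _) (filterI Dn (filterI wn oL)).
exists (Num.min r r2); first by rewrite lt_min r0 r20.
have inD u : `|u| < Num.min r r2 -> [/\ D u, `|cell_coord (sg u)| < r / 2, 0 < o (L u) & `|u| <= r].
  rewrite lt_min => /andP[ur ur2]; have [|? [? ?]] := hr2 u; last by split=> //; exact: ltW.
  by rewrite -ball_normE/= sub0r normrN.
have cr : `|ucoord G - ucoord G| <= r by rewrite subrr normr0 ltW.
split=> [u /inD[/Dc]//|u v /inD[_ _ _ ur] /inD[_ _ _ vr]||u /inD[]//|i b k]; last first.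
- by apply: Ck_on_sub (smL i b k) => u /inD[].
- move=> u /[dup] uU /inD[Du uw _ ur].
  have nn := normalizer_near1 grG pE EE E0 Pconn lp lE.
  (* Equal cell coordinates only give an element of the normalizer; it is in P once v and y are
     close enough to u and sg u. *)
  have n1 : \forall v \near u & y \near sg u, normalizer p ((sg v)^-1 * y)%g -> P ((sg v)^-1 * y)%g.
    have ct : {for (u, sg u), continuous (fun z : 'rV[R]_n * G => (sg z.1)^-1 * z.2)%g}.
      apply: (@continuous_comp _ _ _ (fun z : 'rV[R]_n * G => ((sg z.1)^-1, z.2)%g)
        (fun w : G * G => (w.1 * w.2)%g)); last exact: mulg_continuous.
      apply: pair_continuous; last exact: cvg_snd.
      apply: continuous_comp; last exact: invg_continuous.
      by apply: continuous_comp; [exact: cvg_fst|apply: slice_continuous; exact: DT].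
    by apply: (ct [set z | normalizer p z -> P z]); rewrite /= mulVg.
  have [[N1 N2] /= [/nbhs_ballP[d /= d0 hd] hN2] hN] := n1.
  (* This keeps v in the ball U and within the distance d of u required by [n1]. *)
  pose eps := Num.min d (Num.min r r2 - `|u|).
  have eps0 : 0 < eps by rewrite lt_min d0 subr_gt0.
  have cu : cell (sg u) by have [] := Dc _ Du.
  have cc := cell_coord_continuous cu.
  have h1 : \forall y \near sg u, `|cell_coord y| < r / 2.
    exact: (cvgr_norm_lt (cell_coord (sg u)) cc).
  have h2 : \forall y \near sg u, `|cell_coord y - cell_coord (sg u)| < eps / 2.
    have /cvgrPdist_lt/(_ (eps / 2)) := cc; rewrite divr_gt0// => /(_ isT).
    by apply: filterS => y; rewrite distrC.
  have h3 : \forall y \near sg u, cell y by apply: open_nbhs_nbhs.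
  have h4 : \forall y \near sg u, (`|cell_coord y| < r / 2 /\
      `|cell_coord y - cell_coord (sg u)| < eps / 2) /\ (cell y /\ N2 y).
    by apply: filterI; apply: filterI.
  apply: filterS h4 => y [[y1 y2] [y3 yN]].
  have c0 : cell_map m gr E lam (ucoord G) = 0 by exact: (cell_map0 grG pE E0 lp).
  have [|v vb vE] := rs (ucoord G) (cell_coord y) cr; first by rewrite c0 subr0 ltW.
  rewrite c0 subr0 in vb; have vr : `|v| <= r by lra.
  have vu : `|v - u| < eps.
    have := rl _ _ _ cr vr ur; rewrite vE -/(cell_coord (sg u)).
    have -> : cell_map m gr E lam (ucoord G + u *m cell_dirs e) = cell_coord (sg u) by [].
    lra.
  exists v.
    have := ler_normD (v - u) u; rewrite subrK /=.
    by move: vu; rewrite lt_min => /andP[_]; lra.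
  have Nv : N1 v.
    by apply: hd; rewrite -ball_normE/= distrC; apply: lt_le_trans vu _; rewrite ge_min lexx.
  have := hN (v, y) (conj Nv yN) => /=; apply.
  apply: (cell_fun_sep grG pE EE lp) => //.
    by have [] := ri _ _ cr vr.
  by move=> a; have /rowP/(_ a) := vE; rewrite !mxE.
- exact: (rl _ _ _ cr ur vr).
Qed.

Let r := s2val (cid2 slice_ball).
Let r0 : 0 < r := s2valP (cid2 slice_ball).
Let U : set 'rV[R]_n := [set u | `|u| < r].

Let slice_ballP : [/\ forall u, U u -> slice_dom (cell_dirs e) cell u,
      forall u v, U u -> U v -> `|u - v| <= 2 * `|cell_coord (sg u) - cell_coord (sg v)|,
      forall u, U u -> \forall y \near sg u, exists2 v, U v & P ((sg v)^-1 * y)%g,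
      forall u, U u -> 0 < o (L u)
    & forall i b, smooth_on U (fun u => vcoord b (L u i))] := s2valP' (cid2 slice_ball).

Let cell_coord_mul y h : cell y -> P h -> cell_coord (y * h)%g = cell_coord y.
Proof.
move=> cy Ph; apply/rowP => a; rewrite !mxE; apply: (cell_fun_mul grG pE) => //.
exact: Pnorm.
Qed.

(** The preimage in G of the part of G/P that C parametrizes. *)
Let swept (C : set 'rV[R]_n) : set G := [set y | exists2 u, C u & P ((sg u)^-1 * y)%g].

Let swept_mul C y h : P h -> swept C y -> swept C (y * h)%g.
Proof. by move=> Ph [u Cu Pu]; exists u => //; rewrite mulgA; exact: PM. Qed.

Let swept_cell y : swept U y -> cell y.
Proof.
move=> [u Uu Pu]; rewrite -(mulVKg (sg u) y); apply: (big_cell_mul grG pE); first exact: Pnorm.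
by have [h _ _ _ _] := slice_ballP; have [] := h u Uu.
Qed.

Let open_swept : open (swept U).
Proof.
rewrite openE => y [u Uu Pu]; have [_ _ h _ _] := slice_ballP.
have c : {for y, continuous (fun y' : G => y' * ((sg u)^-1 * y)^-1)%g} by exact: rmul_continuous.
have yE : (y * ((sg u)^-1 * y)^-1 = sg u)%g by rewrite invgM invgK mulVKg.
have H : \forall y' \near y, swept U (y' * ((sg u)^-1 * y)^-1)%g.
  by apply: (c (swept U)); rewrite yE; exact: h.
rewrite /interior; apply: filterS H => y' hy'.
by have := swept_mul Pu hy'; rewrite mulgVK.
Qed.

(** P is closed, and compactness of C makes the avoidance of all its cosets an open condition. *)
Let closed_swept C : compact C -> C `<=` U -> closed (swept C).
Proof.
move=> cC CU; rewrite -openC openE => y ny; rewrite /interior.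
have H : \forall y' \near y, forall u, C u -> ~ P ((sg u)^-1 * y')%g.
  apply: (compact_near_coveringP C).1 => // u Cu.
  have ct : {for (u, y), continuous (fun z : 'rV[R]_n * G => (sg z.1)^-1 * z.2)%g}.
    apply: (@continuous_comp _ _ _ (fun z : 'rV[R]_n * G => ((sg z.1)^-1, z.2)%g)
      (fun w : G * G => (w.1 * w.2)%g)); last exact: mulg_continuous.
    apply: pair_continuous; last exact: cvg_snd.
    apply: continuous_comp; last exact: invg_continuous.
    apply: continuous_comp; first exact: cvg_fst.
    apply: slice_continuous; have [h _ _ _ _] := slice_ballP.
    by have [] := h u (CU _ Cu).
  have oP : open (~` P).
    by rewrite openC; exact: (subgroup_closed grG pE EE E0 Psub Pconn Pnorm lp lE).
  apply: (ct [set z | ~ P z]); apply: open_nbhs_nbhs; split=> //= Pu.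
  by apply: ny; exists u.
by apply: filterS H => y' h [u Cu Pu]; exact: (h u Cu).
Qed.

Let slice_bump (d : R) : 0 < d -> exists (chi : G -> R) (C : set 'rV[R]_n),
  [/\ smooth chi, forall y, 0 <= chi y, forall y h, P h -> chi (y * h)%g = chi y, 0 < chi 1%g &
   [/\ compact C, C `<=` U, forall u, C u -> `|u| <= d,
    forall y, (forall u, C u -> ~ P ((sg u)^-1 * y)%g) -> chi y = 0
    & forall y, cell y \/ \forall y' \near y, chi y' = 0]].
Proof.
(* On the slice, |u| is at most twice the norm of the cell coordinates. So coordinates below rho
   confine u to the ball of radius 2 rho, which is at most d and less than r. *)
move=> d0; pose rho := Num.min d (r / 2) / 2.
have m0 : 0 < Num.min d (r / 2) by rewrite lt_min d0 divr_gt0.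
have rho0 : 0 < rho by rewrite divr_gt0.
have rhod : 2 * rho <= d by rewrite /rho mulrC divfK// ge_min lexx.
have rhor : 2 * rho < r.
  by apply: (@le_lt_trans _ _ (r / 2)); [rewrite /rho mulrC divfK// ge_min lexx orbT|rewrite ltr_pdivrMr// ltr_pMr// ltr1n].
pose C : set 'rV[R]_n := closed_ball_ Num.Def.normr (0 : 'rV[R]_n) (2 * rho).
have CE u : C u -> `|u| <= 2 * rho by rewrite /C /closed_ball_/= sub0r normrN.
have cC : compact C by apply: compact_closed_ball; rewrite mulr_gt0.
have CU : C `<=` U by move=> u /CE h; exact: le_lt_trans h rhor.
pose q y : R := rho ^+ 2 + \sum_a (- 1) * (f a y * f a y).
(* The cell coordinates do not separate cosets of P within the normalizer, so q may be positive away
   from the slice as well; chi is set to 0 there. *)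
pose chi y : R := if y \in swept U then flat 0 (q y) else 0.
have chiE y : swept U y -> chi y = flat 0 (q y) by move=> h; rewrite /chi mem_set.
have chi0 y : ~ swept U y -> chi y = 0 by move=> h; rewrite /chi memNset.
have out y : ~ swept C y -> chi y = 0.
  move=> nC; have [sy|] := pselect (swept U y); last exact: chi0.
  rewrite chiE// flat_le0// /q; have [u Uu Pu] := sy.
  rewrite leNgt; apply/negP => qy; apply: nC; exists u => //.
  rewrite /C /closed_ball_/= sub0r normrN.
  have [h1 h2 _ _ _] := slice_ballP; have cu : cell (sg u) by have [] := h1 u Uu.
  have U0 : U 0 by rewrite /U/= normr0.
  have := h2 u 0 Uu U0; rewrite subr0 cell_coord0 subr0 => /le_trans; apply.
  rewrite ler_pM2l// -(cell_coord_mul cu Pu) mulVKg.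
  apply: row_norm_le => [|a]; first exact: ltW.
  rewrite mxE -(@ler_pXn2r _ 2)// ?nnegrE ?ltW// real_normK ?num_real//.
  have : \sum_(b | b != a) (- 1) * (f b y * f b y) <= 0.
    by apply: sumr_le0 => b _; rewrite mulN1r oppr_le0 -expr2 sqr_ge0.
  by move: qy; rewrite (bigD1 a)//= expr2; lra.
have sq : smooth_in (swept U) q.
  apply: smooth_in_add => //; first exact: (smooth_in_cst (rho ^+ 2)).
  apply: smooth_in_sum => // a; apply: smooth_in_mul => //; first exact: (smooth_in_cst (-1)).
  have fa : smooth_in (swept U) (f a).
    by apply: smooth_in_sub (smooth_cell_fun m gr E lam a) => y; exact: swept_cell.
  exact: smooth_in_mul.
have oC : open (~` swept C) by rewrite openC; exact: closed_swept.
have nC y : ~ swept U y -> open_nbhs y (~` swept C).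
  by move=> nsy; split=> // -[u Cu Pu]; apply: nsy; exists u => //; exact: CU.
exists chi, C; split.
- apply: smooth_local => y; have [sy|nsy] := pselect (swept U y).
    exists (swept U) => //; apply: (@smooth_in_eq _ _ (swept U) (fun y => flat 0 (q y)) chi) => //.
      by move=> z sz; rewrite chiE.
    exact: smooth_in_flat.
  exists (~` swept C); first exact: nC.
  apply: (@smooth_in_eq _ _ _ (cst 0) chi oC); last exact: smooth_in_cst.
  by move=> z nz; rewrite out.
- by move=> y; rewrite /chi; case: ifP => // _; exact: flat_ge0.
- move=> y h Ph; have [sy|nsy] := pselect (swept U y).
    rewrite (chiE _ sy) (chiE _ (swept_mul Ph sy)).
    congr (flat 0 (_ + _)); apply: eq_bigr => a _.
    by have /rowP/(_ a) := cell_coord_mul (swept_cell sy) Ph; rewrite !mxE => ->.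
  rewrite !chi0// => hs; apply: nsy; rewrite -(mulgK h y).
  by apply: swept_mul => //; exact: PV.
- rewrite chiE; last first.
    by exists 0; [rewrite /U/= normr0|rewrite slice0 invg1 mul1g].
  apply: flat_gt0; rewrite /q big1 ?addr0 ?exprn_gt0// => a _.
  by rewrite (cell_fun1 grG pE E0 lp) mul0r mulr0.
split=> // [u /CE h|y ny|y]; first exact: le_trans h rhod.
  by apply: out => -[u Cu Pu]; exact: (ny u).
have [/swept_cell|nsy] := pselect (swept U y); [by left|right].
by apply: filterS (open_nbhs_nbhs (nC y nsy)) => y'; exact: out.
Qed.

Lemma slice_chart : exists2 r : R, 0 < r & bump_charts P cell o e (cell_dirs e) r.
Proof.
exists r => //; rewrite /bump_charts/=; have [h1 h2 h3 h4 h5] := slice_ballP.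
have UT u : U u -> slice_dom (cell_dirs e) setT u by move=> /h1[].
split; [move=> a|exact: UT|exact: h5| |exact: slice_bump]; last first.
  by apply/funext => i; apply: log_deriv0; exact: cell_dirsP.
split=> [|h sh k|u v Uu Uv|u Uu].
- have -> : [set u : 'rV[R]_n | `|u| < r] = ball (0 : 'rV[R]_n) r.
    by apply/seteqP; split=> u; rewrite -ball_normE/= sub0r normrN.
  exact: ball_open.
- apply: (Ck_on_sub (U := slice_dom (cell_dirs e) setT)) => [u /UT//|].
  have sh' := smooth_lmul a sh.
  exact: (@smooth_slice _ _ _ _ setT (fun y => h (a * y)%g) openT (proj2 (smooth_inT _) sh') k).
- rewrite invgM -mulgA mulKg => Puv; apply/eqP; rewrite -subr_eq0 -normr_le0.
  apply: le_trans (h2 u v Uu Uv) _.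
  have cu : cell (sg u) by have [] := h1 u Uu.
  by rewrite -(cell_coord_mul cu Puv) mulVKg subrr normr0 mulr0.
- have -> : log_deriv (fun u => a * sg u)%g u = L u.
    by apply/funext => i; exact: log_deriv_translate (UT u Uu).
  exact: h4.
Qed.

End SliceChart.

(** * Iterated integrals and the Stokes theorem *)

Section IteratedIntegral.
Variable R : realType.
Local Notation r1 t v := (row_mx ((t : R)%:M : 'rV[R]_1) v).

Lemma seg_int_gt0 (a b t0 : R) (f : R -> R) : cont_seg a b f -> a < t0 < b ->
  (forall t, 0 <= f t) -> 0 < f t0 -> 0 < seg_int a b f.
Proof.
move=> cf /andP[at0 t0b] f0 ft0.
have c0 : {for t0, continuous f} by apply: cf; rewrite !ltW.
have /cvgrPdist_lt/(_ (f t0 / 2)) := c0; rewrite divr_gt0// => /(_ isT)/nbhs_ballP[d /= d0 hd].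
pose s := Num.min (d / 2) (Num.min (t0 - a) (b - t0)).
have s0 : 0 < s by rewrite !lt_min divr_gt0// !subr_gt0 at0.
have [s1 s2 s3] : [/\ s <= d / 2, s <= t0 - a & s <= b - t0] by rewrite /s !ge_min !lexx !orbT.
have lb t : t0 - s <= t <= t0 + s -> f t0 / 2 <= f t.
  move=> /andP[h1 h2]; have := hd t; rewrite /ball/= => /(_ _).
  have td : `|t0 - t| < d by rewrite ltr_distlC; apply/andP; split; lra.
  by move=> /(_ td); rewrite ltr_distl => /andP[]; lra.
have cs : cont_seg (t0 - s) (t0 + s) f.
  by move=> t /andP[h1 h2]; apply: cf; apply/andP; split; lra.
apply: (@lt_le_trans _ _ (seg_int (t0 - s) (t0 + s) f)).
  apply: (@lt_le_trans _ _ (seg_int (t0 - s) (t0 + s) (fun=> f t0 / 2))).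
    by rewrite seg_int_cst; last lra; rewrite mulr_gt0// ?divr_gt0//; lra.
  by apply: seg_int_le => //; exact: cont_seg_cst.
rewrite /seg_int /Rintegral fine_le//.
- exact: integrable_fin_num (cont_seg_integrable cs).
- exact: integrable_fin_num (cont_seg_integrable cf).
apply: ge0_subset_integral => //.
- by have /measurable_int := cont_seg_integrable cf.
- by move=> t _; rewrite lee_fin.
- by move=> t /=; rewrite !in_itv/= => /andP[h1 h2]; apply/andP; split; lra.
Qed.

(** Support in a box for the sup norm: each integral over the line in [iter_int] becomes one over
    [-M, M]. *)
Definition box_supp n (M : R) (g : 'rV[R]_n -> R) := forall u, M < `|u| -> g u = 0.

Lemma norm_row_l n t (v : 'rV[R]_n) : `|t| <= `|r1 t v|.
Proof.
apply: le_trans (coord_norm _ (lshift n 0)); rewrite row_mxEl mxE eqxx mulr1n.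
exact: lexx.
Qed.

Lemma norm_row_r n t (v : 'rV[R]_n) : `|v| <= `|r1 t v|.
Proof.
apply: row_norm_le => // i; apply: le_trans (coord_norm _ (rshift 1 i)).
by rewrite row_mxEr.
Qed.

Lemma iter_int0 n : iter_int (fun _ : 'rV[R]_n => 0) = 0.
Proof.
elim: n => [//|n IH] /=; under eq_Rintegral do rewrite IH.
by rewrite /Rintegral integral0.
Qed.

Lemma box_supp_slice n M (g : 'rV[R]_(1 + n) -> R) t : box_supp M g ->
  box_supp M (fun v => g (r1 t v)).
Proof. by move=> h v hv; apply: h; exact: lt_le_trans hv (norm_row_r t v). Qed.

Lemma iter_intS n M (g : 'rV[R]_(1 + n) -> R) : box_supp M g ->
  @iter_int R n.+1 g = seg_int (- M) M (fun t => iter_int (fun v => g (r1 t v))).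
Proof.
move=> h; rewrite /seg_int [RHS]Rintegral_mkcond /=.
apply: eq_Rintegral => t _; rewrite patchE; case: ifP => // /negbT/negP ht.
rewrite (_ : (fun v => _) = fun=> 0) ?iter_int0//; apply/funext => v; apply: h.
apply: lt_le_trans (norm_row_l t v); rewrite ltNge; apply/negP => tM; apply: ht.
by rewrite inE/= in_itv/= -ler_norml.
Qed.

Lemma row_cons_continuous n : continuous (fun z : R * 'rV[R]_n => r1 z.1 z.2).
Proof.
move=> z; apply: (@row_mx_continuous R (R * 'rV[R]_n)%type 1 n (fun z => z.1%:M) snd z); last exact: cvg_snd.
apply: row_continuous => j; rewrite (_ : (fun y : R * 'rV[R]_n => _) = fst); first exact: cvg_fst.
by apply/funext => y; rewrite mxE !ord1 eqxx mulr1n.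
Qed.

Lemma row_cons_continuous1 n t : continuous (fun v : 'rV[R]_n => r1 t v).
Proof.
move=> v; apply: (@continuous_comp _ _ _ (fun v => (t, v)) (fun z : R * 'rV[R]_n => r1 z.1 z.2)).
  by apply: pair_continuous; [exact: cst_continuous|exact: cvg_id].
exact: row_cons_continuous.
Qed.

(** The parameter space is general because the induction passes from T to T * R, the outer
    integration variable becoming a parameter. *)
Lemma iter_int_continuous n (T : topologicalType) (F : T -> 'rV[R]_n -> R) M : 0 <= M ->
  (forall y, box_supp M (F y)) -> continuous (fun z : T * 'rV[R]_n => F z.1 z.2) ->
  continuous (fun y => iter_int (F y)).
Proof.
move=> M0; elim: n T F => [|n IH] T F Fs cF x.
  apply: (continuous_comp (f := fun y : T => (y, 0 : 'rV[R]_0)) (g := fun z => F z.1 z.2)).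
    by apply: pair_continuous; [exact: cvg_id|exact: cst_continuous].
  exact: cF.
have -> : (fun y => iter_int (F y)) =
    fun y => seg_int (- M) M (fun t => iter_int (fun v => F y (r1 t v))).
  by apply/funext => y; exact: iter_intS.
have cI : continuous (fun z : T * R => iter_int (fun v => F z.1 (r1 z.2 v))).
  apply: IH => [z|z]; first exact: box_supp_slice.
  apply: (@continuous_comp _ _ _ (fun z : T * R * 'rV[R]_n => (z.1.1, r1 z.1.2 z.2))
    (fun z => F z.1 z.2)); last exact: cF.
  apply: pair_continuous.
    by apply: continuous_comp; exact: cvg_fst.
  apply: (@continuous_comp _ _ _ (fun z : T * R * 'rV[R]_n => (z.1.2, z.2))
    (fun z : R * 'rV[R]_n => r1 z.1 z.2)); last exact: row_cons_continuous.
  apply: pair_continuous; last exact: cvg_snd.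
  by apply: continuous_comp; [exact: cvg_fst|exact: cvg_snd].
apply: seg_int_continuous; first lra.
- apply: nearW => y t _.
  apply: (@continuous_comp _ _ _ (fun t : R => (y, t))
    (fun z : T * R => iter_int (fun v => F z.1 (r1 z.2 v)))); last exact: cI.
  by apply: pair_continuous; [exact: cst_continuous|exact: cvg_id].
- by move=> t _; exact: cI.
Qed.

Lemma slice_continuous2 n (g : 'rV[R]_(1 + n) -> R) : continuous g ->
  continuous (fun z : R * 'rV[R]_n => g (r1 z.1 z.2)).
Proof. by move=> cg z; apply: continuous_comp; [exact: row_cons_continuous|exact: cg]. Qed.

Lemma slice_continuous1 n (g : 'rV[R]_(1 + n) -> R) t : continuous g ->
  continuous (fun v : 'rV[R]_n => g (r1 t v)).
Proof.
by move=> cg v; apply: continuous_comp; [exact: row_cons_continuous1|exact: cg].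
Qed.

Lemma iter_int_slice_continuous n (g : 'rV[R]_(1 + n) -> R) M : 0 <= M -> box_supp M g ->
  continuous g -> continuous (fun t => iter_int (fun v => g (r1 t v))).
Proof.
move=> M0 gs cg; apply: (iter_int_continuous M0) => [t|]; first exact: box_supp_slice.
exact: slice_continuous2.
Qed.

Lemma iter_int_comb n (g g' : 'rV[R]_n -> R) c M : 0 <= M -> box_supp M g -> box_supp M g' ->
  continuous g -> continuous g' ->
  iter_int (fun u => c * g u + g' u) = c * iter_int g + iter_int g'.
Proof.
move=> M0; elim: n g g' => [//|n IH] g g' gs gs' cg cg'.
have hs : box_supp M (fun u => c * g u + g' u) by move=> u hu; rewrite gs// gs'// mulr0 addr0.
rewrite (iter_intS hs) (iter_intS gs) (iter_intS gs').
have c1 : cont_seg (- M) M (fun t => iter_int (fun v => g (r1 t v))).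
  by move=> t _; exact: (iter_int_slice_continuous M0).
have c2 : cont_seg (- M) M (fun t => iter_int (fun v => g' (r1 t v))).
  by move=> t _; exact: (iter_int_slice_continuous M0).
rewrite -seg_int_scale// -seg_int_add//; last by apply: cont_seg_mul => //; exact: cont_seg_cst.
apply: eq_seg_int => t _; apply: IH; try exact: box_supp_slice; exact: slice_continuous1.
Qed.

Lemma iter_int_sum n (I : Type) (r : seq I) (c : I -> R) (g : I -> 'rV[R]_n -> R) M :
  0 <= M -> (forall i, box_supp M (g i)) -> (forall i, continuous (g i)) ->
  iter_int (fun u => \sum_(i <- r) c i * g i u) = \sum_(i <- r) c i * iter_int (g i).
Proof.
move=> M0 gs cg; elim: r => [|i r IH].
  by under [X in iter_int X]eq_fun do rewrite big_nil; rewrite big_nil iter_int0.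
under [X in iter_int X]eq_fun do rewrite big_cons.
rewrite (@iter_int_comb _ (g i) (fun u => \sum_(j <- r) c j * g j u) _ M) ?big_cons ?IH//.
  by move=> u hu; rewrite big1// => j _; rewrite gs// mulr0.
move=> u; apply: sum_continuous => j; apply: continuousM; first exact: cst_continuous.
exact: cg.
Qed.

Lemma iter_int_ge0 n (g : 'rV[R]_n -> R) : (forall u, 0 <= g u) -> 0 <= iter_int g.
Proof.
elim: n g => [|n IH] g g0 /=; first exact: g0.
by apply: Rintegral_ge0 => t _; exact: IH.
Qed.

Lemma iter_int_gt0 n (g : 'rV[R]_n -> R) M u0 : 0 <= M -> box_supp M g -> continuous g ->
  (forall u, 0 <= g u) -> 0 < g u0 -> 0 < iter_int g.
Proof.
move=> M0; elim: n g u0 => [|n IH] g u0 gs cg g0 gu0.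
  by rewrite /= (_ : 0 = u0) //; apply/rowP => -[].
(* The larger box has the first coordinate of u0 in its interior. *)
have M1 : 0 <= M + 1 by lra.
have gs1 : box_supp (M + 1) g by move=> u hu; apply: gs; lra.
have u0E : r1 (u0 0 0) (rsubmx (u0 : 'rV[R]_(1 + n))) = u0.
  rewrite -[RHS](@hsubmxK R 1 1 n); congr row_mx.
  by apply/rowP => j; rewrite !mxE !ord1 eqxx mulr1n; congr (u0 0 _); apply: val_inj.
have uM : `|u0 0 0| <= M.
  apply: le_trans (coord_norm u0 0) _; rewrite leNgt; apply/negP => /gs u00.
  by rewrite u00 ltxx in gu0.
rewrite (iter_intS gs1); apply: (@seg_int_gt0 _ _ (u0 0 0)).
- by move=> t _; exact: (iter_int_slice_continuous M1).
- by move: uM; rewrite ler_norml => /andP[h1 h2]; apply/andP; split; lra.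
- by move=> t; exact: iter_int_ge0.
- apply: (IH _ (rsubmx (u0 : 'rV[R]_(1 + n)))); first exact: box_supp_slice.
  + exact: slice_continuous1.
  + by move=> v.
  + by rewrite u0E.
Qed.

Lemma is_derive_shift (f : R -> R) (s0 d s : R) :
  is_derive s 1 (fun s => f (s0 + s)) d <-> is_derive (s0 + s) 1 f d.
Proof.
have key (a b c : R) (h : R -> R) : is_derive (a + b) 1 h c -> is_derive b 1 (fun s => h (a + s)) c.
  move=> hd; have D : is_derive b 1 (fun s : R => a + s) 1.
    by have := is_derive_affine a 1 b; congr is_derive; apply/funext => t; rewrite mulr1.
  by have := @is_derive1_comp R h (fun s => a + s) b c 1 hd D; rewrite mulr1.
split; last exact: key.
move=> h; have := key (- s0) (s0 + s) d (fun s => f (s0 + s)).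
rewrite addKr => /(_ h); congr is_derive; apply/funext => t.
by rewrite addrA subrr add0r.
Qed.

Lemma is_derive_iter_int n (F dF : R -> 'rV[R]_n -> R) (M s0 : R) : 0 <= M ->
  (forall s, box_supp M (F s)) -> (forall s, box_supp M (dF s)) ->
  continuous (fun z : R * 'rV[R]_n => F z.1 z.2) ->
  continuous (fun z : R * 'rV[R]_n => dF z.1 z.2) ->
  (forall (s : R) u, is_derive s 1 (fun s : R => F s u) (dF s u)) ->
  is_derive s0 1 (fun s : R => iter_int (F s)) (iter_int (dF s0)).
Proof.
move=> M0; elim: n F dF s0 => [|n IH] F dF s0 Fs dFs cF cdF FD; first exact: FD.
have cs (H : R -> 'rV[R]_(1 + n) -> R) : (forall s, box_supp M (H s)) ->
    continuous (fun z : R * 'rV[R]_(1 + n) => H z.1 z.2) ->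
    continuous (fun z : R * R => iter_int (fun v => H z.1 (r1 z.2 v))).
  move=> Hs cH; apply: (iter_int_continuous M0) => [z|z]; first exact: box_supp_slice.
  apply: (@continuous_comp _ _ _ (fun z : R * R * 'rV[R]_n => (z.1.1, r1 z.1.2 z.2))
    (fun z => H z.1 z.2)); last exact: cH.
  apply: pair_continuous; first by apply: continuous_comp; exact: cvg_fst.
  apply: (@continuous_comp _ _ _ (fun z : R * R * 'rV[R]_n => (z.1.2, z.2))
    (fun z : R * 'rV[R]_n => r1 z.1 z.2)); last exact: row_cons_continuous.
  apply: pair_continuous; last exact: cvg_snd.
  by apply: continuous_comp; [exact: cvg_fst|exact: cvg_snd].
have c1 (H : R * R -> R) (s : R) : continuous H -> cont_seg (- M) M (fun t => H (s, t)).
  move=> cH t _; apply: continuous_comp; last exact: cH.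
  by apply: pair_continuous; [exact: cst_continuous|exact: cvg_id].
have c2 (H : R * R -> R) : continuous H -> continuous (fun z : R * R => H (s0 + z.1, z.2)).
  move=> cH z; apply: (@continuous_comp _ _ _ (fun z : R * R => (s0 + z.1, z.2)) H); last exact: cH.
  apply: pair_continuous; last exact: cvg_snd.
  by apply: cvgD; [exact: cvg_cst|exact: cvg_fst].
rewrite -[s0]addr0; apply/is_derive_shift; rewrite addr0.
have -> : (fun s => @iter_int R n.+1 (F (s0 + s))) = fun s => seg_int (- M) M
    (fun t => iter_int (fun v => F (s0 + s) (r1 t v))).
  by apply/funext => s; exact: iter_intS.
rewrite (iter_intS (dFs s0)).
have -> : seg_int (- M) M (fun t => iter_int (fun v => dF s0 (r1 t v))) =
    seg_int (- M) M (fun t => iter_int (fun v => dF (s0 + 0) (r1 t v))) by rewrite addr0.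
apply: (@is_derive_seg_int R (- M) M (fun s t => iter_int (fun v => F (s0 + s) (r1 t v)))
  (fun s t => iter_int (fun v => dF (s0 + s) (r1 t v))) 1) => //.
- lra.
- by move=> s _; exact: (c1 _ (s0 + s) (cs _ Fs cF)).
- move=> s t _ _; apply/(is_derive_shift (fun s => iter_int (fun v => F s (r1 t v)))).
  apply: (IH (fun s v => F s (r1 t v)) (fun s v => dF s (r1 t v))).
  + by move=> s'; exact: box_supp_slice.
  + by move=> s'; exact: box_supp_slice.
  + move=> z; apply: (@continuous_comp _ _ _ (fun z : R * 'rV[R]_n => (z.1, r1 t z.2))
      (fun z => F z.1 z.2)); last exact: cF.
    apply: pair_continuous; first exact: cvg_fst.
    by apply: continuous_comp; [exact: cvg_snd|exact: row_cons_continuous1].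
  + move=> z; apply: (@continuous_comp _ _ _ (fun z : R * 'rV[R]_n => (z.1, r1 t z.2))
      (fun z => dF z.1 z.2)); last exact: cdF.
    apply: pair_continuous; first exact: cvg_fst.
    by apply: continuous_comp; [exact: cvg_snd|exact: row_cons_continuous1].
- exact: (c1 _ (s0 + 0) (cs _ dFs cdF)).
- by move=> t _; exact: (c2 _ (cs _ dFs cdF)).
Qed.

Lemma box_supp_pderiv n (g : 'rV[R]_n -> R) i M : Ck_on 1 setT g -> box_supp M g ->
  box_supp M (pderiv i g).
Proof.
move=> gC gs u hu; have D := is_derive_line (u := u) (v := delta_mx 0 i) (t0 := 0) _.
have D1 : is_derive (0 : R) 1 (fun t : R => g (u + t *: delta_mx 0 i)) (pderiv i g u).
  by apply: is_derive_line; rewrite scale0r addr0; exact: (Ck_on_is_derive gC).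
have n0 : \forall t \near (0 : R), 0 = g (u + t *: delta_mx 0 i).
  have ct : {for (0 : R), continuous (fun t : R => `|u + t *: delta_mx 0 i : 'rV[R]_n|)}.
    apply: continuous_comp; last exact: norm_continuous.
    apply: cvgD; first exact: cvg_cst.
    exact: scalel_continuous.
  have : \forall t \near (0 : R), M < `|u + t *: delta_mx 0 i : 'rV[R]_n|.
    apply: (ct [set r | M < r]); rewrite scale0r addr0.
    by apply: open_nbhs_nbhs; split=> //; exact: open_gt.
  by apply: filterS => t ht; rewrite gs.
have d0 : is_derive (0 : R) 1 (cst 0 : R -> R) 0 by exact: is_derive_cst.
have d1 := near_eq_is_derive n0 d0.
by rewrite -(@derive_val _ _ _ _ _ _ _ D1) (@derive_val _ _ _ _ _ _ _ d1).
Qed.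

(** Along the first coordinate, the outer integral is evaluated by the fundamental theorem of
    calculus, and the values at M + 1 and -(M + 1) vanish. Along any other coordinate, the inner
    integrals vanish by induction. *)
Lemma iter_int_pderiv n (g : 'rV[R]_n -> R) i M : 0 <= M -> Ck_on 1 setT g -> box_supp M g ->
  iter_int (pderiv i g) = 0.
Proof.
move=> M0; have M1 : 0 <= M + 1 by lra.
elim: n g i => [|n IH] g i gC gs; first by case: i.
have ps := box_supp_pderiv i gC gs.
have cg : continuous g by move=> u; exact: (Ck_on_cont gC).
have cp : continuous (pderiv i g).
  by move=> u; exact: (Ck_on_cont (Ck_on_pderiv i gC)).
rewrite (@iter_intS n (M + 1) (pderiv i g)); last by move=> u hu; apply: ps; lra.
case: (@split_ordP 1 n i) => j ij; last first.
  rewrite (@eq_seg_int _ _ _ _ (fun=> 0)); first by rewrite seg_int_cst ?mul0r//; lra.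
  move=> t _; rewrite -[RHS](IH (fun v => g (r1 t v)) j).
  - by congr iter_int; apply/funext => v; rewrite pderiv_row_mx_r ij.
  - apply: (Ck_on_comp (V := setT) (f := g) (g := fun v : 'rV[R]_n => r1 t v)) => //; try exact: openT.
    apply: (@Ck_row_mx R 1 n 1 n setT (fun _ => t%:M) id) => k.
      exact: (Ck_on_cst 1 _ openT).
    by apply: Ck_on_coord; exact: openT.
  - exact: box_supp_slice.
pose H t := iter_int (fun v => g (r1 t v)).
have HM t : M < `|t| -> H t = 0.
  move=> tM; rewrite /H (_ : (fun v => _) = fun=> 0) ?iter_int0//; apply/funext => v.
  by apply: gs; exact: lt_le_trans tM (norm_row_l t v).
transitivity (H (M + 1) - H (- (M + 1))); last first.
  rewrite !HM ?subrr// ?normrN ger0_norm//; lra.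
apply: seg_int_FTC.
- lra.
- move=> t _; exact: (iter_int_slice_continuous M0 ps cp).
move=> t _; apply: (@is_derive_iter_int n (fun t v => g (r1 t v)) (fun t v => pderiv i g (r1 t v)) M) => //.
- by move=> s; exact: box_supp_slice.
- by move=> s; exact: box_supp_slice.
- exact: slice_continuous2.
- exact: slice_continuous2.
move=> s v; have E (a : R) : r1 a v = r1 0 v + a *: delta_mx 0 i :> 'rV[R]_(1 + n).
  rewrite ij; apply/rowP => k; rewrite !mxE; case: (split_ordP k) => l ->.
    by rewrite !mxE !ord1 !eqxx/= mulr1n mul0rn add0r mulr1.
  by rewrite -val_eqE [j]ord1 andbF mulr0 addr0.
have -> : (fun a : R => g (r1 a v)) = fun a => g (r1 0 v + a *: delta_mx 0 i).
  by apply/funext => a; rewrite E.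
by apply: is_derive_line; rewrite -E; exact: (Ck_on_is_derive gC).
Qed.

End IteratedIntegral.

Lemma Ck_on_extend (R : realType) n k (U C : set 'rV[R]_n) (f : 'rV[R]_n -> R) :
  open U -> closed C -> C `<=` U -> Ck_on k U f -> (forall u, U u -> ~ C u -> f u = 0) ->
  Ck_on k setT (fun u => if u \in U then f u else 0).
Proof.
move=> oU cC CU fC f0; apply: Ck_on_local => u _; have [Uu|nU] := pselect (U u).
  by exists U => //; apply: Ck_on_eq oU _ fC => v Uv; rewrite mem_set.
have oC : open (~` C) by rewrite openC.
exists (~` C); first by split=> // /CU.
apply: (Ck_on_eq (f := cst 0) oC); last exact: Ck_on_cst.
by move=> v nC; case: ifP => // /set_mem Uv; rewrite f0.
Qed.

Lemma pderiv_near (R : realType) n (f g : 'rV[R]_n -> R) u i d :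
  (\near u, g u = f u) -> is_derive u (delta_mx 0 i) f d -> pderiv i g u = d.
Proof.
move=> gf fd; rewrite pderivE.
have gd : is_derive u (delta_mx 0 i) g d.
  by apply: near_eq_is_derive fd; apply: filterS gf => v ->.
exact: derive_val.
Qed.

(** The first slot is expanded in a basis, which leaves products of a coordinate with a multilinear
    map in one variable less. *)
Lemma is_derive_multilin (R : realType) (a : vectType R) n q
    (w : 'rV[R]_n -> ('I_q -> a) -> R^o) dw (X : 'rV[R]_n -> 'I_q -> a) (dX : 'I_q -> a) u v :
  (forall u, multilin (w u)) -> multilin dw ->
  (forall Y, is_derive u v (fun u => w u Y : R) (dw Y)) ->
  (forall l b, is_derive u v (fun u => vcoord b (X u l)) (vcoord b (dX l))) ->
  is_derive u v (fun u => w u (X u) : R) (dw (X u) + \sum_l w u (upd (X u) l (dX l))).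
Proof.
elim: q w dw X dX => [|q IH] w dw X dX wM dwM wD XD.
  rewrite big_ord0 addr0; have := wD (X u); congr is_derive; apply/funext => u'.
  by congr (w u' _); apply/funext; case.
pose wb b u X' := w u (ins ord0 (vbase b) X').
pose dwb b X' := dw (ins ord0 (vbase b) X').
have H b := IH (wb b) (dwb b) (fun u => X u \o lift ord0) (dX \o lift ord0)
  (fun u => multilin_ins _ (wM u)) (multilin_ins _ dwM) (fun Y => wD _) (fun l => XD (lift ord0 l)).
have E (f : ('I_q.+1 -> a) -> R^o) Y Z : multilin f -> \sum_b vcoord b Z * f (ins ord0 (vbase b) Y) = f (ins ord0 Z Y).
  move=> fM; rewrite {2}(vcoord_sum Z) -(upd_ins ord0 0) multilin_sum//.
  by apply: eq_bigr => b _; rewrite multilinZ// upd_ins.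
have := is_derive_bigsum (index_enum _) xpredT (fun b => is_derive_mul (XD ord0 b) (H b)).
have -> : (fun u' : 'rV[R]_n => \sum_b vcoord b (X u' ord0) * wb b u' (X u' \o lift ord0)) =
    fun u' => w u' (X u') by apply/funext => u'; rewrite E ?insK.
move=> D; apply: is_derive_eq D _.
rewrite big_split E ?(wM u)// -updE; under eq_bigr do rewrite mulrDr.
rewrite big_split/= (E dw)// insK addrCA; congr (_ + _); rewrite big_ord_recl; congr (_ + _).
under eq_bigr do rewrite mulr_sumr; rewrite exchange_big; apply: eq_bigr => l _ /=.
rewrite (E (w u))// ; congr (w u _).
by rewrite -upd_ins_lift insK.
Qed.

(** For symmetric A the two terms of each pair in [sum_upd_rest2] cancel. *)
Lemma sum_upd_symmetric (R : realType) (a : vectType R) (V : lmodType R) q (D : ('I_q -> a) -> V)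
    (X : 'I_q.+1 -> a) (A : 'I_q.+1 -> 'I_q.+1 -> a) :
  signed D -> (forall i j, A i j = A j i) ->
  \sum_(i < q.+1) (-1) ^+ i *: \sum_l D (upd (X \o lift i) l (A i (lift i l))) = 0.
Proof.
case: q D X A => [|q] D X A sD AC.
  by rewrite big1// => i _; rewrite big_ord0 scaler0.
rewrite (sum_upd_rest2 X A sD) big1// => i _; rewrite big1// => j _.
by rewrite AC subrr scaler0.
Qed.

Lemma lvf_lvf_expand (R : realType) (G : lieGroup R) (Z Y : lie G) h x : smooth h ->
  lvf Z (lvf Y h) x = \sum_b vcoord b Y * lvf Z (lvf (vbase b) h) x.
Proof.
move=> sh; have -> : lvf Y h = fun y => \sum_b vcoord b Y * lvf (vbase b) h y.
  apply/funext => y; rewrite {1}(vcoord_sum Y) lvf_sumX//.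
  by apply: eq_bigr => b _; rewrite lvf_scaleX.
rewrite lvf_sum => [|b]; last by apply: smooth_scale; exact: lvf_smooth.
by apply: eq_bigr => b _; rewrite lvf_scale//; exact: lvf_smooth.
Qed.

Lemma smooth_slice_translate (R : realType) (G : lieGroup R) n (B : 'M[R]_(n, lg_dim G))
    (U : set 'rV[R]_n) (a : G) h : U `<=` slice_dom B setT -> smooth h ->
  smooth_on U (fun u => h (a * slice B u)%g).
Proof.
move=> UD sh k; apply: (Ck_on_sub UD).
exact: (@smooth_slice _ _ _ B setT (fun y => h (a * y)%g) openT
  (proj2 (smooth_inT _) (smooth_lmul a sh)) k).
Qed.

(** This shares the bracket b of the Maurer-Cartan equation evenly between its two sides. *)
Lemma half_shift (R : realType) (V : lmodType R) (x y b : V) :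
  x + b = y -> x + 2^-1 *: b = y - 2^-1 *: b.
Proof.
move=> <-; rewrite -addrA; congr (_ + _); rewrite -[X in X - _]scale1r -scalerBl.
by congr (_ *: _); lra.
Qed.

(** * The Stokes theorem in a chart *)

Section LocalStokes.
Variables (R : realType) (G : lieGroup R) (q : nat) (B : 'M[R]_(q.+1, lg_dim G)).
Local Notation sg := (slice B).
Local Notation L := (log_deriv sg).
Local Notation ed := (ext_d (@br R G) (@lvf R G)).
Variable U : set 'rV[R]_q.+1.
Hypothesis oU : open U.
Hypothesis UD : U `<=` slice_dom B setT.
Hypothesis smL : forall i b, smooth_on U (fun u => vcoord b (L u i)).
Implicit Types (h : G -> R) (u : 'rV[R]_q.+1).

Lemma is_derive_slice a h i u : smooth h -> U u ->
  is_derive u (delta_mx 0 i) (fun v => h (a * sg v)%g) (lvf (L u i) h (a * sg u)%g).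
Proof.
move=> sh Uu; rewrite -log_derivP//; last exact: UD.
exact: (Ck_on_is_derive (smooth_slice_translate a UD sh 1)).
Qed.

Definition pderiv_frame i j u : lie G := \sum_b pderiv i (fun v => vcoord b (L v j)) u *: vbase b.
Local Notation dL := pderiv_frame.

Lemma is_derive_frame i j b u : U u ->
  is_derive u (delta_mx 0 i) (fun v => vcoord b (L v j)) (vcoord b (dL i j u)).
Proof.
move=> Uu; rewrite /dL vcoordS (bigD1 b)//= big1 ?addr0 => [|c cb].
  by rewrite vcoordZ vcoord_vbase eqxx mulr1; exact: (Ck_on_is_derive (smL j b 1)).
by rewrite vcoordZ vcoord_vbase eq_sym (negbTE cb) mulr0.
Qed.

(** Symmetry of the second partial derivatives of a function on the slice, written with the frame
    L. *)
Lemma maurer_cartan i j u : U u -> dL i j u + br (L u i) (L u j) = dL j i u.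
Proof.
move=> Uu; apply: (lvf_eq_at (y := sg u)) => h sh.
have nU : \near u, U u by exact: open_nbhs_nbhs.
have second i' j' : pderiv i' (pderiv j' (h \o sg)) u =
    lvf (dL i' j' u) h (sg u) + lvf (L u i') (lvf (L u j') h) (sg u).
  pose F b v := vcoord b (L v j') * lvf (vbase b) h (1 * sg v)%g.
  apply: (@pderiv_near _ _ (fun v => \sum_b F b v)).
    apply: filterS nU => v Uv; rewrite /F; under eq_bigr do rewrite mul1g -lvf_scaleX//.
    rewrite -lvf_sumX// -vcoord_sum.
    have := log_derivP j' 1%g (UD Uv) sh; rewrite mul1g => <-.
    by apply: eq_pderiv => v'; rewrite /= mul1g.
  have D := is_derive_bigsum (index_enum _) xpredT
    (fun b => is_derive_mul (is_derive_frame i' j' b Uu)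
      (is_derive_slice 1%g i' (lvf_smooth (vbase b) sh) Uu)).
  apply: is_derive_eq D _; rewrite mul1g big_split; congr (_ + _).
    by under eq_bigr do rewrite -lvf_scaleX//; rewrite -lvf_sumX// -vcoord_sum.
  by rewrite (lvf_lvf_expand _ _ _ sh).
have C2 : Ck_on 2 U (h \o sg).
  apply: Ck_on_eq oU _ (smooth_slice_translate 1%g UD sh 2) => v _.
  by rewrite mul1g.
have := pderivC j i oU C2 Uu; rewrite !second => e.
have alg (x y z t : R) : x + y = z + t -> x + (y - t) = z.
  by move=> E; rewrite addrA E addrK.
by rewrite (lvf_addX _ _ _ sh) (brE _ _ _ sh); exact: alg e.
Qed.

Section Form.
Variables (w : G -> ('I_q -> lie G) -> R^o) (a : G).
Hypothesis wA : forall y, alternating_map (w y).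
Hypothesis wv : forall Y, smoothv (fun y => w y Y).

Let ws Y : smooth (fun y => w y Y).
Proof. exact: (smoothv_functional (idfun : {linear R^o -> R^o}) (wv Y)). Qed.

Let wM y : multilin (w y). Proof. exact: alternating_multilin. Qed.

Let g i u : R := w (a * sg u)%g (L u \o lift i).

Let Ck_g k i : Ck_on k U (g i).
Proof.
apply: (@Ck_on_multilin R (lie G) q.+1 q k U (fun u => w (a * sg u)%g) (fun u => L u \o lift i)) => //.
  by move=> Y; exact: (smooth_slice_translate a UD (ws Y) k).
by move=> l b; exact: smL.
Qed.

(** Differentiating a coefficient also differentiates the frame vectors in its arguments. Together
    with the half brackets of [ext_term], these terms are governed by A, which is symmetric by the
    Maurer-Cartan equation, so that they cancel in the alternating sum. *)
Lemma ext_d_slice u : U u ->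
  \sum_(i < q.+1) (-1) ^+ i * pderiv i (g i) u = ed w (a * sg u)%g (L u).
Proof.
move=> Uu; rewrite (ext_dE (@lvf R G) (@brC R G))//.
pose A i j := dL i j u + 2^-1 *: br (L u i) (L u j).
have AC i j : A i j = A j i.
  have := maurer_cartan i j Uu; rewrite /A.
  generalize (dL i j u) (dL j i u) (L u i) (L u j) => x y X Y e.
  by rewrite (brC Y X) scalerN; exact: half_shift e.
have D i : pderiv i (g i) u =
    ext_term (@br R G) (@lvf R G) w (a * sg u)%g (L u i) (L u \o lift i)
    + \sum_l w (a * sg u)%g (upd (L u \o lift i) l (A i (lift i l))).
  have -> : pderiv i (g i) u = lvf (L u i) (fun y => w y (L u \o lift i)) (a * sg u)%g +
      \sum_l w (a * sg u)%g (upd (L u \o lift i) l (dL i (lift i l) u)).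
    apply: (@pderiv_near _ _ (g i)); first exact: filterE (fun v => erefl).
    apply: (is_derive_multilin (w := fun u => w (a * sg u)%g) (X := fun u => L u \o lift i)
      (dw := fun Y => lvf (L u i) (fun y => w y Y) (a * sg u)%g)) => //.
    - move=> Y l c y z; have -> : (fun y' => w y' (upd Y l (c *: y + z))) =
          fun y' => c * w y' (upd Y l y) + w y' (upd Y l z) by apply/funext => y'; exact: wM.
      by rewrite lvf_add ?lvf_scale//; exact: smooth_scale.
    - by move=> Y; exact: is_derive_slice.
    - by move=> l b; exact: is_derive_frame.
  have -> : lvf (L u i) (fun y => w y (L u \o lift i)) (a * sg u)%g =
      vderiv (@lvf R G) (L u i) (fun y => w y (L u \o lift i)) (a * sg u)%g.
    exact/esym/(vderiv_functional (L u i) (idfun : {linear R^o -> R^o}) _ (wv _)).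
  rewrite /ext_term.
  rewrite -addrA; congr (_ + _); rewrite /slot_sum scaler_sumr -sumrN -big_split.
  apply: eq_bigr => l _ /=; rewrite /A (multilinD _ _ _ _ (wM _)) (multilinZ _ _ _ _ (wM _)).
  by rewrite addrCA addNr addr0.
under eq_bigr do rewrite D mulrDr; rewrite big_split/= [X in _ + X](_ : _ = 0) ?addr0//.
exact: (sum_upd_symmetric (L u) (alternating_signed (wA _)) AC).
Qed.

(** Each coefficient extends by zero to a function of compact support on the whole coordinate space,
    and the integral of its partial derivatives is 0. *)
Lemma local_stokes (C : set 'rV[R]_q.+1) M : 0 <= M -> closed C -> C `<=` U ->
  (forall u, C u -> `|u| <= M) -> (forall u X, U u -> ~ C u -> w (a * sg u)%g X = 0) ->
  iter_int (fun u => if u \in U then ed w (a * sg u)%g (L u) else 0) = 0.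
Proof.
move=> M0 cC CU CM w0; pose gU i u := if u \in U then g i u else 0.
have gC i k : Ck_on k setT (gU i) by apply: (Ck_on_extend oU cC CU (Ck_g k i)) => u Uu nC; exact: w0.
have gs i : box_supp M (gU i).
  move=> u Mu; rewrite /gU; case: ifP => // /set_mem Uu; apply: w0 => // /CM; lra.
have -> : (fun u => if u \in U then ed w (a * sg u)%g (L u) else 0) =
    fun u => \sum_(i < q.+1) (-1) ^+ i * pderiv i (gU i) u.
  apply/funext => u; have [Uu|nU] := pselect (U u).
    rewrite mem_set// -ext_d_slice//; apply: eq_bigr => i _; congr (_ * _).
    apply/esym/(@pderiv_near _ _ (g i)).
      have nU : \near u, U u by exact: open_nbhs_nbhs.
      by apply: filterS nU => v Uv; rewrite /gU mem_set.
    exact: (Ck_on_is_derive (Ck_g 1 i)).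
  rewrite memNset// big1// => i _; rewrite (@pderiv_near _ _ (cst 0) _ u i 0) ?mulr0//.
  have nC : \near u, ~ C u by apply: open_nbhs_nbhs; split; [rewrite openC|move/CU].
  by apply: filterS nC => v nv; rewrite /gU; case: ifP => // /set_mem Uv; exact: w0.
rewrite (iter_int_sum (index_enum _) (fun i : 'I_q.+1 => (-1) ^+ i) M0).
- by rewrite big1// => i _; rewrite (iter_int_pderiv i M0) ?mulr0.
- by move=> i; exact: box_supp_pderiv.
- by move=> i u; exact: (Ck_on_cont (Ck_on_pderiv i (gC i 1%N))).
Qed.

End Form.
End LocalStokes.

Section FormOperations.
Variables (R : realType) (G : lieGroup R) (P : set G) (p : {vspace lie G}).
Local Notation ed := (ext_d (@br R G) (@lvf R G)).

Lemma bundle_form_scale (V : vectType R) k (r : G -> V -> V) (f : G -> ('I_k -> lie G) -> V)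
    (h : G -> R) : (forall x, scalable (r x)) -> smooth h ->
  (forall y q, P q -> h (y * q)%g = h y) ->
  bundle_form P p r f -> bundle_form P p r (fun x X => h x *: f x X).
Proof.
move=> rZ sh hP [fm fs fe]; split.
- by move=> x; exact: (alternating_mod_comp ( *:%R (h x)) (fm x)).
- by move=> X; exact: (smoothvZ sh (fs X)).
- by move=> x q X Pq; rewrite hP// fe// rZ.
Qed.

Lemma bundle_form_comb (V : vectType R) k (f g : G -> ('I_k -> lie G) -> V) c :
  bundle_form P p (fun _ => @id V) f -> bundle_form P p (fun _ => @id V) g ->
  bundle_form P p (fun _ => @id V) (fun x X => c *: f x X + g x X).
Proof.
move=> [fm fs fe] [gm gs ge]; split.
- move=> x; have [[f1 f2] f3] := fm x; have [[g1 g2] g3] := gm x; split; first split.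
  + by move=> X i a y z; rewrite f1 g1 !scalerDr !scalerA [c * a]mulrC addrACA.
  + by move=> X i j ij e; rewrite (f2 X i j)// (g2 X i j)// scaler0 addr0.
  + by move=> X i Xi; rewrite (f3 X i)// (g3 X i)// scaler0 addr0.
- by move=> X; exact: (smoothv_comb c (fs X) (gs X)).
- by move=> x q X Pq; rewrite fe// ge.
Qed.

(** By the Leibniz rule, every term retains one of the two factors that vanish at x. *)
Lemma ext_d_scale0 (V : vectType R) k (h : G -> R) (v : G -> ('I_k -> lie G) -> V) x X :
  smooth h -> (forall Y, smoothv (fun y => v y Y)) -> h x = 0 -> (forall Y, v x Y = 0) ->
  ed (fun y Y => h y *: v y Y) x X = 0.
Proof.
move=> sh sv h0 v0; rewrite /ext_d big1 => [|i _].
  by rewrite add0r big1// => i _; rewrite big1// => j _; rewrite h0 scale0r scaler0.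
rewrite (_ : vderiv _ _ _ _ = 0) ?scaler0//; apply: vcoord_inj => b; rewrite vcoord_vderiv.
under eq_fun do rewrite vcoordZ.
by rewrite lvf_mul//; [rewrite h0 v0 linear0 mulr0 mul0r addr0|exact: sv].
Qed.

Lemma ext_d_sum (V : vectType R) k (I : Type) (s : seq I) (w : I -> G -> ('I_k -> lie G) -> V) x X :
  (forall i Y, smoothv (fun y => w i y Y)) ->
  ed (fun y Y => \sum_(i <- s) w i y Y) x X = \sum_(i <- s) ed (w i) x X.
Proof.
move=> sw; rewrite /ext_d [RHS]big_split; congr (_ + _).
  rewrite exchange_big; apply: eq_bigr => i _ /=.
  by rewrite (vderiv_sum _ _ _ _ (fun a => sw a _)) scaler_sumr.
rewrite exchange_big; apply: eq_bigr => i _ /=; rewrite exchange_big; apply: eq_bigr => j _ /=.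
by rewrite scaler_sumr.
Qed.

End FormOperations.

(** * Integration over G/P and the global Stokes theorem *)

Section Integration.
Variables (R : realType) (G : lieGroup R) (P : set G) (p : {vspace lie G}).
Hypothesis Psub : is_subgroup P.
Local Notation top n := (@bundle_form R G R^o n P p (fun _ => @id R^o)).
Local Notation ed := (ext_d (@br R G) (@lvf R G)).

Section Integral.
Variables (n : nat) (o : ('I_n -> lie G) -> R^o) (I : (G -> ('I_n -> lie G) -> R^o) -> R).
Hypothesis fI : form_integral P p o I.

Lemma bundle_form0 : top n (fun _ _ => 0).
Proof. by split=> // [|X b]; [split|under eq_fun do rewrite linear0; exact: smooth_cst]; split=> // *; rewrite ?scaler0 ?addr0. Qed.

Lemma form_integral0 : I (fun _ _ => 0) = 0.
Proof.
have [h _] := fI; have := h 1 _ _ bundle_form0 bundle_form0.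
by rewrite mulr0 addr0 mul1r => /eqP; rewrite -subr_eq subrr eq_sym => /eqP.
Qed.

Lemma form_integral_sum (T : Type) (s : seq T) (f : T -> G -> ('I_n -> lie G) -> R^o) :
  (forall i, top n (f i)) -> I (fun x X => \sum_(i <- s) f i x X) = \sum_(i <- s) I (f i).
Proof.
move=> tf; have [h _] := fI.
suff [//] : top n (fun x X => \sum_(i <- s) f i x X) /\
  I (fun x X => \sum_(i <- s) f i x X) = \sum_(i <- s) I (f i).
elim: s => [|i s [IH1 IH2]].
  have -> : (fun x X => \sum_(i <- [::]) f i x X) = fun _ _ => 0.
    by apply/funext => x; apply/funext => X; rewrite big_nil.
  by rewrite big_nil form_integral0; split=> //; exact: bundle_form0.
have -> : (fun x X => \sum_(j <- i :: s) f j x X) = fun x X => 1 * f i x X + \sum_(j <- s) f j x X.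
  by apply/funext => x; apply/funext => X; rewrite big_cons mul1r.
rewrite h// mul1r big_cons IH2; split=> //.
exact: (bundle_form_comb 1 (tf i) IH1).
Qed.

Lemma form_integral_scale c (f : G -> ('I_n -> lie G) -> R^o) : top n f ->
  I (fun x X => c * f x X) = c * I f.
Proof.
move=> tf; have [h _] := fI; have := h c _ _ tf bundle_form0; rewrite form_integral0 addr0 => <-.
by congr I; apply/funext => x; apply/funext => X; rewrite addr0.
Qed.

Variables (cell : set G) (e : 'I_n -> lie G) (B : 'M[R]_(n, lg_dim G)) (r : R).
Hypothesis r0 : 0 < r.
Hypothesis bc : bump_charts P cell o e B r.
Local Notation sg := (slice B).
Local Notation L := (log_deriv sg).
Local Notation U := [set u : 'rV[R]_n | `|u| < r].

Lemma form_integral_chart a C f : compact C -> C `<=` U -> top n f ->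
  (forall x, (forall u, C u -> ~ P ((sg u)^-1 * (a^-1 * x))%g) -> forall X, f x X = 0) ->
  I f = iter_int (fun u => if u \in U then f (a * sg u)%g (L u) else 0).
Proof.
move=> cC CU tf f0; have [b1 b2 _ _ _] := bc; have [_ h] := fI.
rewrite (h U (fun u => a * sg u)%g C f (b1 a) cC CU tf) => [|x hx X].
  congr iter_int; apply/funext => u; case: ifP => // /set_mem Uu; congr (f _ _).
  by apply/funext => i; exact: log_deriv_translate (b2 u Uu).
by apply: f0 => u Cu; have := hx u Cu; rewrite invgM -mulgA.
Qed.

Lemma chart_support C u : C `<=` U -> U u -> ~ C u -> forall v, C v -> ~ P ((sg v)^-1 * sg u)%g.
Proof.
move=> CU Uu nC v Cv Pvu; apply: nC; have [b1 _ _ _ _] := bc; have [_ _ inj _] := b1 1%g.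
by rewrite -(inj v u)//; [exact: CU|rewrite !mul1g].
Qed.

(** Near the centre of the chart at y0 the coefficient of f is positive; a bump supported there
    makes the integrand nonnegative everywhere and positive at the centre. *)
Lemma integral_bump_gt0 y0 f : top n f -> 0 < f y0 e -> exists chi : G -> R,
  [/\ smooth chi, forall y q, P q -> chi (y * q)%g = chi y & 0 < I (fun y X => chi y * f y X)].
Proof.
move=> tf f0; have [b1 b2 b3 b4 b5] := bc.
have U0 : U 0 by rewrite /= normr0.
have oU : open U by have [] := b1 1%g.
have [fm fs fe] := tf; have fsm X := smoothv_functional (idfun : {linear R^o -> R^o}) (fs X).
have fA y : multilin (f y) by have [h _] := fm y; exact: alternating_multilin.
pose g u := f (y0 * sg u)%g (L u).
have gC : Ck_on 0 U g.
  apply: (@Ck_on_multilin R (lie G) n n 0 U (fun u => f (y0 * sg u)%g) (fun u => L u)) => //.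
    by move=> Y; exact: (smooth_slice_translate y0 b2 (fsm Y) 0).
  by move=> l b; exact: b3.
have g0 : 0 < g 0 by rewrite /g slice0 mulg1 b4.
have gc : {for 0, continuous (g : 'rV[R]_n -> R)} := Ck_on_cont gC U0.
have : \forall u \near (0 : 'rV[R]_n), 0 < g u.
  apply: (gc [set t : R | 0 < t]).
  by apply: open_nbhs_nbhs; split=> //; exact: open_gt.
move=> /nbhs_ballP[d /= d0 hd]; have [|chi [C [sc c0 cP c1 [cC CU CM cs _]]]] := b5 (d / 2).
  by rewrite divr_gt0.
have sc' := smooth_lmul (y0^-1)%g sc.
have cP' y q : P q -> chi (y0^-1 * (y * q))%g = chi (y0^-1 * y)%g.
  by move=> Pq; rewrite mulgA cP.
exists (fun y => chi (y0^-1 * y)%g); split=> //.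
rewrite (@form_integral_chart y0 C) => [||//||x hx X]; last by rewrite cs// mul0r.
- under [X in iter_int X]eq_fun do rewrite mulKg.
  have out u : U u -> ~ C u -> chi (sg u) * f (y0 * sg u)%g (L u) = 0.
    by move=> Uu nC; rewrite cs ?mul0r//; exact: chart_support.
  have ext : Ck_on 0 setT (fun u => if u \in U then chi (sg u) * f (y0 * sg u)%g (L u) else 0).
    apply: (Ck_on_extend oU (compact_closed (@norm_hausdorff _ _) cC) CU _ out).
    apply: (Ck_on_mul oU) => //; have := smooth_slice_translate 1%g b2 sc 0; congr Ck_on; apply/funext => u.
    by rewrite mul1g.
  apply: (@iter_int_gt0 _ _ _ (d / 2) 0).
  + by rewrite ltW// divr_gt0.
  + move=> u du; case: ifP => // /set_mem Uu; apply: out => // /CM; lra.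
  + by move=> u; exact: (Ck_on_cont ext).
  + move=> u; case: ifP => // /set_mem Uu; have [Cu|nC] := pselect (C u); last by rewrite out.
    rewrite mulr_ge0// ltW//; apply: hd; rewrite -ball_normE/= sub0r normrN.
    by apply: le_lt_trans (CM u Cu) _; rewrite ltr_pdivrMr// ltr_pMr// ltr1n.
  + by rewrite mem_set// mulr_gt0// slice0.
- exact: cC.
- by apply: (bundle_form_scale _ _ _ tf) => //; move=> x a v.
Qed.

Hypothesis KP : exists2 K : set G, compact K & forall y, exists2 k, K k & P (k^-1 * y)%g.

(** The compact set K meets every coset of P, so finitely many translates of the set where chi is
    positive cover G. The sum of squares is the denominator of the partition of unity in
    [stokes]. *)
Lemma finite_cover (chi : G -> R) : smooth chi -> (forall y q, P q -> chi (y * q)%g = chi y) ->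
  0 < chi 1%g -> (forall y, 0 <= chi y) ->
  exists s : seq G, forall y, 0 < \sum_(a <- s) chi (a^-1 * y)%g * chi (a^-1 * y)%g.
Proof.
move=> sc cP c1 c0; have [K cK hK] := KP.
pose N a : set G := [set y | 0 < chi (a^-1 * y)%g].
have oN a : open (N a).
  apply: (open_comp (f := fun y => chi (a^-1 * y)%g) (D := [set t : R | 0 < t])).
    by move=> y _; exact: (smooth_continuous (smooth_lmul (a^-1)%g sc)).
  exact: open_gt.
have Na a : N a a by rewrite /N/= mulVg.
(* Lists are filtered by inclusion; the near-covering form of compactness then yields a single list
   for all of K. *)
pose F : set_system (seq G) := [set A | exists s0 : seq G, forall s : seq G, {subset s0 <= s} -> A s].
have FF : Filter F.
  split; first by exists [::].
    by move=> A A' [s hs] [s' hs']; exists (s ++ s') => t st; split; [apply: hs|apply: hs'] => a as_;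
      apply: st; rewrite mem_cat as_ ?orbT.
  by move=> A A' AA' [s hs]; exists s => t /hs /AA'.
have [|s hs] := proj1 (compact_near_coveringP K) cK (seq G) F
    (fun s y => exists2 a, a \in s & N a y) FF.
  move=> a _; exists (N a, [set s : seq G | a \in s]) => [|[y s] [/= Ny as_]]; last by exists a.
  split; first exact: open_nbhs_nbhs (conj (oN a) (Na a)).
  by exists [:: a] => s; apply; rewrite mem_head.
exists s => y; have [k Kk Pk] := hK y; have [a aD Nak] := hs s (fun _ => id) k Kk.
have Nay : 0 < chi (a^-1 * y)%g by rewrite -(mulVKg k y) mulgA cP.
rewrite (big_rem a)//= ltr_pwDl ?mulr_gt0// sumr_ge0// => b _.
by rewrite mulr_ge0.
Qed.

End Integral.

Section Stokes.
Hypothesis Pnorm : P `<=` normalizer p.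
Hypothesis lvfP : forall Z h, Z \in p -> smooth h -> (forall q : G, P q -> h q = 0) ->
  lvf Z h 1%g = 0.
Hypothesis KP : exists2 K : set G, compact K & forall y, exists2 k, K k & P (k^-1 * y)%g.

(** With a partition of unity, each piece of b is supported in one chart, where [local_stokes]
    applies. The equation q.+1 = n stays a cast because in the applications the degree of a top form
    is a sum. *)
Lemma stokes n q (eqn : q.+1 = n) (o : ('I_n -> lie G) -> R^o)
    (I : (G -> ('I_n -> lie G) -> R^o) -> R) cell e B r (b : G -> ('I_q -> lie G) -> R^o) :
  form_integral P p o I -> 0 < r -> bump_charts P cell o e B r -> top q b ->
  I (fun y Y => ed b y (Y \o cast_ord eqn)) = 0.
Proof.
case: n / eqn o I e B => o I e B fI r0 bc tb.
have -> : (fun y (Y : 'I_q.+1 -> lie G) => ed b y (Y \o cast_ord (erefl q.+1))) = ed b.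
  apply/funext => y; apply/funext => Y; congr (ed b y _).
  by apply/funext => i; rewrite /= cast_ord_id.
have [b1 b2 b3 b4 b5] := bc; have [chi [C [sc c0 cP c1 [cC CU CM cs _]]]] := b5 1 ltr01.
have [s hs] := finite_cover KP sc cP c1 c0.
pose ch (a y : G) := chi (a^-1 * y)%g.
have sch a : smooth (ch a) by exact: smooth_lmul.
have chP a y h : P h -> ch a (y * h)%g = ch a y by move=> Ph; rewrite /ch mulgA cP.
pose T y := \sum_(a <- s) ch a y * ch a y.
have sT : smooth T by apply: smooth_sum => a; exact: smooth_mul.
have TP y h : P h -> T (y * h)%g = T y by move=> Ph; apply: eq_bigr => a _; rewrite chP.
have sTi : smooth (fun y => (T y)^-1).
  apply/smooth_inT; apply: smooth_in_inv; [exact: openT|by move=> y _; rewrite gt_eqF//; exact: hs|].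
  by apply/smooth_inT.
pose v a y Y := (ch a y * (T y)^-1) *: b y Y.
(* Each term carries the square of [ch a], so that its differential vanishes
   wherever [ch a] does. *)
pose w a y Y := ch a y *: v a y Y.
have idZ (x : G) : scalable (@id R^o) by move=> c u.
have tv a : top q (v a).
  apply: (bundle_form_scale idZ _ _ tb); first exact: smooth_mul.
  by move=> y h Ph; rewrite chP// TP.
have tw a : top q (w a) by exact: (bundle_form_scale idZ (sch a) (chP a) (tv a)).
have bE : b = fun y Y => \sum_(a <- s) w a y Y.
  apply/funext => y; apply/funext => Y; rewrite /w /v.
  under eq_bigr do rewrite scalerA mulrA.
  by rewrite -scaler_suml -mulr_suml divff ?scale1r// gt_eqF//; exact: hs.
have -> : ed b = fun y Y => \sum_(a <- s) ed (w a) y Y.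
  rewrite [in LHS]bE; apply/funext => y; apply/funext => Y; apply: ext_d_sum => a Z.
  by have [_ h _] := tw a; exact: h.
have ted a : top q.+1 (ed (w a)) by exact: (ext_d_basic lvfP (tw a)).
rewrite (form_integral_sum fI _ ted) big1// => a _.
have r1 : [set u : 'rV[R]_q.+1 | `|u| < r] 0 by rewrite /= normr0.
have oU : open [set u : 'rV[R]_q.+1 | `|u| < r] by have [] := b1 1%g.
rewrite (form_integral_chart fI bc cC CU (ted a) (a := a)) => [|x hx X]; last first.
  have cx : ch a x = 0 by exact: cs.
  have [_ sv _] := tv a.
  by apply: ext_d_scale0 => // Y; rewrite /v cx mul0r scale0r.
have [wm wsm _] := tw a.
apply: (local_stokes oU b2 b3 _ wsm ler01 (compact_closed (@norm_hausdorff _ _) cC) CU CM) => [y|u X Uu nC].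
  by have [] := wm y.
rewrite /w /ch mulKg cs ?scale0r//; exact: (chart_support bc CU Uu nC).
Qed.

End Stokes.

End Integration.

(** * Nondegeneracy and the equivalence *)

(** Induction on the degree of B: contraction with the first argument is moved to A by
    [contract_wedge_ins], the form of degree n + 1 being zero. In degree 0 the test form is A = o
    tensor u with the volume form o. *)
Lemma contract_nondegenerate (R : realType) (a V W : vectType R) (p : {vspace a}) n
    (v : 'I_n -> a) (t : 'I_n -> a -> R) (o : ('I_n -> a) -> R^o) :
  (forall w, w - \sum_b t b w *: v b \in p) -> alternating_mod p o -> (exists Y, o Y != 0) ->
  forall j k (B : ('I_j -> a) -> 'Hom(V, W)), (j + k)%N = n -> alternating_mod p B ->
  (forall A : ('I_k -> a) -> V, alternating_mod p A -> forall Y, contract_wedge B A Y = 0) ->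
  forall Y, B Y = 0.
Proof.
move=> ex oA [Y0 oY0]; elim=> [|j IH] k B jk BA h Y.
  rewrite add0n in jk; case: n / jk v t o ex oA Y0 oY0 => v t o ex oA Y0 oY0.
  apply/lfunP => u; rewrite zero_lfunE.
  pose A (X : 'I_k -> a) : V := o X *: u.
  have AA : alternating_mod p A.
    pose g (c : R^o) : V := c *: u.
    have gl : linear g by move=> c x y; rewrite /g scalerDl scalerA.
    exact: (alternating_mod_comp (HB.pack_for {linear R^o -> V} g (GRing.isLinear.Build R R^o V _ g gl)) oA).
  have := h A AA Y0; rewrite contract_wedgeE.
  have wE (Z : 'I_(0 + k) -> a) : wedge_arg B A Z = o Z *: B Y u.
    rewrite /wedge_arg /A linearZ/=; congr (o _ *: B _ u).
      by apply/funext => i; congr Z; apply: val_inj.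
    by apply/funext; case.
  rewrite (eq_altsum (Psi' := fun Z => o Z *: B Y u))// altsum_of_signed; last first.
    by move=> s Z; have [oA' _] := oA; rewrite (alternating_signed oA') scalerA.
  rewrite scalerA mul1n mulVf ?pnatr_eq0 -?lt0n ?fact_gt0// scale1r => /eqP.
  by rewrite scaler_eq0 (negbTE oY0) => /eqP.
rewrite -(insK ord0 Y).
apply: (IH k.+1 (fun X => B (ins ord0 (Y ord0) X))); first by rewrite -jk addSnnS.
  exact: alternating_mod_ins.
move=> A AA Z; have [BA' _] := BA; have [AA' _] := AA.
rewrite contract_wedge_ins ?h ?scaler0//.
- exact: alternating_mod_ins.
- exact: alternating_signed.
- exact: alternating_signed.
have hC := contract_wedge_mod BA AA.
have lt : (n < j.+1 + k.+1)%N by rewrite -jk; lia.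
have := alternating_mod_over (ins (ord0 : 'I_(j + k.+1).+1) (Y ord0) Z) hC ex lt.
rewrite contract_wedgeE => /eqP; rewrite scaler_eq0 invr_eq0 pnatr_eq0 -leqn0 leqNgt.
by rewrite muln_gt0 !fact_gt0 => /eqP.
Qed.

Lemma bundle_form_translate (R : realType) (G : lieGroup R) (P : set G) (p : {vspace lie G})
    (V : vectType R) k (r : G -> V -> V) (a : G) (f : G -> ('I_k -> lie G) -> V) :
  bundle_form P p r f -> bundle_form P p r (fun y => f (a * y)%g).
Proof.
move=> [fm fs fe]; split=> [x|X b|x h X Ph]; first exact: fm.
  exact: (smooth_lmul a (fs X b)).
by rewrite mulgA; exact: fe.
Qed.

(** * Equivariant forms with a prescribed value; nondegeneracy of the pairing *)

Section Extension.
Variables (R : realType) (G : lieGroup R) (m : nat) (gr : int -> {vspace lie G}).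
Hypothesis grG : grading m gr.
Variable p : {vspace lie G}.
Hypothesis pE : p = (\sum_(i < m.+1) gr i%:Z)%VS.
Variables (n : nat) (c : 'I_n -> {linear lie G -> R^o}).
Hypothesis cp : forall v, v \in p <-> forall a, c a v = 0.
Variable P : set G.
Hypothesis Pnorm : P `<=` normalizer p.
Hypothesis PV : forall x, P x -> P (x^-1)%g.
Local Notation cell := (big_cell m gr).

(** On the big cell, F z = flag_inv z o Ad z preserves p and satisfies F (z h) = F z o Ad h modulo
    p. So pulling A0 back by F z gives a form that is horizontal and equivariant; chi cuts it off,
    and at z = 1 the map F z is the identity. *)
Lemma basic_extension (V : vectType R) (r : G -> 'End(V)) k (A0 : ('I_k -> lie G) -> V) y0 chi :
  representation r -> alternating_mod p A0 -> smooth chi ->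
  (forall y h, P h -> chi (y * h)%g = chi y) ->
  (forall y, cell y \/ \forall y' \near y, chi y' = 0) ->
  exists2 alpha, bundle_form P p (fun x => r x) alpha & forall Y, alpha y0 Y = chi 1%g *: A0 Y.
Proof.
move=> rr A0A sc cP cs; have [A0a A00] := A0A; have A0M := alternating_multilin A0a.
have ncell z : ~ cell z -> chi z = 0.
  by move=> nz; have [//|] := cs z; exact: nbhs_singleton.
pose F z w := flag_inv m gr z (Ad z w).
pose al z (Y : 'I_k -> lie G) := chi z *: r (z^-1)%g (A0 (F z \o Y)).
have Fu z Y i w : F z \o upd Y i w = upd (F z \o Y) i (F z w).
  by apply/funext => l; rewrite /upd /=; case: eqP.
have Fl z : linear (F z) by move=> d x y; rewrite /F !linearP.
exists (fun y => al (y0^-1 * y)%g); last first.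
  move=> Y; rewrite /al mulVg invg1 (rep1 rr); congr (_ *: _).
  congr A0; apply/funext => i; rewrite /F/= Ad1 -[RHS](flag_opK (Y i) (big_cell1 m gr)).
  by rewrite /flag_op Ad1 subrK.
apply: bundle_form_translate; split.
- move=> z; split.
    have aM : alternating_map (fun Y => A0 (F z \o Y)).
      split=> [X i d x y|X i j ij Xij].
        by rewrite !fwithE !Fu Fl A0M.
      by apply: (A0a.2 _ i j ij); rewrite /= Xij.
    split=> [X i d x y|X i j ij Xij]; rewrite /al.
      by rewrite aM.1 linearP scalerDr !scalerA mulrC.
    by rewrite (aM.2 X i j ij Xij) linear0 scaler0.
  move=> X i Xi; rewrite /al; have [cz|/ncell ->] := pselect (cell z); last by rewrite scale0r.
  by rewrite (A00 _ i) ?linear0 ?scaler0// /= /F (flag_inv_Ad grG pE).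
- move=> Y; rewrite -/(smoothv _) => b; apply: smooth_local => z.
  have [cz|cz0] := cs z; last first.
    exists ([set y | chi y = 0]°); first by split=> //; exact: open_interior.
    apply: (@smooth_in_eq _ _ _ (cst 0) (fun z => vcoord b (al z Y))).
    - exact: open_interior.
    - by move=> y /interior_subset cy; rewrite /al cy scale0r linear0.
    - by apply: smooth_in_cst; exact: open_interior.
  have oc : open cell := open_big_cell m gr.
  exists cell => //; pose q (s : {ffun 'I_k -> 'I_(\dim {:lie G})}) z :=
    vcoord b (r (z^-1)%g (A0 (fun l => vbase (s l)))).
  pose h1 z : R := chi z * \sum_(s : {ffun 'I_k -> 'I_(\dim {:lie G})}) (\prod_l vcoord (s l) (F z (Y l))) * q s z.
  suff sh : smooth_in cell h1.
    apply: (smooth_in_eq oc _ sh) => y _; rewrite /h1 /al vcoordZ; congr (_ * _).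
    have -> : A0 (F y \o Y) = \sum_(s : {ffun 'I_k -> 'I_(\dim {:lie G})})
        (\prod_l vcoord (s l) (F y (Y l))) *: A0 (fun l => vbase (s l)).
      rewrite -(multilin_expand (fun l b => vcoord b (F y (Y l))) (fun b => vbase b) A0M).
      by congr A0; apply/funext => l; exact: vcoord_sum.
    by rewrite linear_sum vcoordS; apply: eq_bigr => s _; rewrite linearZ/= vcoordZ.
  apply: smooth_in_mul => //; first exact: smooth_smooth_in.
  apply: smooth_in_sum => // s; apply: smooth_in_mul => //.
    by apply: smooth_in_prod => // l; exact: (smooth_flag_inv_Ad m gr (vcoord (s l))).
  have [_ _ rs] := rr; apply: smooth_smooth_in; exact: (smooth_inv (rs _ b)).
- move=> z h Y Ph; rewrite /al cP// invgM (repM rr).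
  have [cz|/ncell ->] := pselect (cell z); last by rewrite !scale0r linear0.
  rewrite linearZ/=; congr (_ *: r _ (r _ _)); apply: (alternating_mod_eq A0A) => i.
  apply/cp => a; rewrite linearB/= /F AdM (flag_inv_mul grG pE) ?subrr//.
    by move=> w /cp.
  exact: Pnorm.
Qed.
Lemma top_vcoord (V : vectType R) q (f : G -> ('I_q -> lie G) -> V) b :
  bundle_form P p (fun _ => @id V) f ->
  bundle_form P p (fun _ => @id R^o) (fun y Y => vcoord b (f y Y)).
Proof.
move=> [fm fs fe]; split.
- by move=> x; exact: (alternating_mod_comp (vcoord b) (fm x)).
- by move=> X; exact: (smoothv_linear (vcoord b) (fs X)).
- by move=> x h X Ph; rewrite fe.
Qed.

Variables (e : 'I_n -> lie G) (o : ('I_n -> lie G) -> R^o).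
Hypothesis ce : forall a b, c a (e b) = (a == b)%:R.
Hypothesis oA : alternating_mod p o.
Hypothesis o0 : exists Y, o Y != 0.

Lemma frame_expand w : w - \sum_b c b w *: e b \in p.
Proof.
apply/cp => a; rewrite linearB (linear_sum (c a))/= (bigD1 a)//= big1 ?addr0 => [|b ba].
  by rewrite linearZ/= ce eqxx [X in _ - X]mulr1 subrr.
by rewrite linearZ/= ce eq_sym (negbTE ba) [LHS]mulr0.
Qed.

Variables (I : (G -> ('I_n -> lie G) -> R^o) -> R) (B : 'M[R]_(n, lg_dim G)) (rho : R).
Hypothesis fI : form_integral P p o I.
Hypothesis rho0 : 0 < rho.
Hypothesis bc : bump_charts P cell o e B rho.

(** If b does not vanish at y0, it has a nonzero top product there with some alternating A. Extend A
    to an equivariant form; a sign and a further bump then make the integral positive, against the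
    hypothesis. *)
Lemma pairing_nondegenerate (V W : vectType R) (r : G -> 'End(V)) j k (eqn : (j + k)%N = n)
    (b : G -> ('I_j -> lie G) -> 'Hom(V, W)) :
  representation r -> bundle_form P p (fun x => hom_rep W r x) b ->
  (forall alpha : G -> ('I_k -> lie G) -> V, bundle_form P p (fun x => r x) alpha -> forall d,
    I (fun y Y => vcoord d (contract_wedge (b y) (alpha y) (Y \o cast_ord eqn))) = 0) ->
  forall y Y, b y Y = 0.
Proof.
case: n / eqn e c o B I ce cp oA o0 fI bc => e' c' o' B' I' ce' cp' oA' o0' fI' bc' rr bB h y0 Y0.
have cid (Y : 'I_(j + k) -> lie G) : Y \o cast_ord (erefl (j + k)%N) = Y.
  by apply/funext => i; rewrite /= cast_ord_id.
have ex w : w - \sum_b c' b w *: e' b \in p.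
  apply/cp' => a; rewrite linearB (linear_sum (c' a))/= (bigD1 a)//= big1 ?addr0 => [|d da].
    by rewrite linearZ/= ce' eqxx [X in _ - X]mulr1 subrr.
  by rewrite linearZ/= ce' eq_sym (negbTE da) [LHS]mulr0.
have [bm bs be] := bB.
apply: (contract_nondegenerate ex oA' o0' erefl (bm y0)) => A AA Y1.
apply: (alternating_mod_top Y1 (contract_wedge_mod (bm y0) AA) ex).
apply: vcoord_inj => d; rewrite linear0; apply/eqP; apply: contraT => ne0.
have [b1 b2 b3 b4 b5] := bc'; have [chi [C [sc c0 cP c1 [_ _ _ _ cs]]]] := b5 1 ltr01.
have [al alB alE] := basic_extension y0 rr AA sc cP cs.
(* The sign that makes the integrand positive on the frame e' at y0. *)
pose s : R := Num.sg (vcoord d (contract_wedge (b y0) A e')).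
have sal : bundle_form P p (fun x => r x) (fun y Y => s *: al y Y).
  by apply: (bundle_form_scale (h := fun=> s) _ _ _ alB) => // [x a v|]; [rewrite linearZ|exact: smooth_cst].
have tf := top_vcoord d (contract_wedge_basic rr bB sal).
have f0 : 0 < vcoord d (contract_wedge (b y0) (fun Y => s *: al y0 Y) e').
  rewrite (_ : (fun Y => _) = fun Y => (s * chi 1%g) *: A Y + 0); last first.
    by apply/funext => Y; rewrite alE scalerA addr0.
  rewrite contract_wedge_linear_r contract_wedge0r addr0 vcoordZ mulrAC pmulr_lgt0//.
  by rewrite -normrEsg normr_gt0.
have [ch [sch chP]] := integral_bump_gt0 fI' rho0 bc' tf f0.
have chal : bundle_form P p (fun x => r x) (fun y Y => ch y *: (s *: al y Y)).
  by apply: (bundle_form_scale _ sch chP sal) => x a v; rewrite linearZ.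
have := h _ chal d; rewrite (_ : (fun y Y => _) =
    fun y Y => ch y * vcoord d (contract_wedge (b y) (fun Y => s *: al y Y) Y)).
  by move=> ->; rewrite ltxx.
apply/funext => y; apply/funext => Y; rewrite cid -vcoordZ; congr (vcoord d _).
have := contract_wedge_linear_r (b y) (fun Y => s *: al y Y) (fun=> 0) (ch y) Y.
rewrite contract_wedge0r addr0 => <-; congr contract_wedge.
by apply/funext => X; rewrite addr0.
Qed.

End Extension.

Lemma codiffZ (R : realType) (G : lieGroup R) (V : lmodType R) (pp : {vspace lie G})
    (act : lie G -> V -> V) k (f : ('I_k.+1 -> lie G) -> V) d X : (forall Z, linear (act Z)) ->
  codiff pp act (fun Y => d *: f Y) X = d *: codiff pp act f X.
Proof.
move=> al; have aZ Z v : act Z (d *: v) = d *: act Z v.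
  exact: (linearZ_LR (HB.pack_for {linear V -> V} (act Z) (GRing.isLinear.Build R V V _ (act Z) (al Z)))).
rewrite /codiff scalerA mulrC -scalerA; congr (_ *: _); rewrite scaler_sumr.
apply: eq_bigr => s _; rewrite /codiff_decomposable scalerDr; congr (_ + _).
  rewrite scaler_sumr; apply: eq_bigr => i _; rewrite aZ /decomposable !scalerA.
  by congr (_ *: _); rewrite mulrA mulrC mulrA.
rewrite scaler_sumr; apply: eq_bigr => i _; rewrite scaler_sumr; apply: eq_bigr => l _.
by rewrite /decomposable !scalerA; congr (_ *: _); rewrite mulrA mulrC mulrA.
Qed.

Lemma codiff0 (R : realType) (G : lieGroup R) (V : lmodType R) (pp : {vspace lie G})
    (act : lie G -> V -> V) k (f : ('I_k.+1 -> lie G) -> V) X : (forall Z, linear (act Z)) ->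
  (forall Y, f Y = 0) -> codiff pp act f X = 0.
Proof.
move=> al f0; have -> : f = fun Y => 0 *: f Y by apply/funext => Y; rewrite f0 scaler0.
by rewrite codiffZ// scale0r.
Qed.

Lemma bundle_form_cast (R : realType) (G : lieGroup R) (P : set G) (p : {vspace lie G})
    (V : vectType R) (r : G -> V -> V) q n (eqn : q = n) (f : G -> ('I_q -> lie G) -> V) :
  bundle_form P p r f -> bundle_form P p r (fun y Y => f y (Y \o cast_ord eqn)).
Proof.
case: n / eqn => fB; rewrite (_ : (fun y Y => _) = f)//.
apply/funext => y; apply/funext => Y; congr (f y _).
by apply/funext => i; rewrite /= cast_ord_id.
Qed.

Lemma vcoord_ext_d (R : realType) (G : lieGroup R) (W : vectType R) q
    (F : G -> ('I_q -> lie G) -> W) d x X : (forall Y, smoothv (fun y => F y Y)) ->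
  ext_d (@br R G) (@lvf R G) (fun y Y => vcoord d (F y Y) : R^o) x X =
  vcoord d (ext_d (@br R G) (@lvf R G) F x X).
Proof.
move=> sF; rewrite /ext_d [RHS]linearD/= !vcoordS; congr (_ + _); apply: eq_bigr => i _.
  by rewrite vcoordZ (vderiv_linear (X i) (vcoord d) x (sF (X \o lift i))).
by rewrite vcoordS; apply: eq_bigr => l _; rewrite vcoordZ.
Qed.

Lemma vbase_sum_eq0 (R : realType) (W : vectType R) (f : 'I_(\dim {:W}) -> R) :
  \sum_b f b *: (vbase b : W) = 0 <-> forall b, f b = 0.
Proof.
split=> [h b|h]; last by rewrite big1// => b _; rewrite h scale0r.
have := congr1 (vcoord b) h; rewrite vcoordS linear0 (bigD1 b)//= vcoordZ vcoord_vbase eqxx mulr1.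
by rewrite big1 ?addr0// => d db; rewrite vcoordZ vcoord_vbase eq_sym (negbTE db) mulr0.
Qed.

(** If o is negative on the frame, the first vector changes sign together with its entries in the
    two coframes; in dimension 0 there would be no vector to reverse. *)
Lemma oriented_frame (R : realType) (G : lieGroup R) (p : {vspace lie G}) (E : lie G) n
    (e : 'I_n -> lie G) (c lam : 'I_n -> {linear lie G -> R^o}) (o : ('I_n -> lie G) -> R^o) :
  (0 < n)%N -> (forall a b, c a (e b) = (a == b)%:R) ->
  (forall v, v \in p <-> forall a, c a v = 0) -> (forall v, v \in p <-> forall a, lam a v = 0) ->
  (forall a b, lam a (br E (e b)) = (a == b)%:R) ->
  alternating_mod p o -> (exists Y, o Y != 0) ->
  exists (e' : 'I_n -> lie G) (c' lam' : 'I_n -> {linear lie G -> R^o}),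
  [/\ forall a b, c' a (e' b) = (a == b)%:R, forall v, v \in p <-> forall a, c' a v = 0,
      forall v, v \in p <-> forall a, lam' a v = 0,
      forall a b, lam' a (br E (e' b)) = (a == b)%:R & 0 < o e'].
Proof.
move=> n0 ce cp lp lE oA [Y oY].
have oe0 : o e != 0.
  apply: contraNneq oY => oe; apply/eqP.
  exact: (alternating_mod_top Y oA (frame_expand cp ce)).
have [oe|oe] := ltP 0 (o e); first by exists e, c, lam.
have {oe0}oe : o e < 0 by rewrite lt_neqAle oe0.
pose i0 := Ordinal n0; pose s (i : 'I_n) : R := if i == i0 then -1 else 1.
have ss i : s i * s i = 1 by rewrite /s; case: ifP; rewrite ?mulrNN mulr1.
have s0 i : s i != 0 by rewrite /s; case: ifP; rewrite ?oppr_eq0 oner_eq0.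
pose sc (l : 'I_n -> {linear lie G -> R^o}) i (v : lie G) : R^o := s i * l i v.
have scl l i : linear (sc l i).
  by move=> a x y; rewrite /sc linearP mulrDr; congr (_ + _); rewrite [LHS]mulrCA.
pose S l i : {linear lie G -> R^o} := HB.pack_for {linear lie G -> R^o} (sc l i)
  (GRing.isLinear.Build R (lie G) R^o _ (sc l i) (scl l i)).
have Sp (l : 'I_n -> {linear lie G -> R^o}) : (forall v, v \in p <-> forall a, l a v = 0) -> forall v, v \in p <-> forall a, S l a v = 0.
  move=> h v; split=> [/h hv a|hv]; first by rewrite /S/= /sc hv mulr0.
  by apply/h => a; have /eqP := hv a; rewrite mulf_eq0 (negbTE (s0 a)) => /eqP.
have Sd (l : 'I_n -> {linear lie G -> R^o}) (x : 'I_n -> lie G) a b : l a (x b) = (a == b)%:R -> S l a (s b *: x b) = (a == b)%:R.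
  move=> h; rewrite /S/= /sc (linearZ_LR (l a)) h.
  have [->|_] := eqVneq a b; last by rewrite scaler0 mulr0.
  by rewrite -[s b *: _]/(s b * _) mulr1; exact: ss.
exists (fun i => s i *: e i), (S c), (S lam); split.
- by move=> a b; exact: Sd.
- exact: Sp.
- exact: Sp.
- move=> a b; rewrite (linearZ_LR (br E : {linear lie G -> lie G})).
  exact: (Sd lam (fun b => br E (e b))).
- have -> : (fun i => s i *: e i) = upd e i0 (- e i0).
    by apply/funext => i; rewrite /s /upd; case: eqP => [->|_]; rewrite ?scaleN1r ?scale1r.
  have [oA' _] := oA; rewrite (multilinN _ _ _ (alternating_multilin oA')) upd_id.
  by rewrite oppr_gt0.
Qed.

(** * The equivalence *)

Section Main.
Variables (R : realType) (G : lieGroup R) (m : nat) (gr : int -> {vspace lie G}).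
Hypothesis grG : grading m gr.
Hypothesis ss : semisimple G.
Variables p pp : {vspace lie G}.
Hypothesis pE : p = (\sum_(i < m.+1) gr i%:Z)%VS.
Hypothesis ppN : nilradical p pp.
Variable P : set G.
Hypothesis Pnorm : P `<=` normalizer p.
Hypothesis lvfP : forall Z h, Z \in p -> smooth h -> (forall q : G, P q -> h q = 0) ->
  lvf Z h 1%g = 0.
Hypothesis KP : exists2 K : set G, compact K & forall y, exists2 k, K k & P (k^-1 * y)%g.
Variables (n : nat) (o : ('I_n -> lie G) -> R^o) (I : (G -> ('I_n -> lie G) -> R^o) -> R).
Hypothesis fI : form_integral P p o I.
Hypothesis oA : alternating_mod p o.
Hypothesis o0 : exists Y, o Y != 0.
Hypothesis dimpp : \dim pp = n.
(** The restriction on n is that of [oriented_frame]. The arguments that use charts involve forms of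
    positive degree, so that n > 0. *)
Hypothesis charts : (0 < n)%N -> exists (e : 'I_n -> lie G) (c : 'I_n -> {linear lie G -> R^o}) B r,
  [/\ forall a b, c a (e b) = (a == b)%:R, forall v, v \in p <-> forall a, c a v = 0,
      0 < r & bump_charts P (big_cell m gr) o e B r].
Variables (V W : vectType R) (rV : G -> 'End(V)).
Hypothesis rVr : representation rV.
Local Notation hom := (hom_rep W rV).
Local Notation ed := (ext_d (@br R G) (@lvf R G)).
Let hr : representation hom := hom_rep_representation W rVr.

Lemma form_over (U : lmodType R) q (f : ('I_q -> lie G) -> U) Y : (n < q)%N ->
  alternating_mod p f -> f Y = 0.
Proof.
move=> nq fm; have [v [t [ex _]]] := top_frame grG ss pE ppN dimpp.
exact: (alternating_mod_over Y fm ex nq).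
Qed.

Let signI (f : G -> ('I_n -> lie G) -> R^o) (f' : G -> ('I_n -> lie G) -> R^o) q :
  bundle_form P p (fun _ => @id R^o) f -> (forall y Y, f' y Y = (-1) ^+ q * f y Y) ->
  I f' = 0 <-> I f = 0.
Proof.
move=> tf ff'; have -> : f' = fun y Y => (-1) ^+ q * f y Y.
  by apply/funext => y; apply/funext => Y.
rewrite (form_integral_scale fI)//; split=> [/eqP|->]; last by rewrite mulr0.
by rewrite mulf_eq0 signr_eq0 => /eqP.
Qed.

(** [codiff_adjoint] moves the codifferential from alpha to b under the integral, and nondegeneracy
    of the pairing turns vanishing for all alpha into pointwise vanishing. *)
Lemma pairing_dstar j k (eqn : (j.+1 + k)%N = n) (b : G -> ('I_j.+1 -> lie G) -> 'Hom(V, W)) :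
  bundle_form P p (fun x => hom x) b ->
  (forall alpha : G -> ('I_k.+1 -> lie G) -> V, bundle_form P p (fun x => rV x) alpha -> forall d,
    I (fun y Y => vcoord d (contract_wedge (b y) (dstar pp rV alpha y) (Y \o cast_ord eqn))) = 0) <->
  (forall y Y, codiff pp (drep (fun g => hom g)) (b y) Y = 0).
Proof.
move=> bB; have dB := dstar_bundle Pnorm grG ss pE ppN hr bB.
have eqn' : (j + k.+1)%N = n by rewrite -addSnnS.
have key (alpha : G -> ('I_k.+1 -> lie G) -> V) d : bundle_form P p (fun x => rV x) alpha ->
  I (fun y Y => vcoord d (contract_wedge (b y) (dstar pp rV alpha y) (Y \o cast_ord eqn))) = 0 <->
  I (fun y Y => vcoord d (contract_wedge (dstar pp hom b y) (alpha y) (Y \o cast_ord eqn'))) = 0.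
  move=> aB; apply: (signI (q := j.+1)).
    exact: (bundle_form_cast eqn' (top_vcoord d (contract_wedge_basic rVr dB aB))).
  move=> y Y; have [bm _ _] := bB; have [am _ _] := aB; rewrite -vcoordZ; congr (vcoord d _).
  rewrite -(codiff_adjoint grG ss pE ppN (drep_linear rVr) (drep_hom rVr) _ (bm y) (am y)).
    by congr contract_wedge; apply/funext => i; congr Y; apply: val_inj.
  by rewrite dimpp.
split=> h; last first.
  move=> alpha aB d; apply/(key alpha d aB).
  have -> : (fun y Y => vcoord d (contract_wedge (dstar pp hom b y) (alpha y) (Y \o cast_ord eqn'))) =
      fun _ _ => 0.
    apply/funext => y; apply/funext => Y; rewrite (_ : dstar pp hom b y = fun=> 0).
      by rewrite contract_wedge0l linear0.
    by apply/funext => X; exact: h.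
  exact: (form_integral0 fI).
have [|e [c [B [r [ce cp r0 bc]]]]] := charts; first by rewrite -eqn.
suff H : forall y Y, dstar pp hom b y Y = 0 by [].
apply: (pairing_nondegenerate grG pE cp Pnorm ce oA o0 fI r0 bc (eqn := eqn') rVr dB) => alpha aB d.
by apply/(key alpha d aB); exact: h.
Qed.

(** The Stokes theorem for the product of b and g, a form of degree n - 1, and the Leibniz rule. *)
Lemma pairing_dV j k (eqn : (j + k.+1)%N = n) (eqn' : (j.+1 + k)%N = n)
    (b : G -> ('I_j -> lie G) -> 'Hom(V, W)) (g : G -> ('I_k -> lie G) -> V) d :
  bundle_form P p (fun x => hom x) b -> bundle_form P p (fun x => rV x) g ->
  I (fun y Y => vcoord d (contract_wedge (b y) (dV rV g y) (Y \o cast_ord eqn))) = 0 <->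
  I (fun y Y => vcoord d (contract_wedge (dV hom b y) (g y) (Y \o cast_ord eqn'))) = 0.
Proof.
move=> bB gB; have dbB := dV_bundle lvfP hr bB; have dgB := dV_bundle lvfP rVr gB.
have t1 := bundle_form_cast eqn (top_vcoord d (contract_wedge_basic rVr bB dgB)).
have t2 := bundle_form_cast eqn' (top_vcoord d (contract_wedge_basic rVr dbB gB)).
have [|e [c [B [r [ce cp r0 bc]]]]] := charts; first by rewrite -eqn'.
have t3 := top_vcoord d (contract_wedge_basic rVr bB gB).
have := stokes lvfP KP (eqn' : (j + k).+1 = n) fI r0 bc t3.
have -> : (fun y (Y : 'I_n -> lie G) => ed (fun y Y => vcoord d (contract_wedge (b y) (g y) Y) : R^o) y
    (Y \o cast_ord (eqn' : (j + k).+1 = n))) =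
  fun y Y => (-1) ^+ j * vcoord d (contract_wedge (b y) (dV rV g y) (Y \o cast_ord eqn)) +
    vcoord d (contract_wedge (dV hom b y) (g y) (Y \o cast_ord eqn')).
  apply/funext => y; apply/funext => Y; rewrite vcoord_ext_d; last first.
    by have [_ h _] := contract_wedge_basic rVr bB gB.
  have gen (u u' v : W) (s : R) : v = u' -> vcoord d (u + s *: v) = s * vcoord d u' + vcoord d u.
    by move=> ->; rewrite linearD/= vcoordZ addrC.
  rewrite (dV_wedge rVr y _ bB gB); apply: gen.
  by congr contract_wedge; apply/funext => i; congr Y; apply: val_inj.
have [lin _] := fI; rewrite lin// => h.
split=> h'; move: h; rewrite h' ?mulr0 ?add0r// addr0 => /eqP.
by rewrite mulf_eq0 signr_eq0 => /eqP.
Qed.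

Variables (K : set G) (kk : {vspace lie G}) (rW : G -> 'End(W)) (l j k : nat).
Variables (phi : G -> G -> ('I_l -> lie G) -> ('I_j -> lie G) -> 'Hom(V, W)).
Variable Phi : (G -> ('I_k -> lie G) -> V) -> G -> ('I_l -> lie G) -> W.
Hypothesis eqn : (j + k)%N = n.
Hypothesis K1 : K 1%g.
Hypothesis rWr : representation rW.
Hypothesis phiB : biform K P kk p rV rW phi.
(** Vanishing of the Poisson transform is tested on the coordinates of W; the cast leaves room for
    cases on j and k. *)
Hypothesis PhiE : forall alpha, bundle_form P p (fun x => rV x) alpha -> forall x X,
  Phi alpha x X = 0 <-> forall d,
  I (fun y Y => vcoord d (contract_wedge (phi x y X) (alpha y) (Y \o cast_ord eqn))) = 0.

Lemma dstar_condition :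
  (forall alpha : G -> ('I_k.+1 -> lie G) -> V, bundle_form P p (fun x => rV x) alpha ->
     forall x X, Phi (dstar pp rV alpha) x X = 0) <-> in_ker_dPstar pp rV phi.
Proof.
have dB (alpha : G -> ('I_k.+1 -> lie G) -> V) : bundle_form P p (fun x => rV x) alpha ->
    bundle_form P p (fun x => rV x) (dstar pp rV alpha).
  by move=> aB; exact: (dstar_bundle Pnorm grG ss pE ppN rVr aB).
(* For j = 0, alpha has degree n + 1 and vanishes, so both sides hold. *)
case: j phi eqn phiB PhiE => [|j'] phi' eqn' phiB' PhiE'.
  split=> // _ alpha aB x X; apply/(PhiE' _ (dB _ aB)) => d.
  rewrite (_ : (fun y Y => _) = fun _ _ => 0) ?(form_integral0 fI)//.
  apply/funext => y; apply/funext => Y; rewrite (_ : dstar pp rV alpha y = fun=> 0).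
    by rewrite contract_wedge0r linear0.
  apply/funext => Z; apply: codiff0 => [|Z']; first exact: drep_linear.
  by have [am _ _] := aB; apply: form_over (am y); rewrite -eqn' add0n.
have bB x X := biform_bundle phiB' rWr x X K1.
split=> [h x y X Y|h alpha aB x X].
  have [bm _ _] := bB x X.
  rewrite (dPstarE grG ss pE ppN Y rVr (bm y)) (proj1 (pairing_dstar eqn' (bB x X))) ?scaler0//.
  by move=> alpha aB d; apply: (proj1 (PhiE' _ (dB _ aB) x X)); exact: h.
apply/(PhiE' _ (dB _ aB)); apply: (proj2 (pairing_dstar eqn' (bB x X))) => // y Y.
have [bm _ _] := bB x X; have /eqP := h x y X Y.
by rewrite (dPstarE grG ss pE ppN Y rVr (bm y)) scaler_eq0 signr_eq0 => /eqP.
Qed.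

(** The sign (-1)^l from [dPE] cancels the one in the definition of [dPstar]. *)
Lemma dP_dstarE x y X Y : dPstar pp rV (dP rV rW phi) x y X Y = 0 <->
  codiff pp (drep (fun g => hom g)) (dV hom (phi x ^~ X) y) Y = 0.
Proof.
have bB := biform_bundle phiB rWr x X K1; have [dm _ _] := dV_bundle lvfP hr bB.
have dPE' : dP rV rW phi x y X = fun Y => (-1) ^+ l *: dV hom (phi x ^~ X) y Y.
  by apply/funext => Z; exact: (dPE phiB rVr rWr x y X Z K1).
rewrite (dPstarE grG ss pE ppN Y rVr); last first.
  by rewrite dPE'; exact: (alternating_mod_comp ( *:%R ((-1) ^+ l)) (dm y)).
rewrite dPE' codiffZ; last exact: (drep_linear hr).
by rewrite scalerA -expr2 sqrr_sign scale1r.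
Qed.

Lemma BGG_condition : factors_to_BGG P p pp rV Phi <->
  (in_ker_dPstar pp rV phi /\ in_ker_dPstar pp rV (dP rV rW phi)).
Proof.
have C2 : (match k return
     ((G -> ('I_k -> lie G) -> V) -> G -> ('I_l -> lie G) -> W) -> Prop with
   | 0%N => fun _ => True
   | k'.+1 => fun Phi' =>
       forall alpha : G -> ('I_k'.+1 -> lie G) -> V,
       bundle_form P p (fun x => rV x) alpha ->
       forall x X, Phi' (dV rV (dstar pp rV alpha)) x X = 0
   end) Phi <-> forall x y X Y, dPstar pp rV (dP rV rW phi) x y X Y = 0.
  have bB x X := biform_bundle phiB rWr x X K1.
  have dbB x X := dV_bundle lvfP hr (bB x X).
  (* For k = 0, d_P phi has degree n + 1 along G/P and vanishes, so both sides hold. *)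
  case: k Phi eqn PhiE => [|k'] Phi' eqn' PhiE'.
    split=> // _ x y X Y; apply/dP_dstarE; apply: codiff0 => [|Z]; first exact: drep_linear.
    by have [dm _ _] := dbB x X; apply: form_over (dm y); rewrite -eqn' addn0.
  have eqn2 : (j.+1 + k')%N = n by rewrite addSnnS.
  have dB (alpha : G -> ('I_k'.+1 -> lie G) -> V) : bundle_form P p (fun x => rV x) alpha ->
      bundle_form P p (fun x => rV x) (dstar pp rV alpha).
    by move=> aB; exact: (dstar_bundle Pnorm grG ss pE ppN rVr aB).
  split=> [h x y X Y|h alpha aB x X].
    apply/dP_dstarE; apply: (proj1 (pairing_dstar eqn2 (dbB x X))) => alpha aB d.
    apply/(pairing_dV eqn' eqn2 d (bB x X) (dB _ aB)).
    by apply: (proj1 (PhiE' _ (dV_bundle lvfP rVr (dB _ aB)) x X)); exact: h.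
  apply/(PhiE' _ (dV_bundle lvfP rVr (dB _ aB))) => d.
  apply/(pairing_dV eqn' eqn2 d (bB x X) (dB _ aB)).
  by apply: (proj2 (pairing_dstar eqn2 (dbB x X))) => // y Y; apply/dP_dstarE.
have C1 := dstar_condition.
by split=> -[h1 h2]; split; by [apply/C1|apply/C2].
Qed.

End Main.

Unset Implicit Arguments.

Theorem corollary7 (R : realType) (G : lieGroup R)
    (K P : set G) (kk p pp : {vspace lie G})
    (V W : vectType R) (rV : G -> 'End(V)) (rW : G -> 'End(W))
    (k l j : nat)
    (o : ('I_(j + k) -> lie G) -> R^o)
    (I : (G -> ('I_(j + k) -> lie G) -> R^o) -> R)
    (phi : G -> G -> ('I_l -> lie G) -> ('I_j -> lie G) -> 'Hom(V, W))
    (Phi : (G -> ('I_k -> lie G) -> V) -> G -> ('I_l -> lie G) -> W) :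
  semisimple G -> finite_centre G ->
  maximal_compact_subgroup K -> lie_algebra_of K kk ->
  parabolic_subgroup P p -> nilradical p pp ->
  quotient_splits K P ->
  representation rV -> representation rW ->
  (j + k = \dim {:lie G} - \dim p)%N ->
  invariant_orientation P p o -> form_integral P p o I ->
  poisson_transform K P kk p rV rW I phi Phi ->
  factors_to_BGG P p pp rV Phi <->
  (in_ker_dPstar pp rV phi /\ in_ker_dPstar pp rV (dP rV rW phi)).
Proof.
move=> ss _ [[K1 _ KV] Kc _] _ [Psub [m [gr [grG pE]]] Pconn Pnorm] ppN split_KP rVr rWr dimE.
move=> [oA o0 _] fI [phiB PhiE _].
have [E EE] := grading_element grG ss; have E0 := grading_element_gr0 grG EE.
have [e [c [lam [ce cp lp lE _]]]] := weight_frame grG pE EE dimE.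
have lvfP Z h := @lvf_subgroup R G m gr grG p pE E EE E0 P Pconn _ e lam lp lE Z h.
(* The splitting at the points 1 and y says that G = K P. *)
have KP : exists2 K : set G, compact K & forall y, exists2 k, K k & P (k^-1 * y)%g.
  exists K => // y; have [g [Kg Pg]] := split_KP 1%g y; exists g => //.
  by rewrite -[g]invgK; apply: KV; rewrite -[(g^-1)%g]mulg1.
have dimpp : \dim pp = (j + k)%N by rewrite dimE; exact: (dim_nilradical grG ss pE ppN).
apply: (@BGG_condition R G m gr grG ss p pp pE ppN P Pnorm lvfP KP (j + k) o I fI oA o0 dimpp _
  V W rV rVr K kk rW l j k phi Phi erefl K1 rWr phiB).
  move=> n0; have [e' [c' [lam' [ce' cp' lp' lE' oe]]]] := oriented_frame n0 ce cp lp lE oA o0.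
  have [oA' _] := oA.
  have [r r0 bc] := slice_chart grG pE EE E0 Psub Pconn Pnorm lp' lE' (alternating_multilin oA') oe.
  by exists e', c', (cell_dirs e'), r.
move=> alpha aB x X; rewrite (PhiE _ aB) /poisson_integral vbase_sum_eq0.
have cid (Y : 'I_(j + k) -> lie G) : Y \o cast_ord (erefl (j + k)%N) = Y.
  by apply/funext => i; rewrite /= cast_ord_id.
have E1 d : (fun y Y => vcoord d (contract_wedge (phi x y X) (alpha y) (Y \o cast_ord (erefl (j + k)%N)))) =
    fun y Y => vcoord d (contract_wedge (phi x y X) (alpha y) Y).
  by apply/funext => y; apply/funext => Y; rewrite cid.
by split=> h d; [rewrite E1; exact: h|rewrite -E1; exact: h].
Qed.
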